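(* Let $F$ be a non-Archimedean valued field of characteristic zero, $\Sigma$ a compact Riemann surface of genus at least $2$, $\Gamma=\pi_1(\Sigma)$, and $\Phi:\mathcal{X}_F(\Gamma)\to H^0(\Sigma,\mathcal{K}_\Sigma^{\otimes 2})$ the non-Archimedean Hitchin map. Then the image of $\Phi$ is contained in the subspace $\mathcal{JS}(\Sigma)$ of Jenkins–Strebel differentials on $\Sigma$.
   Context: **Jenkins–Strebel differentials.** $\mathcal{K}_\Sigma$ is the canonical bundle of $\Sigma$. A (vertical) trajectory of a holomorphic quadratic differential $q\in H^0(\Sigma,\mathcal{K}_\Sigma^{\otimes 2})$ is a maximal curve along which $\mathrm{Re}\sqrt q$ vanishes; it is closed if periodic. A non-zero $q$ is called a Jenkins–Strebel differential if its non-closed trajectories cover a set of measure zero. **Field and tree.** A non-Archimedean valued field $F$ carries a discrete valuation $v:F^\times\to\mathbb{Z}$ (with $v(0)=\infty$) and absolute value $|x|=c^{v(x)}$, $c\in(0,1)$; $\mathcal{O}_v=\{v\ge 0\}$, and $\pi$ is a uniformizer, $v(\pi)=1$. $F$ is not assumed locally compact or algebraically closed. $T_F$ is the Bruhat–Tits tree of $\mathrm{SL}_2(F)$: vertices are homothety classes of $\mathcal{O}_v$-lattices in $F^2$, $[\Lambda],[\Lambda']$ are joined by an edge iff representatives satisfy $\pi\Lambda\subsetneq\Lambda'\subsetneq\Lambda$, and every edge has length $1$; $\mathrm{SL}_2(F)$ acts on it isometrically. **Trees and length functions.** An $\mathbb{R}$-tree is a metric space in which any two points are joined by a unique simple path,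 and this path is isometric to a closed interval. A $\Gamma$-tree is an $\mathbb{R}$-tree $T$ with an isometric $\Gamma$-action; it is minimal if it has no proper nonempty connected closed $\Gamma$-invariant subspace. Its length function is $\ell_T(\gamma)=\inf_{x\in T}d(x,\gamma.x)$. A length function $\ell$ is abelian if $\ell=|\mu|$ for some homomorphism $\mu:\Gamma\to\mathbb{R}$. For $\rho:\Gamma\to\mathrm{SL}_2(F)$ put $\ell_\rho(\gamma)=\inf_{x\in T_F}d(x,\rho(\gamma).x)$. Call $\rho$ bounded if $\rho(\Gamma)$ is a bounded subgroup of $\mathrm{SL}_2(F)$ (equivalently $\ell_\rho\equiv0$), and unbounded otherwise. **Harmonic maps.** $\widetilde\Sigma$ is the universal cover of $\Sigma$. A $\Gamma$-equivariant map $u:\widetilde\Sigma\to T$ of class $W^{1,2}_{\mathrm{loc}}$ (in the sense of Korevaar–Schoen) is harmonic if it minimizes energy under compactly supported $\Gamma$-equivariant variations. Its Hopf differential is the holomorphic quadratic differential $q_u$ on $\Sigma$ given in local coordinates by $4(u_z)^2dz^2$ (near regular points $u$ maps into a geodesic segment and is viewed as a real-valued function). **Definition of $H$ on nonzero length functions $\ell$ of $\Gamma$-trees.** If $\ell$ is nonabelian, there is a unique minimal $\Gamma$-tree $T$ (up to equivariant isometry) with $\ell_T=\ell$ and a unique $\Gamma$-equivariant harmonic map $u:\widetilde\Sigma\to T$; set $H(\ell)=q_u$. If $\ell$ is abelian, set $H(\ell)=\omega\otimes\omega$, where $\omega$ is a holomorphic $1$-form on $\Sigma$ with $\ell(\gamma)=|\int_\gamma\mathrm{Re}\,\omega|$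 for all $\gamma\in\Gamma$ ($\omega\otimes\omega$ being the Hopf differential of an equivariant harmonic map $\widetilde\Sigma\to\mathbb{R}$, for an action of $\Gamma$ on $\mathbb{R}$ by translations with length function $\ell$). **The Hitchin map.** $\mathcal{R}_F(\Gamma)=\mathrm{Hom}(\Gamma,\mathrm{SL}_2(F))$, embedded in $F^{4n}$ via the images of $n$ fixed generators, with the subspace topology from $|\cdot|$ (non-Archimedean topology). $\overline\Phi:\mathcal{R}_F(\Gamma)\to H^0(\Sigma,\mathcal{K}_\Sigma^{\otimes 2})$ is given by $\overline\Phi(\rho)=H(\ell_\rho)$ if $\rho$ is unbounded and $\overline\Phi(\rho)=0$ if $\rho$ is bounded. For a topological space $X$, $\mathrm{Hau}(X)=X/\!\sim$, where $x\sim y$ iff $x\approx y$ for every equivalence relation $\approx$ with $X/\!\approx$ Hausdorff. $\mathcal{X}_F(\Gamma)=\mathrm{Hau}(\mathcal{R}_F(\Gamma)/\mathrm{SL}_2(F))$ (conjugation action), $Q:\mathcal{R}_F(\Gamma)\to\mathcal{X}_F(\Gamma)$ is the quotient map, and $\Phi$ is the unique continuous map with $\overline\Phi=\Phi\circ Q$.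
   Formalization: JS(Σ) is taken to include the zero differential: the image of Φ is shown to lie in the Jenkins–Strebel differentials together with 0, since Φ takes the value 0 at bounded representations (e.g. the trivial one) while Jenkins–Strebel differentials are non-zero by definition. *)

(* Defs.v *)
From HB Require Import structures.
From mathcomp Require Import all_boot all_order all_algebra.
From mathcomp Require Import all_classical all_reals all_analysis.
From mathcomp Require Import complex.

Set Implicit Arguments.
Unset Strict Implicit.
Unset Printing Implicit Defensive.

Import Order.TTheory GRing.Theory Num.Theory numFieldNormedType.Exports.

Local Open Scope classical_set_scope.
Local Open Scope ring_scope.
Local Open Scope complex_scope.

(* The complex numbers over R, as a normed module over themselves: derivatives
   of maps Cplx R -> Cplx R are complex derivatives. *)
Notation Cplx R := (R[i]^o).

Section Plane.
Context {R : realType}.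

Definition plane : measurableType _ :=
  (measurableTypeR R * measurableTypeR R)%type.

Definition plane_measure : {measure set plane -> \bar R} :=
  (@lebesgue_measure R \x @lebesgue_measure R)%E.

Definition cplx_of (y : plane) : Cplx R := y.1 +i* y.2.

Definition holomorphic_on (U : set (Cplx R)) (f : Cplx R -> Cplx R) : Prop :=
  forall z, U z -> derivable f z 1.

Definition dz (g : Cplx R -> R) (z : Cplx R) : Cplx R :=
  (derive1 (fun t : R => g (z + (t +i* 0))) 0 +i*
   (- derive1 (fun t : R => g (z + (0 +i* t))) 0)) / 2%:R.

End Plane.

Section RiemannSurfaces.
Context {R : realType}.

(* chart_inv is only meaningful on chart_map @` chart_dom, and chart_map only
   on chart_dom. *)
Record chart (X : topologicalType) := Chart {
  chart_dom : set X ;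
  chart_map : X -> Cplx R ;
  chart_inv : Cplx R -> X ;
  chart_dom_open : open chart_dom ;
  chart_img_open : open (chart_map @` chart_dom) ;
  chart_mapK : forall x, chart_dom x -> chart_inv (chart_map x) = x ;
  chart_map_cts : forall x, chart_dom x -> {for x, continuous chart_map} ;
  chart_inv_cts : forall z, (chart_map @` chart_dom) z ->
    {for z, continuous chart_inv}
}.

Definition transition (X : topologicalType) (k l : chart X) :
    Cplx R -> Cplx R :=
  chart_map l \o chart_inv k.

Record riemannSurface := RiemannSurface {
  rs_space :> topologicalType ;
  rs_hausdorff : hausdorff_space rs_space ;
  rs_connected : connected [set: rs_space] ;
  rs_idx : Type ;
  rs_chart : rs_idx -> chart rs_space ;
  rs_cover : forall x, exists i, chart_dom (rs_chart i) x ;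
  rs_holo : forall i j,
    holomorphic_on
      (chart_map (rs_chart i) @`
        (chart_dom (rs_chart i) `&` chart_dom (rs_chart j)))
      (transition (rs_chart i) (rs_chart j))
}.

Context (S : riemannSurface).

Definition rdom (i : rs_idx S) : set S := chart_dom (rs_chart i).
Definition rmap (i : rs_idx S) : S -> Cplx R := chart_map (rs_chart i).

(* A section of the k-th tensor power of the canonical bundle is the family of
   its coefficients s i in the charts: s = s_i(x) (dz_i)^k.  Coefficients are
   set to 0 outside the chart, so that equal sections are equal families. *)
Definition section_family := {ptws rs_idx S -> {ptws S -> Cplx R}}.

Definition holo_section (k : nat) : set section_family :=
  [set s | [/\ forall i x, ~ rdom i x -> s i x = 0,
      forall i, holomorphic_on (rmap i @` rdom i)
                  (fun z => s i (chart_inv (rs_chart i) z)) &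
      forall i j x, rdom i x -> rdom j x ->
        s i x = s j x *
          derive1 (transition (rs_chart i) (rs_chart j)) (rmap i x) ^+ k]].

(* H^0(S, K^k).  It carries the topology of pointwise convergence, which on
   this finite-dimensional space is the unique Hausdorff vector topology. *)
Definition H0K (k : nat) : topologicalType := set_type (holo_section k).

Definition one_form := H0K 1.
Definition quad_diff := H0K 2.

Definition coef (k : nat) (s : H0K k) : rs_idx S -> S -> Cplx R := \val s.

Lemma holo_section0 k : holo_section k (fun _ _ => 0).
Proof.
split=> // [i z _|i j x _ _]; last by rewrite mul0r.
exact: derivable_cst.
Qed.

Definition H0K0 k : H0K k :=
  @exist _ (fun s : section_family => s \in holo_section k) _
    (mem_set (holo_section0 k)).

(* The genus as the dimension of the space of holomorphic 1-forms. *)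
Definition has_genus (g : nat) : Prop :=
  exists b : 'I_g -> one_form, forall w : one_form,
    exists! a : {ffun 'I_g -> R[i]},
      forall i x, coef w i x = \sum_(k < g) a k * coef (b k) i x.

Definition square_of (w : one_form) (q : quad_diff) : Prop :=
  forall i x, coef q i x = coef w i x ^+ 2.

(* c is differentiable at t with q(c'(t)) = -1: c is vertical, and parametrized
   by arc length of |q|.  In particular q does not vanish at c t. *)
Definition vertical_at (q : quad_diff) (c : R -> S) (t : R) : Prop :=
  {for t, continuous c} /\
  forall i, rdom i (c t) ->
    exists a b : R,
      [/\ is_derive t 1 (fun s : R => complex.Re (rmap i (c s)) : R) a,
          is_derive t 1 (fun s : R => complex.Im (rmap i (c s)) : R) b &
          coef q i (c t) * (a +i* b) ^+ 2 = -1].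

Definition vertical_curve (q : quad_diff) (I : set R) (c : R -> S) : Prop :=
  [/\ I !=set0, open I, is_interval I & forall t, I t -> vertical_at q c t].

Definition trajectory (q : quad_diff) (I : set R) (c : R -> S) : Prop :=
  vertical_curve q I c /\
  forall J d, vertical_curve q J d -> I `<=` J ->
    (forall t, I t -> d t = c t) -> J = I.

Definition closed_trajectory (q : quad_diff) (I : set R) (c : R -> S) : Prop :=
  [/\ trajectory q I c, I = setT & exists2 T, 0 < T & forall t, c (t + T) = c t].

Definition null_set (A : set S) : Prop :=
  forall i, plane_measure.-negligible
    [set y : plane | exists x, [/\ A x, rdom i x & rmap i x = cplx_of y]].

Definition jenkins_strebel (q : quad_diff) : Prop :=
  q <> H0K0 2 /\
  null_set [set x | exists I c, [/\ trajectory q I c,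
    ~ closed_trajectory q I c & (c @` I) x]].

(* The set JS(S), completed by 0 (the value of the Hitchin map at bounded
   representations). *)
Definition JS : set quad_diff :=
  [set q | q = H0K0 2 \/ jenkins_strebel q].

End RiemannSurfaces.

Arguments riemannSurface R : clear implicits.
Arguments JS {R} S.

Section Covers.
Context {R : realType}.

Definition covering (X Y : topologicalType) (p : X -> Y) : Prop :=
  [/\ continuous p, range p = setT &
   forall y, exists U : set Y, exists V : set (set X),
     [/\ open U, U y,
         p @^-1` U = \bigcup_(W in V) W,
         (forall W W', V W -> V W' -> W `&` W' !=set0 -> W = W') &
         forall W, V W ->
           [/\ open W, {in W &, injective p}, p @` W = U &
               forall O, open O -> O `<=` W -> open (p @` O)]]].

(* Paths and homotopies on [0, 1] are extended by clamping to R and R * R. *)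
Definition simply_connected (X : topologicalType) : Prop :=
  [/\ [set: X] !=set0,
      (forall x y : X, exists c : R -> X,
         [/\ continuous c, c 0 = x & c 1 = y]) &
      forall c : R -> X, continuous c -> c 0 = c 1 ->
        exists h : R * R -> X,
          [/\ continuous h,
              forall t, 0 <= t <= 1 -> h (0, t) = c t,
              forall t, 0 <= t <= 1 -> h (1, t) = c 0 &
              forall s, 0 <= s <= 1 -> h (s, 0) = c 0 /\ h (s, 1) = c 0]].

Definition group_action (G : groupType) (X : Type) (act : G -> X -> X) : Prop :=
  (forall x, act 1%g x = x) /\
  (forall g h x, act (g * h)%g x = act g (act h x)).

(* A universal cover of S; the fundamental group G of S is its group of deck
   transformations. *)
Record universal_cover (S : riemannSurface R) (G : groupType) :=
  UniversalCover {
  uc_space :> topologicalType ;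
  uc_proj : uc_space -> S ;
  uc_covering : covering uc_proj ;
  uc_simply_connected : simply_connected uc_space ;
  uc_act : G -> uc_space -> uc_space ;
  uc_group_action : group_action uc_act ;
  uc_act_cts : forall g, continuous (uc_act g) ;
  uc_act_deck : forall g x, uc_proj (uc_act g x) = uc_proj x ;
  uc_act_faithful : forall g, (forall x, uc_act g x = x) -> g = 1%g ;
  uc_deck : forall f f' : uc_space -> uc_space,
    continuous f -> continuous f' -> cancel f f' -> cancel f' f ->
    (forall x, uc_proj (f x) = uc_proj x) ->
    exists g, forall x, f x = uc_act g x
}.

Section LocalCoordinates.
Context (S : riemannSurface R) (G : groupType) (X : universal_cover S G).

(* Local coordinates of the universal cover: charts of S composed with the
   projection, on open sets where the latter is injective. *)
Record loc_coord := Coord {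
  co_idx : rs_idx S ;
  co_dom : set X ;
  co_inv : Cplx R -> X ;
  co_dom_open : open co_dom ;
  co_sub : forall x, co_dom x -> rdom co_idx (uc_proj x) ;
  co_mapK : forall x, co_dom x -> co_inv (rmap co_idx (uc_proj x)) = x
}.

Definition co_map (k : loc_coord) (x : X) : Cplx R := rmap (co_idx k) (uc_proj x).
Definition co_img (k : loc_coord) : set (Cplx R) := co_map k @` co_dom k.

Definition primitive (w : one_form S) (P : X -> Cplx R) : Prop :=
  forall (k : loc_coord) z, co_img k z ->
    derivable (P \o co_inv k : Cplx R -> Cplx R) z 1 /\
    derive1 (P \o co_inv k : Cplx R -> Cplx R) z =
      coef w (co_idx k) (uc_proj (co_inv k z)).

(* r is the integral of Re w over the element g of the fundamental group,
   that is over the projection of a path from x to g x. *)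
Definition re_period (w : one_form S) (g : G) (r : R) : Prop :=
  exists2 P, primitive w P &
    forall x, r = complex.Re (P (uc_act g x) - P x).

End LocalCoordinates.
End Covers.

Section Trees.
Context {R : realType}.

Definition isometric_on (T : metricType R) (A : set R) (c : R -> T) : Prop :=
  forall s t, A s -> A t -> mdist (c s) (c t) = `|s - t|.

Definition simple_path (T : topologicalType) (x y : T) (a : R -> T) : Prop :=
  [/\ {within `[0, 1], continuous a}, {in `[0, 1] &, injective a},
      a 0 = x & a 1 = y].

Definition rtree (T : metricType R) : Prop :=
  forall x y : T, exists c : R -> T,
    [/\ isometric_on `[0, mdist x y] c, c 0 = x, c (mdist x y) = y &
        forall a, simple_path x y a -> a @` `[0, 1] = c @` `[0, mdist x y]].

Definition gtree (G : groupType) (T : metricType R) (act : G -> T -> T) : Prop :=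
  [/\ rtree T, group_action act &
      forall g x y, mdist (act g x) (act g y) = mdist x y].

Definition minimal_gtree (G : groupType) (T : metricType R)
    (act : G -> T -> T) : Prop :=
  gtree act /\
  forall A : set T, A !=set0 -> connected A -> closed A ->
    (forall g x, A x -> A (act g x)) -> A = setT.

Definition translation_length (X : Type) (D : set X) (d : X -> X -> R)
    (f : X -> X) : R :=
  inf [set d x (f x) | x in D].

Definition length_function (G : groupType) (T : metricType R)
    (act : G -> T -> T) (g : G) : R :=
  translation_length setT mdist (act g).

Definition abelian_length (G : groupType) (l : G -> R) : Prop :=
  exists2 mu : G -> R, (forall g h, mu (g * h)%g = mu g + mu h) &
    forall g, l g = `|mu g|.

End Trees.

Section Energy.
Context {R : realType} (T : metricType R).
Local Open Scope ereal_scope.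

(* Korevaar--Schoen approximate energy density of w on the planar domain U
   (average over balls), normalized so that it tends to |grad w|^2 when w is
   smooth and real-valued. *)
Definition ks_density (U : set (Cplx R)) (w : Cplx R -> T) (e : R)
    (y : @plane R) : \bar R :=
  (4 / (pi * e ^+ 4))%:E *
  \int[plane_measure]_(y' in [set y' : plane | U (cplx_of y') /\
        ((y'.1 - y.1) ^+ 2 + (y'.2 - y.2) ^+ 2 < e ^+ 2)%R])
    ((mdist (w (cplx_of y)) (w (cplx_of y'))) ^+ 2)%:E.

Definition cutoff (U : set (Cplx R)) : set (Cplx R -> R) :=
  [set phi : Cplx R -> R | [/\ continuous phi, forall z, (0 <= phi z <= 1)%R &
     exists K, [/\ compact K, K `<=` U & forall z, ~ K z -> phi z = 0%R]]].

Definition ks_energy (U : set (Cplx R)) (w : Cplx R -> T) : \bar R :=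
  ereal_sup [set limf_esup
    (fun e : R => \int[plane_measure]_(y in [set y | U (cplx_of y)])
                    ((phi (cplx_of y))%:E * ks_density U w e y)) 0^'+
    | phi in cutoff U].

Context (S : riemannSurface R) (G : groupType) (X : universal_cover S G).
Context (act : G -> T -> T).

Definition equivariant (u : X -> T) : Prop :=
  forall g x, u (uc_act g x) = act g (u x).

Definition local_energy (u : X -> T) (k : loc_coord X) : \bar R :=
  ks_energy (co_img k) (u \o co_inv k).

Definition W12loc (u : X -> T) : Prop :=
  [/\ (exists2 D : set T, countable D & range u `<=` closure D),
      (forall (k : loc_coord X) (O : set T), open O -> measurable
         [set y : plane | co_img k (cplx_of y) /\ O (u (co_inv k (cplx_of y)))]),
      (forall (k : loc_coord X) (K : set (Cplx R)) (t : T),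
         compact K -> K `<=` co_img k ->
         \int[plane_measure]_(y in [set y | K (cplx_of y)])
           ((mdist t (u (co_inv k (cplx_of y)))) ^+ 2)%:E < +oo) &
      forall x, exists2 k : loc_coord X, co_dom k x & local_energy u k < +oo].

(* Energy of an equivariant map on S: the energy of a map from a surface is
   conformally invariant and absolutely continuous with respect to the area,
   hence it is the supremum of the sums of the energies, computed in local
   coordinates, over disjoint open subsets of S. *)
Definition energy (u : X -> T) : \bar R :=
  ereal_sup [set e | exists (m : nat) (k : 'I_m -> loc_coord X),
    trivIset setT (fun i => [set uc_proj x | x in co_dom (k i)]) /\
    e = \sum_(i < m) local_energy u (k i)].

(* Harmonic maps are taken with their continuous representative. *)
Definition harmonic (u : X -> T) : Prop :=
  [/\ equivariant u, continuous u, W12loc u &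
      forall (K : set X) (v : X -> T), compact K ->
        equivariant v -> W12loc v ->
        (forall x, (forall g, ~ K (uc_act g x)) -> v x = u x) ->
        energy u <= energy v].

(* q is the Hopf differential of u: near a regular point, u is c \o f for an
   isometric embedding c of an interval and a real-valued function f, which is
   g in a local coordinate z; there q = 4 (g_z)^2 dz^2. *)
Definition hopf (u : X -> T) (q : quad_diff S) : Prop :=
  forall (k : loc_coord X) (I : interval R) (c : R -> T) (g : Cplx R -> R),
    isometric_on [set` I] c ->
    (forall x, co_dom k x ->
       g (co_map k x) \in I /\ u x = c (g (co_map k x))) ->
    forall x, co_dom k x ->
      coef q (co_idx k) (uc_proj x) = (4%:R * dz g (co_map k x) ^+ 2)%R.

End Energy.

Definition H_spec {R : realType} (S : riemannSurface R) (G : groupType)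
    (X : universal_cover S G) (l : G -> R) : set (quad_diff S) :=
  [set q |
    (~ abelian_length l /\
     exists (T : metricType R) (act : G -> T -> T) (u : X -> T),
       [/\ minimal_gtree act, length_function act = l,
           harmonic act u & hopf u q]) \/
    (abelian_length l /\
     exists2 w : one_form S,
       (forall g, exists2 r, re_period X w g r & l g = `|r|) &
       square_of w q)].

Definition H_map {R : realType} (S : riemannSurface R) (G : groupType)
    (X : universal_cover S G) (l : G -> R) : quad_diff S :=
  xget (H0K0 S 2) (H_spec X l).

(* The value of v at 0 is irrelevant: every use below treats 0 separately,
   following the convention v(0) = +oo. *)
Record discrete_valuation (F : fieldType) := DiscreteValuation {
  dv :> F -> int ;
  dvM : forall x y, x != 0 -> y != 0 -> dv (x * y) = dv x + dv y ;
  dvD : forall x y, x != 0 -> y != 0 -> x + y != 0 ->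
    Num.min (dv x) (dv y) <= dv (x + y) ;
  dv_uniformizer : exists2 p, p != 0 & dv p = 1
}.

Section BruhatTits.
Context {R : realType} (F : fieldType) (v : discrete_valuation F).

Definition vabs (c : R) (x : F) : R := if x == 0 then 0 else c ^ v x.

Definition val_ring : set F := [set x | x = 0 \/ 0 <= v x].

Definition uniformizer (p : F) : Prop := p != 0 /\ v p = 1.

Definition lattice : set (set 'cV[F]_2) :=
  [set L | exists2 e : 'M[F]_2, e \in unitmx &
    L = [set e *m a | a in [set a : 'cV[F]_2 | forall i, val_ring (a i 0)]]].

Definition scale_lattice (x : F) (L : set 'cV[F]_2) : set 'cV[F]_2 :=
  [set x *: w | w in L].

(* Vertices are represented by homothety classes, as sets of lattices. *)
Definition hclass : Type := set (set 'cV[F]_2).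

Definition homothety_class (L : set 'cV[F]_2) : hclass :=
  [set scale_lattice x L | x in [set x | x != 0]].

Definition bt_vertex : set hclass := [set homothety_class L | L in lattice].

Definition bt_edge (a b : hclass) : Prop :=
  [/\ bt_vertex a, bt_vertex b &
      exists L L' p, [/\ a L, b L', uniformizer p,
        scale_lattice p L `<` L' & L' `<` L]].

Definition bt_walk (m : nat) (a b : hclass) : Prop :=
  exists w : nat -> hclass,
    [/\ w 0%N = a, w m = b & forall i, (i < m)%N -> bt_edge (w i) (w i.+1)].

(* A point of the geometric realization is given by its barycentric
   coordinates: t at a, 1 - t at b, for a vertex a = b or an edge {a, b}. *)
Definition bt_point : set (hclass -> R) :=
  [set x | exists a b t,
    [/\ bt_vertex a, bt_vertex b, a = b \/ bt_edge a b, 0 <= t <= 1 &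
        x = fun d => t * \1_[set a] d + (1 - t) * \1_[set b] d]].

(* Path metric of the geometric realization, all edges having length 1: a path
   from x to y either stays in an edge, or leaves x through a vertex a, follows
   edges to a vertex b and reaches y from there. *)
Definition bt_dist (x y : hclass -> R) : R :=
  inf ([set r | exists a b m, [/\ 0 < x a, 0 < y b, bt_walk m a b &
          r = (1 - x a) + m%:R + (1 - y b)]] `|`
       [set r | exists a b, [/\ bt_edge a b,
          (forall d, x d != 0 \/ y d != 0 -> d = a \/ d = b) &
          r = `|x a - y a|]]).

Definition act_class (g : 'M[F]_2) (a : hclass) : hclass :=
  [set [set g *m w | w in L] | L in a].

Definition act_point (g : 'M[F]_2) (x : hclass -> R) : hclass -> R :=
  x \o act_class (invmx g).

Definition bt_length (g : 'M[F]_2) : R :=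
  translation_length bt_point bt_dist (act_point g).

End BruhatTits.

Section Hau.
Local Open Scope quotient_scope.
Context (X : topologicalType).

Definition hau_rel (x y : X) : bool :=
  `[< forall e : equiv_rel X,
        hausdorff_space (quotient_topology {eq_quot e}) -> e x y >].

Lemma hau_rel_refl : reflexive hau_rel.
Proof. by move=> x; apply/asboolP => e _; exact: generic_quotient.equiv_refl. Qed.

Lemma hau_rel_sym : symmetric hau_rel.
Proof.
by move=> x y; apply/asboolP/asboolP => h e he; rewrite generic_quotient.equiv_sym; exact: h.
Qed.

Lemma hau_rel_trans : transitive hau_rel.
Proof.
move=> y x z /asboolP h1 /asboolP h2; apply/asboolP => e he.
exact: generic_quotient.equiv_trans (h1 e he) (h2 e he).
Qed.

Canonical hau_equiv := EquivRel hau_rel hau_rel_refl hau_rel_sym hau_rel_trans.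

Definition Hau : topologicalType := quotient_topology {eq_quot hau_equiv}.

Definition hau_proj (x : X) : Hau := \pi_{eq_quot hau_equiv} x.

End Hau.

Definition is_rep (F : fieldType) (G : groupType) : set (G -> 'M[F]_2) :=
  [set rho | (forall g, \det (rho g) = 1) /\
             forall g h, rho (g * h)%g = rho g *m rho h].

(* v, c and the generators s only matter for the topology, which is the one
   induced by the embedding rho |-> (rho (s i))_i in F^(4n). *)
Definition rep_space (R : realType) (F : fieldType)
    (v : discrete_valuation F) (c : R) (G : groupType) (n : nat)
    (s : 'I_n -> G) : Type :=
  set_type (@is_rep F G).

Section Representations.
Context {R : realType} (F : fieldType) (v : discrete_valuation F) (c : R).
Context (G : groupType) (n : nat) (s : 'I_n -> G).
Local Notation rep_space := (rep_space v c s).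

HB.instance Definition _ := Choice.on rep_space.

Definition rep_fun (rho : rep_space) : G -> 'M[F]_2 := \val rho.

Definition rep_open : set (set rep_space) :=
  [set O | forall rho, O rho -> exists2 e : R, 0 < e & forall rho' : rep_space,
    (forall i k l,
       vabs v c (rep_fun rho' (s i) k l - rep_fun rho (s i) k l) < e) ->
    O rho'].

Lemma rep_openT : rep_open setT.
Proof. by move=> rho _; exists 1. Qed.

Lemma rep_openI : setI_closed rep_open.
Proof.
move=> A B oA oB rho [/oA[e e0 eA] /oB[e' e'0 eB]].
exists (Num.min e e'); first by rewrite lt_min e0.
by move=> rho' h; split; [apply: eA|apply: eB] => i k l;
  have := h i k l; rewrite lt_min => /andP[].
Qed.

Lemma rep_open_bigU (I : Type) (f : I -> set rep_space) :
  (forall i, rep_open (f i)) -> rep_open (\bigcup_i f i).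
Proof.
move=> oF rho [i _ /oF[e e0 h]]; exists e => // rho' /h ?; by exists i.
Qed.

HB.instance Definition _ :=
  isOpenTopological.Build rep_space rep_openT rep_openI rep_open_bigU.

Definition conj_rel (rho rho' : rep_space) : bool :=
  `[< exists2 a : 'M[F]_2, \det a = 1 &
        forall g, rep_fun rho' g = a *m rep_fun rho g *m invmx a >].

Lemma conj_rel_refl : reflexive conj_rel.
Proof.
move=> rho; apply/asboolP; exists 1%:M; first by rewrite det1.
by move=> g; rewrite invmx1 mulmx1 mul1mx.
Qed.

Let det1_unit (a : 'M[F]_2) : \det a = 1 -> a \in unitmx.
Proof. by rewrite unitmxE => ->; rewrite unitr1. Qed.

Let conj_imp rho rho' : conj_rel rho rho' -> conj_rel rho' rho.
Proof.
move=> /asboolP[a a1 h]; apply/asboolP; exists (invmx a).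
  by rewrite det_inv a1 invr1.
move=> g; rewrite h invmxK !mulmxA mulVmx ?det1_unit// mul1mx.
by rewrite -mulmxA mulVmx ?det1_unit// mulmx1.
Qed.

Lemma conj_rel_sym : symmetric conj_rel.
Proof. by move=> rho rho'; apply/idP/idP; exact: conj_imp. Qed.

Lemma conj_rel_trans : transitive conj_rel.
Proof.
move=> y x z /asboolP[a a1 ha] /asboolP[b b1 hb]; apply/asboolP.
exists (b *m a); first by rewrite det_mulmx a1 b1 mulr1.
move=> g; rewrite hb ha; have -> : invmx (b *m a) = invmx a *m invmx b.
  have ua := det1_unit a1; have ub := det1_unit b1.
  have u : b *m a \in unitmx by rewrite unitmx_mul ub.
  apply: (can_inj (mulKmx u)); rewrite mulmxV//.
  by rewrite !mulmxA -(mulmxA b) mulmxV// mulmx1 mulmxV.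
by rewrite !mulmxA.
Qed.

Canonical conj_equiv :=
  EquivRel conj_rel conj_rel_refl conj_rel_sym conj_rel_trans.

Local Open Scope quotient_scope.

Definition orbit_space : topologicalType :=
  quotient_topology {eq_quot conj_equiv}.

Definition orbit_proj (rho : rep_space) : orbit_space :=
  \pi_{eq_quot conj_equiv} rho.

Definition character_space : topologicalType := Hau orbit_space.

Definition character_proj (rho : rep_space) : character_space :=
  hau_proj (orbit_proj rho).

Definition bounded_rep (rho : rep_space) : Prop :=
  exists M : R, forall g k l, vabs v c (rep_fun rho g k l) <= M.

Definition rep_length (rho : rep_space) (g : G) : R :=
  bt_length v (rep_fun rho g).

Definition hitchin_bar (S : riemannSurface R) (X : universal_cover S G)
    (rho : rep_space) : quad_diff S :=
  if `[< bounded_rep rho >] then H0K0 S 2 else H_map X (rep_length rho).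

Definition is_hitchin_map (S : riemannSurface R) (X : universal_cover S G)
    (Phi : character_space -> quad_diff S) : Prop :=
  continuous Phi /\ forall rho, hitchin_bar X rho = Phi (character_proj rho).

End Representations.

Definition generates (G : groupType) (n : nat) (s : 'I_n -> G) : Prop :=
  forall A : set G, A 1%g -> (forall g h, A g -> A h -> A (g * h)%g) ->
    (forall g, A g -> A (g^-1)%g) -> (forall i, A (s i)) -> A = setT.

(* Main.v *)
(* The displacement of g in SL_2(F) on the Bruhat-Tits tree is piecewise linear
   with integer breakpoints, so l = rep_length takes values in the natural
   numbers.

   If l is abelian, then q = w^2 with Re w having integral periods, and
   F = dist(Re P, Z), with P a primitive of w, descends to Sigma.

   If l is not abelian, two elements of Gamma have disjoint characteristic sets
   in the minimal tree T.  An endpoint x0 of the bridge between them satisfies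
   d(x0, g x0) in Z/2 for all g, hence the branch points of T lie at distance in
   Z/4 from x0, and F = dist(d(x0, u), Z/4) descends to Sigma.

   In both cases F takes values in [0, a] and, away from the values 0 and a and
   from the zeros of q, is locally of the form +-Re P + const with P'^2 = q.  For
   u this rests on the equation 4 (f_z)^2 = q, which holds a priori in the sense
   of partial derivatives only: f = +-Re P + k(y), and the finiteness of the
   energy forces k to be absolutely continuous, hence constant.

   So F is constant along the vertical trajectories of q.  A trajectory on a
   level v not in {0, a} that contains no zero of q stays in a compact set
   without zeros: it is complete, and returns to a flat box in which the level v
   is a single vertical segment, hence it is closed.  The zeros being isolated,
   only finitely many levels remain, and level sets are locally contained in
   vertical lines of flat charts, hence null. *)
Require Import Defs.
From HB Require Import structures.
From mathcomp Require Import all_boot all_order all_algebra.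
From mathcomp Require Import all_classical all_reals all_analysis.
From mathcomp Require Import complex ring lra zify measurable_realfun.
Set Implicit Arguments.
Unset Strict Implicit.
Unset Printing Implicit Defensive.
Import Order.TTheory GRing.Theory Num.Theory numFieldNormedType.Exports.
Local Open Scope classical_set_scope.
Local Open Scope ring_scope.
Local Open Scope complex_scope.

(** * Translation lengths on the Bruhat-Tits tree *)

Section BruhatTitsLength.
Context {R : realType} (F : fieldType) (v : discrete_valuation F).

(** The field enters only through the integrality of translation lengths: [T] is an abstract minimal
    tree, never compared with the Bruhat-Tits tree, and its discreteness is recovered from the
    length function. Half-integers come from the formula l(hg) = l(g) + l(h) + 2 dist for disjoint
    characteristic sets; quarters appear because two orbit segments from x0 branch at half a signed
    sum of three half-integers.

    The analytic obstacle is that [hopf] constrains partial derivatives only, with value 0 where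
    they do not exist, so a Cantor-type function k(y) is a priori possible. Finite energy yields
    |dk|^2 <= dy dW for a nondecreasing W, and this excludes a singular part in the Stieltjes
    measure of k.

    On the levels 0 and a, F is only known to be continuous. There, two points of a small flat box
    off a common vertical line would bound an interval shorter than a, with end values in {0, a} and
    slope 1 or -1 inside, which is impossible. F is not extremal on a whole open set free of zeros
    of q, since u (or Re P) would be locally constant and q would vanish. *)

Lemma act_class_surj (g : 'M[F]_2) : g \in unitmx ->
  forall d : hclass F, exists d', act_class (invmx g) d' = d.
Proof.
move=> ug d; exists (act_class g d); apply/seteqP; split.
  move=> _ [_ [L dL <-] <-].
  suff -> : [set invmx g *m w | w in [set g *m w | w in L]] = L by [].
  apply/seteqP; split; first by move=> _ [_ [w Lw <-] <-]; rewrite mulKmx.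
  by move=> w Lw; exists (g *m w); [exists w|rewrite mulKmx].
move=> L dL; exists [set g *m w | w in L]; first by exists L.
apply/seteqP; split; first by move=> _ [_ [w Lw <-] <-]; rewrite mulKmx.
by move=> w Lw; exists (g *m w); [exists w|rewrite mulKmx].
Qed.

(** [bt_dist v x y] is by definition the infimum of this set. *)
Let dset (x y : hclass F -> R) : set R :=
  [set r | exists a b m, [/\ 0 < x a, 0 < y b, bt_walk v m a b &
          r = (1 - x a) + m%:R + (1 - y b)]] `|`
  [set r | exists a b, [/\ bt_edge v a b,
          (forall d, x d != 0 \/ y d != 0 -> d = a \/ d = b) &
          r = `|x a - y a|]].

Let pt (t : R) (a b : hclass F) : hclass F -> R :=
  fun d => t * \1_[set a] d + (1 - t) * \1_[set b] d.

Lemma pt_eq1 t (a : hclass F) : pt t a a a = 1.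
Proof. by rewrite /pt indicE mem_set//=; lra. Qed.

Lemma pt_l t (a b : hclass F) : a <> b -> pt t a b a = t.
Proof.
by move=> ab; rewrite /pt !indicE mem_set//= memNset//= mulr1 mulr0 addr0.
Qed.

Lemma pt_r t (a b : hclass F) : a <> b -> pt t a b b = 1 - t.
Proof.
move=> ab; rewrite /pt !indicE memNset//=; last by move=> h; apply: ab.
by rewrite mem_set//= mulr1 mulr0 add0r.
Qed.

Lemma pt_out t (a b d : hclass F) : d <> a -> d <> b -> pt t a b d = 0.
Proof. by move=> da db; rewrite /pt !indicE !memNset//=; rewrite !mulr0 addr0. Qed.

Lemma pt_ge0 t (a b d : hclass F) : 0 <= t <= 1 -> 0 <= pt t a b d <= 1.
Proof.
move=> t01; have [->|/eqP da] := eqVneq d a.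
  have [->|/eqP ab] := eqVneq a b; first by rewrite pt_eq1; lra.
  by rewrite pt_l.
have [->|/eqP db] := eqVneq d b; last by rewrite pt_out//; lra.
have [->|/eqP ab] := eqVneq a b; first by rewrite pt_eq1; lra.
rewrite pt_r//; lra.
Qed.

Lemma pt_sym t (a b : hclass F) : pt t a b = pt (1 - t) b a.
Proof. by apply/funext => d; rewrite /pt; ring. Qed.

Lemma bt_point_vertex (a : hclass F) : bt_vertex v a -> bt_point v (pt 1 a a).
Proof. by move=> va; exists a, a, 1; split => //; [left|lra]. Qed.

Lemma bt_pointP (x : hclass F -> R) : bt_point v x ->
  exists a b t, [/\ bt_vertex v a, bt_vertex v b, a = b \/ bt_edge v a b, 0 <= t <= 1 &
  x = pt t a b].
Proof. by []. Qed.

(** Every competitor [r] in the double infimum defining the translation length dominates a natural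
    number which is itself a competitor, possibly at another point: an end of the edge carrying x,
    or the midpoint of an inverted edge. The infimum is thus a minimum of natural numbers. *)
Lemma dset_natural (g : 'M[F]_2) x r : g \in unitmx -> bt_point v x ->
  dset x (act_point g x) r ->
  exists N : nat, N%:R <= r /\
    exists2 x', bt_point v x' & dset x' (act_point g x') N%:R.
Proof.
move=> ug px; case.
- move=> [a' [b' [m [xa yb wk ->]]]].
  have xb : 0 < x (act_class (invmx g) b') by [].
  rewrite /act_point /=.
  set b'' := act_class _ _ in xb *.
  have [a [b [t [va vb ab t01 xE]]]] := bt_pointP px.
  have xle d : 0 <= x d <= 1 by rewrite xE; exact: pt_ge0.
  (* The walk ends at the image of b'' under g. If a' = b'', the vertex a' itself gives the value m;
     otherwise a' and b'' are the two ends of the edge of x, their weights add up to 1, and r = m +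
     1. *)
  have [e|/eqP ne] := eqVneq a' b''.
    exists m; split; first by have := xle a'; have := xle b''; lra.
    have va' : bt_vertex v a'.
      have [->//|/eqP aa] := eqVneq a' a; have [->//|/eqP bb] := eqVneq a' b.
      by move: xa; rewrite xE pt_out// ltxx.
    exists (pt 1 a' a'); first exact: bt_point_vertex.
    left; exists a', b', m; rewrite /act_point /= -/b'' -e !pt_eq1.
    by split => //; lra.
  have inab d : 0 < x d -> d = a \/ d = b.
    have [->|/eqP da] := eqVneq d a; first by left.
    have [->|/eqP db] := eqVneq d b; first by right.
    by rewrite xE pt_out// ltxx.
  have s1 : x a' + x b'' = 1.
    have := inab _ xa; have := inab _ xb; move: (ne); rewrite xE.
    move=> ne' [] eb [] ea; first by case: ne'; rewrite ea eb.
    - by rewrite ea eb pt_l ?pt_r//; [lra|move=> h; apply: ne'; rewrite ea eb h..].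
    - by rewrite ea eb pt_l ?pt_r//; [lra|move=> h; apply: ne'; rewrite ea eb h..].
    - by case: ne'; rewrite ea eb.
  have rE : (1 - x a') + m%:R + (1 - x b'') = m.+1%:R by rewrite -natr1; lra.
  exists m.+1; split; first by rewrite rE.
  by exists x => //; left; exists a', b', m; split; rewrite // -rE.
- move=> [a [b [eab supp ->]]].
  rewrite /act_point /=; set a'' := act_class _ a.
  have [va vb _] := eab.
  have [s [s01 xE]] : exists s : R, 0 <= s <= 1 /\ x = pt s a b.
    have [a0 [b0 [t [_ _ _ t01 xE]]]] := bt_pointP px.
    have h1 : t != 0 -> a0 = a \/ a0 = b.
      move=> t0; apply: supp; left; rewrite xE.
      have [->|/eqP ab] := eqVneq a0 b0; first by rewrite pt_eq1; lra.
      by rewrite pt_l.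
    have h2 : 1 - t != 0 -> b0 = a \/ b0 = b.
      move=> t0; apply: supp; left; rewrite xE.
      have [->|/eqP ab] := eqVneq a0 b0; first by rewrite pt_eq1; lra.
      by rewrite pt_r.
    have pt0 c d : pt 0 c d = \1_[set d] by apply/funext => e; rewrite /pt; ring.
    have pt1 c d : pt 1 c d = \1_[set c] by apply/funext => e; rewrite /pt; ring.
    have ptt u c : pt u c c = \1_[set c] by apply/funext => e; rewrite /pt; ring.
    have [t0|t0] := eqVneq t 0.
      rewrite xE t0 pt0; case: h2 => [|->|->]; first by rewrite t0 subr0 oner_eq0.
        by exists 1; rewrite pt1; split => //; lra.
      by exists 0; rewrite pt0; split => //; lra.
    have [t1|t1] := eqVneq (1 - t) 0.
      have {}t1 : t = 1 by lra.
      rewrite xE t1 pt1; case: h1 => [//|->|->].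
        by exists 1; rewrite pt1; split => //; lra.
      by exists 0; rewrite pt0; split => //; lra.
    rewrite xE; case: (h1 t0) (h2 t1) => -> [] ->.
    - by exists 1; rewrite pt1 ptt; split => //; lra.
    - by exists t.
    - by exists (1 - t); rewrite [LHS]pt_sym; split => //; lra.
    - by exists 0; rewrite pt0 ptt; split => //; lra.
  have nat_case (N : nat) : `|x a - x a''| = N%:R -> exists N : nat, N%:R <= `|x a - x a''| /\
    exists2 x', bt_point v x' & dset x' (act_point g x') N%:R.
    move=> h; exists N; split; first by rewrite h.
    by exists x => //; right; exists a, b.
  have [ab|/eqP ab] := eqVneq a b.
    have x1 : x a = 1 by rewrite xE -ab pt_eq1.
    have [e|/eqP ne] := eqVneq a'' a; first by apply: (nat_case 0%N); rewrite e subrr normr0.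
    apply: (nat_case 1%N); rewrite x1 xE -ab pt_out// subr0 normr1//.
  have [e|/eqP ne] := eqVneq a'' a; first by apply: (nat_case 0%N); rewrite e subrr normr0.
  have xa : x a = s by rewrite xE pt_l.
  have xb : x b = 1 - s by rewrite xE pt_r.
  have [s0|s0] := eqVneq s 0.
    have [e2|/eqP ne2] := eqVneq a'' b.
      by apply: (nat_case 1%N); rewrite e2 xa xb s0 subr0 sub0r normrN normr1.
    by apply: (nat_case 0%N); rewrite xa xE pt_out// s0 subr0 normr0.
  have [s1|s1] := eqVneq s 1.
    have [e2|/eqP ne2] := eqVneq a'' b.
      by apply: (nat_case 1%N); rewrite e2 xa xb s1 subrr subr0 normr1.
    by apply: (nat_case 1%N); rewrite xa xE pt_out// s1 subr0 normr1.
  have xb0 : x b != 0 by rewrite xb; lra.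
  have xa0 : x a != 0 by rewrite xa.
  have sup2 d : act_class (invmx g) d = a \/ act_class (invmx g) d = b -> d = a \/ d = b.
    by move=> h; apply: supp; right; rewrite /act_point/=; case: h => ->.
  (* The inverse of g maps a to b: the midpoint of the edge gives the value 0, whatever the weights
     of x. *)
  have [e2|/eqP ne2] := eqVneq a'' b.
    exists 0%N; split; first exact: normr_ge0.
    exists (pt (1/2) a b).
      by exists a, b, (1/2); split => //; [right|lra].
    right; exists a, b; split => //; last first.
      by rewrite /act_point/= -/a'' e2 pt_l// pt_r//= [X in `|X|](_ : _ = 0) ?normr0//; lra.
    have out d : pt (1/2) a b d != 0 -> d = a \/ d = b.
      have [->|/eqP aa] := eqVneq d a; [by left|].
      have [->|/eqP bb] := eqVneq d b; [by right|].
      by rewrite pt_out// eqxx.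
    by move=> d [/out//|/out/sup2].
  (* By the support condition, the vertices that the inverse of g maps to a and to b lie in {a, b};
     as a is mapped to neither, both would be b. *)
  exfalso.
  have [d ed] := act_class_surj ug a; have [d2 ed2] := act_class_surj ug b.
  have db : d = b.
    case: (sup2 d (or_introl ed)) => // da.
    by move: ed; rewrite da.
  case: (sup2 d2 (or_intror ed2)) => d2E.
    by move: ed2; rewrite d2E.
  by apply: ab; rewrite -ed -ed2 db d2E.
Qed.

Lemma dset_ge0 (g : 'M[F]_2) x r : bt_point v x -> dset x (act_point g x) r -> 0 <= r.
Proof.
move=> /bt_pointP[a0 [b0 [t [_ _ _ t01 ->]]]] [[a [b [m [_ _ _ ->]]]]|[a [b [_ _ ->]]]]; last exact: normr_ge0.
have /andP[_ h1] := @pt_ge0 t a0 b0 a t01.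
have /andP[_ h2] := @pt_ge0 t a0 b0 (act_class (invmx g) b) t01.
have h3 := ler0n R m.
by apply: addr_ge0; [apply: addr_ge0|]; rewrite ?subr_ge0.
Qed.

Lemma bt_length_natural (g : 'M[F]_2) : g \in unitmx ->
  exists N : nat, bt_length v g = N%:R :> R.
Proof.
move=> ug; rewrite /bt_length /translation_length.
set A := [set _ | _ in _].
have distE (x y : hclass F -> R) : bt_dist v x y = inf (dset x y) by [].
have dist_ge0 (x : hclass F -> R) : bt_point v x -> 0 <= bt_dist v x (act_point g x).
  move=> px; rewrite distE.
  have [->|/set0P n0] := eqVneq (dset x (act_point g x)) set0; first by rewrite inf0.
  by apply: lb_le_inf => // r; exact: dset_ge0.
have lbA : has_lbound A by exists 0 => _ [x px <-]; exact: dist_ge0.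
have lbD x : bt_point v x -> has_lbound (dset x (act_point g x)).
  by move=> px; exists 0 => r; exact: dset_ge0.
have [A0|/set0P [_ [x0 px0 _]]] := eqVneq A set0; first by exists 0%N; rewrite A0 inf0.
(* [inf set0] is 0: a point without any path to its image has displacement 0 by convention, and the
   length is then 0. *)
have [[x px d0]|ne] := pselect (exists2 x, bt_point v x & dset x (act_point g x) = set0).
  exists 0%N; apply/eqP; rewrite eq_le; apply/andP; split.
    by apply: ge_inf => //; exists x => //; rewrite distE d0 inf0.
  by apply: lb_le_inf => [|_ [y py <-]]; [exists (bt_dist v x0 (act_point g x0)); exists x0|exact: dist_ge0].
have {}ne x : bt_point v x -> dset x (act_point g x) !=set0.
  by move=> px; apply/set0P/eqP => e; apply: ne; exists x.
pose P (N : nat) := `[< exists2 x', bt_point v x' & dset x' (act_point g x') N%:R >].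
have exP : exists N, P N.
  have [r hr] := ne _ px0.
  by have [N [_ h]] := dset_natural ug px0 hr; exists N; apply/asboolP.
exists (ex_minn exP); case: ex_minnP => N /asboolP[x px hN] Nmin.
apply/eqP; rewrite eq_le; apply/andP; split.
  apply: (@le_trans _ _ (bt_dist v x (act_point g x))).
    by apply: ge_inf => //; exists x.
  by rewrite distE; apply: ge_inf => //; exact: lbD.
apply: lb_le_inf => [|_ [y py <-]]; first by exists (bt_dist v x0 (act_point g x0)); exists x0.
rewrite distE; apply: lb_le_inf; first exact: ne.
move=> r hr; have [M [Mr h]] := dset_natural ug py hr.
by apply: le_trans Mr; rewrite ler_nat; apply: Nmin; apply/asboolP.
Qed.

End BruhatTitsLength.

(** * Real trees *)

Section RealTrees.
Context {R : realType} (T : metricType R).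
Local Notation d := (@mdist R T).

Lemma lipschitz_within (A : set R) (L : R) (a : R -> T) :
  (forall s t, A s -> A t -> d (a s) (a t) <= L * `|s - t|) ->
  {within A, continuous a}.
Proof.
move=> aL; apply/subspace_continuousP => x Ax; apply/cvg_ballP => e e0.
have L0 : 0 < `|L| + 1 by rewrite ltr_pwDr.
rewrite near_withinE; near=> y => Ay; rewrite ballEmdist/=.
apply: le_lt_trans (aL _ _ Ax Ay) _.
apply: (@le_lt_trans _ _ ((`|L| + 1) * `|x - y|)).
  by rewrite ler_wpM2r// ler_wpDr// ler_norm.
rewrite mulrC -ltr_pdivlMr//; near: y.
by apply: cvgr_dist_lt => //; rewrite divr_gt0.
Unshelve. all: by end_near. Qed.

Lemma isometric_concat_simple (c1 c2 : R -> T) (l1 l2 : R) y m z :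
  0 <= l1 -> 0 <= l2 -> 0 < l1 + l2 ->
  isometric_on `[0, l1] c1 -> isometric_on `[0, l2] c2 ->
  c1 0 = y -> c1 l1 = m -> c2 0 = m -> c2 l2 = z ->
  (forall s1 s2, 0 <= s1 < l1 -> 0 < s2 <= l2 -> c1 s1 <> c2 s2) ->
  simple_path y z (fun r => if r * (l1 + l2) <= l1 then c1 (r * (l1 + l2))
                            else c2 (r * (l1 + l2) - l1)).
Proof.
move=> l10 l20 l0 i1 i2 c10 c1l c20 c2l dis.
have [L LE] : exists L, L = l1 + l2 by eexists.
rewrite -!LE in l0 *.
have in1 s : 0 <= s -> s <= l1 -> `[0, l1]%classic s by move=> ? ?; rewrite /= in_itv/=; lra.
have in2 s : 0 <= s -> s <= l2 -> `[0, l2]%classic s by move=> ? ?; rewrite /= in_itv/=; lra.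
have b01 r : 0 <= r <= 1 -> 0 <= r * L <= L.
  move=> r01; apply/andP; split; first by rewrite mulr_ge0//; lra.
  by rewrite ler_piMl//; lra.
have cross s1 s2 : 0 <= s1 -> s1 <= l1 -> 0 <= s2 -> s2 <= l2 ->
    d (c1 s1) (c2 s2) <= (l1 - s1) + s2.
  move=> *; apply: le_trans (metric_triangle _ m _) _.
  rewrite -[in X in X + _]c1l -c20 i1 ?i2; try (exact: in1 || exact: in2).
  by rewrite !ler0_norm; lra.
split.
- apply: (@lipschitz_within _ L) => s t; rewrite /= !in_itv/= => /b01 sL /b01 tL.
  have -> : L * `|s - t| = `|s * L - t * L|.
    by rewrite -mulrBl normrM [`|L|]gtr0_norm// mulrC.
  case: ifPn => s1; case: ifPn => t1.
  + by rewrite i1//; apply: in1; lra.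
  + rewrite -ltNge in t1; apply: le_trans (cross _ _ _ _ _ _) _; [lra..|].
    by rewrite ler0_norm; lra.
  + rewrite -ltNge in s1; rewrite metric_sym; apply: le_trans (cross _ _ _ _ _ _) _; [lra..|].
    by rewrite ger0_norm; lra.
  + by rewrite -!ltNge in s1 t1; rewrite i2; [rewrite opprB addrA subrK|apply: in2; lra..].
- move=> s t; rewrite !in_itv/= => /b01 sL /b01 tL.
  have fin : `|s * L - t * L| = 0 -> s = t.
    by move/normr0_eq0/eqP; rewrite subr_eq0 => /eqP/mulIf; apply; rewrite gt_eqF.
  case: ifPn => s1; case: ifPn => t1.
  + by move=> e; apply: fin; rewrite -i1; [rewrite e mdistxx|apply: in1; lra..].
  + rewrite -ltNge in t1; move=> e; exfalso; have [s2|s2] := ltrP (s * L) l1.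
      by apply: dis e; lra.
    have {}s2 : s * L = l1 by lra.
    have : d (c2 0) (c2 (t * L - l1)) = 0 by rewrite -e c20 -c1l -s2 mdistxx.
    rewrite i2; [|apply: in2; lra..].
    by rewrite ler0_norm; lra.
  + rewrite -ltNge in s1; move=> e; exfalso; have [s2|s2] := ltrP (t * L) l1.
      by apply: dis (esym e); lra.
    have {}s2 : t * L = l1 by lra.
    have : d (c2 0) (c2 (s * L - l1)) = 0 by rewrite e c20 -c1l -s2 mdistxx.
    rewrite i2; [|apply: in2; lra..].
    by rewrite ler0_norm; lra.
  + rewrite -!ltNge in s1 t1 => e; apply: fin.
    have -> : s * L - t * L = (s * L - l1) - (t * L - l1) by lra.
    by rewrite -i2; [rewrite e mdistxx|apply: in2; lra..].
- by rewrite mul0r l10.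
- rewrite mul1r; case: ifPn => [h|_]; last by rewrite -c2l; congr c2; lra.
  have l2E : l2 = 0 by lra.
  by rewrite -c2l LE l2E addr0 c1l -c20.
Qed.

Hypothesis treeT : rtree T.

(** The tree axiom identifies the image of the geodesic [c] with that of every simple path between
    its ends, in particular with that of the concatenation, which passes through m. *)
Lemma tree_concat (c1 c2 : R -> T) (l1 l2 : R) y m z :
  0 <= l1 -> 0 <= l2 ->
  isometric_on `[0, l1] c1 -> isometric_on `[0, l2] c2 ->
  c1 0 = y -> c1 l1 = m -> c2 0 = m -> c2 l2 = z ->
  (forall s1 s2, 0 <= s1 < l1 -> 0 < s2 <= l2 -> c1 s1 <> c2 s2) ->
  forall c, isometric_on `[0, d y z] c -> c 0 = y -> c (d y z) = z ->
  (forall a : R -> T, simple_path y z a -> a @` `[0, 1] = c @` `[0, d y z]) ->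
  d y m + d m z = d y z /\ c (d y m) = m.
Proof.
move=> l10 l20 i1 i2 c10 c1l c20 c2l dis c ic c0 cE cS.
have [l0|l0] := ltrP 0 (l1 + l2); last first.
  have [e1 e2] : l1 = 0 /\ l2 = 0 by split; lra.
  have ym : y = m by rewrite -c10 -c1l e1.
  have mz : m = z by rewrite -c20 -c2l e2.
  by move: c0; rewrite -mz -ym mdistxx addr0.
have sp := isometric_concat_simple l10 l20 l0 i1 i2 c10 c1l c20 c2l dis.
have : (c @` `[0, d y z]) m.
  rewrite -(cS _ sp); exists (l1 / (l1 + l2)).
    by rewrite /= in_itv/= divr_ge0 ?(ltW l0)//= ler_pdivrMr// mul1r; lra.
  by rewrite divfK ?gt_eqF// lexx c1l.
case=> s; rewrite /= in_itv/= => s0 cs.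
have dym : d y m = s.
  rewrite -c0 -cs ic; rewrite ?sub0r ?normrN ?ger0_norm//=; rewrite ?in_itv/=; lra.
rewrite dym cs; split => //.
rewrite -cs -[in X in _ + d _ X]cE ic/= ?in_itv/=; try lra.
by rewrite ler0_norm; lra.
Qed.

(** Geodesics from x to p and from p to y concatenate to a simple path, so p is the value at d x p
    of the geodesic of the tree axiom; the same holds for p'. *)
Lemma tree_between_unique x y p p' : d x p + d p y = d x y -> d x p' + d p' y = d x y ->
  d x p = d x p' -> p = p'.
Proof.
move=> hp hp' e.
have [c [ic c0 cE cS]] := treeT x y.
suff H q : d x q + d q y = d x y -> c (d x q) = q.
  by rewrite -(H _ hp) e H.
move=> hq.
have [c1 [i1 c10 c1E _]] := treeT x q; have [c2 [i2 c20 c2E _]] := treeT q y.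
apply: (tree_concat (mdist_ge0 _ _) (mdist_ge0 _ _) i1 i2 c10 c1E c20 c2E _ ic c0 cE cS).2.
move=> s1 s2 h1 h2 e12.
have a1 : d x (c1 s1) = s1.
  by rewrite -{1}c10 i1/= ?in_itv/= ?sub0r ?normrN ?ger0_norm//; have := mdist_ge0 x q; lra.
have a2 : d (c2 s2) y = d q y - s2.
  by rewrite -{1}c2E i2/= ?in_itv/= ?ler0_norm//; have := mdist_ge0 q y; lra.
have := metric_triangle x (c1 s1) y; rewrite {2}e12 a1 a2; lra.
Qed.

(** [t] is the last parameter at which the two geodesics agree; beyond it they are disjoint, so
    going back along [c1] to [c1 t] and then along [c2] is a simple path. Thus t is the Gromov
    product of y and z based at x. *)
Lemma tree_branch (c1 c2 : R -> T) x y z :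
  isometric_on `[0, d x y] c1 -> c1 0 = x -> c1 (d x y) = y ->
  isometric_on `[0, d x z] c2 -> c2 0 = x -> c2 (d x z) = z ->
  exists t, [/\ 0 <= t <= d x y, t <= d x z, c1 t = c2 t, d y z = d x y + d x z - 2 * t &
    forall s, 0 <= s <= d x y -> s <= d x z -> c1 s = c2 s -> s <= t].
Proof.
move=> i1 c10 c1E i2 c20 c2E.
pose S := [set t | [/\ 0 <= t <= d x y, t <= d x z & c1 t = c2 t]].
have D1 := mdist_ge0 x y; have D2 := mdist_ge0 x z.
have S0 : S 0 by split; rewrite ?lexx ?c10.
have ubS : has_ubound S by exists (d x y) => t [/andP[]].
have hS : has_sup S by split => //; exists 0.
pose t := sup S.
have t0 : 0 <= t by exact: ub_le_sup.
have txy : t <= d x y by apply: ge_sup => [|s [/andP[]]//]; exists 0.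
have txz : t <= d x z by apply: ge_sup => [|s []//]; exists 0.
have in1 s : 0 <= s <= d x y -> `[0, d x y]%classic s by rewrite /= in_itv.
have in2 s : 0 <= s <= d x z -> `[0, d x z]%classic s by rewrite /= in_itv.
have et : c1 t = c2 t.
  apply: mdist_positivity; apply/eqP; rewrite eq_le mdist_ge0 andbT.
  apply/ler_addgt0Pl => e e0; rewrite addr0.
  have e20 : 0 < e / 2 by rewrite divr_gt0.
  have [s Ss ts] := sup_adherent e20 hS.
  have st : s <= t by exact: ub_le_sup.
  have [s1 s2 s3] := Ss.
  apply: le_trans (metric_triangle _ (c1 s) _) _.
  rewrite [in X in _ + X]s3 i1 ?i2; [|apply: in1 || apply: in2; rewrite -/t in ts; lra..].
  by rewrite ger0_norm ?ler0_norm; rewrite -/t in ts; lra.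
have mx s : 0 <= s <= d x y -> s <= d x z -> c1 s = c2 s -> s <= t.
  by move=> *; apply: ub_le_sup.
exists t; split => //; first by rewrite t0.
have [c [ic c0 cE cS]] := treeT y z.
pose r1 s := c1 (d x y - s); pose r2 s := c2 (t + s).
have l10 : 0 <= d x y - t by lra.
have l20 : 0 <= d x z - t by lra.
have ir1 : isometric_on `[0, d x y - t] r1.
  move=> a b; rewrite /= !in_itv/= => ha hb.
  rewrite /r1 i1; [|apply: in1; lra..].
  by rewrite -normrN; congr (`|_|); lra.
have ir2 : isometric_on `[0, d x z - t] r2.
  move=> a b; rewrite /= !in_itv/= => ha hb.
  rewrite /r2 i2; [|apply: in2; lra..].
  by congr (`|_|); lra.
have dis s1 s2 : 0 <= s1 < d x y - t -> 0 < s2 <= d x z - t -> r1 s1 <> r2 s2.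
  move=> h1 h2 e.
  have a1 : d x (r1 s1) = d x y - s1.
    rewrite -{1}c10 i1; [|apply: in1; lra..].
    by rewrite sub0r normrN ger0_norm; lra.
  have a2 : d x (r2 s2) = t + s2.
    rewrite -{1}c20 i2; [|apply: in2; lra..].
    by rewrite sub0r normrN ger0_norm; lra.
  have E : d x y - s1 = t + s2 by rewrite -a1 -a2 e.
  suff : t + s2 <= t by lra.
  by apply: mx; [lra|lra|move: e; rewrite /r1 /r2 E].
have r10 : r1 0 = y by rewrite /r1 subr0.
have r1l : r1 (d x y - t) = c1 t by rewrite /r1 opprB addrC subrK.
have r20 : r2 0 = c1 t by rewrite /r2 addr0.
have r2l : r2 (d x z - t) = z by rewrite /r2 addrC subrK.
have [<- _] := tree_concat l10 l20 ir1 ir2 r10 r1l r20 r2l dis ic c0 cE cS.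
rewrite -{1}c1E {2}et -c2E i1; [|apply: in1; lra..].
rewrite i2; [|apply: in2; lra..].
by rewrite c2E ger0_norm ?ler0_norm; lra.
Qed.

Lemma tree_geodesic x y r : 0 <= r <= d x y -> exists2 p, d x p = r & d p y = d x y - r.
Proof.
move=> r0; have [c [ic c0 cE _]] := treeT x y.
have D := mdist_ge0 x y.
exists (c r); [rewrite -{1}c0|rewrite -{1}cE]; rewrite ic/= ?in_itv/=; try lra.
- by rewrite sub0r normrN ger0_norm; lra.
- by rewrite ler0_norm; lra.
Qed.

(** 0-hyperbolicity: the Gromov products based at w satisfy (x|z) >= min((x|y), (y|z)), because
    geodesics from w that agree at one parameter agree before it. Most of what follows on trees is
    linear arithmetic from instances of this inequality. *)
Lemma tree_four_point w x y z :
  d x z + d w y <= d w z + d x y \/ d x z + d w y <= d w x + d y z.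
Proof.
have [cx [ix cx0 cxE _]] := treeT w x.
have [cy [iy cy0 cyE _]] := treeT w y.
have [cz [iz cz0 czE _]] := treeT w z.
have [t1 [t10 t1y e1 D1 _]] := tree_branch ix cx0 cxE iy cy0 cyE.
have [t2 [t20 t2z e2 D2 _]] := tree_branch iy cy0 cyE iz cz0 czE.
have [t3 [t30 t3z e3 D3 M3]] := tree_branch ix cx0 cxE iz cz0 czE.
have dist0 c p s : isometric_on `[0, d w p] c -> c 0 = w -> 0 <= s <= d w p ->
    d w (c s) = s.
  move=> ic c0 hs; rewrite -{1}c0 ic/= ?in_itv/=; [|lra..].
  by rewrite sub0r normrN ger0_norm; lra.
have distd c p s t : isometric_on `[0, d w p] c -> 0 <= s <= t -> t <= d w p ->
    d (c s) (c t) = t - s.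
  move=> ic hs ht; rewrite ic/= ?in_itv/=; [|lra..].
  by rewrite ler0_norm; lra.
have agree c c' p p' s t : isometric_on `[0, d w p] c -> c 0 = w ->
    isometric_on `[0, d w p'] c' -> c' 0 = w -> 0 <= s <= t -> t <= d w p -> t <= d w p' ->
    c t = c' t -> c s = c' s.
  move=> ic c0 ic' c0' hs ht ht' e.
  apply: (@tree_between_unique w (c t)).
  - rewrite (dist0 c p)// ?(distd c p)// ?(dist0 c p)//; clear - hs ht ht'; lra.
  - rewrite e (distd c' p')// !(dist0 c' p')//; clear - hs ht ht'; lra.
  - by rewrite (dist0 c p)// ?(dist0 c' p')//; clear - hs ht ht'; lra.
have [t12|t12] := leP t1 t2.
- have : t1 <= t3.
    apply: M3; [lra|lra|rewrite e1; apply: (agree cy cz y z t1 t2) => //; lra].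
  by left; lra.
- have : t2 <= t3.
    apply: M3; [lra|lra|rewrite -e2; apply: (agree cx cy x y t2 t1) => //; lra].
  by right; lra.
Qed.

End RealTrees.

(** * Characteristic sets and translation lengths of tree isometries *)

Section TreeIsometries.
Context {R : realType} (T : metricType R) (G : groupType) (act : G -> T -> T).
Local Notation d := (@mdist R T).
Hypothesis gtT : gtree act.
Local Notation "g \\ x" := (act g x) (at level 35, right associativity).
Local Notation l := (length_function act).

Let geo := @tree_geodesic R T (let: And3 h _ _ := gtT in h).
Let fp := @tree_four_point R T (let: And3 h _ _ := gtT in h).
Let tri := @metric_triangle R T.
Let sym := @metric_sym R T.
Let ge0 := @mdist_ge0 R T.

Lemma gtree_act1 x : 1%g \\ x = x.
Proof. by case: gtT => _ [h _] _. Qed.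

Lemma gtree_actM g h x : (g * h)%g \\ x = g \\ h \\ x.
Proof. by case: gtT => _ [_ h'] _. Qed.

Lemma gtree_iso g x y : d (g \\ x) (g \\ y) = d x y.
Proof. by case: gtT. Qed.

Lemma gtree_actV g x : (g^-1)%g \\ g \\ x = x.
Proof. by rewrite -gtree_actM mulVg gtree_act1. Qed.

Lemma gtree_actVr g x : g \\ (g^-1)%g \\ x = x.
Proof. by rewrite -gtree_actM mulgV gtree_act1. Qed.

Let iso := gtree_iso.

(** Local geodesics are geodesics: two geodesic triples overlapping in a segment of positive length
    concatenate. *)
Lemma tree_join a b c e : d a c = d a b + d b c -> d b e = d b c + d c e -> 0 < d b c ->
  d a e = d a b + d b c + d c e.
Proof.
move=> h1 h2 h3; have := fp b a e c; have := tri a b e; have := sym a b; have := sym e c.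
by move=> *; lra.
Qed.

Lemma length_le g x : l g <= d x (g \\ x).
Proof. by apply: ge_inf => [|/=]; [exists 0 => _ [y _ <-]; exact: ge0|exists x]. Qed.

Lemma le_length g x b : b <= d x (g \\ x) ->
  (forall y, b <= d y (g \\ y)) -> b <= l g.
Proof.
move=> _ h; apply: lb_le_inf => [|_ [y _ <-]//]; by exists (d x (g \\ x)), x.
Qed.

Lemma axis_power g p b : d p (g \\ p) = b -> 0 < b -> d p (g \\ g \\ p) = 2 * b ->
  forall n, d p ((g ^+ n)%g \\ p) = n%:R * b.
Proof.
move=> pb b0 p2b n.
suff [] : d p ((g ^+ n)%g \\ p) = n%:R * b /\ d p ((g ^+ n.+1)%g \\ p) = n.+1%:R * b by [].
elim: n => [|n [IH1 IH2]].
  by rewrite expg0 expg1 gtree_act1 mdistxx mul0r mul1r.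
split => //.
have e m : (g ^+ m.+1)%g \\ p = (g ^+ m)%g \\ g \\ p by rewrite expgSr gtree_actM.
have e' m : d ((g ^+ m)%g \\ p) ((g ^+ m.+1)%g \\ p) = b by rewrite e iso pb.
rewrite (@tree_join p ((g ^+ n)%g \\ p) ((g ^+ n.+1)%g \\ p)).
- by rewrite IH1 !e' -!natr1; ring.
- by rewrite IH1 IH2 e' -natr1; ring.
- by rewrite !e' e expgSr gtree_actM iso p2b; ring.
- by rewrite e'.
Qed.

(** The path from p to g^n p through y and g^n y has length at most 2 d(p, y) + n d(y, g y);
    dividing by n gives the bound in the limit. *)
Lemma displacement_ge g p b : (forall n, d p ((g ^+ n)%g \\ p) = n%:R * b) ->
  forall y, b <= d y (g \\ y).
Proof.
move=> h y; rewrite leNgt; apply/negP => yb.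
have pw n : d y ((g ^+ n)%g \\ y) <= n%:R * d y (g \\ y).
  elim: n => [|n IH]; first by rewrite expg0 gtree_act1 mdistxx mul0r.
  have := tri y (g \\ y) ((g ^+ n.+1)%g \\ y); rewrite expgS gtree_actM iso -natr1; lra.
set c := d y _ in yb pw.
have e0 : 0 < b - c by rewrite subr_gt0.
have x0 : 0 <= 2 * d p y / (b - c) by rewrite divr_ge0 ?(ltW e0)// mulr_ge0.
have := archi_boundP x0; set n := Num.bound _; rewrite ltr_pdivrMr// mulrBr => nP.
have := tri p y ((g ^+ n)%g \\ p); have := tri y ((g ^+ n)%g \\ y) ((g ^+ n)%g \\ p).
by rewrite iso ?(sym y p) h; have := pw n; lra.
Qed.

(** [p] is the projection of x to the characteristic set of g. If g^2 x is not farther from x than g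
    x, the midpoint of [x, g x] is fixed; otherwise the length is d(x, g^2 x) - d(x, g x), and p
    lies on [x, g x] where [x, g^2 x] forces it. *)
Lemma nearest_point_ex g x : exists p, d p (g \\ p) = l g /\
  d x (g \\ x) = l g + 2 * d x p /\ (0 < l g -> d p (g \\ g \\ p) = 2 * l g).
Proof.
suff [p [b [pb xb bb]]] : exists p b, [/\ d p (g \\ p) = b, d x (g \\ x) = b + 2 * d x p &
    b = 0 \/ 0 < b /\ d p (g \\ g \\ p) = 2 * b].
  have lb y : b <= d y (g \\ y).
    by case: bb => [->|[b0 p2b]]; [exact: ge0|exact: (displacement_ge (axis_power pb b0 p2b))].
  have <- : b = l g.
    by apply/eqP; rewrite eq_le; apply/andP; split; [exact: le_length (lb p) lb|rewrite -pb length_le].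
  by exists p; split => //; split => // b0; case: bb b0 => [->|[_ ->//]]; rewrite ltxx.
set a := d x (g \\ x); set e := d x (g \\ g \\ x).
have gxgg : d (g \\ x) (g \\ g \\ x) = a by rewrite iso.
have e2a : e <= 2 * a by have := tri x (g \\ x) (g \\ g \\ x); rewrite gxgg -/a -/e; lra.
have a0 : 0 <= a := ge0 _ _.
have [ea|ae] := leP e a.
- have [p xp px] := @geo x (g \\ x) (a / 2) ltac:(rewrite -/a; lra).
  exists p, 0; split; [|by rewrite xp; lra|by left].
  have gp1 : d (g \\ x) (g \\ p) = a / 2 by rewrite iso.
  have gp2 : d (g \\ p) (g \\ g \\ x) = a / 2 by rewrite iso px -/a; lra.
  apply/eqP; rewrite eq_le ge0 andbT.
  have := fp (g \\ x) p x (g \\ g \\ x); rewrite ?(sym p x) ?(sym (g \\ x) x) ?(sym (g \\ x) p).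
  have := fp (g \\ x) p (g \\ g \\ x) (g \\ p); rewrite ?(sym (g \\ g \\ x) (g \\ p)) ?(sym (g \\ x) p).
  rewrite -/a -/e gxgg gp1 gp2 xp px -/a; lra.
- have [p xp px] := @geo x (g \\ x) (a - e / 2) ltac:(rewrite -/a; lra).
  rewrite -/a in px.
  have gp1 : d (g \\ x) (g \\ p) = a - e / 2 by rewrite iso.
  have gp2 : d (g \\ p) (g \\ g \\ x) = e / 2 by rewrite iso px -/a; lra.
  have h1 : d (g \\ p) x <= e / 2.
    have := fp (g \\ x) (g \\ p) (g \\ g \\ x) x.
    rewrite ?(sym (g \\ g \\ x) x) ?(sym (g \\ x) x) -/a -/e gxgg gp1 gp2; lra.
  have h2 : d p (g \\ p) <= e - a.
    have := fp x p (g \\ x) (g \\ p).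
    rewrite ?(sym p (g \\ x)) ?(sym x (g \\ p)) -/a gp1 xp ?(sym (g \\ x) p) px; lra.
  have h3 : d p (g \\ p) = e - a.
    have := tri x p (g \\ p); have := tri x (g \\ p) (g \\ x); have := sym (g \\ p) (g \\ x); rewrite gp1 -/a xp; lra.
  exists p, (e - a); split => //; first by rewrite xp -/a; lra.
  right; split; first lra.
  have := tri p (g \\ p) (g \\ g \\ p); rewrite iso h3.
  have := tri x p (g \\ g \\ p); have := tri x (g \\ g \\ p) (g \\ g \\ x).
  rewrite !iso ?(sym p x) -/e xp; lra.
Qed.

Lemma length_ge0 g : T -> 0 <= l g.
Proof. by move=> x; have [p [<- _]] := nearest_point_ex g x. Qed.

Lemma axis_double g p : d p (g \\ p) = l g -> 0 < l g -> d p (g \\ g \\ p) = 2 * l g.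
Proof.
move=> pg l0; have [q [_ [h1 h2]]] := nearest_point_ex g p.
have /mdist_positivity -> : d p q = 0 by lra.
exact: h2.
Qed.

Lemma axis_lengthX g p n : d p (g \\ p) = l g -> 0 < l g ->
  d p ((g ^+ n)%g \\ p) = n%:R * l g.
Proof. by move=> pg l0; apply: axis_power => //; exact: axis_double. Qed.

Lemma length_axis g p b : d p (g \\ p) = b -> 0 < b -> d p (g \\ g \\ p) = 2 * b -> l g = b.
Proof.
move=> pb b0 p2b; apply/eqP; rewrite eq_le -{1}pb length_le/=.
by apply: (@le_length _ p) => [|y]; [rewrite pb|exact: (displacement_ge (axis_power pb b0 p2b))].
Qed.

Lemma lengthJ g h : l (h * g * h^-1)%g = l g.
Proof.
rewrite /length_function /translation_length; congr inf; apply/seteqP; split.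
  move=> _ [x _ <-]; exists ((h^-1)%g \\ x) => //.
  by rewrite -(iso h) gtree_actVr !gtree_actM.
by move=> _ [x _ <-]; exists (h \\ x) => //; rewrite !gtree_actM gtree_actV iso.
Qed.

Lemma axisJ g h p : d p (g \\ p) = l g -> d (h \\ p) ((h * g * h^-1)%g \\ h \\ p) = l (h * g * h^-1)%g.
Proof. by move=> pg; rewrite lengthJ !gtree_actM gtree_actV iso. Qed.

Lemma axis_convex g p q m : d p (g \\ p) = l g -> d q (g \\ q) = l g ->
  d p m + d m q = d p q -> d m (g \\ m) = l g.
Proof.
move=> pg qg pmq; apply/eqP; rewrite eq_le length_le andbT.
have e1 := iso g p m; have e2 := iso g m q; have e3 := iso g p q.
have := fp p (g \\ p) (g \\ m) (g \\ q); have := fp q (g \\ p) (g \\ m) (g \\ q).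
have := tri p q (g \\ q); have := tri q p (g \\ p).
have := fp m p (g \\ m) q.
rewrite ?(sym q p) ?(sym q m) ?(sym (g \\ m) (g \\ p)) ?(sym (g \\ m) p) ?(sym (g \\ m) q) ?(sym m p).
by have := ge0 p m; have := ge0 m q; lra.
Qed.

(** The axis of hg meets q, h q, h p, h g q, h g h p in this order; the segments between them are
    glued by [tree_join], and [length_axis] concludes. *)
Lemma product_length g h p q : d p (g \\ p) = l g -> d q (h \\ q) = l h -> p <> q ->
  d q (g \\ q) = l g + 2 * d p q -> d p (h \\ p) = l h + 2 * d p q ->
  l (h * g)%g = l g + l h + 2 * d p q.
Proof.
move=> pg qh /eqP pq gq hp.
have d0 : 0 < d p q by rewrite mdist_gt0.
have lg0 : 0 <= l g by rewrite -pg.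
have lh0 : 0 <= l h by rewrite -qh.
set D := d p q in gq hp d0 *.
have qhp : d q (h \\ p) = D + l h.
  by have := tri q (h \\ q) (h \\ p); have := tri p q (h \\ p); rewrite iso ?(sym q p) -/D qh hp; lra.
have pgq : d p (g \\ q) = D + l g.
  by have := tri p (g \\ p) (g \\ q); have := tri q p (g \\ q); rewrite iso ?(sym q p) -/D pg gq; lra.
have gpq : d (g \\ p) q = D + l g.
  have := tri (g \\ p) p q; have := tri q (g \\ p) (g \\ q); rewrite iso ?(sym q (g \\ p)) ?(sym (g \\ p) p) -/D pg gq; lra.
have qk : d q (h \\ g \\ q) = l g + l h + 2 * D.
  rewrite (@tree_join q (h \\ q) (h \\ p)).
  - by rewrite qh !iso ?(sym q p) -/D pgq; lra.
  - by rewrite qhp qh iso ?(sym q p) -/D; lra.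
  - by rewrite !iso gq ?(sym q p) -/D pgq; lra.
  - by rewrite iso ?(sym q p).
have hpk : d (h \\ p) (h \\ g \\ h \\ p) = l g + l h + 2 * D.
  rewrite iso (@tree_join p (g \\ p) (g \\ q)).
  - by rewrite pg !iso -/D qhp; lra.
  - by rewrite pgq pg iso -/D; lra.
  - by rewrite !iso hp -/D qhp; lra.
  - by rewrite iso.
have hpkq : d (h \\ p) (h \\ g \\ q) = D + l g by rewrite iso pgq.
have kqkhp : d (h \\ g \\ q) (h \\ g \\ h \\ p) = D + l h by rewrite !iso qhp.
have qkhp : d q (h \\ g \\ h \\ p) = l g + 2 * l h + 3 * D.
  rewrite (@tree_join q (h \\ p) (h \\ g \\ q)); rewrite ?qhp ?hpkq ?kqkhp ?qk ?hpk; lra.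
apply: (@length_axis _ q); rewrite ?gtree_actM ?qk//; first lra.
rewrite (@tree_join q (h \\ g \\ q) (h \\ g \\ h \\ p)).
- by rewrite qk kqkhp !iso pgq; lra.
- by rewrite qkhp qk kqkhp; lra.
- by rewrite !iso qk qhp pgq; lra.
- by rewrite kqkhp; lra.
Qed.

(** The inequality on y says that [p, y] and [p, q] share an initial segment, so y leaves the
    characteristic set of g at the same point p as q does. *)
Lemma same_direction_nearest g p q y : d p (g \\ p) = l g -> d q (g \\ q) = l g + 2 * d p q ->
  d y q < d p y + d p q -> d y (g \\ y) = l g + 2 * d p y.
Proof.
move=> pg qg yq.
have pgq : d p (g \\ q) = d p q + l g.
  by have := tri p (g \\ p) (g \\ q); have := tri q p (g \\ q); rewrite iso ?(sym q p) pg qg; lra.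
have gpq : d q ((g^-1)%g \\ p) = d p q + l g by rewrite -(iso g) gtree_actVr sym.
have gpp : d p ((g^-1)%g \\ p) = l g by rewrite -(iso g) gtree_actVr sym.
have gpy : d y ((g^-1)%g \\ p) = d p y + l g.
  have := tri y p ((g^-1)%g \\ p); have := fp p q y ((g^-1)%g \\ p).
  rewrite gpp gpq ?(sym y p) ?(sym q y); have := sym y p; have := fp p y q ((g^-1)%g \\ p).
  rewrite gpp gpq ?(sym q y); lra.
have pgy : d p (g \\ y) = d p y + l g by rewrite -gpy -(iso g y) gtree_actVr sym.
have ygq : l g + d p q + d p y <= d y (g \\ q).
  have := fp p q y (g \\ q); rewrite ?(sym q y) qg pgq; lra.
have := tri y p (g \\ y); have := iso g y q.
rewrite pgy ?(sym (g \\ q)) ?(sym y p); have := ge0 p q; have := length_ge0 g p.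
have := fp p y (g \\ y) (g \\ q); rewrite ?(sym (g \\ q)) pgy pgq; lra.
Qed.

(** If the distances did not add up, [same_direction_nearest] would make p the projection of y,
    forcing y = p. *)
Lemma nearest_gate g p q y : d p (g \\ p) = l g -> d q (g \\ q) = l g + 2 * d p q ->
  d y (g \\ y) = l g -> d q y = d q p + d p y.
Proof.
move=> pg qg yg; have [h|h] := ltP (d y q) (d p y + d p q).
  have := same_direction_nearest pg qg h; rewrite yg => e.
  have /mdist_positivity -> : d p y = 0 by lra.
  by rewrite mdistxx addr0.
by have := tri q p y; rewrite ?(sym q p) ?(sym q y); lra.
Qed.

(** [p, q] is the segment joining two disjoint characteristic sets: the last two conditions say that
    p is the projection of q to the first set and q that of p to the second. *)
Definition bridge g h p q := [/\ d p (g \\ p) = l g, d q (h \\ q) = l h, p <> q,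
  d q (g \\ q) = l g + 2 * d p q & d p (h \\ p) = l h + 2 * d p q].

(** Project any point to the first set, the result p to the second, giving q, and q back, giving p0.
    Then p0 lies between q and p, hence projects to the same point q as p does. *)
Lemma bridge_ex g h : T -> (forall x, d x (g \\ x) = l g -> d x (h \\ x) = l h -> False) ->
  exists p q, bridge g h p q.
Proof.
move=> x dis; have [p [pg _]] := nearest_point_ex g x.
have [q [qh [hp _]]] := nearest_point_ex h p.
have [p0 [p0g [gq _]]] := nearest_point_ex g q.
have ne : p0 <> q by move=> e; apply: (dis q) => //; rewrite -e.
exists p0, q; split => //; first by rewrite gq sym.
have gq' : d q (g \\ q) = l g + 2 * d p0 q by rewrite gq sym.
have gate := nearest_gate p0g gq' pg.
have hp' : d p (h \\ p) = l h + 2 * d q p by rewrite hp sym.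
rewrite ?(sym p0 q).
apply: (same_direction_nearest qh hp'); rewrite gate.
have : 0 < d p0 q by rewrite mdist_gt0; apply/eqP.
rewrite ?(sym q p0); lra.
Qed.

(** One of the two characteristic sets lies on the other side of p from y; all points z leaving p in
    the direction of y project to it at one point r, through p. *)
Lemma bridge_pick g h p q y : bridge g h p q -> y <> p ->
  exists k r, [/\ d r (k \\ r) = l k, r = p \/ r = q &
    forall z, d z y < d p z + d p y -> d z (k \\ z) = l k + 2 * d z r /\ d z r = d z p + d p r].
Proof.
move=> [pg qh /eqP pq gq hp] /eqP yp.
have D0 : 0 < d p q by rewrite mdist_gt0.
have [h1|h1] := ltP (d y q) (d p y + d p q).
  exists g, p; split => //; first by left.
  move=> z hz; rewrite mdistxx addr0; split => //; rewrite ?(sym z p).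
  apply: (same_direction_nearest pg gq).
  by have := fp z p q y; rewrite ?(sym z p) ?(sym q y); lra.
exists h, q; split => //; first by right.
move=> z hz.
have zq : d z q = d z p + d p q.
  have := tri z p q; have := fp y p q z; rewrite ?(sym y z) ?(sym z p) ?(sym y p) ?(sym q z); lra.
split => //; rewrite ?(sym z q).
have hp' : d p (h \\ p) = l h + 2 * d q p by rewrite hp sym.
apply: (same_direction_nearest qh hp'); rewrite ?(sym q z) zq ?(sym q p); lra.
Qed.

Hypothesis l_nat : forall g, exists N : nat, l g = N%:R.

(** Choose one of g, h and one of their conjugates by c with characteristic sets lying beyond p and
    beyond c p on a line through both. Their bridge contains [p, c p]; its length is a half-integer
    by [product_length], and so are the two excess pieces, each of length 0 or d(p, q). *)
Lemma bridge_orbit_integral g h p q c : bridge g h p q ->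
  exists z : int, 2 * d p (c \\ p) = z%:~R.
Proof.
move=> B; have [pg qh pq gq hp] := B.
have lz k : exists z : int, l k = z%:~R by have [N ->] := l_nat k; exists (Posz N).
have [e|/eqP ne] := eqVneq (c \\ p) p; first by exists 0; rewrite e mdistxx mulr0.
have B' : bridge (c * g * c^-1)%g (c * h * c^-1)%g (c \\ p) (c \\ q).
  split; [exact: axisJ|exact: axisJ| | |].
  - by move=> /(congr1 (act (c^-1)%g)); rewrite !gtree_actV.
  - by rewrite lengthJ !gtree_actM gtree_actV !iso.
  - by rewrite lengthJ !gtree_actM gtree_actV !iso.
have [k [r [kr rpq kz]]] := bridge_pick B ne.
have [k' [r' [kr' rpq' kz']]] := bridge_pick B' (nesym ne).
have dpp : 0 < d p (c \\ p) by rewrite mdist_gt0; apply/eqP => /esym.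
have [_ pr'] : d p (k' \\ p) = l k' + 2 * d p r' /\ d p r' = d p (c \\ p) + d (c \\ p) r'.
  by apply: kz'; rewrite mdistxx sym; lra.
have [cpk cpr] : d (c \\ p) (k \\ c \\ p) = l k + 2 * d (c \\ p) r /\ d (c \\ p) r = d (c \\ p) p + d p r.
  by apply: kz; rewrite mdistxx; lra.
have [r'k r'r] : d r' (k \\ r') = l k + 2 * d r' r /\ d r' r = d r' p + d p r.
  by apply: kz; rewrite pr' ?(sym r'); lra.
have [rk' rr'] : d r (k' \\ r) = l k' + 2 * d r r' /\ d r r' = d r (c \\ p) + d (c \\ p) r'.
  by apply: kz'; rewrite cpr ?(sym r p) ?(sym (c \\ p) p); lra.
have rne : r <> r'.
  move=> e; have := ge0 p r'; have := ge0 (c \\ p) r'; have := sym r' p; move: r'r pr'; rewrite e mdistxx; lra.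
have PL : l (k' * k)%g = l k + l k' + 2 * d r r'.
  by apply: product_length => //; rewrite r'k ?(sym r').
have [z1 e1] := lz (k' * k)%g; have [z2 e2] := lz k; have [z3 e3] := lz k'.
have PD := product_length pg qh pq gq hp.
have [z4 e4] := lz (h * g)%g; have [z5 e5] := lz g; have [z6 e6] := lz h.
have two x : x = p \/ x = q -> exists z : int, 2 * d p x = z%:~R.
  case=> ->; first by exists 0; rewrite mdistxx mulr0.
  by exists (z4 - z5 - z6); rewrite !intrB -e4 -e5 -e6 PD; ring.
have [z7 e7] := two r rpq.
have [z8 e8] : exists z : int, 2 * d (c \\ p) r' = z%:~R.
  by case: rpq' => ->; rewrite iso; apply: two; [left|right].
exists (z1 - z2 - z3 - z7 - z8); rewrite !intrB -e1 -e2 -e3 -e7 -e8 PL.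
by move: r'r pr'; rewrite ?(sym r r') ?(sym r' p) => -> ->; ring.
Qed.

End TreeIsometries.

(** * Pairwise meeting characteristic sets and abelian length functions *)

Section AbelianOrBridge.
Context {R : realType} (T : metricType R) (G : groupType) (act : G -> T -> T).
Local Notation d := (@mdist R T).
Hypothesis gtT : gtree act.
Local Notation "g \\ x" := (act g x) (at level 35, right associativity).
Local Notation l := (length_function act).
Let tT : rtree T := (let: And3 h _ _ := gtT in h).
Let geo := @tree_geodesic R T tT.
Let fp := @tree_four_point R T tT.
Let tri := @metric_triangle R T.
Let sym := @metric_sym R T.
Let ge0 := @mdist_ge0 R T.
Let iso := gtree_iso gtT.
Let actM := gtree_actM gtT.

Definition tree_convex (A : set T) :=
  forall p q m, A p -> A q -> d p m + d m q = d p q -> A m.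

Lemma tree_median x y z : exists m, [/\ d x m + d m y = d x y, d x m + d m z = d x z &
  d y m + d m z = d y z].
Proof.
have [m xm my] := @geo x y ((d x y + d x z - d y z) / 2) ltac:(have := tri x y z; have := tri x z y; have := tri y x z; have := sym y x; have := sym y z; lra).
exists m; have := fp m x z y; have := tri x m z; have := tri y m z.
by rewrite (sym m x) (sym y m) my (sym z y) xm; split; lra.
Qed.

Lemma helly3 (A B C : set T) : tree_convex A -> tree_convex B -> tree_convex C ->
  A `&` B !=set0 -> B `&` C !=set0 -> A `&` C !=set0 -> A `&` B `&` C !=set0.
Proof.
move=> cA cB cC [x [Ax Bx]] [y [By Cy]] [z [Az Cz]].
have [m [xy xz yz]] := tree_median x y z.
by exists m; split; [split; [exact: cA xz|exact: cB xy]|exact: cC yz].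
Qed.

(** Induction on the number of sets: the intersections with the last member are convex and meet
    pairwise by [helly3]. *)
Lemma helly (n : nat) (A : nat -> set T) : T -> (forall i, tree_convex (A i)) ->
  (forall i j, A i `&` A j !=set0) -> exists x, forall i, (i < n)%N -> A i x.
Proof.
move=> x0; elim: n A => [|n IH] A cA pA; first by exists x0.
case: n IH => [_|n IH].
  by have [x [A0 _]] := pA 0%N 0%N; exists x => i; rewrite ltnS leqn0 => /eqP ->.
have [i j|i j|x hx] := IH (fun i => A i `&` A n.+1).
- by move=> q m [? ?] [? ?] ?; split; [exact: (cA i j q)|exact: (cA n.+1 j q)].
- have [x [[Ai Aj] An]] := helly3 (cA i) (cA j) (cA n.+1) (pA i j) (pA j n.+1) (pA i n.+1).
  by exists x.
exists x => i; rewrite ltnS leq_eqVlt => /orP[/eqP ->|/hx[]//].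
by have [] := hx 0%N isT.
Qed.

Hypothesis meet : forall g h, exists x, d x (g \\ x) = l g /\ d x (h \\ x) = l h.

Lemma helly_axes (w : seq G) : T -> exists x, forall i, (i < size w)%N ->
  d x (nth 1%g w i \\ x) = l (nth 1%g w i).
Proof.
move=> x0; apply: (@helly (size w) (fun i => [set x | d x (nth 1%g w i \\ x) = l (nth 1%g w i)]) x0).
  by move=> i p q m; exact: axis_convex.
by move=> i j; exact: meet.
Qed.

Lemma axis_conj c k p : d p ((c^-1 * k * c)%g \\ p) = l (c^-1 * k * c)%g ->
  d (c \\ p) (k \\ c \\ p) = l k.
Proof.
have := lengthJ gtT k (c^-1)%g; rewrite invgK => ->.
by rewrite !actM -(iso c) (gtree_actVr gtT).
Qed.

Section Axis.
Variable (h : G).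
Hypothesis b0 : 0 < l h.
Local Notation b := (l h).
Local Notation Ch x := (d x (h \\ x) = l h).

(** y lies ahead of x on the axis of h, in the direction of translation. The order is expressed by
    distances alone, so the axis is never parametrized. *)
Definition fwd x y := forall N : nat, d x ((h ^+ N)%g \\ y) = N%:R * b + d x y.

Lemma fwdI x y N : Ch y -> (0 < N)%N -> d x ((h ^+ N)%g \\ y) = N%:R * b + d x y -> fwd x y.
Proof.
move=> yh N0 xy M; have [MN|NM] := leqP M N.
- have e : (h ^+ N)%g \\ y = (h ^+ M)%g \\ (h ^+ (N - M))%g \\ y by rewrite -actM -expgnDr subnKC.
  have := tri x ((h ^+ M)%g \\ y) ((h ^+ N)%g \\ y); have := tri x y ((h ^+ M)%g \\ y).
  by rewrite xy e iso !(axis_lengthX gtT)// natrB// mulrBl; lra.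
- have e : (h ^+ M)%g \\ y = (h ^+ N)%g \\ (h ^+ (M - N))%g \\ y by rewrite -actM -expgnDr subnKC// ltnW.
  rewrite (@tree_join _ _ _ _ gtT x y ((h ^+ N)%g \\ y)).
  + by rewrite e iso !(axis_lengthX gtT)// natrB ?(ltnW NM)// mulrBl; lra.
  + by rewrite xy (axis_lengthX gtT)//; lra.
  + by rewrite e iso -actM -expgnDr subnKC ?(ltnW NM)// !(axis_lengthX gtT)// natrB ?(ltnW NM)// mulrBl; lra.
  + by rewrite (axis_lengthX gtT)// mulr_gt0// ltr0n.
Qed.

Lemma fwd_dich x y : Ch x -> Ch y -> exists N, (0 < N)%N /\ d x y <= N%:R * b /\
  (fwd x y /\ d y ((h ^+ N)%g \\ x) = N%:R * b - d x y \/
   fwd y x /\ d x ((h ^+ N)%g \\ y) = N%:R * b - d x y).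
Proof.
move=> xh yh.
have q0 : 0 <= d x y / b := divr_ge0 (ge0 _ _) (ltW b0).
have := archi_boundP q0; set N := Num.bound _ => NP.
rewrite ltr_pdivrMr// in NP.
have N0 : (0 < N)%N by rewrite lt0n; apply/eqP => e; move: NP; rewrite e mul0r ltNge ge0.
exists N; split => //; split; first exact: ltW.
have xk := axis_lengthX gtT N xh b0; have yk := axis_lengthX gtT N yh b0.
have x2k := axis_lengthX gtT (N + N) xh b0.
rewrite expgnDr actM natrD mulrDl in x2k.
set k := (h ^+ N)%g in xk yk x2k *; set L := N%:R * b in xk yk x2k NP *.
have := fp x (k \\ x) (k \\ k \\ x) (k \\ y).
have := fp x y (k \\ y) (k \\ x).
have t1 := tri x y (k \\ y); have t2 := tri y x (k \\ x).
have t3 := tri x (k \\ y) (k \\ x); have t4 := tri y (k \\ x) (k \\ y).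
move: t1 t2 t3 t4; rewrite !iso x2k xk yk (sym (k \\ x) y) ?(sym y x).
move=> t1 t2 t3 t4 f1 f2.
have [f3|f3] : d x (k \\ y) = L + d x y \/ d y (k \\ x) = L + d x y by lra.
  by left; split; [exact: (fwdI yh N0)|lra].
by right; split; [apply: (fwdI xh N0); rewrite (sym y x)|lra].
Qed.

Lemma fwd_total x y : Ch x -> Ch y -> fwd x y \/ fwd y x.
Proof. by move=> xh yh; have [N [_ [_ [[? _]|[? _]]]]] := fwd_dich xh yh; [left|right]. Qed.

Lemma fwd_anti x y : Ch x -> Ch y -> fwd x y -> fwd y x -> d x y = 0.
Proof.
move=> xh yh f1 f2; have [N [_ [_ []]]] := fwd_dich xh yh.
  by move=> [_]; rewrite f2 (sym y x); lra.
by move=> [_]; rewrite f1; lra.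
Qed.

Lemma fwd_back x y N : Ch x -> Ch y -> fwd x y -> d x y <= N%:R * b ->
  d y ((h ^+ N)%g \\ x) = N%:R * b - d x y.
Proof.
move=> xh yh f hN.
have xk := axis_lengthX gtT N xh b0; have yk := axis_lengthX gtT N yh b0.
have := f N; set k := (h ^+ N)%g in xk yk *; set L := N%:R * b in xk yk hN *.
move=> e; have := fp x y (k \\ y) (k \\ x).
have t4 := tri y (k \\ x) (k \\ y); move: t4; rewrite (sym (k \\ y)) !iso xk yk e; lra.
Qed.

Lemma fwd_trans x y z : Ch x -> Ch y -> Ch z -> fwd x y -> fwd y z ->
  fwd x z /\ d x z = d x y + d y z.
Proof.
move=> xh yh zh xy yz.
have [/mdist_positivity e|d1] := eqVneq (d x y) 0; first by rewrite e mdistxx add0r; split.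
have [/mdist_positivity e|d2] := eqVneq (d y z) 0; first by rewrite -e mdistxx addr0; split.
have D1 : 0 < d x y by rewrite lt0r d1 ge0.
have D2 : 0 < d y z by rewrite lt0r d2 ge0.
have S0 : 0 <= d x y + d y z by lra.
have q0 : 0 <= (d x y + d y z) / b := divr_ge0 S0 (ltW b0).
have := archi_boundP q0; set N := Num.bound _ => NP.
rewrite ltr_pdivrMr// in NP.
have N0 : (0 < N)%N by rewrite lt0n; apply/eqP => e; move: NP; rewrite e mul0r ltNge S0.
have yk := axis_lengthX gtT N yh b0.
have e1 := xy N; have e2 := yz N.
have hN2 : d y z <= N%:R * b by lra.
have e3 := fwd_back yh zh yz hN2.
have e : d x z = d x y + d y z.
  have := fp x y ((h ^+ N)%g \\ y) z; have := tri x y z.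
  rewrite e1 yk (sym ((h ^+ N)%g \\ y) z) e3; lra.
split => //.
have [//|zx] := fwd_total xh zh.
have dzx : d z x <= N%:R * b by rewrite sym e; exact: ltW.
have := fwd_back zh xh zx dzx; have := tri x ((h ^+ N)%g \\ z) ((h ^+ N)%g \\ y).
rewrite iso (sym z y) (sym z x) e1 e; lra.
Qed.

Definition sdist x y := if `[< fwd x y >] then d x y else - d x y.

Lemma sdist_fwd x y : fwd x y -> sdist x y = d x y.
Proof. by move=> f; rewrite /sdist; case: asboolP. Qed.

Lemma sdist_bwd x y : Ch x -> Ch y -> fwd y x -> sdist x y = - d x y.
Proof.
by move=> xh yh f; rewrite /sdist; case: asboolP => // f'; rewrite (fwd_anti xh yh f' f) oppr0.
Qed.

Lemma norm_sdist x y : `|sdist x y| = d x y.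
Proof. by rewrite /sdist; case: ifP => _; rewrite ?normrN ger0_norm. Qed.

Lemma sdist_add x y z : Ch x -> Ch y -> Ch z -> sdist x z = sdist x y + sdist y z.
Proof.
move=> xh yh zh.
have [xy|xy] := fwd_total xh yh; have [yz|yz] := fwd_total yh zh.
- by have [f e] := fwd_trans xh yh zh xy yz; rewrite !sdist_fwd.
- rewrite (sdist_fwd xy) (sdist_bwd yh zh yz).
  have [xz|xz] := fwd_total xh zh.
    have [_ e] := fwd_trans xh zh yh xz yz; rewrite sdist_fwd// e (sym z y); lra.
  have [_ e] := fwd_trans zh xh yh xz xy; rewrite (sdist_bwd xh zh xz) (sym y z) e (sym z x); lra.
- rewrite (sdist_bwd xh yh xy) (sdist_fwd yz).
  have [xz|xz] := fwd_total xh zh.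
    have [_ e] := fwd_trans yh xh zh xy xz; rewrite sdist_fwd// e (sym y x); lra.
  have [_ e] := fwd_trans yh zh xh yz xz; rewrite (sdist_bwd xh zh xz) (sym x y) e (sym z x); lra.
- have [f e] := fwd_trans zh yh xh yz xy.
  rewrite (sdist_bwd xh yh xy) (sdist_bwd yh zh yz) (sdist_bwd xh zh f) (sym x z) e (sym z y) (sym y x); lra.
Qed.

Lemma sdist_xx x : Ch x -> sdist x x = 0.
Proof. by move=> xh; have := norm_sdist x x; rewrite mdistxx => /normr0_eq0. Qed.

(** At a good point g moves p along the axis of h by exactly its translation length; the signed
    displacement there is the value at g of the homomorphism to be built. *)
Definition good g p := [/\ Ch p, Ch (g \\ p) & d p (g \\ p) = l g].

(** If the signs at p and p' differed, additivity would force g to exchange p and p'; then g^2 p =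
    p, against [axis_double]. *)
Lemma good_sdist g p p' : good g p -> good g p' -> sdist p (g \\ p) = sdist p' (g \\ p').
Proof.
move=> [ph gph pg] [ph' gph' pg'].
have n1 := norm_sdist p (g \\ p); have n2 := norm_sdist p' (g \\ p').
have n3 := norm_sdist p p'; have n4 := norm_sdist (g \\ p) (g \\ p').
rewrite iso -n3 in n4.
have c1 := sdist_add gph ph gph'; have c2 := sdist_add ph ph' gph'.
have c3 := sdist_add ph gph ph; rewrite sdist_xx// in c3.
have c4 := sdist_add ph' gph ph'; rewrite sdist_xx// in c4.
rewrite pg in n1; rewrite pg' -n1 in n2.
apply/eqP/negPn/negP => /eqP ne.
have l0 : l g <> 0.
  by move=> l0; move: n2; rewrite n1 l0 => /normr0_eq0 e; move: n1; rewrite l0 => /normr0_eq0 e'; apply: ne; rewrite e e'.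
have e1 : sdist p' (g \\ p') = - sdist p (g \\ p).
  by move/eqP: n2; rewrite eqr_norm2 => /orP[/eqP e|/eqP//]; case: ne.
have e2 : sdist (g \\ p) (g \\ p') = sdist p p' - 2 * sdist p (g \\ p) by lra.
have e3 : sdist p p' = sdist p (g \\ p).
  move/eqP: n4; rewrite e2 eqr_norm2 => /orP[/eqP e|/eqP e]; last lra.
  by case: l0; rewrite -n1; apply/normr0P/eqP; lra.
have z1 : g \\ p = p'.
  apply: mdist_positivity; rewrite -norm_sdist; apply/normr0P/eqP.
  have := sdist_add gph ph ph'; lra.
have z2 : g \\ p' = p.
  apply: mdist_positivity; rewrite -norm_sdist; apply/normr0P/eqP.
  have := sdist_add gph' gph ph; have := sdist_add gph' gph gph'; rewrite sdist_xx//; lra.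
have lg0 : 0 < l g by rewrite lt0r; apply/andP; split; [exact/eqP|rewrite -n1].
have := axis_double gtT pg lg0; rewrite z1 z2 mdistxx; lra.
Qed.

Lemma good_ex g : T -> exists p, good g p.
Proof.
move=> x0; have [p hp] := helly_axes [:: h; (g^-1 * h * g)%g; g] x0.
by exists p; split; [exact: (hp 0%N)|apply: axis_conj; exact: (hp 1%N)|exact: (hp 2%N)].
Qed.

Lemma axis_abelian_length : T -> abelian_length l.
Proof.
move=> x0; pose mu g := let p := sval (cid (good_ex g x0)) in sdist p (g \\ p).
have muE g p : good g p -> mu g = sdist p (g \\ p).
  by move=> gp; rewrite /mu; case: cid => q gq /=; exact: good_sdist.
exists mu; last first.
  by move=> g; have [p gp] := good_ex g x0; rewrite (muE _ _ gp) norm_sdist; case: gp.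
move=> g g'.
(* A common point p of these six characteristic sets is good for g' and for g g', and g' p is good
   for g: the conjugates of h put g' p and g g' p on the axis of h. *)
have [p hp] := helly_axes [:: h; (g'^-1 * h * g')%g; g'; ((g * g')^-1 * h * (g * g'))%g;
  (g * g')%g; (g'^-1 * g * g')%g] x0.
have p0 := hp 0%N isT; have p1 := axis_conj (hp 1%N isT); have p2 := hp 2%N isT.
have p3 := axis_conj (hp 3%N isT); have p4 := hp 4%N isT; have p5 := axis_conj (hp 5%N isT).
rewrite /= in p0 p1 p2 p3 p4 p5.
have g1 : good g' p by [].
have g2 : good (g * g')%g p by [].
have g3 : good g (g' \\ p) by split => //; rewrite -actM.
rewrite (muE _ _ g1) (muE _ _ g2) (muE _ _ g3) actM addrC.
by apply: sdist_add => //; rewrite -actM.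
Qed.

End Axis.

End AbelianOrBridge.

Lemma nonabelian_bridge {R : realType} (T : metricType R) (G : groupType) (act : G -> T -> T) :
  gtree act -> T -> ~ abelian_length (length_function act) ->
  exists g h p q, bridge act g h p q.
Proof.
move=> gtT x0 nab; apply: contrapT => nob; apply: nab.
have meet g h : exists x, mdist x (act g x) = length_function act g /\
    mdist x (act h x) = length_function act h.
  apply: contrapT => nx; apply: nob; exists g, h; apply: (bridge_ex gtT x0) => x gx hx.
  by apply: nx; exists x.
have [[h h0]|h0] := pselect (exists h, 0 < length_function act h).
  exact: (axis_abelian_length gtT meet h0 x0).
(* No element has positive length, and the zero homomorphism serves. *)
exists (fun=> 0) => [*|g]; first by rewrite addr0.
rewrite normr0; apply/eqP; rewrite eq_le (length_ge0 gtT g x0) andbT leNgt.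
by apply/negP => g0; apply: h0; exists g.
Qed.

(** * The minimal tree as the hull of an orbit with half-integral distances *)

Section IntegralOrbit.
Context {R : realType} (T : metricType R) (G : groupType) (act : G -> T -> T).
Local Notation d := (@mdist R T).
Hypothesis minT : minimal_gtree act.
Let gtT : gtree act := minT.1.
Local Notation "g \\ x" := (act g x) (at level 35, right associativity).
Let tT : rtree T := (let: And3 h _ _ := gtT in h).
Let fp := @tree_four_point R T tT.
Let tri := @metric_triangle R T.
Let sym := @metric_sym R T.
Let ge0 := @mdist_ge0 R T.
Let iso := gtree_iso gtT.
Let actM := gtree_actM gtT.

Variable x0 : T.
Hypothesis orbZ : forall g, exists z : int, 2 * d x0 (g \\ x0) = z%:~R.

Definition gromov x y := (d x0 x + d x0 y - d x y) / 2.

Lemma gromov_min t x y z : t <= gromov x y -> t <= gromov y z -> t <= gromov x z.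
Proof. by rewrite /gromov => h1 h2; have := fp x0 x y z; rewrite ?(sym y x0); lra. Qed.

Lemma gromov_sym x y : gromov x y = gromov y x.
Proof. by rewrite /gromov (sym x y); lra. Qed.

Lemma gromov_orbit g h : exists z : int, gromov (g \\ x0) (h \\ x0) = z%:~R / 4.
Proof.
have [z1 e1] := orbZ g; have [z2 e2] := orbZ h; have [z3 e3] := orbZ (g^-1 * h)%g.
rewrite actM -(iso g) (gtree_actVr gtT) in e3.
by exists (z1 + z2 - z3); rewrite intrB intrD /gromov -e1 -e2 -e3; field.
Qed.

Lemma int_gap (z w : int) (t : R) : z%:~R < t -> t <= w%:~R -> (z + 1)%:~R <= (w%:~R : R).
Proof. by move=> h1 h2; rewrite ler_int lezD1 -(ltr_int R); apply: lt_le_trans h2. Qed.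

(** The interval is open on the left and closed on the right because orbit segments sharing a point
    strictly beyond z/4 agree up to (z+1)/4 included. *)
Lemma quarter_floor (r : R) : 0 < r -> exists2 z : int, z%:~R / 4 < r & r <= (z + 1)%:~R / 4.
Proof.
move=> r0; pose z := Num.ceil (4 * r) - 1; exists z.
  have := gt_pred_ceil (4 * r); rewrite /z intrB; lra.
have := ceil_ge (4 * r); rewrite /z subrK; lra.
Qed.

Definition between_orbit g y := d x0 y + d y (g \\ x0) = d x0 (g \\ x0).

Lemma between_orbitP g y : between_orbit g y <-> d x0 y <= gromov y (g \\ x0).
Proof. by rewrite /gromov /between_orbit; have := tri x0 y (g \\ x0); split; lra. Qed.

(* Two orbit segments issued from x0 which share a point beyond z/4 share
   everything up to (z+1)/4. *)
Lemma gromov_orbit_gap g h (z : int) t : z%:~R / 4 < t -> t <= gromov (g \\ x0) (h \\ x0) ->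
  (z + 1)%:~R / 4 <= gromov (g \\ x0) (h \\ x0).
Proof.
have [w ->] := gromov_orbit g h => h1 h2.
rewrite ler_pM2r ?invr_gt0//; apply: (@int_gap _ _ (4 * t)); lra.
Qed.

(** Fix a hull point y1 on [x0, g1 x0] close to the limit y. Any other close hull point lies on an
    orbit segment that agrees with this one beyond z/4, hence up to (z+1)/4 >= d(x0, y). So y is
    approximated by points of the single segment [x0, g1 x0]. *)
Lemma orbit_hull_closed : closed [set y | exists g, between_orbit g y].
Proof.
move=> y cy; have [y0|y0] := eqVneq (d x0 y) 0.
  exists 1%g; rewrite -(mdist_positivity _ _ y0) /between_orbit mdistxx add0r.
  by rewrite (gtree_act1 gtT).
have {}y0 : 0 < d x0 y by rewrite lt0r y0 ge0.
have [z z1 z2] := quarter_floor y0.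
have near e : 0 < e -> exists2 y', d y y' < e & exists g, between_orbit g y'.
  move=> e0; have [y' [[g gy'] yy']] := cy _ (nbhsx_ballx y e e0).
  by exists y'; [move: yy'; rewrite ballEmdist|exists g].
(* A quarter of the gap leaves d(x0, y) - 2 e above z/4 after the loss in the Gromov products. *)
pose e := (d x0 y - z%:~R / 4) / 4.
have e0 : 0 < e by rewrite divr_gt0// subr_gt0.
have eE : 4 * e = d x0 y - z%:~R / 4 by rewrite /e; field.
move: e e0 eE => e e0 eE.
have [y1 yy1 [g1 /between_orbitP b1]] := near e e0.
exists g1; apply/between_orbitP; apply/ler_addgt0Pr => dl dl0.
pose ee := Num.min e dl.
have ee0 : 0 < ee by rewrite lt_min e0.
have [eel eer] : ee <= e /\ ee <= dl by rewrite !ge_min !lexx orbT.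
move: ee ee0 eel eer => ee ee0 eel eer.
have [y2 yy2 [g2 /between_orbitP b2]] := near ee ee0.
have t1 := tri x0 y1 y; have t2 := tri x0 y2 y; have t3 := tri y1 y y2.
rewrite (sym y1 y) in t1 t3; rewrite (sym y2 y) in t2.
have t4 := tri x0 y y1; have t5 := tri x0 y y2.
have g12 : d x0 y - 2 * e <= gromov y1 y2 by rewrite /gromov; lra.
have gg : d x0 y - 2 * e <= gromov (g1 \\ x0) (g2 \\ x0).
  apply: (@gromov_min _ _ y1); first by rewrite gromov_sym; lra.
  by apply: (@gromov_min _ _ y2) => //; lra.
have := @gromov_orbit_gap g1 g2 z (d x0 y - 2 * e) ltac:(lra) gg => gg'.
suff : d x0 y - ee <= gromov y (g1 \\ x0) by lra.
apply: (@gromov_min _ _ y2); first by rewrite /gromov; lra.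
apply: (@gromov_min _ _ (g2 \\ x0)); first lra.
by rewrite gromov_sym; lra.
Qed.

Lemma orbit_hull_connected : connected [set y | exists g, between_orbit g y].
Proof.
have -> : [set y | exists g, between_orbit g y] =
    \bigcup_(g in [set: G]) [set y | between_orbit g y].
  by apply/seteqP; split => [y [g hg]|y [g _ hg]]; exists g.
apply: bigcup_connected.
  by exists x0 => g _; rewrite /= /between_orbit mdistxx add0r.
move=> g _; have [c [ic c0 cE _]] := tT x0 (g \\ x0).
have D := ge0 x0 (g \\ x0).
suff -> : [set y | between_orbit g y] = c @` `[0, d x0 (g \\ x0)]%classic.
  apply: connected_continuous_connected.
    exact/connected_intervalP/interval_is_interval.
  apply: (@lipschitz_within R T _ 1) => s t hs ht.
  by rewrite mul1r ic.
apply/seteqP; split => [y yb|_ [s hs <-]].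
  have d1 := ge0 x0 y; have d2 := ge0 y (g \\ x0); rewrite /= /between_orbit in yb.
  have hs : `[0, d x0 (g \\ x0)]%classic (d x0 y) by rewrite /= in_itv/=; lra.
  have h0 : `[0, d x0 (g \\ x0)]%classic 0 by rewrite /= in_itv/=; lra.
  have hD : `[0, d x0 (g \\ x0)]%classic (d x0 (g \\ x0)) by rewrite /= in_itv/=; lra.
  exists (d x0 y) => //.
  have e1 : d x0 (c (d x0 y)) = d x0 y by rewrite -{1}c0 ic// sub0r normrN ger0_norm.
  have e2 : d (c (d x0 y)) (g \\ x0) = d x0 (g \\ x0) - d x0 y.
    by rewrite -{1}cE ic// ler0_norm; lra.
  by apply: (tree_between_unique tT (x := x0) (y := g \\ x0)); lra.
have h0 : `[0, d x0 (g \\ x0)]%classic 0 by rewrite /= in_itv/=; lra.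
have hD : `[0, d x0 (g \\ x0)]%classic (d x0 (g \\ x0)) by rewrite /= in_itv/=; lra.
have hs' := hs; rewrite /= in_itv/= in hs'.
rewrite /between_orbit /= -{1}c0 ic// -[X in _ + d _ X = _]cE ic//.
by rewrite sub0r normrN ger0_norm ?ler0_norm; lra.
Qed.

Lemma orbit_hullT y : exists g, between_orbit g y.
Proof.
suff : [set y | exists g, between_orbit g y] = setT by move=> e; have : [set: T] y by []; rewrite -e.
have [_ h] := minT; apply: h.
- by exists x0, 1%g; rewrite /between_orbit mdistxx add0r.
- exact: orbit_hull_connected.
- exact: orbit_hull_closed.
(* Invariance: by the four-point inequality, g y lies on [x0, g h x0] or on [x0, g x0]. *)
move=> g {}y [h hy].
have e := iso g x0 (h \\ x0); have e1 := iso g x0 y; have e2 := iso g y (h \\ x0).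
rewrite /between_orbit in hy.
have t1 := tri x0 (g \\ y) (g \\ x0); have t2 := tri x0 (g \\ y) (g \\ h \\ x0).
rewrite (sym (g \\ y)) in t1.
have [hh|hh] := fp x0 (g \\ x0) (g \\ y) (g \\ h \\ x0).
  by exists (g * h)%g; rewrite /between_orbit actM; lra.
by exists g; rewrite /between_orbit (sym (g \\ y)); lra.
Qed.

(** Nearby points at the same distance from x0 lie on orbit segments that agree up to the next
    multiple of 1/4, hence coincide. *)
Lemma orbit_sphere_discrete y : exists2 e, 0 < e &
  forall z, d y z < e -> d x0 z = d x0 y -> z = y.
Proof.
have [y0|y0] := eqVneq (d x0 y) 0.
  exists 1 => // z _; rewrite y0 => /mdist_positivity <-; exact: (mdist_positivity _ _ y0).
have {}y0 : 0 < d x0 y by rewrite lt0r y0 ge0.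
have [w w1 w2] := quarter_floor y0.
exists (d x0 y - w%:~R / 4); first by rewrite subr_gt0.
move=> z yz zy; have [g /between_orbitP gy] := orbit_hullT y; have [h /between_orbitP hz] := orbit_hullT z.
have e1 : (d x0 y + w%:~R / 4) / 2 <= gromov y z by rewrite /gromov; lra.
have gh : (d x0 y + w%:~R / 4) / 2 <= gromov (g \\ x0) (h \\ x0).
  apply: (@gromov_min _ _ y); first by rewrite gromov_sym; lra.
  by apply: (@gromov_min _ _ z) => //; lra.
have wt : w%:~R / 4 < (d x0 y + w%:~R / 4) / 2 by lra.
have gh' := gromov_orbit_gap wt gh.
have : d x0 y <= gromov y z.
  apply: (@gromov_min _ _ (g \\ x0)) => //; apply: (@gromov_min _ _ (h \\ x0)); first lra.
  by rewrite gromov_sym; lra.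
rewrite /gromov zy => h1; apply: mdist_positivity.
have := ge0 z y; have := sym z y; lra.
Qed.

(** Off the levels in Z/4 there is no branching: all orbit segments that come close to y coincide up
    to the next multiple of 1/4. *)
Lemma orbit_segment y : (forall z : int, 4 * d x0 y <> z%:~R) ->
  exists (e D : R) (c : R -> T), [/\ 0 < e, isometric_on `[0, D] c &
    forall z, d y z < e -> 0 <= d x0 z <= D /\ z = c (d x0 z)].
Proof.
move=> nz; have y0 : 0 < d x0 y.
  rewrite lt0r ge0 andbT; apply/eqP => e; apply: (nz 0); rewrite e; lra.
have [w w1 w2] := quarter_floor y0.
have {}w2 : d x0 y < (w + 1)%:~R / 4.
  by rewrite lt_neqAle w2 andbT; apply/eqP => e; apply: (nz (w + 1)); rewrite e; field.
pose e := Num.min (d x0 y - w%:~R / 4) ((w + 1)%:~R / 4 - d x0 y).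
have e0 : 0 < e by rewrite lt_min !subr_gt0 w1.
have [ea eb] : e <= d x0 y - w%:~R / 4 /\ e <= (w + 1)%:~R / 4 - d x0 y.
  by rewrite !ge_min !lexx orbT.
move: e e0 ea eb => e e0 ea eb.
have [g gy] := orbit_hullT y.
have [c [ic c0 cE _]] := tT x0 (g \\ x0).
exists e, (d x0 (g \\ x0)), c; split => // z yz.
have [h /between_orbitP hz] := orbit_hullT z.
have t1 := tri x0 y z; have t2 := tri x0 z y; rewrite (sym z y) in t2.
have zlow : w%:~R / 4 < gromov y z by rewrite /gromov; lra.
have /between_orbitP gy' := gy.
have zb : between_orbit g z.
  apply/between_orbitP; apply: (@gromov_min _ _ (h \\ x0)) => //.
  pose t := Num.min (gromov y z) (Num.min (d x0 y) (d x0 z)).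
  have [ta [tb tc]] : t <= gromov y z /\ t <= d x0 y /\ t <= d x0 z.
    by rewrite /t !ge_min !lexx !orbT.
  have tw : w%:~R / 4 < t by rewrite !lt_min zlow w1/=; lra.
  move: t ta tb tc tw => t ta tb tc tw.
  have gh : t <= gromov (h \\ x0) (g \\ x0).
    apply: (@gromov_min _ _ z); first by rewrite gromov_sym; lra.
    by apply: (@gromov_min _ _ y); [rewrite gromov_sym|lra].
  by have := gromov_orbit_gap tw gh; lra.
have D := ge0 x0 (g \\ x0); have d1 := ge0 x0 z; have d2 := ge0 z (g \\ x0).
rewrite /between_orbit in zb.
split; first lra.
have hs : `[0, d x0 (g \\ x0)]%classic (d x0 z) by rewrite /= in_itv/=; lra.
have h0 : `[0, d x0 (g \\ x0)]%classic 0 by rewrite /= in_itv/=; lra.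
have hD : `[0, d x0 (g \\ x0)]%classic (d x0 (g \\ x0)) by rewrite /= in_itv/=; lra.
have e1 : d x0 (c (d x0 z)) = d x0 z by rewrite -{1}c0 ic// sub0r normrN ger0_norm.
have e2 : d (c (d x0 z)) (g \\ x0) = d x0 (g \\ x0) - d x0 z.
  by rewrite -{1}cE ic// ler0_norm; lra.
by apply: (tree_between_unique tT (x := x0) (y := g \\ x0)); lra.
Qed.

(** Let y lie on [x0, h x0] and k = g^-1. Then d(k x0, y) is d(x0, k x0) - d(x0, y) if y comes
    before the branch point of [x0, k x0] and [x0, h x0], and otherwise d(x0, k x0) + d(x0, y) minus
    twice the level of that branch point, which is in Z/4. *)
Lemma orbit_dist_fold g y : exists z : int,
  4 * (d x0 (g \\ y) - d x0 y) = z%:~R \/ 4 * (d x0 (g \\ y) + d x0 y) = z%:~R.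
Proof.
have [h hy] := orbit_hullT y.
have -> : d x0 (g \\ y) = d ((g^-1)%g \\ x0) y by rewrite -[in RHS](iso g) (gtree_actVr gtT).
set k := (g^-1)%g.
have [z1 e1] := orbZ k; have [z2 e2] := gromov_orbit k h.
have /between_orbitP hy' := hy.
have [c1|c1] := leP (d x0 y) (gromov (k \\ x0) (h \\ x0)).
  have : d x0 y <= gromov y (k \\ x0).
    by apply: (@gromov_min _ _ (h \\ x0)) => //; rewrite gromov_sym.
  have := tri x0 y (k \\ x0); rewrite /gromov (sym y (k \\ x0)) => t1 t2.
  by exists (2 * z1); right; rewrite intrM -e1; lra.
have m1 : gromov (k \\ x0) (h \\ x0) <= gromov (k \\ x0) y.
  by apply: (@gromov_min _ _ (h \\ x0)) => //; rewrite (gromov_sym (h \\ x0)); lra.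
have m2 : gromov (k \\ x0) y <= gromov (k \\ x0) (h \\ x0).
  apply: (@gromov_min _ _ y) => //; apply: le_trans hy'.
  by rewrite /gromov; have := tri x0 y (k \\ x0); have := tri x0 (k \\ x0) y; rewrite (sym y (k \\ x0)); lra.
exists (2 * z1 - 2 * z2); left; rewrite intrB !intrM -e1.
have : gromov (k \\ x0) y = z2%:~R / 4 by lra.
by rewrite /gromov; lra.
Qed.

End IntegralOrbit.

(** The three conclusions serve, in order, the invariance of F under the group, its local form off
    the extremal levels, and the exclusion of extremal values on open sets. *)
Lemma integral_tree {R : realType} (T : metricType R) (G : groupType) (act : G -> T -> T) :
  minimal_gtree act -> T -> (forall g, exists N : nat, length_function act g = N%:R) ->
  ~ abelian_length (length_function act) ->
  exists x0 : T, [/\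
    forall g y, exists z : int, 4 * (mdist x0 (act g y) - mdist x0 y) = z%:~R \/
                                4 * (mdist x0 (act g y) + mdist x0 y) = z%:~R,
    forall y, (forall z : int, 4 * mdist x0 y <> z%:~R) ->
      exists (e D : R) (c : R -> T), [/\ 0 < e, isometric_on `[0, D] c &
      forall z, mdist y z < e -> 0 <= mdist x0 z <= D /\ z = c (mdist x0 z)] &
    forall y, exists2 e, 0 < e & forall z, mdist y z < e -> mdist x0 z = mdist x0 y -> z = y].
Proof.
move=> minT t0 lN nab; have [g [h [p [q B]]]] := nonabelian_bridge minT.1 t0 nab.
have orbZ k := bridge_orbit_integral minT.1 lN k B.
exists p; split.
- exact: (orbit_dist_fold minT orbZ).
- exact: (orbit_segment minT orbZ).
- exact: (orbit_sphere_discrete minT orbZ).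
Qed.

(** * Complex analysis *)

(** Stated over a [numFieldType] to serve real and complex derivatives alike; the calculus below
    works with this division-free form. *)
Lemma is_derive_epsP (K : numFieldType) (f : K -> K) (t a : K) :
  is_derive t 1 f a <-> forall e : K, 0 < e -> exists2 dl : K, 0 < dl &
    forall s : K, `|s - t| < dl -> `|f s - f t - a * (s - t)| <= e * `|s - t|.
Proof.
split=> [fa e e0|H].
- have [df da] : derivable f t 1 /\ 'D_1 f t = a by split; [exact: ex_derive|rewrite derive_val].
  have : h^-1 *: (f (h *: 1 + t) - f t) @[h --> 0^'] --> a by rewrite -da; exact: df.
  move/cvgrPdist_lt => /(_ e e0) [dl /= dl0 Hd]; exists dl => // s sd.
  have [->|st] := eqVneq s t; first by rewrite !subrr mulr0 subrr normr0 mulr0.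
  have h0 : s - t != 0 by rewrite subr_eq0.
  have := Hd (s - t); rewrite /= sub0r normrN => /(_ sd h0)/ltW.
  rewrite /GRing.scale/= mulr1 subrK => h.
  have -> : f s - f t - a * (s - t) = (s - t) * ((s - t)^-1 * (f s - f t) - a).
    by rewrite [RHS]mulrBr mulVKf// [a * _]mulrC.
  by rewrite normrM mulrC ler_wpM2r// distrC.
- have C : h^-1 *: (f (h *: 1 + t) - f t) @[h --> 0^'] --> a.
    apply/cvgrPdist_lt => e e0; have e20 : 0 < e / 2 by rewrite divr_gt0.
    have [dl dl0 Hd] := H _ e20.
    exists dl => //= h; rewrite /= sub0r normrN => hd h0.
    have := Hd (h + t); rewrite addrK => /(_ hd) hh.
    rewrite /GRing.scale/= mulr1 distrC.
    have -> : h^-1 * (f (h + t) - f t) - a = h^-1 * (f (h + t) - f t - a * h).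
      by rewrite [RHS]mulrBr [a * h]mulrC mulKf.
    rewrite normrM normfV mulrC ltr_pdivrMr ?normr_gt0//.
    by apply: le_lt_trans hh _; rewrite ltr_pM2r ?normr_gt0// gtr_pMr// invf_lt1// ltr1n.
  by split; [apply/cvg_ex; exists a|exact/cvg_lim].
Qed.

(** * Moduli, complex derivatives and mean value inequalities *)

Section ComplexBasics.
Context {R : realType}.
Local Notation nc := (@Normc.normc R).
Implicit Types (z w : R[i]).

Lemma nc_normr z : `|z| = (nc z)%:C.
Proof. by case: z => a b. Qed.

Lemma nc_ge0 z : 0 <= nc z.
Proof. by case: z => a b; exact: sqrtr_ge0. Qed.

Lemma nc_lt z (e : R) : (`|z| < e%:C) = (nc z < e).
Proof. by rewrite nc_normr ltcR. Qed.

Lemma gt0_complex (e : R[i]) : 0 < e -> exists2 r : R, 0 < r & e = r%:C.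
Proof. by case: e => a b; rewrite ltcE/= => /andP[/eqP -> a0]; exists a. Qed.

Lemma ncM z w : nc (z * w) = nc z * nc w. Proof. exact: Normc.normcM. Qed.
Lemma ncD z w : nc (z + w) <= nc z + nc w. Proof. exact: le_normcD. Qed.
Lemma ncN z : nc (- z) = nc z. Proof. exact: normcN. Qed.
Lemma ncB z w : nc (z - w) = nc (w - z). Proof. by rewrite -ncN opprB. Qed.
Lemma nc0 : nc 0 = 0. Proof. by rewrite /= !expr0n/= addr0 sqrtr0. Qed.
Lemma nc1 : nc 1 = 1. Proof. by rewrite /= expr1n expr0n/= addr0 sqrtr1. Qed.
Lemma nc_eq0 z : (nc z == 0) = (z == 0).
Proof. by apply/eqP/eqP => [/Normc.eq0_normc//|->]; rewrite nc0. Qed.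
Lemma nc_gt0 z : (0 < nc z) = (z != 0).
Proof. by rewrite lt0r nc_ge0 andbT nc_eq0. Qed.
Lemma ncV z : nc z^-1 = (nc z)^-1. Proof. exact: Normc.normcV. Qed.
Lemma ncX z n : nc (z ^+ n) = nc z ^+ n.
Proof. by elim: n => [|n IH]; rewrite ?expr0 ?nc1// !exprS ncM IH. Qed.
Lemma nc_real (r : R) : nc r%:C = `|r|.
Proof. by rewrite /= expr0n/= addr0 sqrtr_sqr. Qed.
Lemma nc_triangle z w x : nc (z - x) <= nc (z - w) + nc (w - x).
Proof. by apply: le_trans (ncD _ _); rewrite addrA subrK. Qed.

Lemma Re_le_nc z : `|complex.Re z| <= nc z.
Proof.
case: z => a b /=; rewrite -sqrtr_sqr; apply: ler_wsqrtr; by rewrite lerDl sqr_ge0.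
Qed.

Lemma Im_le_nc z : `|complex.Im z| <= nc z.
Proof.
case: z => a b /=; rewrite -sqrtr_sqr; apply: ler_wsqrtr; by rewrite lerDr sqr_ge0.
Qed.

Lemma nc_le_ReIm z : nc z <= `|complex.Re z| + `|complex.Im z|.
Proof.
case: z => a b /=; rewrite -[X in _ <= X]ger0_norm ?addr_ge0// -sqrtr_sqr.
apply: ler_wsqrtr; rewrite sqrrD !real_normK ?num_real//.
by rewrite -[in leRHS]addrA lerD2l lerDr mulrn_wge0// mulr_ge0.
Qed.

Lemma ReB z w : complex.Re (z - w) = complex.Re z - complex.Re w.
Proof. by case: z => a b; case: w. Qed.
Lemma ImB z w : complex.Im (z - w) = complex.Im z - complex.Im w.
Proof. by case: z => a b; case: w. Qed.
Lemma ReD z w : complex.Re (z + w) = complex.Re z + complex.Re w.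
Proof. by case: z => a b; case: w. Qed.
Lemma ImD z w : complex.Im (z + w) = complex.Im z + complex.Im w.
Proof. by case: z => a b; case: w. Qed.
Lemma Re_realM (r : R) z : complex.Re (r%:C * z) = r * complex.Re z.
Proof. by case: z => a b; rewrite /= mul0r subr0. Qed.
Lemma Im_realM (r : R) z : complex.Im (r%:C * z) = r * complex.Im z.
Proof. by case: z => a b; rewrite /= mul0r addr0. Qed.
Lemma complex_eq z w : complex.Re z = complex.Re w -> complex.Im z = complex.Im w -> z = w.
Proof. by case: z => a b; case: w => c e /= -> ->. Qed.

Lemma cplx_nbhsP (z : Cplx R) (A : set (Cplx R)) :
  nbhs z A <-> exists2 e : R, 0 < e & forall w, nc (w - z) < e -> A w.
Proof.
split=> [/nbhs_ballP[e /= /gt0_complex[r r0 ->] zA]|[e e0 zA]].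
  by exists r => // w wz; apply: zA; rewrite -ball_normE/= nc_lt ncB.
apply/nbhs_ballP; exists (e%:C) => /=; first by rewrite ltcR.
by move=> w; rewrite -ball_normE/= nc_lt ncB; exact: zA.
Qed.

Lemma cplx_near_nbhs (z : Cplx R) (e : R) : 0 < e -> nbhs z [set w : Cplx R | nc (w - z) < e].
Proof. by move=> e0; apply/cplx_nbhsP; exists e. Qed.

Lemma cvg_cplxP (T : Type) (F : set_system T) (FF : Filter F) (f : T -> Cplx R) z :
  f @ F --> (z : Cplx R) <-> forall e : R, 0 < e -> \forall t \near F, nc (f t - z) < e.
Proof.
split=> [fz e e0|H A]; first exact: (fz _ (cplx_near_nbhs z e0)).
by move=> /cplx_nbhsP[e e0 eA]; near do apply: eA; exact: H.
Unshelve. all: by end_near. Qed.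

Lemma continuous_Re : continuous (@complex.Re R : Cplx R -> R).
Proof.
move=> z A /nbhs_ballP[e /= e0 eA]; apply/cplx_nbhsP; exists e => // w wz.
by apply: eA; rewrite -ball_normE/= -ReB; apply: le_lt_trans (Re_le_nc _) _; rewrite ncB.
Qed.

Lemma continuous_Im : continuous (@complex.Im R : Cplx R -> R).
Proof.
move=> z A /nbhs_ballP[e /= e0 eA]; apply/cplx_nbhsP; exists e => // w wz.
by apply: eA; rewrite -ball_normE/= -ImB; apply: le_lt_trans (Im_le_nc _) _; rewrite ncB.
Qed.

Lemma cvg_ReIm (T : Type) (F : set_system T) (FF : Filter F) (f : T -> Cplx R) (z : Cplx R) :
  (fun t => complex.Re (f t)) @ F --> complex.Re z ->
  (fun t => complex.Im (f t)) @ F --> complex.Im z -> f @ F --> z.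
Proof.
move=> h1 h2; apply/cvg_cplxP => e e0.
have e20 : 0 < e / 2 by rewrite divr_gt0.
move/cvgrPdist_lt: h1 => /(_ _ e20) h1; move/cvgrPdist_lt: h2 => /(_ _ e20) h2.
near=> t; apply: le_lt_trans (nc_le_ReIm _) _; rewrite (splitr e) ReB ImB.
by rewrite ltrD// distrC; near: t.
Unshelve. all: by end_near. Qed.

(** The estimates use the real-valued modulus [nc], the norm of [R[i]] having its values in [R[i]];
    [cdiff_is_derive] relates the two. *)
Definition cdiff (f : Cplx R -> Cplx R) (z L : Cplx R) := forall e : R, 0 < e ->
  exists2 dl : R, 0 < dl & forall w, nc (w - z) < dl ->
    nc (f w - f z - L * (w - z)) <= e * nc (w - z).

Lemma cdiff_is_derive f (z L : Cplx R) : cdiff f z L <-> is_derive z 1 f L.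
Proof.
split=> [H|/(is_derive_epsP f z L) H e e0].
  apply/(is_derive_epsP f z L) => _ /gt0_complex[e e0 ->]; have [dl dl0 h] := H e e0.
  exists (dl%:C); first by rewrite ltcR.
  by move=> w; rewrite nc_lt => /h; rewrite !nc_normr -rmorphM lecR.
have [|_ /gt0_complex[dl dl0 ->] h] := H e%:C; first by rewrite ltcR.
by exists dl => // w; have := h w; rewrite nc_lt !nc_normr -rmorphM lecR.
Qed.

Lemma derivable_cdiff f (z : Cplx R) : derivable f z 1 -> cdiff f z (derive1 f z).
Proof. by move=> df; apply/cdiff_is_derive; rewrite derive1E; exact: derivableP. Qed.

Lemma cdiff_derivable f (z L : Cplx R) : cdiff f z L -> derivable f z 1 /\ derive1 f z = L.
Proof.
by move=> /cdiff_is_derive h; split; [exact: ex_derive|rewrite derive1E derive_val].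
Qed.

Lemma cdiff_local f g (z L : Cplx R) : cdiff f z L ->
  (exists2 e : R, 0 < e & forall w, nc (w - z) < e -> g w = f w) -> cdiff g z L.
Proof.
move=> fz [e1 e10 gf] e e0; have [dl dl0 h] := fz e e0.
exists (Num.min e1 dl); first by rewrite lt_min e10.
move=> w; rewrite lt_min => /andP[w1 w2]; rewrite (gf w w1) (gf z) ?subrr ?nc0//.
exact: h.
Qed.

Lemma cdiff_lip f (z L : Cplx R) : cdiff f z L -> exists2 dl : R, 0 < dl &
  forall w, nc (w - z) < dl -> nc (f w - f z) <= (nc L + 1) * nc (w - z).
Proof.
move=> fz; have [dl dl0 h] := fz 1 ltr01; exists dl => // w wz.
have := h w wz; rewrite mul1r => {}h.
have -> : f w - f z = (f w - f z - L * (w - z)) + L * (w - z) by rewrite subrK.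
by apply: le_trans (ncD _ _) _; rewrite ncM mulrDl mul1r addrC lerD2l.
Qed.

Lemma cdiff_cts f (z L : Cplx R) : cdiff f z L -> {for z, continuous f}.
Proof.
move=> /cdiff_derivable[df _]; apply: differentiable_continuous.
exact/derivable1_diffP.
Qed.

Lemma cdiff_comp f g (z L M : Cplx R) : cdiff f z L -> cdiff g (f z) M ->
  cdiff (g \o f) z (M * L).
Proof.
move=> fz gz e e0; have [d1 d10 lip] := cdiff_lip fz.
have L1 : 0 < nc L + 1 by rewrite ltr_wpDl ?nc_ge0.
have M1 : 0 < nc M + 1 by rewrite ltr_wpDl ?nc_ge0.
have e1 : 0 < e / 2 / (nc L + 1) by rewrite !divr_gt0.
have e2 : 0 < e / 2 / (nc M + 1) by rewrite !divr_gt0.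
have [d2 d20 hg] := gz _ e1; have [d3 d30 hf] := fz _ e2.
have d4 : 0 < d2 / (nc L + 1) by rewrite divr_gt0.
exists (Num.min (Num.min d1 d3) (d2 / (nc L + 1))); first by rewrite !lt_min d10 d30.
move=> w; rewrite !lt_min => /andP[/andP[w1 w3]]; rewrite ltr_pdivlMr// => w2.
have lw := lip w w1.
have fw : nc (f w - f z) < d2 by apply: le_lt_trans lw _; rewrite mulrC.
have -> : (g \o f) w - (g \o f) z - M * L * (w - z) =
  (g (f w) - g (f z) - M * (f w - f z)) + M * (f w - f z - L * (w - z)).
  by rewrite /=; ring.
apply: le_trans (ncD _ _) _; rewrite ncM.
have h1 : nc (g (f w) - g (f z) - M * (f w - f z)) <= e / 2 * nc (w - z).
  apply: le_trans (hg _ fw) _; rewrite -mulrA ler_wpM2l ?divr_ge0 ?(ltW e0)//.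
  by rewrite ler_pdivrMl.
have h2 : nc M * nc (f w - f z - L * (w - z)) <= e / 2 * nc (w - z).
  apply: (@le_trans _ _ (nc M * (e / 2 / (nc M + 1) * nc (w - z)))).
    by rewrite ler_wpM2l ?nc_ge0// hf.
  rewrite mulrA ler_wpM2r ?nc_ge0// mulrCA ler_piMr ?divr_ge0 ?ltW//.
  by rewrite ltr_pdivrMr// mul1r ltrDl.
by rewrite (splitr e) mulrDl lerD.
Qed.

Lemma cdiff_id (z : Cplx R) : cdiff id z 1.
Proof.
by move=> e e0; exists 1 => // w _; rewrite mul1r subrr nc0 mulr_ge0 ?nc_ge0 ?ltW.
Qed.

Lemma cdiff_cst (c z : Cplx R) : cdiff (fun=> c) z 0.
Proof.
by move=> e e0; exists 1 => // w _; rewrite mul0r !subrr nc0 mulr_ge0 ?nc_ge0 ?ltW.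
Qed.

Lemma cdiffD f g (z L M : Cplx R) : cdiff f z L -> cdiff g z M ->
  cdiff (fun w => f w + g w) z (L + M).
Proof. by move=> /cdiff_is_derive h1 /cdiff_is_derive h2; apply/cdiff_is_derive; exact: is_deriveD. Qed.

Lemma cdiffN f (z L : Cplx R) : cdiff f z L -> cdiff (fun w => - f w) z (- L).
Proof. by move=> /cdiff_is_derive h1; apply/cdiff_is_derive; exact: is_deriveN. Qed.

Lemma cdiffM f g (z L M : Cplx R) : cdiff f z L -> cdiff g z M ->
  cdiff (fun w => f w * g w) z (f z * M + g z * L).
Proof. by move=> /cdiff_is_derive h1 /cdiff_is_derive h2; apply/cdiff_is_derive; exact: is_deriveM. Qed.

Lemma cdiffV (z : Cplx R) : z != 0 -> cdiff (fun w => w^-1) z (- z ^- 2).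
Proof.
move=> z0; have dz : derivable (id : Cplx R -> Cplx R) z 1 by exact: derivable_id.
apply/cdiff_is_derive; split; first exact: (derivableV (f := id)).
by rewrite (deriveV (f := id))// derive_id /GRing.scale/= mulr1.
Qed.

Definition rcdiff (c : R -> Cplx R) (t : R) (v : Cplx R) := forall e : R, 0 < e ->
  exists2 dl : R, 0 < dl & forall s, `|s - t| < dl ->
    nc (c s - c t - v * (s - t)%:C) <= e * `|s - t|.

Lemma rcdiff_is_derive (c : R -> Cplx R) t a b : rcdiff c t (a +i* b) <->
  is_derive t 1 (fun s => complex.Re (c s) : R) a /\
  is_derive t 1 (fun s => complex.Im (c s) : R) b.
Proof.
have reE s : complex.Re (c s - c t - (a +i* b) * (s - t)%:C) =
   complex.Re (c s) - complex.Re (c t) - a * (s - t).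
  by rewrite !ReB /= mulr0 subr0.
have imE s : complex.Im (c s - c t - (a +i* b) * (s - t)%:C) =
   complex.Im (c s) - complex.Im (c t) - b * (s - t).
  by rewrite !ImB /= mulr0 add0r.
split=> [H|[H1 H2] e e0].
  split; apply/is_derive_epsP => e e0; have [dl dl0 h] := H e e0; exists dl => // s sd;
    apply: le_trans (h s sd); rewrite -?reE -?imE; [exact: Re_le_nc|exact: Im_le_nc].
have e20 : 0 < e / 2 by rewrite divr_gt0.
move/is_derive_epsP: H1 => /(_ _ e20)[d1 d10 h1]; move/is_derive_epsP: H2 => /(_ _ e20)[d2 d20 h2].
exists (Num.min d1 d2); first by rewrite lt_min d10.
move=> s; rewrite lt_min => /andP[/h1 s1 /h2 s2].
apply: le_trans (nc_le_ReIm _) _; rewrite reE imE (splitr e) mulrDl; exact: lerD.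
Qed.

Lemma rcdiffP (c : R -> Cplx R) t v : rcdiff c t v <->
  is_derive t 1 (fun s => complex.Re (c s) : R) (complex.Re v) /\
  is_derive t 1 (fun s => complex.Im (c s) : R) (complex.Im v).
Proof. by case: v => a b; exact: rcdiff_is_derive. Qed.

Lemma rcdiff_comp (f : Cplx R -> Cplx R) (c : R -> Cplx R) t v L :
  rcdiff c t v -> cdiff f (c t) L -> rcdiff (f \o c) t (L * v).
Proof.
move=> ct fc e e0.
have V1 : 0 < nc v + 1 by rewrite ltr_wpDl ?nc_ge0.
have L1 : 0 < nc L + 1 by rewrite ltr_wpDl ?nc_ge0.
have e1 : 0 < e / 2 / (nc v + 1) by rewrite !divr_gt0.
have e2 : 0 < e / 2 / (nc L + 1) by rewrite !divr_gt0.
have [d2 d20 hf] := fc _ e1; have [d3 d30 hc] := ct _ e2; have [d1 d10 hc1] := ct 1 ltr01.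
have d4 : 0 < d2 / (nc v + 1) by rewrite divr_gt0.
exists (Num.min (Num.min d1 d3) (d2 / (nc v + 1))); first by rewrite !lt_min d10 d30.
move=> s; rewrite !lt_min => /andP[/andP[s1 s3]]; rewrite ltr_pdivlMr// => s2.
have lw : nc (c s - c t) <= (nc v + 1) * `|s - t|.
  have -> : c s - c t = (c s - c t - v * (s - t)%:C) + v * (s - t)%:C by rewrite subrK.
  apply: le_trans (ncD _ _) _; rewrite ncM nc_real mulrDl mul1r addrC lerD2l.
  by have := hc1 s s1; rewrite mul1r.
have cw : nc (c s - c t) < d2 by apply: le_lt_trans lw _; rewrite mulrC.
have -> : (f \o c) s - (f \o c) t - L * v * (s - t)%:C =
  (f (c s) - f (c t) - L * (c s - c t)) + L * (c s - c t - v * (s - t)%:C).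
  by rewrite /=; ring.
apply: le_trans (ncD _ _) _; rewrite ncM.
have h1 : nc (f (c s) - f (c t) - L * (c s - c t)) <= e / 2 * `|s - t|.
  apply: le_trans (hf _ cw) _; rewrite -mulrA ler_wpM2l ?divr_ge0 ?(ltW e0)//.
  by rewrite ler_pdivrMl.
have h2 : nc L * nc (c s - c t - v * (s - t)%:C) <= e / 2 * `|s - t|.
  apply: (@le_trans _ _ (nc L * (e / 2 / (nc L + 1) * `|s - t|))).
    by rewrite ler_wpM2l ?nc_ge0// hc.
  rewrite mulrA ler_wpM2r// mulrCA ler_piMr ?divr_ge0 ?ltW//.
  by rewrite ltr_pdivrMr// mul1r ltrDl.
by rewrite (splitr e) mulrDl lerD.
Qed.

Lemma rcdiff_line (z v : Cplx R) t : rcdiff (fun s => z + s%:C * v) t v.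
Proof.
move=> e e0; exists 1 => // s _.
rewrite (_ : _ - _ - _ = 0) ?nc0 ?mulr_ge0 ?(ltW e0)//.
by rewrite rmorphB/=; ring.
Qed.

Lemma rcdiff_cts (c : R -> Cplx R) t v : rcdiff c t v -> {for t, continuous c}.
Proof.
move=> /rcdiffP[h1 h2]; apply: cvg_ReIm.
  by apply: differentiable_continuous; apply/derivable1_diffP; exact: ex_derive.
by apply: differentiable_continuous; apply/derivable1_diffP; exact: ex_derive.
Qed.

Lemma rcdiff_unit_direction z : z != 0 -> exists2 u : R[i], nc u = 1 & complex.Re (u * z) = nc z.
Proof.
move=> z0; have n0 : nc z != 0 by rewrite nc_eq0.
exists (((nc z)^-1)%:C * z^*).
  rewrite ncM nc_real ger0_norm ?invr_ge0 ?nc_ge0//.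
  by have -> : nc z^* = nc z; [case: z {z0 n0} => a b /=; rewrite sqrrN|rewrite mulVf].
rewrite -mulrA Re_realM mulrC.
have -> : complex.Re (z^* * z) = nc z ^+ 2.
  case: z {z0 n0} => a b /=; rewrite sqr_sqrtr ?addr_ge0 ?sqr_ge0//; ring.
by rewrite expr2 mulfK.
Qed.

(** The scalar mean value theorem is applied to Re (u c), where the unit number u rotates the total
    increment onto the positive real axis. *)
Lemma rcdiff_MVT (c : R -> Cplx R) (v : R -> Cplx R) K :
  (forall t, 0 <= t <= 1 -> rcdiff c t (v t)) -> (forall t, 0 <= t <= 1 -> nc (v t) <= K) ->
  nc (c 1 - c 0) <= K.
Proof.
move=> dc vK; have [->|z0] := eqVneq (c 1 - c 0) 0.
  by rewrite nc0; apply: le_trans (vK 0 _); [exact: nc_ge0|lra].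
have [u u1 uE] := rcdiff_unit_direction z0.
pose f t := complex.Re (u * c t); pose df t := complex.Re (u * v t).
have fdf (t : R) : 0 <= t <= 1 -> is_derive t 1 f (df t).
  move=> t01; have hu : cdiff (fun w => u * w) (c t) u.
    move=> e e0; exists 1 => // w _.
    by rewrite (_ : _ - _ - _ = 0) ?nc0 ?mulr_ge0 ?nc_ge0 ?ltW//; ring.
  by have /rcdiffP[] := rcdiff_comp (dc t t01) hu.
have [||t] := @MVT R f df 0 1 ltr01.
- by move=> t; rewrite in_itv/= => t01; apply: fdf; lra.
- apply: continuous_in_subspaceT => t; rewrite inE/= in_itv/= => t01.
  by apply: differentiable_continuous; apply/derivable1_diffP; have [] := fdf t t01.
rewrite in_itv/= subr0 mulr1 /f -ReB -mulrBr uE => t01 ->.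
apply: le_trans (ler_norm _) _; apply: le_trans (Re_le_nc _) _.
by rewrite ncM u1 mul1r; apply: vK; lra.
Qed.

Lemma cdiff_MVT (f f' : Cplx R -> Cplx R) (L z w : Cplx R) K :
  (forall t : R, 0 <= t <= 1 -> cdiff f (w + t%:C * (z - w)) (f' (w + t%:C * (z - w)))) ->
  (forall t : R, 0 <= t <= 1 -> nc (f' (w + t%:C * (z - w)) - L) <= K) ->
  nc (f z - f w - L * (z - w)) <= K * nc (z - w).
Proof.
move=> df dK.
pose F x := f x - L * x.
have dF t : 0 <= t <= 1 ->
    rcdiff (F \o (fun s => w + s%:C * (z - w))) t ((f' (w + t%:C * (z - w)) - L) * (z - w)).
  move=> t01; apply: rcdiff_comp; first exact: rcdiff_line.
  apply: cdiffD; first exact: df.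
  apply: cdiffN; move=> e e0; exists 1 => // x _.
  by rewrite (_ : _ - _ - _ = 0) ?nc0 ?mulr_ge0 ?nc_ge0 ?ltW//; ring.
have := rcdiff_MVT dF (K := K * nc (z - w)).
rewrite /F /= !rmorph1 mul1r mul0r addr0 (addrC w) subrK => h.
have -> : f z - f w - L * (z - w) = f z - L * z - (f w - L * w) by ring.
by apply: h => t t01; rewrite ncM ler_wpM2r ?nc_ge0// dK.
Qed.

End ComplexBasics.
Notation nc := Normc.normc.

(** * Oriented integrals of continuous real functions *)

Section Primitives.
Context {R : realType}.
Local Notation mu := (@lebesgue_measure R).
Implicit Types (f g : R -> R) (a b c t : R).

Lemma continuous_itv_integrable f a b : continuous f ->
  mu.-integrable `[a, b] (EFin \o f).
Proof.
move=> cf; apply: continuous_compact_integrable; first exact: segment_compact.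
exact: continuous_subspaceT.
Qed.

Lemma half_primitive_ex f a : continuous f ->
  exists F : R -> R, forall t, a < t -> is_derive t 1 F (f t).
Proof.
move=> cf; exists (fun x => \int[mu]_(t in `[a, x]) f t)%R => t at_.
have [d1 d2] := @continuous_FTC1_closed R f a t (t + 1) ltac:(lra) (continuous_itv_integrable a (t + 1) cf) at_ (cf t).
by split; [exact: d1|exact: (etrans (esym (derive1E _ _)) d2)].
Qed.

Lemma is_derive_local f g t v : is_derive t 1 f v ->
  (exists2 e : R, 0 < e & forall s, `|s - t| < e -> g s = f s) -> is_derive t 1 g v.
Proof.
move=> /is_derive_epsP H [e e0 gf]; apply/is_derive_epsP => e1 e10.
have [dl dl0 h] := H e1 e10; exists (Num.min e dl); first by rewrite lt_min e0.
move=> s; rewrite lt_min => /andP[s1 s2]; rewrite !gf ?subrr ?normr0//; exact: h.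
Qed.

(** Integration from a base point gives primitives on half-lines only: one beyond -1 and, by
    reflection, one below 1. They are glued at 0. *)
Lemma primitive_ex f : continuous f -> exists F : R -> R, forall t, is_derive t 1 F (f t).
Proof.
move=> cf; have [F dF] := @half_primitive_ex f (-1) cf.
have cfN : continuous (f \o -%R) by move=> t; apply: continuous_comp; [exact: opp_continuous|exact: cf].
have [H dH] := @half_primitive_ex (f \o -%R) (-1) cfN.
have dH' t : t < 1 -> is_derive t 1 (fun x => - H (- x)) (f t).
  move=> t1; apply/is_derive_epsP => e e0.
  have /is_derive_epsP/(_ e e0)[dl dl0 h] := dH (- t) ltac:(lra).
  exists dl => // s st; have := h (- s); have -> : - s - - t = - (s - t) by ring.
  rewrite normrN /= opprK => /(_ st).
  rewrite -[X in X <= _ -> _]normrN; apply: le_trans.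
  by rewrite le_eqVlt; apply/orP; left; apply/eqP; congr (`|_|); ring.
pose K x := if 0 <= x then F x - F 0 else H 0 - H (- x).
exists K => t; apply/is_derive_epsP => e e0.
have h0 : - H (- 0) = - H 0 by rewrite oppr0.
have pos : 0 <= t -> exists2 dl : R, 0 < dl & forall s, 0 <= s -> `|s - t| < dl ->
    `|K s - K t - f t * (s - t)| <= e * `|s - t|.
  move=> t0; have /is_derive_epsP/(_ e e0)[dl dl0 h] := dF t ltac:(lra).
  exists dl => // s s0 st; rewrite /K s0 t0.
  by have := h s st; apply: le_trans; rewrite le_eqVlt; apply/orP; left; apply/eqP; congr (`|_|); ring.
have neg : t <= 0 -> exists2 dl : R, 0 < dl & forall s, s <= 0 -> `|s - t| < dl ->
    `|K s - K t - f t * (s - t)| <= e * `|s - t|.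
  move=> t0; have /is_derive_epsP/(_ e e0)[dl dl0 h] := dH' t ltac:(lra).
  have KE s : s <= 0 -> K s = H 0 - H (- s).
    rewrite le_eqVlt => /orP[/eqP ->|s0]; first by rewrite /K lexx oppr0 !subrr.
    by rewrite /K leNgt s0.
  exists dl => // s s0 st; rewrite !KE//.
  by have := h s st; apply: le_trans; rewrite le_eqVlt; apply/orP; left; apply/eqP; congr (`|_|); ring.
have [t0|t0|t0] := ltgtP t 0.
- have [dl dl0 h] := neg (ltW t0); exists (Num.min dl (- t)); first by rewrite lt_min dl0 oppr_gt0.
  move=> s; rewrite lt_min => /andP[s1 s2]; apply: h => //.
  by move: s2; rewrite ltr_norml; lra.
- have [dl dl0 h] := pos (ltW t0); exists (Num.min dl t); first by rewrite lt_min dl0.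
  move=> s; rewrite lt_min => /andP[s1 s2]; apply: h => //.
  by move: s2; rewrite ltr_norml; lra.
- have [d1 d10 h1] := neg ltac:(lra); have [d2 d20 h2] := pos ltac:(lra).
  exists (Num.min d1 d2); first by rewrite lt_min d10.
  by move=> s; rewrite lt_min => /andP[s1 s2]; have [s0|s0] := leP 0 s; [exact: h2|apply: h1; lra].
Qed.

Lemma derive_bound (F dF : R -> R) a b M : a <= b ->
  (forall t, a <= t <= b -> is_derive t 1 F (dF t)) ->
  (forall t, a <= t <= b -> `|dF t| <= M) -> `|F b - F a| <= M * (b - a).
Proof.
rewrite le_eqVlt => /orP[/eqP -> _ _|ab dFt FM]; first by rewrite !subrr normr0 mulr0.
have [||t] := @MVT R F dF a b ab.
- by move=> t; rewrite in_itv/= => tab; apply: dFt; lra.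
- apply: continuous_in_subspaceT => t; rewrite inE/= in_itv/= => tab.
  by apply: differentiable_continuous; apply/derivable1_diffP; have [] := dFt t tab.
rewrite in_itv/= => tab ->; rewrite normrM (ger0_norm (_ : 0 <= b - a)); last lra.
by rewrite ler_wpM2r; [|lra|apply: FM; lra].
Qed.

Lemma derive_mono (F dF : R -> R) a b m : a <= b ->
  (forall t, a <= t <= b -> is_derive t 1 F (dF t)) ->
  (forall t, a <= t <= b -> m <= dF t) -> m * (b - a) <= F b - F a.
Proof.
rewrite le_eqVlt => /orP[/eqP -> _ _|ab dFt FM]; first by rewrite !subrr mulr0.
have [||t] := @MVT R F dF a b ab.
- by move=> t; rewrite in_itv/= => tab; apply: dFt; lra.
- apply: continuous_in_subspaceT => t; rewrite inE/= in_itv/= => tab.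
  by apply: differentiable_continuous; apply/derivable1_diffP; have [] := dFt t tab.
rewrite in_itv/= => tab ->.
by rewrite ler_wpM2r; [|lra|apply: FM; lra].
Qed.

Definition prim f : R -> R := xget (fun=> 0) [set F | forall t, is_derive t 1 F (f t)].

Lemma primP f : continuous f -> forall t, is_derive t 1 (prim f) (f t).
Proof. by move=> /primitive_ex[F dF]; rewrite /prim; case: xgetP => [G _ //|/(_ F)]. Qed.

(** Defined as an increment of a chosen primitive, so that additivity and change of orientation hold
    for bounds in any order. *)
Definition cint f a b := prim f b - prim f a.

Lemma cint_chasles f a b c : cint f a c = cint f a b + cint f b c.
Proof. by rewrite /cint; ring. Qed.

Lemma cintC f a b : cint f b a = - cint f a b.
Proof. by rewrite /cint opprB. Qed.

Lemma cint_FTC F f a b : continuous f -> a <= b ->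
  (forall t, a <= t <= b -> is_derive t 1 F (f t)) -> cint f a b = F b - F a.
Proof.
move=> cf ab dF.
have h (t : R) : a <= t <= b -> is_derive t 1 (fun x => prim f x - F x) 0.
  by move=> tab; rewrite -(subrr (f t)); apply: is_deriveB; [exact: primP|exact: dF].
have := @derive_bound _ (fun=> 0) a b 0 ab h; rewrite mul0r => /(_ _)/[!normr0] H.
have : `|prim f b - F b - (prim f a - F a)| <= 0 by apply: H.
by rewrite normr_le0 /cint => /eqP; lra.
Qed.

Lemma cint_bound f a b M : continuous f -> a <= b ->
  (forall t, a <= t <= b -> `|f t| <= M) -> `|cint f a b| <= M * (b - a).
Proof. by move=> cf ab h; apply: (derive_bound ab (fun t _ => primP cf t)). Qed.

Lemma cint_ge f a b m : continuous f -> a <= b ->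
  (forall t, a <= t <= b -> m <= f t) -> m * (b - a) <= cint f a b.
Proof. by move=> cf ab h; apply: (derive_mono ab (fun t _ => primP cf t)). Qed.

Lemma cintD f g a b : continuous f -> continuous g ->
  cint (fun t => f t + g t) a b = cint f a b + cint g a b.
Proof.
move=> cf cg; have cfg : continuous (fun t => f t + g t) by move=> t; apply: continuousD; [exact: cf|exact: cg].
wlog ab : a b / a <= b.
  move=> H; have [/H//|/ltW/H h] := leP a b.
  by rewrite (cintC _ b a) h (cintC f b a) (cintC g b a) opprD.
have h (t : R) : a <= t <= b -> is_derive t 1 (fun x => prim f x + prim g x) (f t + g t).
  by move=> _; apply: is_deriveD; exact: primP.
by rewrite (cint_FTC cfg ab h) /cint; ring.
Qed.

Lemma continuous_scale k f : continuous f -> continuous (fun t => k * f t).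
Proof. by move=> cf t; apply: continuousM; [exact: cvg_cst|exact: cf]. Qed.

Lemma cintZ f k a b : continuous f -> cint (fun t => k * f t) a b = k * cint f a b.
Proof.
move=> cf; have ckf := continuous_scale (k := k) cf.
wlog ab : a b / a <= b.
  move=> H; have [/H//|/ltW/H h] := leP a b.
  by rewrite (cintC _ b a) h (cintC f b a) mulrN.
have h (t : R) : a <= t <= b -> is_derive t 1 (fun x => k * prim f x) (k * f t).
  by move=> _; have h := primP cf t; exact: is_deriveZ.
by rewrite (cint_FTC ckf ab h) /cint; ring.
Qed.

End Primitives.

(** * Integrals of complex functions of a real variable *)

Section ComplexIntegral.
Context {R : realType}.
Implicit Types (f g : R -> Cplx R) (a b c t : R).

Definition cintc f a b : Cplx R :=
  cint (fun t => complex.Re (f t)) a b +i* cint (fun t => complex.Im (f t)) a b.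

Lemma continuous_Re_comp f : continuous f -> continuous (fun t => complex.Re (f t) : R).
Proof. by move=> cf t; apply: (continuous_comp (cf t)); exact: continuous_Re. Qed.

Lemma continuous_Im_comp f : continuous f -> continuous (fun t => complex.Im (f t) : R).
Proof. by move=> cf t; apply: (continuous_comp (cf t)); exact: continuous_Im. Qed.

Lemma cintc_chasles f a b c : cintc f a c = cintc f a b + cintc f b c.
Proof. by rewrite /cintc (cint_chasles _ a b c) [in X in _ +i* X](cint_chasles _ a b c). Qed.

Lemma cintcC f a b : cintc f b a = - cintc f a b.
Proof. by rewrite /cintc cintC [in X in _ +i* X]cintC. Qed.

Lemma cintcD f g a b : continuous f -> continuous g ->
  cintc (fun t => f t + g t) a b = cintc f a b + cintc g a b.
Proof.
move=> cf cg; rewrite /cintc.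
under [X in cint X]eq_fun do rewrite ReD.
under [X in _ +i* cint X _ _]eq_fun do rewrite ImD.
by rewrite !cintD//; [exact: continuous_Im_comp..|exact: continuous_Re_comp|exact: continuous_Re_comp].
Qed.

Lemma cintcZ f (k : Cplx R) a b : continuous f ->
  cintc (fun t => k * f t) a b = k * cintc f a b.
Proof.
move=> cf; have c1 := continuous_Re_comp cf; have c2 := continuous_Im_comp cf.
case: k => k1 k2; apply: complex_eq => /=.
  have -> : (fun t => complex.Re ((k1 +i* k2) * f t)) =
      (fun t => k1 * complex.Re (f t) + (- k2) * complex.Im (f t)).
    by apply/funext => t; case: (f t) => x y /=; ring.
  by rewrite (cintD a b (continuous_scale (k := k1) c1) (continuous_scale (k := - k2) c2)) !cintZ//; ring.
have -> : (fun t => complex.Im ((k1 +i* k2) * f t)) =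
    (fun t => k1 * complex.Im (f t) + k2 * complex.Re (f t)).
  by apply/funext => t; case: (f t) => x y /=; ring.
by rewrite (cintD a b (continuous_scale (k := k1) c2) (continuous_scale (k := k2) c1)) !cintZ//; ring.
Qed.

Lemma cdiff_scale (k z : Cplx R) : cdiff (fun w => k * w) z k.
Proof.
move=> e e0; exists 1 => // w _.
by rewrite (_ : _ - _ - _ = 0) ?nc0 ?mulr_ge0 ?nc_ge0 ?(ltW e0)//; ring.
Qed.

Lemma continuous_cscale (k : Cplx R) f : continuous f -> continuous (fun t => k * f t).
Proof. by move=> cf t; apply: (continuous_comp (cf t)); exact: cdiff_cts (cdiff_scale k _). Qed.

Lemma cintcB f g a b : continuous f -> continuous g ->
  cintc (fun t => f t - g t) a b = cintc f a b - cintc g a b.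
Proof.
move=> cf cg; have -> : (fun t => f t - g t) = (fun t => f t + (-1) * g t).
  by apply/funext => t; rewrite mulN1r.
by rewrite (cintcD a b cf (continuous_cscale (k := -1) cg)) cintcZ// mulN1r.
Qed.

(** The factor 2 comes from bounding real and imaginary parts separately. *)
Lemma cintc_bound f a b M : continuous f ->
  (forall t, (a <= t <= b) || (b <= t <= a) -> nc (f t) <= M) ->
  nc (cintc f a b) <= 2 * M * `|b - a|.
Proof.
move=> cf; wlog ab : a b / a <= b.
  move=> H; have [/H//|/ltW/H h hf] := leP a b.
  by rewrite cintcC ncN distrC; apply: h => t ht; apply: hf; rewrite orbC.
move=> fM; apply: le_trans (nc_le_ReIm _) _ => /=.
rewrite (ger0_norm (_ : 0 <= b - a)) ?subr_ge0//.
have -> : 2 * M * (b - a) = M * (b - a) + M * (b - a) by ring.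
apply: lerD; apply: cint_bound => //.
- exact: continuous_Re_comp.
- by move=> t tab; apply: le_trans (Re_le_nc _) _; apply: fM; rewrite tab.
- exact: continuous_Im_comp.
- by move=> t tab; apply: le_trans (Im_le_nc _) _; apply: fM; rewrite tab.
Qed.

Lemma cintc_FTC (F : R -> Cplx R) f a b : continuous f ->
  (forall t, (a <= t <= b) || (b <= t <= a) -> rcdiff F t (f t)) -> cintc f a b = F b - F a.
Proof.
move=> cf; wlog ab : a b / a <= b.
  move=> H; have [/H//|/ltW/H h hf] := leP a b.
  by rewrite cintcC h ?opprB// => t ht; apply: hf; rewrite orbC.
move=> dF; have dF' t : a <= t <= b -> rcdiff F t (f t) by move=> tab; apply: dF; rewrite tab.
apply: complex_eq; rewrite ?ReB ?ImB /=.
  by apply: (@cint_FTC R (fun t => complex.Re (F t))) => //; [exact: continuous_Re_comp|move=> t /dF'/rcdiffP[]].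
by apply: (@cint_FTC R (fun t => complex.Im (F t))) => //; [exact: continuous_Im_comp|move=> t /dF'/rcdiffP[]].
Qed.

Lemma cintc_eq f g a b : continuous f -> continuous g ->
  (forall t, (a <= t <= b) || (b <= t <= a) -> f t = g t) -> cintc f a b = cintc g a b.
Proof.
move=> cf cg fg; apply/eqP; rewrite -subr_eq0 -cintcB// -nc_eq0 eq_le nc_ge0 andbT.
have := @cintc_bound (fun t => f t - g t) a b 0; rewrite mulr0 mul0r; apply.
  by move=> t; apply: (@continuousB _ (Cplx R)); [exact: cf|exact: cg].
by move=> t /fg ->; rewrite subrr nc0.
Qed.

End ComplexIntegral.

Lemma half_pow_lt {R : realType} (K e : R) : 0 <= K -> 0 < e -> exists n : nat, K / 2 ^+ n < e.
Proof.
move=> K0 e0; have := archi_boundP (divr_ge0 K0 (ltW e0)); set n := Num.bound _ => h.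
exists n; rewrite ltr_pdivrMr ?exprn_gt0// mulrC -ltr_pdivrMr//.
by apply: lt_le_trans h _; rewrite -natrX ler_nat ltnW// ltn_expl.
Qed.

Lemma nested_intervals {R : realType} (A B : nat -> R) :
  (forall n, A n <= A n.+1) -> (forall n, B n.+1 <= B n) -> (forall n, A n <= B n) ->
  exists x, forall n, A n <= x <= B n.
Proof.
move=> hA hB hAB.
have mA n m : A n <= A (n + m)%N by elim: m => [|m IH]; rewrite ?addn0// addnS (le_trans IH).
have mB n m : B (n + m)%N <= B n by elim: m => [|m IH]; rewrite ?addn0// addnS (le_trans _ IH).
have AB n m : A n <= B m by apply: le_trans (mA n m) (le_trans (hAB _) _); rewrite addnC.
exists (sup (range A)) => n; apply/andP; split.
  by apply: ub_le_sup; [exists (B n) => _ [m _ <-]|exists n].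
by apply: ge_sup; [exists (A 0%N), 0%N|move=> _ [m _ <-]].
Qed.

(** * Bisection of rectangles *)

Section Cousin.
Context {R : realType} (Q : R -> R -> R -> R -> Prop).
Hypothesis split4 : forall a b c d, a <= b -> c <= d ->
  Q a ((a + b) / 2) c ((c + d) / 2) -> Q ((a + b) / 2) b c ((c + d) / 2) ->
  Q a ((a + b) / 2) ((c + d) / 2) d -> Q ((a + b) / 2) b ((c + d) / 2) d -> Q a b c d.

Let rect : Type := (R * R) * (R * R).
Let bad (r : rect) := ~ Q r.1.1 r.1.2 r.2.1 r.2.2.
Let mid (p : R * R) := (p.1 + p.2) / 2.
Let quarters (r : rect) : seq rect :=
  [:: ((r.1.1, mid r.1), (r.2.1, mid r.2)); ((mid r.1, r.1.2), (r.2.1, mid r.2));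
      ((r.1.1, mid r.1), (mid r.2, r.2.2)); ((mid r.1, r.1.2), (mid r.2, r.2.2))].
Let step (r : rect) : rect := nth r (quarters r) (find (fun r' => `[< bad r' >]) (quarters r)).

Let ord (r : rect) := r.1.1 <= r.1.2 /\ r.2.1 <= r.2.2.

Let step_bad r : ord r -> bad r -> bad (step r).
Proof.
move=> [u1 u2] br; suff h : has (fun r' => `[< bad r' >]) (quarters r).
  by have := nth_find r h => /asboolP.
apply: contrapT => /negP; rewrite -all_predC /= => /and5P[h1 h2 h3 h4 _].
by apply: br; apply: split4 => //; apply: contrapT => h; [move: h1|move: h2|move: h3|move: h4];
  case: asboolP.
Qed.

Let halves (p p' : R * R) := p' = (p.1, mid p) \/ p' = (mid p, p.2).

Let step_halves r : ord r -> bad r -> halves r.1 (step r).1 /\ halves r.2 (step r).2.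
Proof.
move=> [u1 u2] br; have h : has (fun r' => `[< bad r' >]) (quarters r).
  apply: contrapT => /negP; rewrite -all_predC /= => /and5P[h1 h2 h3 h4 _].
  by apply: br; apply: split4 => //; apply: contrapT => h; [move: h1|move: h2|move: h3|move: h4];
    case: asboolP.
rewrite has_find in h; rewrite /step; case: (find _ _) h => [|[|[|[|//]]]] _ /=; rewrite /halves;
  by split; (by left) || (by right).
Qed.

(** If Q failed, it would fail on some quarter; the nested quarters shrink to a point, where the
    local hypothesis is contradicted. This serves both Goursat's theorem and the lifting of squares
    through a covering. *)
Lemma cousin a b c d : a <= b -> c <= d ->
  (forall x y, a <= x <= b -> c <= y <= d -> exists2 e, 0 < e & forall a' b' c' d',
    a <= a' -> a' <= x <= b' -> b' <= b -> c <= c' -> c' <= y <= d' -> d' <= d ->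
    b' - a' < e -> d' - c' < e -> Q a' b' c' d') -> Q a b c d.
Proof.
move=> ab cd loc; apply: contrapT => bad0.
pose r n := iter n step ((a, b), (c, d)).
have halfP p p' : halves p p' -> p.1 <= p.2 ->
    [/\ p.1 <= p'.1, p'.2 <= p.2, p'.1 <= p'.2 & p'.2 - p'.1 = (p.2 - p.1) / 2].
  by case: p => u v; rewrite /halves /mid /= => -[] -> /= uv; split; lra.
have inv n : ord (r n) /\ bad (r n).
  elim: n => [|n [rn bn]]; first by [].
  split; last exact: step_bad.
  have [h1 h2] := step_halves rn bn.
  by split; [have [] := halfP _ _ h1 rn.1|have [] := halfP _ _ h2 rn.2].
have st n : [/\ (r n).1.1 <= (r n.+1).1.1, (r n.+1).1.2 <= (r n).1.2 &
    (r n.+1).1.2 - (r n.+1).1.1 = ((r n).1.2 - (r n).1.1) / 2] /\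
    [/\ (r n).2.1 <= (r n.+1).2.1, (r n.+1).2.2 <= (r n).2.2 &
    (r n.+1).2.2 - (r n.+1).2.1 = ((r n).2.2 - (r n).2.1) / 2].
  have [rn bn] := inv n; have [h1 h2] := step_halves rn bn.
  by split; [have [] := halfP _ _ h1 rn.1|have [] := halfP _ _ h2 rn.2].
have w n : (r n).1.2 - (r n).1.1 = (b - a) / 2 ^+ n /\ (r n).2.2 - (r n).2.1 = (d - c) / 2 ^+ n.
  elim: n => [|n [IH1 IH2]]; first by rewrite expr0 !divr1.
  have [[_ _ ->] [_ _ ->]] := st n; rewrite IH1 IH2 exprSr invfM.
  by split; ring.
have [x xP] := @nested_intervals R (fun n => (r n).1.1) (fun n => (r n).1.2)
  (fun n => let: And3 h _ _ := (st n).1 in h) (fun n => let: And3 _ h _ := (st n).1 in h) (fun n => (inv n).1.1).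
have [y yP] := @nested_intervals R (fun n => (r n).2.1) (fun n => (r n).2.2)
  (fun n => let: And3 h _ _ := (st n).2 in h) (fun n => let: And3 _ h _ := (st n).2 in h) (fun n => (inv n).1.2).
have [e e0 he] := loc x y (xP 0%N) (yP 0%N).
have K0 : 0 <= (b - a) + (d - c) by lra.
have [n hn] := half_pow_lt K0 e0.
have nn n' : [/\ a <= (r n').1.1, (r n').1.2 <= b, c <= (r n').2.1 & (r n').2.2 <= d].
  elim: n' => [|m [i1 i2 i3 i4]]; first by [].
  by have [[s1 s2 _] [s3 s4 _]] := st m; split; [exact: le_trans s1|exact: le_trans i2|exact: le_trans s3|exact: le_trans i4].
have [i1 i2 i3 i4] := nn n; have [w1 w2] := w n.
rewrite mulrDl in hn.
have p1 : 0 <= (b - a) / 2 ^+ n by rewrite divr_ge0 ?exprn_ge0//; lra.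
have p2 : 0 <= (d - c) / 2 ^+ n by rewrite divr_ge0 ?exprn_ge0//; lra.
by apply: (inv n).2; apply: he => //; lra.
Qed.

End Cousin.

(** * Goursat's theorem on rectangles *)

Section Goursat.
Context {R : realType}.
Implicit Types (f g : Cplx R -> Cplx R) (a b c d x y : R).

Definition hseg y : R -> Cplx R := fun t => t +i* y.
Definition vseg x : R -> Cplx R := fun t => x +i* t.

Lemma rcdiff_hseg y t : rcdiff (hseg y) t 1.
Proof.
move=> e e0; exists 1 => // s _; rewrite (_ : _ - _ - _ = 0) ?nc0 ?mulr_ge0 ?(ltW e0)//.
by apply: complex_eq; rewrite /hseg /=; ring.
Qed.

Lemma rcdiff_vseg x t : rcdiff (vseg x) t 'i.
Proof.
move=> e e0; exists 1 => // s _; rewrite (_ : _ - _ - _ = 0) ?nc0 ?mulr_ge0 ?(ltW e0)//.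
by apply: complex_eq; rewrite /vseg /=; ring.
Qed.

Lemma continuous_hseg f y : continuous f -> continuous (f \o hseg y).
Proof. by move=> cf t; apply: continuous_comp; [exact: rcdiff_cts (rcdiff_hseg _ _)|exact: cf]. Qed.

Lemma continuous_vseg f x : continuous f -> continuous (f \o vseg x).
Proof. by move=> cf t; apply: continuous_comp; [exact: rcdiff_cts (rcdiff_vseg _ _)|exact: cf]. Qed.

(** The integral of f dz along the boundary of [a, b] x [c, d], counterclockwise when a <= b and c
    <= d. *)
Definition rint f a b c d : Cplx R :=
  cintc (f \o hseg c) a b - cintc (f \o hseg d) a b +
  'i * (cintc (f \o vseg b) c d - cintc (f \o vseg a) c d).

(** Continuity is asked along the full lines carrying the four sides, since [prim] is chosen for
    functions continuous on the whole real line. *)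
Definition lcont f a b c d := [/\ continuous (f \o hseg c), continuous (f \o hseg d),
  continuous (f \o vseg a) & continuous (f \o vseg b)].

Lemma continuous_lcont f a b c d : continuous f -> lcont f a b c d.
Proof. by move=> cf; split; [exact: continuous_hseg|exact: continuous_hseg|exact: continuous_vseg|exact: continuous_vseg]. Qed.

Definition btw a b t := (a <= t <= b) || (b <= t <= a).

Definition rboundary a b c d (w : Cplx R) :=
  (btw a b (complex.Re w) /\ (complex.Im w = c \/ complex.Im w = d)) \/
  (btw c d (complex.Im w) /\ (complex.Re w = a \/ complex.Re w = b)).

Lemma rint_bound f a b c d M : lcont f a b c d ->
  (forall w, rboundary a b c d w -> nc (f w) <= M) ->
  nc (rint f a b c d) <= 4 * M * (`|b - a| + `|d - c|).
Proof.
move=> [c1 c2 c3 c4] fM; rewrite /rint; apply: le_trans (ncD _ _) _.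
have i1 : nc ('i : R[i]) = 1 by rewrite /= expr0n/= add0r expr1n sqrtr1.
rewrite ncM i1 mul1r.
have h1 := @cintc_bound R (f \o hseg c) a b M c1 (fun t ht => fM (hseg c t) (or_introl (conj ht (or_introl erefl)))).
have h2 := @cintc_bound R (f \o hseg d) a b M c2 (fun t ht => fM (hseg d t) (or_introl (conj ht (or_intror erefl)))).
have h3 := @cintc_bound R (f \o vseg a) c d M c3 (fun t ht => fM (vseg a t) (or_intror (conj ht (or_introl erefl)))).
have h4 := @cintc_bound R (f \o vseg b) c d M c4 (fun t ht => fM (vseg b t) (or_intror (conj ht (or_intror erefl)))).
have h5 := ncD (cintc (f \o hseg c) a b) (- cintc (f \o hseg d) a b).
have h6 := ncD (cintc (f \o vseg b) c d) (- cintc (f \o vseg a) c d).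
rewrite ncN in h5; rewrite ncN in h6.
have -> : 4 * M * (`|b - a| + `|d - c|) = 2 * (2 * M * `|b - a|) + 2 * (2 * M * `|d - c|) by ring.
lra.
Qed.

Lemma rintD f g a b c d : lcont f a b c d -> lcont g a b c d ->
  rint (fun w => f w + g w) a b c d = rint f a b c d + rint g a b c d.
Proof.
move=> [c1 c2 c3 c4] [g1 g2 g3 g4]; rewrite /rint.
have e (k : R -> Cplx R) : (fun w => f w + g w) \o k = (fun t => (f \o k) t + (g \o k) t) by [].
by rewrite !e !cintcD//; ring.
Qed.

Lemma rintZ (k : Cplx R) f a b c d : lcont f a b c d ->
  rint (fun w => k * f w) a b c d = k * rint f a b c d.
Proof.
move=> [c1 c2 c3 c4]; rewrite /rint.
have e (h : R -> Cplx R) : (fun w => k * f w) \o h = (fun t => k * (f \o h) t) by [].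
by rewrite !e !cintcZ//; ring.
Qed.

Lemma rint_eq f g a b c d : lcont f a b c d -> lcont g a b c d ->
  (forall w, rboundary a b c d w -> f w = g w) -> rint f a b c d = rint g a b c d.
Proof.
move=> [c1 c2 c3 c4] [g1 g2 g3 g4] fg; rewrite /rint; congr (_ - _ + _ * (_ - _)); apply: cintc_eq => // t ht;
  apply: fg; [left; split=> //; left|left; split=> //; right|right; split=> //; right|right; split=> //; left] => //.
Qed.

Lemma rint_primitive f F a b c d : lcont f a b c d ->
  (forall w, rboundary a b c d w -> cdiff F w (f w)) -> rint f a b c d = 0.
Proof.
move=> [c1 c2 c3 c4] dF; rewrite /rint mulrBr -!cintcZ//.
rewrite (@cintc_FTC _ (F \o hseg c))//; last first.
  move=> t ht; rewrite -[(f \o hseg c) t]mulr1; apply: rcdiff_comp; first exact: rcdiff_hseg.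
  by apply: dF; left; split=> //; left.
rewrite (@cintc_FTC _ (F \o hseg d))//; last first.
  move=> t ht; rewrite -[(f \o hseg d) t]mulr1; apply: rcdiff_comp; first exact: rcdiff_hseg.
  by apply: dF; left; split=> //; right.
rewrite (@cintc_FTC _ (F \o vseg b)); [|exact: continuous_cscale|]; last first.
  move=> t ht; rewrite mulrC; apply: rcdiff_comp; first exact: rcdiff_vseg.
  by apply: dF; right; split=> //; right.
rewrite (@cintc_FTC _ (F \o vseg a)); [|exact: continuous_cscale|]; last first.
  move=> t ht; rewrite mulrC; apply: rcdiff_comp; first exact: rcdiff_vseg.
  by apply: dF; right; split=> //; left.
by rewrite /hseg /vseg /=; ring.
Qed.

Lemma rint_vsplit f a m b c d : rint f a b c d = rint f a m c d + rint f m b c d.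
Proof. by rewrite /rint (cintc_chasles _ a m b) (cintc_chasles (f \o hseg d) a m b); ring. Qed.

Lemma rint_hsplit f a b c n d : rint f a b c d = rint f a b c n + rint f a b n d.
Proof. by rewrite /rint (cintc_chasles _ c n d) (cintc_chasles (f \o vseg a) c n d); ring. Qed.

Lemma rint_swaph f a b c d : rint f b a c d = - rint f a b c d.
Proof. by rewrite /rint (cintcC _ a b) (cintcC (f \o hseg d) a b); ring. Qed.

Lemma rint_swapv f a b c d : rint f a b d c = - rint f a b c d.
Proof. by rewrite /rint (cintcC _ c d) (cintcC (f \o vseg a) c d); ring. Qed.

(** The bound by e1 times the square of half the perimeter is stable under cutting into four, each
    quarter having a quarter of that square. Near a point it holds because the affine part of f has
    a primitive and the remainder is small to first order. *)
Lemma goursat_ord f a b c d : continuous f -> a <= b -> c <= d ->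
  (forall x y, a <= x <= b -> c <= y <= d -> exists L, cdiff f (x +i* y) L) ->
  rint f a b c d = 0.
Proof.
move=> cf ab cd df; apply/eqP; rewrite -nc_eq0 eq_le nc_ge0 andbT.
apply/ler_addgt0Pl => e e0; rewrite addr0.
set K := ((b - a) + (d - c) + 1) ^+ 2.
have K0 : 0 < K by rewrite exprn_gt0//; lra.
pose e1 := e / K; have e10 : 0 < e1 by rewrite divr_gt0.
suff H : nc (rint f a b c d) <= e1 * ((b - a) + (d - c)) ^+ 2.
  apply: le_trans H _; rewrite /e1 -mulrA ger_pMr// mulrC ler_pdivrMr// mul1r /K.
  by rewrite ler_sqr ?nnegrE; lra.
apply: (@cousin R (fun a b c d => nc (rint f a b c d) <= e1 * ((b - a) + (d - c)) ^+ 2)) => //.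
  move=> p q m n pq mn h1 h2 h3 h4.
  rewrite (@rint_vsplit f p ((p + q) / 2)) (@rint_hsplit f p _ m ((m + n) / 2) n) (@rint_hsplit f _ q m ((m + n) / 2) n).
  apply: le_trans (ncD _ _) _; apply: le_trans (lerD (ncD _ _) (ncD _ _)) _.
  have -> : e1 * (q - p + (n - m)) ^+ 2 = 4 * (e1 * ((q - p) / 2 + (n - m) / 2) ^+ 2) by field.
  have E1 : (p + q) / 2 - p = (q - p) / 2 by field.
  have E2 : q - (p + q) / 2 = (q - p) / 2 by field.
  have E3 : (m + n) / 2 - m = (n - m) / 2 by field.
  have E4 : n - (m + n) / 2 = (n - m) / 2 by field.
  rewrite E1 E3 in h1; rewrite E2 E3 in h2; rewrite E1 E4 in h3; rewrite E2 E4 in h4; lra.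
move=> x y hx hy; have [L dL] := df x y hx hy.
(* The quarter absorbs the factor 4 of [rint_bound]; two sides shorter than dl / 2 then keep the
   rectangle in the ball of radius dl. *)
have e40 : 0 < e1 / 4 by rewrite divr_gt0.
have [dl dl0 h] := dL _ e40; exists (dl / 2); first by rewrite divr_gt0.
move=> a' b' c' d' aa xab bb cc ycd dd wa wc.
pose w0 : Cplx R := x +i* y; pose lin (w : Cplx R) := f w0 + L * (w - w0).
have clin : continuous lin.
  move=> w; apply: (@cdiff_cts _ _ _ (0 + L * 1)); apply: cdiffD; first exact: cdiff_cst.
  apply: (@cdiff_comp _ (fun w => w - w0) (fun w => L * w)); last exact: cdiff_scale.
  by rewrite -[1]addr0; apply: cdiffD; [exact: cdiff_id|exact: cdiff_cst].
have cr : continuous (fun w => f w - lin w).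
  by move=> w; apply: (@continuousB _ (Cplx R)); [exact: cf|exact: clin].
have -> : f = (fun w => lin w + (f w - lin w)) by apply/funext => w; rewrite addrC subrK.
rewrite (@rintD lin (fun w => f w - lin w) a' b' c' d'
  (continuous_lcont _ _ _ _ clin) (continuous_lcont _ _ _ _ cr)).
rewrite (@rint_primitive lin (fun w => f w0 * (w - w0) + L / 2 * ((w - w0) * (w - w0)))); last first.
- move=> w _; have dw : cdiff (fun w => w - w0) w 1.
    by rewrite -[1]addr0; apply: cdiffD; [exact: cdiff_id|exact: cdiff_cst].
  have -> : lin w = f w0 * 1 + L / 2 * ((w - w0) * 1 + (w - w0) * 1) by rewrite /lin; field.
  apply: cdiffD.
    by apply: (@cdiff_comp _ (fun w => w - w0) (fun w => f w0 * w)) => //; exact: cdiff_scale.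
  apply: (@cdiff_comp _ (fun w => (w - w0) * (w - w0)) (fun w => L / 2 * w)); last exact: cdiff_scale.
  exact: cdiffM.
- exact: (continuous_lcont _ _ _ _ clin).
rewrite add0r.
apply: le_trans (rint_bound (M := e1 / 4 * ((b' - a') + (d' - c'))) (continuous_lcont _ _ _ _ cr) _) _.
- move=> w hw; rewrite /lin opprD addrA.
  have wn : nc (w - w0) <= (b' - a') + (d' - c').
    apply: le_trans (nc_le_ReIm _) _; rewrite ReB ImB /=.
    have [h1 h2] : a' <= complex.Re w <= b' /\ c' <= complex.Im w <= d'.
      by move: hw; rewrite /rboundary /btw => -[] [/orP[] h1 [] ->]; clear - h1 xab ycd; lra.
    by apply: lerD; rewrite ler_norml; lra.
  apply: (@le_trans _ _ (e1 / 4 * nc (w - w0))); first by apply: h; apply: le_lt_trans wn _; lra.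
  by rewrite ler_wpM2l// ltW.
- have -> : `|b' - a'| = b' - a' by rewrite ger0_norm//; lra.
  have -> : `|d' - c'| = d' - c' by rewrite ger0_norm//; lra.
  by rewrite le_eqVlt; apply/orP; left; apply/eqP; field.
Qed.

Lemma goursat f a b c d : continuous f ->
  (forall x y, btw a b x -> btw c d y -> exists L, cdiff f (x +i* y) L) ->
  rint f a b c d = 0.
Proof.
move=> cf.
wlog ab : a b / a <= b.
  move=> H; have [/H//|/ltW/H h hf] := leP a b.
  by rewrite rint_swaph h ?oppr0// => x y hx hy; apply: hf; rewrite // /btw orbC.
wlog cd : c d / c <= d.
  move=> H; have [/H//|/ltW/H h hf] := leP c d.
  by rewrite rint_swapv h ?oppr0// => x y hx hy; apply: hf; rewrite // /btw orbC.
by move=> df; apply: goursat_ord => // x y hx hy; apply: df; rewrite /btw ?hx ?hy.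
Qed.

(** After splitting, only a small square around the exceptional point contributes; f is bounded
    there and the perimeter tends to 0. *)
Lemma removable_goursat f a b c d x0 y0 : continuous f -> a < x0 < b -> c < y0 < d ->
  (forall x y, a <= x <= b -> c <= y <= d -> x +i* y <> x0 +i* y0 -> exists L, cdiff f (x +i* y) L) ->
  rint f a b c d = 0.
Proof.
move=> cf hx hy df; apply/eqP; rewrite -nc_eq0 eq_le nc_ge0 andbT.
have [dl dl0 hM] : exists2 dl : R, 0 < dl & forall w, nc (w - (x0 +i* y0)) < dl -> nc (f w) <= nc (f (x0 +i* y0)) + 1.
  have /cvg_cplxP/(_ 1 ltr01)/cplx_nbhsP[dl dl0 h] := cf (x0 +i* y0).
  exists dl => // w /h; rewrite /= => h'.
  have -> : f w = f (x0 +i* y0) + (f w - f (x0 +i* y0)) by rewrite addrC subrK.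
  by apply: le_trans (ncD _ _) _; rewrite lerD2l ltW.
set M := nc (f _) + 1 in hM; have M0 : 0 < M by rewrite ltr_wpDl ?nc_ge0.
apply/ler_addgt0Pl => e e0; rewrite addr0.
pose r := Num.min (Num.min (x0 - a) (b - x0)) (Num.min (Num.min (y0 - c) (d - y0)) (Num.min (dl / 3) (e / (16 * M)))).
have r0 : 0 < r by rewrite !lt_min !divr_gt0 ?mulr_gt0//; apply/andP; split; [lra|rewrite !andbT; lra].
have [[r1 r2] [r3 r4] [r5 r6]] : [/\ r <= x0 - a /\ r <= b - x0, r <= y0 - c /\ r <= d - y0 & r <= dl / 3 /\ r <= e / (16 * M)].
  by rewrite /r !ge_min !lexx !orbT.
move: r r0 r1 r2 r3 r4 r5 r6 => r r0 r1 r2 r3 r4 r5 r6.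
have G x1 x2 y1 y2 : a <= x1 -> x1 <= x2 -> x2 <= b -> c <= y1 -> y1 <= y2 -> y2 <= d ->
    (x2 < x0 \/ x0 < x1) \/ (y2 < y0 \/ y0 < y1) -> rint f x1 x2 y1 y2 = 0.
  move=> h1 h2 h3 h4 h5 h6 out; apply: goursat_ord => // x y hx' hy'; apply: df; [lra|lra|].
  by move=> [ex ey]; move: out; rewrite -ex -ey; lra.
have -> : rint f a b c d = rint f (x0 - r) (x0 + r) (y0 - r) (y0 + r).
  rewrite (@rint_vsplit f a (x0 - r)) (@rint_vsplit f (x0 - r) (x0 + r) b).
  rewrite (@rint_hsplit f (x0 - r) (x0 + r) c (y0 - r)) (@rint_hsplit f (x0 - r) (x0 + r) (y0 - r) (y0 + r) d).
  rewrite (G a (x0 - r) c d) ?(G (x0 + r) b c d) ?(G (x0 - r) (x0 + r) c (y0 - r)) ?(G (x0 - r) (x0 + r) (y0 + r) d);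
    by [rewrite !(add0r, addr0)|clear - hx hy r0 r1 r2 r3 r4; lra].
apply: le_trans (rint_bound (M := M) (continuous_lcont _ _ _ _ cf) _) _.
  move=> w hw; apply: hM; apply: le_lt_trans (nc_le_ReIm _) _; rewrite ReB ImB /=.
  have : `|complex.Re w - x0| <= r /\ `|complex.Im w - y0| <= r.
    by rewrite !ler_norml; move: hw; rewrite /rboundary /btw => -[] [/orP[] h1 [] h2]; clear - h1 h2 r0; lra.
  lra.
have -> : 4 * M * (`|x0 + r - (x0 - r)| + `|y0 + r - (y0 - r)|) = 16 * M * r.
  by rewrite !ger0_norm; [ring|lra|lra].
by move: r6; rewrite ler_pdivlMr ?mulr_gt0// mulrC.
Qed.

End Goursat.

(** * Local primitives and square roots of holomorphic functions *)

Section HolomorphicLocal.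
Context {R : realType}.
Implicit Types (f g : Cplx R -> Cplx R) (z w : Cplx R) (r s : R).

Lemma cplx_cts_eps f z : (forall e : R, 0 < e -> exists2 dl : R, 0 < dl &
  forall w, nc (w - z) < dl -> nc (f w - f z) < e) -> {for z, continuous f}.
Proof.
move=> H A /cplx_nbhsP[e e0 eA]; have [dl dl0 h] := H e e0.
by apply/cplx_nbhsP; exists dl => // w /h /eA.
Qed.

Definition hol_ball f z0 r := forall w, nc (w - z0) < r -> exists L, cdiff f w L.

Definition clamp (x0 s x : R) : R := if x < x0 - s then x0 - s else if x0 + s < x then x0 + s else x.

Lemma clamp_lip x0 s x y : 0 <= s -> `|clamp x0 s x - clamp x0 s y| <= `|x - y|.
Proof.
move=> s0; rewrite /clamp; have := ler_norm (x - y); have := ler_norm (y - x); rewrite distrC.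
have := normr_ge0 (x - y).
by case: ltP => h1; [|case: ltP => h2]; case: ltP => h3; rewrite ?ler_norml; try lra;
  case: ltP => h4; rewrite ?ler_norml; try lra; rewrite -ler_norml.
Qed.

Lemma clamp_in x0 s x : 0 <= s -> x0 - s <= clamp x0 s x <= x0 + s.
Proof. by move=> s0; rewrite /clamp; case: ltP => h1; [lra|case: ltP => h2; lra]. Qed.

Lemma clamp_id x0 s x : x0 - s <= x <= x0 + s -> clamp x0 s x = x.
Proof. by move=> hx; rewrite /clamp; case: ltP => h1; [lra|case: ltP => h2; lra]. Qed.

Definition cclamp z0 s z : Cplx R :=
  clamp (complex.Re z0) s (complex.Re z) +i* clamp (complex.Im z0) s (complex.Im z).

Lemma cclamp_continuous z0 s : 0 <= s -> continuous (cclamp z0 s).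
Proof.
move=> s0 z; apply: cplx_cts_eps => e e0; exists (e / 2); first by rewrite divr_gt0.
move=> w wz; apply: le_lt_trans (nc_le_ReIm _) _; rewrite ReB ImB /=.
have h1 := clamp_lip (complex.Re z0) (complex.Re w) (complex.Re z) s0.
have h2 := clamp_lip (complex.Im z0) (complex.Im w) (complex.Im z) s0.
have := Re_le_nc (w - z); have := Im_le_nc (w - z); rewrite ReB ImB; lra.
Qed.

Definition in_square z0 s w := `|complex.Re w - complex.Re z0| <= s /\ `|complex.Im w - complex.Im z0| <= s.

Lemma ball_in_square z0 s w : nc (w - z0) <= s -> in_square z0 s w.
Proof. by move=> h; have := Re_le_nc (w - z0); have := Im_le_nc (w - z0); rewrite ReB ImB /in_square; split; lra. Qed.

Lemma square_in_ball z0 s w : in_square z0 s w -> nc (w - z0) <= 2 * s.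
Proof. by move=> [h1 h2]; apply: le_trans (nc_le_ReIm _) _; rewrite ReB ImB; lra. Qed.

(** Composing with the clamp to a square extends f continuously to the whole plane, as the integrals
    demand. The clamp is at r / 3 and the conclusion at r / 4, so that f and g agree around each
    point considered and share its derivative. *)
Lemma hol_localize f z0 r : 0 < r -> hol_ball f z0 r ->
  exists2 g, continuous g & (forall w, in_square z0 (r / 4) w -> g w = f w) /\
    forall w, in_square z0 (r / 4) w -> exists L, cdiff g w L /\ cdiff f w L.
Proof.
move=> r0 hf; have s0 : 0 <= r / 3 by rewrite divr_ge0// ltW.
have insq w : in_square z0 (r / 3) (cclamp z0 (r / 3) w).
  have := clamp_in (complex.Re z0) (complex.Re w) s0; have := clamp_in (complex.Im z0) (complex.Im w) s0.
  by rewrite /in_square /= !ler_norml; split; lra.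
have idsq w : in_square z0 (r / 3) w -> cclamp z0 (r / 3) w = w.
  move=> [h1 h2]; apply: complex_eq => /=; apply: clamp_id; rewrite ler_norml in h1 h2; rewrite ?ler_norml in h2; lra.
exists (f \o cclamp z0 (r / 3)); [|split].
- move=> w; apply: continuous_comp; first exact: cclamp_continuous.
  have [|L dL] := hf (cclamp z0 (r / 3) w); last exact: cdiff_cts dL.
  by apply: le_lt_trans (square_in_ball (insq w)) _; lra.
- by move=> w [h1 h2]; rewrite /= idsq//; split; lra.
- move=> w [h1 h2].
  have [|L dL] := hf w; first by apply: le_lt_trans (square_in_ball (conj h1 h2)) _; lra.
  exists L; split => //; apply: cdiff_local dL _; exists (r / 12); first lra.
  move=> w' ww; rewrite /= idsq//.
  have := Re_le_nc (w' - w); have := Im_le_nc (w' - w); rewrite ReB ImB /in_square.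
  by rewrite !ler_norml in h1 h2 *; split; lra.
Qed.

(** F integrates horizontally, then vertically. Goursat's theorem on the rectangle between two such
    paths reduces an increment of F to an integral along two short sides near w. *)
Lemma hol_primitive f z0 r : 0 < r -> hol_ball f z0 r ->
  exists F r', 0 < r' /\ forall w, nc (w - z0) < r' -> cdiff F w (f w).
Proof.
move=> r0 hf; have [g cg [gf dg]] := hol_localize r0 hf.
pose F (w : Cplx R) := cintc (g \o hseg (complex.Im z0)) (complex.Re z0) (complex.Re w) +
  'i * cintc (g \o vseg (complex.Re w)) (complex.Im z0) (complex.Im w).
exists F, (r / 4); split; first by rewrite divr_gt0.
move=> w wz e e0.
have [d1 d10 hc] : exists2 d1 : R, 0 < d1 & forall w', nc (w' - w) < d1 -> nc (g w' - g w) <= e / 4.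
  have e40 : 0 < e / 4 by rewrite divr_gt0.
  have /cvg_cplxP/(_ _ e40)/cplx_nbhsP[d1 d10 h] := cg w.
  by exists d1 => // w' /h/ltW.
have d20 : 0 < r / 4 - nc (w - z0) by lra.
exists (Num.min (d1 / 2) (r / 4 - nc (w - z0))); first by rewrite lt_min d20 divr_gt0.
move=> w'; rewrite lt_min => /andP[ww1 ww2].
have wsq := ball_in_square (ltW wz).
have w'z : nc (w' - z0) <= r / 4 by apply: le_trans (nc_triangle _ w _) _; lra.
have w'sq := ball_in_square w'z.
rewrite -(gf _ wsq).
have [c1 c2] := wsq; have [c3 c4] := w'sq.
rewrite !ler_norml in c1 c2 c3 c4.
have G : rint g (complex.Re w) (complex.Re w') (complex.Im z0) (complex.Im w) = 0.
  apply: goursat => // x y hx hy; have [|L [dL _]] := dg (x +i* y); last by exists L.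
  by move: hx hy; rewrite /btw /in_square /= !ler_norml => /orP[] hx /orP[] hy; clear - hx hy c1 c2 c3 c4 r0; split; lra.
have FE : F w' - F w = cintc (g \o hseg (complex.Im w)) (complex.Re w) (complex.Re w') +
    'i * cintc (g \o vseg (complex.Re w')) (complex.Im w) (complex.Im w').
  move: G; rewrite /rint /F.
  rewrite (cintc_chasles (g \o hseg (complex.Im z0)) (complex.Re z0) (complex.Re w) (complex.Re w')).
  rewrite (cintc_chasles (g \o vseg (complex.Re w')) (complex.Im z0) (complex.Im w) (complex.Im w')).
  set a1 := cintc _ _ _; set a2 := cintc _ _ _; set a3 := cintc _ _ _; set a4 := cintc _ _ _.
  set a5 := cintc _ _ _; set a6 := cintc _ _ _ => G.
  have -> : a5 + a1 + 'i * (a3 + a6) - (a5 + 'i * a4) = (a1 - a2 + 'i * (a3 - a4)) + a2 + 'i * a6 by ring.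
  by rewrite G add0r.
have cst : continuous (fun _ : R => g w) by move=> t; exact: cst_continuous.
have E1 : cintc (fun _ : R => g w) (complex.Re w) (complex.Re w') = g w * (complex.Re w' - complex.Re w)%:C.
  rewrite (@cintc_FTC _ (fun t => 0 + t%:C * g w)) => [|//|t _]; last exact: rcdiff_line.
  by rewrite rmorphB/=; ring.
have E2 : cintc (fun _ : R => g w) (complex.Im w) (complex.Im w') = g w * (complex.Im w' - complex.Im w)%:C.
  rewrite (@cintc_FTC _ (fun t => 0 + t%:C * g w)) => [|//|t _]; last exact: rcdiff_line.
  by rewrite rmorphB/=; ring.
have -> : F w' - F w - g w * (w' - w) =
    cintc (fun t => (g \o hseg (complex.Im w)) t - g w) (complex.Re w) (complex.Re w') +
    'i * cintc (fun t => (g \o vseg (complex.Re w')) t - g w) (complex.Im w) (complex.Im w').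
  rewrite (@cintcB _ (g \o hseg (complex.Im w)) (fun=> g w) _ _ (@continuous_hseg R g (complex.Im w) cg) cst).
  rewrite (@cintcB _ (g \o vseg (complex.Re w')) (fun=> g w) _ _ (@continuous_vseg R g (complex.Re w') cg) cst).
  have D : w' - w = (complex.Re w' - complex.Re w)%:C + 'i * (complex.Im w' - complex.Im w)%:C.
    by rewrite [LHS]complexE ReB ImB.
  rewrite E1 E2 FE D; move: (cintc _ _ _) (cintc _ _ _) (g w) (_%:C) (_%:C) => A B C u v.
  by rewrite (mulrDr C) (mulrBr 'i) opprD addrACA; congr (_ + (_ - _)); rewrite mulrCA.
have i1 : nc ('i : R[i]) = 1 by rewrite /= expr0n/= add0r expr1n sqrtr1.
apply: le_trans (ncD _ _) _; rewrite ncM i1 mul1r.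
have q1 := Re_le_nc (w' - w); have q2 := Im_le_nc (w' - w); rewrite ReB in q1; rewrite ImB in q2.
have B1 : nc (cintc (fun t => (g \o hseg (complex.Im w)) t - g w) (complex.Re w) (complex.Re w')) <=
    2 * (e / 4) * `|complex.Re w' - complex.Re w|.
  apply: cintc_bound; first by move=> t; apply: (@continuousB _ (Cplx R)); [exact: continuous_hseg|exact: cst].
  move=> t ht; apply: hc; apply: le_lt_trans (nc_le_ReIm _) _; rewrite ReB ImB /= subrr normr0 addr0.
  suff : `|t - complex.Re w| <= `|complex.Re w' - complex.Re w| by lra.
  have := ler_norm (complex.Re w' - complex.Re w); have := ler_norm (complex.Re w - complex.Re w').
  by rewrite distrC ler_norml; clear - ht; move: ht => /orP[] ht; lra.
have B2 : nc (cintc (fun t => (g \o vseg (complex.Re w')) t - g w) (complex.Im w) (complex.Im w')) <=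
    2 * (e / 4) * `|complex.Im w' - complex.Im w|.
  apply: cintc_bound; first by move=> t; apply: (@continuousB _ (Cplx R)); [exact: continuous_vseg|exact: cst].
  move=> t ht; apply: hc; apply: le_lt_trans (nc_le_ReIm _) _; rewrite ReB ImB /=.
  suff : `|t - complex.Im w| <= `|complex.Im w' - complex.Im w| by lra.
  have := ler_norm (complex.Im w' - complex.Im w); have := ler_norm (complex.Im w - complex.Im w').
  by rewrite distrC ler_norml; clear - ht; move: ht => /orP[] ht; lra.
have M1 : e / 2 * `|complex.Re w' - complex.Re w| <= e / 2 * nc (w' - w) by rewrite ler_wpM2l// divr_ge0// ltW.
have M2 : e / 2 * `|complex.Im w' - complex.Im w| <= e / 2 * nc (w' - w) by rewrite ler_wpM2l// divr_ge0// ltW.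
have -> : e * nc (w' - w) = e / 2 * nc (w' - w) + e / 2 * nc (w' - w) by field.
apply: lerD; [apply: le_trans B1 _|apply: le_trans B2 _].
  by have -> : 2 * (e / 4) = e / 2 by field.
by have -> : 2 * (e / 4) = e / 2 by field.
Qed.

Definition sqrt_right z : Cplx R := if 0 <= complex.Re (sqrtc z) then sqrtc z else - sqrtc z.

Lemma sqrt_rightE z : sqrt_right z ^+ 2 = z.
Proof. by rewrite /sqrt_right; case: ifP => _; rewrite ?sqrrN sqr_sqrtc. Qed.

Lemma sqrt_right_ge0 z : 0 <= complex.Re (sqrt_right z).
Proof.
rewrite /sqrt_right; case: ifPn => //; rewrite -ltNge => h.
by case: (sqrtc z) h => a b /= h; rewrite oppr_ge0 ltW.
Qed.

Lemma sqrt_right_gt0 z : 0 < complex.Re z -> 0 < complex.Re (sqrt_right z).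
Proof.
move=> z0; rewrite lt0r sqrt_right_ge0 andbT; apply/eqP => h.
have := sqrt_rightE z; case: (sqrt_right z) h => a b /= -> h.
by move: z0; rewrite -h /= mul0r add0r oppr_gt0 => hb; have := mulr_ge0_le0; have := sqr_ge0 b; rewrite expr2; lra.
Qed.

(** If s and s' are the roots of z and w, then (s' - s)(s' + s) = w - z, and s' + s has real part at
    least Re s > 0. *)
Lemma cdiff_sqrt_right z : 0 < complex.Re z -> cdiff sqrt_right z (2 * sqrt_right z)^-1.
Proof.
move=> z0; have s0 := sqrt_right_gt0 z0; set s := sqrt_right z in s0 *.
set m := complex.Re s in s0.
have sn0 : s != 0 by apply/eqP => h; move: s0; rewrite /m h ltxx.
have mul w : (sqrt_right w - s) * (sqrt_right w + s) = w - z.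
  by rewrite -subr_sqr !sqrt_rightE.
have sm w : m <= nc (sqrt_right w + s).
  apply: le_trans (Re_le_nc _); rewrite ReD; apply: le_trans (ler_norm _).
  by rewrite lerDr sqrt_right_ge0.
have lip w : nc (sqrt_right w - s) <= nc (w - z) / m.
  rewrite ler_pdivlMr// -(mul w) ncM ler_wpM2l ?nc_ge0//.
move=> e e0; have d0 : 0 < e * m ^+ 3 by rewrite mulr_gt0// exprn_gt0.
exists (e * m ^+ 3) => // w wz.
have w0 : sqrt_right w + s != 0 by rewrite -nc_gt0; exact: lt_le_trans (sm w).
have -> : sqrt_right w - s - (2 * s)^-1 * (w - z) = - (sqrt_right w - s) ^+ 2 / (2 * s).
  rewrite -(mul w); field; exact: sn0.
rewrite ncM ncN ncX ncV ncM.
have n2 : nc (2 : R[i]) = 2 by rewrite -[2]/(2%:R) -(rmorph_nat (real_complex R)) nc_real ger0_norm.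
have ms : m <= nc s by apply: le_trans (Re_le_nc _); exact: ler_norm.
rewrite n2 ler_pdivrMr; last by rewrite mulr_gt0//; exact: lt_le_trans ms.
apply: (@le_trans _ _ ((nc (w - z) / m) ^+ 2)).
  by rewrite ler_sqr ?nnegrE ?nc_ge0// divr_ge0 ?nc_ge0 ?ltW.
rewrite expr_div_n ler_pdivrMr ?exprn_gt0// expr2.
apply: (@le_trans _ _ (nc (w - z) * (e * m ^+ 3))); first by rewrite ler_wpM2l ?nc_ge0// ltW.
have -> : nc (w - z) * (e * m ^+ 3) = e * nc (w - z) * (m ^+ 2) * m by ring.
have -> : e * nc (w - z) * (2 * nc s) * m ^+ 2 = e * nc (w - z) * m ^+ 2 * (2 * nc s) by ring.
by rewrite ler_wpM2l; [|by rewrite !mulr_ge0 ?nc_ge0 ?exprn_ge0 ?ltW|lra].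
Qed.

(** Dividing by f z0 brings the values near 1, where [sqrt_right] is differentiable. *)
Lemma hol_sqrt f z0 r : 0 < r -> hol_ball f z0 r -> f z0 != 0 ->
  exists h r', [/\ 0 < r', hol_ball h z0 r', r' <= r & forall w, nc (w - z0) < r' -> h w ^+ 2 = f w /\ h w != 0].
Proof.
move=> r0 hf f0.
have [L dL] : exists L, cdiff f z0 L by apply: hf; rewrite subrr nc0.
have cq : {for z0, continuous (fun w => f w / f z0)}.
  exact: cdiff_cts (cdiffM dL (cdiff_cst _ _)).
have /cvg_cplxP/(_ (1/2) ltac:(lra))/cplx_nbhsP[d d0 hd] := cq.
pose h w := sqrt_right (f w / f z0) * sqrtc (f z0).
have pos w : nc (w - z0) < d -> 0 < complex.Re (f w / f z0).
  move=> /hd; rewrite divff// => hw; have := Re_le_nc (f w / f z0 - 1).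
  by rewrite ReB /= ler_norml; lra.
exists h, (Num.min d r); split.
- by rewrite lt_min d0.
- move=> w; rewrite lt_min => /andP[wd wr]; have [M dM] := hf w wr.
  have dq : cdiff (fun w => f w / f z0) w (f w * 0 + (f z0)^-1 * M) by exact: cdiffM dM (cdiff_cst _ _).
  eexists; apply: cdiffM; last exact: cdiff_cst.
  exact: cdiff_comp dq (cdiff_sqrt_right (pos w wd)).
- by rewrite ge_min lexx orbT.
- move=> w; rewrite lt_min => /andP[wd wr].
  have e : h w ^+ 2 = f w by rewrite /h exprMn sqrt_rightE sqr_sqrtc divfK.
  split => //; rewrite /h mulf_eq0 sqrtc_eq0 negb_or f0 andbT.
  by apply/eqP => e0; have := sqrt_right_gt0 (pos w wd); rewrite e0 ltxx.
Qed.

End HolomorphicLocal.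

(** * Cauchy integrals and isolated zeros *)

Section IsolatedZeros.
Context {R : realType}.
Implicit Types (f g : Cplx R -> Cplx R) (z w : Cplx R).

Lemma cvg_cmul (T : Type) (F : set_system T) (FF : Filter F) (f g : T -> Cplx R) (z w : Cplx R) :
  f @ F --> z -> g @ F --> w -> (fun t => f t * g t) @ F --> (z * w : Cplx R).
Proof.
move=> fz gw.
have c1 : (fun t => complex.Re (f t) : R) @ F --> complex.Re z by apply: (cvg_comp _ _ fz); exact: continuous_Re.
have c2 : (fun t => complex.Im (f t) : R) @ F --> complex.Im z by apply: (cvg_comp _ _ fz); exact: continuous_Im.
have c3 : (fun t => complex.Re (g t) : R) @ F --> complex.Re w by apply: (cvg_comp _ _ gw); exact: continuous_Re.
have c4 : (fun t => complex.Im (g t) : R) @ F --> complex.Im w by apply: (cvg_comp _ _ gw); exact: continuous_Im.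
have reM (x y : R[i]) : complex.Re (x * y) = complex.Re x * complex.Re y - complex.Im x * complex.Im y :> R.
  by case: x => ? ?; case: y.
have imM (x y : R[i]) : complex.Im (x * y) = complex.Re x * complex.Im y + complex.Im x * complex.Re y :> R.
  by case: x => ? ?; case: y.
apply: cvg_ReIm.
  under eq_fun do rewrite reM.
  by rewrite reM; apply: (@cvgB R); apply: cvgM.
under eq_fun do rewrite imM.
by rewrite imM; apply: (@cvgD R); apply: cvgM.
Qed.

Lemma continuous_cmul (f g : R -> Cplx R) : continuous f -> continuous g ->
  continuous (fun t => f t * g t).
Proof. by move=> cf cg t; apply: cvg_cmul; [exact: cf|exact: cg]. Qed.

Lemma continuous_cinv (f : R -> Cplx R) : continuous f -> (forall t, f t != 0) ->
  continuous (fun t => (f t)^-1).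
Proof. by move=> cf f0 t; apply: (continuous_comp (cf t)); exact: cdiff_cts (cdiffV (f0 t)). Qed.

Lemma lcontM f g a b c d : lcont f a b c d -> lcont g a b c d ->
  lcont (fun w => f w * g w) a b c d.
Proof.
move=> [f1 f2 f3 f4] [g1 g2 g3 g4]; split.
- exact: (@continuous_cmul (f \o hseg c) (g \o hseg c)).
- exact: (@continuous_cmul (f \o hseg d) (g \o hseg d)).
- exact: (@continuous_cmul (f \o vseg a) (g \o vseg a)).
- exact: (@continuous_cmul (f \o vseg b) (g \o vseg b)).
Qed.

Lemma lcontZ (k : Cplx R) f a b c d : lcont f a b c d -> lcont (fun w => k * f w) a b c d.
Proof.
move=> [f1 f2 f3 f4]; split.
- exact: (@continuous_cscale R k (f \o hseg c)).
- exact: (@continuous_cscale R k (f \o hseg d)).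
- exact: (@continuous_cscale R k (f \o vseg a)).
- exact: (@continuous_cscale R k (f \o vseg b)).
Qed.

Lemma lcontD f g a b c d : lcont f a b c d -> lcont g a b c d ->
  lcont (fun w => f w + g w) a b c d.
Proof.
move=> [f1 f2 f3 f4] [g1 g2 g3 g4]; split=> t.
- exact: (@continuousD _ (Cplx R) _ (f \o hseg c) (g \o hseg c) t (f1 t) (g1 t)).
- exact: (@continuousD _ (Cplx R) _ (f \o hseg d) (g \o hseg d) t (f2 t) (g2 t)).
- exact: (@continuousD _ (Cplx R) _ (f \o vseg a) (g \o vseg a) t (f3 t) (g3 t)).
- exact: (@continuousD _ (Cplx R) _ (f \o vseg b) (g \o vseg b) t (f4 t) (g4 t)).
Qed.

Lemma cdiff_subr (z w : Cplx R) : cdiff (fun w => w - z) w 1.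
Proof. by rewrite -[1]addr0; apply: cdiffD; [exact: cdiff_id|exact: cdiff_cst]. Qed.

Lemma lcont_inv z a b c d : a < complex.Re z < b -> c < complex.Im z < d ->
  lcont (fun w => (w - z)^-1) a b c d.
Proof.
move=> hx hy; have cz : continuous (fun w : Cplx R => w - z) by move=> w; exact: cdiff_cts (cdiff_subr z w).
split; apply: continuous_cinv.
- exact: (@continuous_hseg R _ c cz).
- by move=> t; apply/eqP => /(congr1 (@complex.Im R)); rewrite ImB /=; lra.
- exact: (@continuous_hseg R _ d cz).
- by move=> t; apply/eqP => /(congr1 (@complex.Im R)); rewrite ImB /=; lra.
- exact: (@continuous_vseg R _ a cz).
- by move=> t; apply/eqP => /(congr1 (@complex.Re R)); rewrite ReB /=; lra.
- exact: (@continuous_vseg R _ b cz).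
- by move=> t; apply/eqP => /(congr1 (@complex.Re R)); rewrite ReB /=; lra.
Qed.

Lemma lcontX f n a b c d : lcont f a b c d -> lcont (fun w => f w ^+ n) a b c d.
Proof.
move=> cf; elim: n => [|n IH].
  by apply: continuous_lcont => w; exact: cst_continuous.
have -> : (fun w => f w ^+ n.+1) = (fun w => f w * f w ^+ n) by apply/funext => w; rewrite exprS.
exact: lcontM.
Qed.

Variables (z0 : Cplx R) (s : R).
Hypothesis s0 : 0 < s.
Let a := complex.Re z0 - s. Let b := complex.Re z0 + s.
Let c := complex.Im z0 - s. Let d := complex.Im z0 + s.

Lemma rboundary_dist w : rboundary a b c d w -> s <= nc (w - z0).
Proof.
have h1 := Re_le_nc (w - z0); have h2 := Im_le_nc (w - z0); rewrite ReB in h1; rewrite ImB in h2.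
have n1 := ler_norm (complex.Re w - complex.Re z0); have n2 := ler_norm (complex.Re z0 - complex.Re w).
have n3 := ler_norm (complex.Im w - complex.Im z0); have n4 := ler_norm (complex.Im z0 - complex.Im w).
rewrite distrC in n2; rewrite distrC in n4.
by rewrite /rboundary /a /b /c /d; case=> -[_ []] e; lra.
Qed.

Lemma rboundary_dist2 w z : rboundary a b c d w -> nc (z - z0) <= s / 2 -> s / 2 <= nc (w - z).
Proof. by have s1 := s0; move=> /rboundary_dist h hz; have := nc_triangle w z z0; lra. Qed.

Lemma inside z : nc (z - z0) <= s / 2 -> a < complex.Re z < b /\ c < complex.Im z < d.
Proof.
have s1 := s0; move=> h; have h1 := Re_le_nc (z - z0); have h2 := Im_le_nc (z - z0); rewrite ReB in h1; rewrite ImB in h2.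
rewrite /a /b /c /d; have : `|complex.Re z - complex.Re z0| <= s / 2 by lra.
by have : `|complex.Im z - complex.Im z0| <= s / 2 by [lra]; rewrite !ler_norml; lra.
Qed.

(** At z = z0 this is a Taylor coefficient up to the winding factor, at other z the remainder of
    order n. *)
Definition cauchy_int g n z := rint (fun w => g w * (w - z0)^-1 ^+ n * (w - z)^-1) a b c d.

Lemma cauchy_lcont g n z : continuous g -> nc (z - z0) <= s / 2 ->
  lcont (fun w => g w * (w - z0)^-1 ^+ n * (w - z)^-1) a b c d.
Proof.
move=> cg hz; have hz0 : nc (z0 - z0) <= s / 2 by rewrite subrr nc0 divr_ge0 ?ltW.
have [h1 h2] := inside hz; have [h3 h4] := inside hz0.
apply: lcontM; last exact: lcont_inv.
apply: lcontM; first exact: continuous_lcont.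
by apply: lcontX; exact: lcont_inv.
Qed.

(** Integrates the identity 1/(w - z) = 1/(w - z0) + (z - z0)/((w - z0)(w - z)). *)
Lemma cauchy_int_step g n z : continuous g -> nc (z - z0) <= s / 2 ->
  cauchy_int g n z = cauchy_int g n z0 + (z - z0) * cauchy_int g n.+1 z.
Proof.
have s1 := s0; move=> cg hz; have hz0 : nc (z0 - z0) <= s / 2 by rewrite subrr nc0 divr_ge0 ?ltW.
have l1 := cauchy_lcont n cg hz0; have l2 := cauchy_lcont n.+1 cg hz; have l3 := cauchy_lcont n cg hz.
have l4 : lcont (fun w => (z - z0) * (g w * (w - z0)^-1 ^+ n.+1 * (w - z)^-1)) a b c d.
  exact: lcontZ.
rewrite /cauchy_int -(rintZ (z - z0) l2) -(rintD l1 l4).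
apply: (rint_eq l3 (lcontD l1 l4)) => w hw; have w0 : w - z0 != 0 by rewrite -nc_gt0; exact: lt_le_trans (rboundary_dist hw).
have wz : w - z != 0 by rewrite -nc_gt0; apply: lt_le_trans (rboundary_dist2 hw hz); lra.
rewrite exprS; set X := (w - z0)^-1 ^+ n; field.
by rewrite wz w0.
Qed.

Lemma cauchy_int_bound g n z M : continuous g -> nc (z - z0) <= s / 2 -> 0 <= M ->
  (forall w, rboundary a b c d w -> nc (g w) <= M) ->
  nc (cauchy_int g n z) <= 32 * M / s ^+ n.
Proof.
have s1 := s0; move=> cg hz M0 gM; apply: le_trans (rint_bound (M := M / s ^+ n * (s / 2)^-1) (cauchy_lcont n cg hz) _) _.
  move=> w hw; rewrite !ncM ncX !ncV.
  have h1 := rboundary_dist hw; have h2 := rboundary_dist2 hw hz.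
  have s20 : 0 < s / 2 by lra.
  apply: ler_pM; rewrite ?mulr_ge0 ?exprn_ge0 ?invr_ge0 ?nc_ge0//.
    apply: ler_pM; rewrite ?exprn_ge0 ?invr_ge0 ?nc_ge0//; first exact: gM.
    rewrite -exprVn; apply: lerXn2r; rewrite ?nnegrE ?invr_ge0 ?nc_ge0 ?(ltW s0)//.
    by rewrite lef_pV2 ?posrE//; exact: lt_le_trans h1.
  by rewrite lef_pV2 ?posrE//; exact: lt_le_trans h2.
have -> : `|b - a| = 2 * s by rewrite /a /b ger0_norm; lra.
have -> : `|d - c| = 2 * s by rewrite /c /d ger0_norm; lra.
rewrite le_eqVlt; apply/orP; left; apply/eqP; field.
by rewrite expf_neq0 ?gt_eqF.
Qed.

(** Each side contributes at least 1 to the imaginary part: the integrand there is s / (x^2 + s^2)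
    with |x| <= s, hence at least 1 / (2 s), on a length 2 s. *)
Lemma cauchy_winding : cauchy_int (fun=> 1) 0 z0 != 0.
Proof.
have s1 := s0; have hz0 : nc (z0 - z0) <= s / 2 by rewrite subrr nc0 divr_ge0 ?ltW.
have c1 : continuous (fun _ : Cplx R => 1 : Cplx R) by move=> w; exact: cst_continuous.
have [l1 l2 l3 l4] := cauchy_lcont 0 c1 hz0.
suff : 0 < complex.Im (cauchy_int (fun=> 1) 0 z0) by apply: contraTneq => ->; rewrite ltxx.
set q := fun w : Cplx R => _ in l1 l2 l3 l4.
have -> : complex.Im (cauchy_int (fun=> 1) 0 z0) =
   cint (fun t => complex.Im (q (hseg c t))) a b - cint (fun t => complex.Im (q (hseg d t))) a b +
   (cint (fun t => complex.Re (q (vseg b t))) c d - cint (fun t => complex.Re (q (vseg a t))) c d).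
  by rewrite /cauchy_int /rint -/q ImD ImB /= mul0r mul1r add0r.
have ab : a <= b by rewrite /a /b; lra. have cd : c <= d by rewrite /c /d; lra.
have key (x y : R) : - s <= x <= s -> y ^+ 2 = s ^+ 2 -> (2 * s)^-1 <= s / (x ^+ 2 + y ^+ 2).
  move=> hx ->; have x2 : x ^+ 2 <= s ^+ 2 by rewrite -real_normK ?num_real// ler_sqr ?nnegrE ?(ltW s1)// ler_norml.
  have d0 : 0 < x ^+ 2 + s ^+ 2 by rewrite ltr_wpDl ?sqr_ge0// exprn_gt0.
  rewrite ler_pdivlMr// mulrC ler_pdivrMr ?mulr_gt0//; rewrite expr2 in x2 *; nra.
have qE w : q w = (w - z0)^-1 by rewrite /q expr0 !mul1r.
have qI w : complex.Im (q w) = - (complex.Im w - complex.Im z0) /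
    ((complex.Re w - complex.Re z0) ^+ 2 + (complex.Im w - complex.Im z0) ^+ 2).
  by rewrite qE; case: (w) (z0) => ? ? [? ?] /=; rewrite mulNr.
have qR w : complex.Re (q w) = (complex.Re w - complex.Re z0) /
    ((complex.Im w - complex.Im z0) ^+ 2 + (complex.Re w - complex.Re z0) ^+ 2).
  by rewrite qE; case: (w) (z0) => ? ? [? ?] /=; rewrite [X in _ / X]addrC.
have I1 : (2 * s)^-1 * (b - a) <= cint (fun t => complex.Im (q (hseg c t))) a b.
  apply: cint_ge => //; first exact: (continuous_Im_comp l1).
  move=> t; rewrite qI /hseg /= /a /b /c => ht.
  rewrite (_ : complex.Im z0 - s - complex.Im z0 = - s); last ring.
  by rewrite opprK; apply: key; [lra|rewrite sqrrN].
have I2 : (2 * s)^-1 * (b - a) <= - cint (fun t => complex.Im (q (hseg d t))) a b.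
  have cI : continuous (fun t => complex.Im (q (hseg d t))) := continuous_Im_comp l2.
  rewrite -[X in _ <= X]mulN1r -[X in _ <= X](cintZ (-1) a b cI); apply: cint_ge => //; first exact: (continuous_scale (k := -1) cI).
  move=> t; rewrite qI /hseg /= /a /b /d => ht.
  rewrite (_ : complex.Im z0 + s - complex.Im z0 = s); last ring.
  by rewrite mulN1r mulNr opprK; apply: key; [lra|].
have I3 : (2 * s)^-1 * (d - c) <= cint (fun t => complex.Re (q (vseg b t))) c d.
  apply: cint_ge => //; first exact: (continuous_Re_comp l4).
  move=> t; rewrite qR /vseg /= /c /d /b => ht.
  rewrite (_ : complex.Re z0 + s - complex.Re z0 = s); last ring.
  by apply: key; [lra|].
have I4 : (2 * s)^-1 * (d - c) <= - cint (fun t => complex.Re (q (vseg a t))) c d.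
  have cI : continuous (fun t => complex.Re (q (vseg a t))) := continuous_Re_comp l3.
  rewrite -[X in _ <= X]mulN1r -[X in _ <= X](cintZ (-1) c d cI); apply: cint_ge => //; first exact: (continuous_scale (k := -1) cI).
  move=> t; rewrite qR /vseg /= /c /d /a => ht.
  rewrite (_ : complex.Re z0 - s - complex.Re z0 = - s); last ring.
  by rewrite mulN1r mulNr opprK; apply: key; [lra|rewrite sqrrN].
have p1 : 0 < (2 * s)^-1 * (b - a) by rewrite mulr_gt0 ?invr_gt0 ?mulr_gt0// /a /b; lra.
have p2 : 0 < (2 * s)^-1 * (d - c) by rewrite mulr_gt0 ?invr_gt0 ?mulr_gt0// /c /d; lra.
lra.
Qed.

(** The difference quotient of g at z, completed by the derivative, is continuous, and
    differentiable off z; [removable_goursat] makes its integral vanish. *)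
Lemma cauchy_formula g z : continuous g -> (forall w, in_square z0 s w -> exists L, cdiff g w L) ->
  nc (z - z0) <= s / 2 -> cauchy_int g 0 z = g z * cauchy_int (fun=> 1) 0 z.
Proof.
have s1 := s0; move=> cg dg hz; have [hx hy] := inside hz.
have insq x y : a <= x <= b -> c <= y <= d -> in_square z0 s (x +i* y).
  by rewrite /in_square /a /b /c /d /= !ler_norml; split; lra.
have [L dL] : exists L, cdiff g z L.
  have := dg _ (insq _ _ (ltac:(lra) : a <= complex.Re z <= b) (ltac:(lra) : c <= complex.Im z <= d)).
  by have -> : complex.Re z +i* complex.Im z = z by case: (z).
pose G w := if w == z then L else (g w - g z) * (w - z)^-1.
have dG w L' : w != z -> cdiff g w L' -> exists M, cdiff G w M.
  move=> wz dw; have wz0 : w - z != 0 by rewrite subr_eq0.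
  have h1 : cdiff (fun w => g w - g z) w (L' + 0) by apply: cdiffD => //; exact: cdiff_cst.
  have h2 := cdiff_comp (cdiff_subr z w) (cdiffV wz0).
  eexists; apply: (cdiff_local (cdiffM h1 h2)).
  exists (nc (w - z)); first by rewrite nc_gt0.
  move=> w' h; rewrite /G; case: eqP => // e; move: h; rewrite e ncB ltxx//.
have cG : continuous G.
  move=> w; have [->|wz] := eqVneq w z.
    apply: cplx_cts_eps => e e0; have [dl dl0 h] := dL _ (ltac:(lra) : 0 < e / 2).
    exists dl => // w' ww; rewrite /G eqxx; case: eqP => [_|/eqP wz]; first by rewrite subrr nc0.
    have wz0 : w' - z != 0 by rewrite subr_eq0.
    have -> : (g w' - g z) * (w' - z)^-1 - L = (g w' - g z - L * (w' - z)) * (w' - z)^-1 by field.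
    rewrite ncM ncV ltr_pdivrMr ?nc_gt0//; apply: le_lt_trans (h _ ww) _.
    by rewrite ltr_pM2r ?nc_gt0//; lra.
  have wz0 : w - z != 0 by rewrite subr_eq0.
  have e0 : 0 < nc (w - z) by rewrite nc_gt0.
  have cH : {for w, continuous (fun w' : Cplx R => (g w' - g z) * (w' - z)^-1)}.
    apply: cvg_cmul; [exact: nbhs_filter| |exact: (cdiff_cts (cdiff_comp (cdiff_subr z w) (cdiffV wz0)))].
    exact: (@continuousB _ (Cplx R) _ g (cst (g z)) w (cg w) (@cst_continuous _ _ (g z) w)).
  apply: cplx_cts_eps => e1 e10.
  have /cvg_cplxP/(_ e1 e10)/cplx_nbhsP[dl dl0 h] := cH.
  exists (Num.min dl (nc (w - z))); first by rewrite lt_min dl0.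
  move=> w'; rewrite lt_min => /andP[/h h1 h2]; rewrite /G (negPf wz).
  by case: eqP => // e; move: h2; rewrite e ncB ltxx.
have rG : rint G a b c d = 0.
  apply: (@removable_goursat _ G a b c d (complex.Re z) (complex.Im z)) => // x y h1 h2 ne.
  have [L' dL'] := dg _ (insq x y h1 h2); apply: (dG _ L') => //.
  by apply/eqP => e; apply: ne; rewrite e; case: (z).
have c1 : continuous (fun _ : Cplx R => 1 : Cplx R) by move=> w; exact: cst_continuous.
have l1 := cauchy_lcont 0 cg hz; have l2 := cauchy_lcont 0 c1 hz.
have lm : lcont (fun w => (- g z) * (1 * (w - z0)^-1 ^+ 0 * (w - z)^-1)) a b c d.
  exact: lcontZ.
apply/eqP; rewrite -subr_eq0 -mulNr /cauchy_int -(rintZ (- g z) l2) -(rintD l1 lm) -rG; apply/eqP.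
apply: (rint_eq (lcontD l1 lm) (continuous_lcont _ _ _ _ cG)) => w hw.
have wz : w - z != 0 by rewrite -nc_gt0; apply: lt_le_trans (rboundary_dist2 hw hz); lra.
by rewrite /G -subr_eq0 (negPf wz) !expr0; ring.
Qed.

End IsolatedZeros.

Section IsolatedZerosThm.
Context {R : realType}.
Implicit Types (f g : Cplx R -> Cplx R) (z w : Cplx R).

(* The coefficients of the expansion of f at z0 are, up to the nonzero factor
   [cauchy_int 1 0], the integrals [cauchy_int f n z0]. *)
Lemma hol_zeros f z0 r : 0 < r -> hol_ball f z0 r ->
  (exists2 e : R, 0 < e & forall w, nc (w - z0) < e -> f w = 0) \/
  (exists2 e : R, 0 < e & forall w, nc (w - z0) < e -> w <> z0 -> f w <> 0).
Proof.
move=> r0 hf; have [g cg [gf dg]] := hol_localize r0 hf.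
have s0 : 0 < r / 4 by rewrite divr_gt0.
move: (r / 4) s0 gf dg => s s0 gf dg.
pose Phi n z := cauchy_int z0 s g n z.
have c1 : continuous (fun _ : Cplx R => 1 : Cplx R) by move=> w; exact: cst_continuous.
have hz0 : nc (z0 - z0) <= s / 2 by rewrite subrr nc0 divr_ge0 ?ltW.
have [M M0 gM] : exists2 M : R, 0 <= M & forall w, in_square z0 s w -> nc (g w) <= M.
  have [M hM] : exists M : R, forall x y : R, `|x| <= s -> `|y| <= s -> nc (g (z0 + (x +i* y))) <= M.
    pose k (p : R * R) := nc (g (z0 + (p.1 +i* p.2))) : R.
    have ck : continuous k.
      move=> p A /nbhs_ballP[e /= e0 eA].
      have /cvg_cplxP/(_ e e0)/cplx_nbhsP[dl dl0 h] := cg (z0 + (p.1 +i* p.2)).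
      have dl2 : 0 < dl / 2 by lra.
      exists ([set x : R | `|p.1 - x| < dl / 2], [set x : R | `|p.2 - x| < dl / 2]) => /=.
        by split; apply/nbhs_ballP; exists (dl / 2).
      move=> p' [/= t1 t2]; apply: eA; rewrite -ball_normE /=.
      have hh : nc (g (z0 + (p'.1 +i* p'.2)) - g (z0 + (p.1 +i* p.2))) < e.
        apply: h; apply: le_lt_trans (nc_le_ReIm _) _.
        rewrite opprD addrACA subrr add0r ReB ImB /=.
        by rewrite distrC in t1; rewrite distrC in t2; lra.
      rewrite /k; have := nc_triangle (g (z0 + (p'.1 +i* p'.2))) (g (z0 + (p.1 +i* p.2))) 0.
      have := nc_triangle (g (z0 + (p.1 +i* p.2))) (g (z0 + (p'.1 +i* p'.2))) 0.
      by rewrite !subr0 ncB in hh *; rewrite ltr_norml; lra.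
    have cc : compact (`[- s, s] `*` `[- s, s] : set (R * R)) by apply: compact_setX; exact: segment_compact.
    have /compact_bounded[M [_ hM]] := continuous_compact (continuous_subspaceT ck) cc.
    exists (M + 1) => x y hx hy; rewrite -[leLHS]ger0_norm ?nc_ge0//.
    apply: (hM (M + 1)); first by rewrite ltrDl.
    by exists (x, y) => //=; rewrite !in_itv/= -!ler_norml.
  exists (Num.max M 0); first by rewrite le_max lexx orbT.
  move=> w [h1 h2]; rewrite le_max; apply/orP; left.
  have -> : w = z0 + ((complex.Re w - complex.Re z0) +i* (complex.Im w - complex.Im z0)).
    by apply: complex_eq; rewrite ?ReD ?ImD /=; ring.
  exact: hM.
have bM w : rboundary (complex.Re z0 - s) (complex.Re z0 + s) (complex.Im z0 - s) (complex.Im z0 + s) w -> nc (g w) <= M.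
  move=> hw; apply: gM; rewrite /in_square !ler_norml.
  by move: hw; rewrite /rboundary /btw => -[] [/orP[] h1 [] ->]; clear - h1 s0; split; lra.
have PhiB n z : nc (z - z0) <= s / 2 -> nc (Phi n z) <= 32 * M / s ^+ n.
  by move=> hz; exact: cauchy_int_bound.
(* The step identity shows that the winding integral at z differs from its value at z0 by at most |z
   - z0| (32 / s), so it is nonzero near z0. *)
have [e1 e10 W0] : exists2 e1 : R, 0 < e1 & forall z, nc (z - z0) < e1 -> cauchy_int z0 s (fun=> 1) 0 z != 0.
  have W00 := cauchy_winding z0 s0; set W := cauchy_int _ _ _ _ in W00 *.
  have B z : nc (z - z0) <= s / 2 -> nc (W z - W z0) <= nc (z - z0) * (32 / s).
    move=> hz; rewrite [W z](cauchy_int_step _ _ c1 hz)// addrC addKr ncM ler_wpM2l ?nc_ge0//.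
    have := @cauchy_int_bound R z0 s s0 (fun=> 1) 1 z 1 c1 hz ler01.
    by rewrite mulr1 expr1; apply => w _; rewrite nc1.
  have k0 : 0 < nc (W z0) / (32 / s) by rewrite !divr_gt0 ?nc_gt0.
  exists (Num.min (s / 2) (nc (W z0) / (32 / s))); first by rewrite lt_min k0 andbT divr_gt0.
  move=> z; rewrite lt_min => /andP[h1]; rewrite ltr_pdivlMr ?divr_gt0// => h2.
  apply/eqP => e; have := B z (ltW h1); rewrite e sub0r ncN; lra.
have form z : nc (z - z0) <= s / 2 -> Phi 0%N z = g z * cauchy_int z0 s (fun=> 1) 0 z.
  by move=> hz; apply: cauchy_formula => // w /dg[L []]; exists L.
have expand n z : nc (z - z0) <= s / 2 -> (forall m, (m < n)%N -> Phi m z0 = 0) ->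
    Phi 0%N z = (z - z0) ^+ n * Phi n z.
  move=> hz; elim: n => [|n IH] h0; first by rewrite expr0 mul1r.
  rewrite IH; last by move=> m mn; apply: h0; rewrite ltnS ltnW.
  by rewrite {1}/Phi cauchy_int_step// -/(Phi n z0) h0// add0r exprSr mulrA.
have fg z : nc (z - z0) <= s -> f z = g z by move=> h; rewrite gf//; exact: ball_in_square.
(* If all coefficients vanish, the bounds on the remainders of every order force g = 0 near z0;
   otherwise the first nonzero coefficient dominates the remainder near z0. *)
have [allz|nz] := pselect (forall n, Phi n z0 = 0); last first.
  right; have exn : exists n, Phi n z0 != 0.
    apply: contrapT => h; apply: nz => n; apply/eqP/negPn/negP => hn; apply: h; exists n; exact: hn.
  have [n Pn Pm] : exists2 n, Phi n z0 != 0 & forall m, (m < n)%N -> Phi m z0 = 0.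
    case: (ex_minnP exn) => m hm mmin; exists m => // k km.
    by apply/eqP/negPn/negP => /mmin; rewrite leqNgt km.
  have K0 : 0 < 32 * M / s ^+ n.+1 + 1 by rewrite ltr_wpDl// divr_ge0 ?exprn_ge0 ?mulr_ge0// ltW.
  have k0 : 0 < nc (Phi n z0) / (32 * M / s ^+ n.+1 + 1) by rewrite divr_gt0 ?nc_gt0.
  exists (Num.min (s / 2) (nc (Phi n z0) / (32 * M / s ^+ n.+1 + 1))); first by rewrite lt_min k0 andbT divr_gt0.
  move=> z; rewrite lt_min => /andP[h1 h2] zz0 fz; rewrite ltr_pdivlMr// in h2.
  have hz := ltW h1.
  have s1 := s0; have := expand n z hz Pm; rewrite form// -fg ?fz ?mul0r; last by clear -hz s1; lra.
  move/esym/eqP; rewrite mulf_eq0 expf_eq0 subr_eq0 => /orP[/andP[_ /eqP//]|/eqP e].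
  have := @cauchy_int_step R z0 s s0 g n z cg hz; rewrite -/(Phi n z) e -/(Phi n z0) -/(Phi n.+1 z) => e'.
  have e2 : Phi n z0 = - ((z - z0) * Phi n.+1 z) by apply/eqP; rewrite -addr_eq0 -e'.
  move: h2; rewrite e2 ncN ncM; have := PhiB n.+1 z hz; have := nc_ge0 (z - z0).
  move=> q1 q2 q3; have := ler_wpM2l q1 q2; move: q3 q1; clear; rewrite mulrDr mulr1; lra.
left; exists (Num.min (s / 2) e1); first by rewrite lt_min e10 divr_gt0.
move=> z; rewrite lt_min => /andP[h1 h2]; have hz := ltW h1.
have P0 : Phi 0%N z = 0.
  apply/eqP; rewrite -nc_eq0 eq_le nc_ge0 andbT; apply/ler_addgt0Pl => e e0; rewrite addr0.
  have [n hn] := half_pow_lt (mulr_ge0 (ler0n R 32) M0) e0.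
  rewrite (expand n z hz)//; apply: le_trans (ltW hn).
  rewrite ncM ncX; apply: (@le_trans _ _ ((s / 2) ^+ n * (32 * M / s ^+ n))).
    by apply: ler_pM; rewrite ?exprn_ge0 ?nc_ge0//; [apply: lerXn2r; rewrite ?nnegrE ?nc_ge0 ?divr_ge0 ?ltW|exact: PhiB].
  rewrite expr_div_n le_eqVlt; apply/orP; left; apply/eqP; field.
  by rewrite !expf_neq0 ?gt_eqF.
move: P0; rewrite form// => /eqP; rewrite mulf_eq0 (negPf (W0 z h2)) orbF => /eqP gz.
by rewrite fg//; lra.
Qed.

End IsolatedZerosThm.

(** * Regularity of maps of finite energy with a flat Hopf differential *)

Section Stieltjes.
Context {R : realType}.
Implicit Types (f g h : R -> R).

Section Cumul.
Variables (f : R -> R) (nd : {homo f : x y / x <= y}) (rc : right_continuous f).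
(** Carrying the two properties as arguments lets the [isCumulative] instance be inferred for any
    such f. *)
Definition cumul of {homo f : x y / x <= y} & right_continuous f := f.
HB.instance Definition _ := isCumulative.Build R _ R (cumul nd rc) nd rc.
Definition stieltjes : {measure set (measurableTypeR R) -> \bar R} :=
  lebesgue_stieltjes_measure (cumul nd rc : cumulative R R).

Lemma stieltjes_itv (x y : R) : x <= y -> stieltjes `]x, y]%classic = (f y - f x)%:E.
Proof.
move=> xy; rewrite /stieltjes /= /lebesgue_stieltjes_measure/= /measure_extension.
rewrite measurable_mu_extE; last exact: is_ocitv.
exact: (@wlength_itv_bnd _ (cumul nd rc) x y false false xy).
Qed.

Lemma stieltjes_unique (mu : {measure set (measurableTypeR R) -> \bar R}) :
  (forall x y : R, x <= y -> mu `]x, y]%classic = (f y - f x)%:E) ->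
  forall A, measurable A -> stieltjes A = mu A.
Proof.
move=> h A mA; apply: lebesgue_stieltjes_measure_unique => // X /ocitvP[->|[[x y] /= xy ->]].
  by rewrite !measure0.
by rewrite -/stieltjes h ?ltW//; exact: (stieltjes_itv (ltW xy)).
Qed.
End Cumul.

Lemma stieltjesD f g h nf rf ng rg nh rh : (forall x, h x = f x + g x) ->
  forall A, measurable A ->
  @stieltjes h nh rh A = (@stieltjes f nf rf A + @stieltjes g ng rg A)%E.
Proof.
move=> hE A mA; rewrite -measure_addE; apply: stieltjes_unique => // x y xy.
by rewrite [LHS]measure_addE !stieltjes_itv// -EFinD !hE; congr (_%:E); ring.
Qed.

Lemma stieltjesZ f h (r : {nonneg R}) nf rf nh rh : (forall x, h x = r%:num * f x) ->
  forall A, measurable A ->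
  @stieltjes h nh rh A = (r%:num%:E * @stieltjes f nf rf A)%E.
Proof.
move=> hE A mA; rewrite -[RHS]/(mscale r (stieltjes nf rf) A).
apply: stieltjes_unique => // x y xy.
transitivity (r%:num%:E * stieltjes nf rf `]x, y]%classic)%E; first by [].
by rewrite stieltjes_itv// -EFinM !hE; congr (_%:E); ring.
Qed.

Lemma stieltjes_id nd rc A : measurable A ->
  @stieltjes id nd rc A = @lebesgue_measure R A.
Proof.
move=> mA; apply: stieltjes_unique => // x y xy.
rewrite [LHS](@lebesgue_measure_itv R (Interval (BRight x) (BRight y)))/= lte_fin EFinB.
by case: ltP => // yx; rewrite (le_anti (_ : y <= x <= y)) ?subee// yx xy.
Qed.

Opaque stieltjes.

Lemma right_continuousD f g : right_continuous f -> right_continuous g ->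
  right_continuous (fun x => f x + g x).
Proof. by move=> rf rg x; apply: (@cvgD R); [exact: rf|exact: rg]. Qed.

Lemma right_continuousZ f (r : R) : right_continuous f -> right_continuous (fun x => r * f x).
Proof. by move=> rf x; apply: (@cvgMr R); exact: rf. Qed.

Section AbsolutelyContinuous.
Variables (k W : R -> R) (a b : R).
Hypothesis ab : a < b.
Hypothesis kc : continuous k.
Hypothesis Wnd : {homo W : x y / x <= y}.
Hypothesis Wrc : right_continuous W.
Hypothesis kW : forall l x y, 0 < l -> x <= y -> 2 * `|k y - k x| <= l * (y - x) + (W y - W x) / l.

(** [kW] for all l amounts to |k y - k x|^2 <= (y - x)(W y - W x). In this linearized form it says
    that [B s l] is nondecreasing for s = 1 and s = -1, so that the signed measure of 2 k is a
    difference of the positive measures of [B 1 l] and [A l]. *)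
Let A l x := l * x + l^-1 * W x.
Let B s l x := l * x + l^-1 * W x + s * (2 * k x).

Let idnd : {homo (@id R) : x y / x <= y}. Proof. by []. Qed.
Let idrc : right_continuous (@id R). Proof. by apply: right_continuousW => x; exact: cvg_id. Qed.
Let Arc l : right_continuous (A l).
Proof. by apply: right_continuousD; apply: right_continuousZ. Qed.
Let And l : 0 < l -> {homo A l : x y / x <= y}.
Proof.
move=> l0 x y xy; rewrite /A lerD// ler_wpM2l ?(ltW l0)//; last exact: Wnd.
by rewrite invr_ge0 ltW.
Qed.
Let Brc s l : right_continuous (B s l).
Proof.
apply: right_continuousD; first exact: Arc.
by do 2! apply: right_continuousZ; exact: right_continuousW.
Qed.
Let Bnd s l : `|s| = 1 -> 0 < l -> {homo B s l : x y / x <= y}.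
Proof.
move=> s1 l0 x y xy; rewrite -subr_ge0 /B.
have := kW l0 xy; have : - `|k y - k x| <= s * (k y - k x).
  by have := ler_norm (- (s * (k y - k x))); rewrite normrN normrM s1 mul1r; lra.
set z := s * (k y - k x); rewrite (mulrC (W y - W x)) => h1 h2.
have -> : l * y + l^-1 * W y + s * (2 * k y) - (l * x + l^-1 * W x + s * (2 * k x)) =
  l * (y - x) + l^-1 * (W y - W x) + 2 * z by rewrite /z; ring.
lra.
Qed.

Let n1 : `|1 : R| = 1. Proof. exact: normr1. Qed.
Let nN1 : `|- 1 : R| = 1. Proof. by rewrite normrN1. Qed.
Let w := stieltjes Wnd Wrc.
Let mu l (l0 : 0 < l) := stieltjes (And l0) (@Arc l).
Let p l (l0 : 0 < l) := stieltjes (Bnd n1 l0) (@Brc 1 l).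
Let m l (l0 : 0 < l) := stieltjes (Bnd nN1 l0) (@Brc (-1) l).
Let D : set (measurableTypeR R) := `]a, b]%classic.
Let mD : measurable D. Proof. exact: measurable_itv. Qed.

Let muE l (l0 : 0 < l) E : measurable E ->
  mu l0 E = (l%:E * @lebesgue_measure R E + l^-1%:E * w E)%E.
Proof.
move=> mE; have l1 : 0 <= l^-1 by rewrite invr_ge0 ltW.
have nd1 : {homo (fun x => l * x) : x y / x <= y} by move=> x y xy; rewrite ler_wpM2l ?(ltW l0).
have nd2 : {homo (fun x => l^-1 * W x) : x y / x <= y} by move=> x y xy; rewrite ler_wpM2l//; exact: Wnd.
rewrite /mu (stieltjesD nd1 (right_continuousZ (r := l) idrc) nd2 (right_continuousZ (r := l^-1) Wrc))//.
rewrite (@stieltjesZ id (fun x => l * x) (NngNum (ltW l0)) idnd idrc)// stieltjes_id//.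
by rewrite (@stieltjesZ W (fun x => l^-1 * W x) (NngNum l1) Wnd Wrc).
Qed.

Let pmE l (l0 : 0 < l) E : measurable E -> (p l0 E + m l0 E = mu l0 E + mu l0 E)%E.
Proof.
move=> mE; have nd2 : {homo (fun x => A l x + A l x) : x y / x <= y}.
  by move=> x y xy; rewrite lerD// And.
have rc2 := right_continuousD (@Arc l) (@Arc l).
transitivity (stieltjes nd2 rc2 E); last exact: stieltjesD.
by apply/esym/stieltjesD => // x; rewrite /A /B; ring.
Qed.

Let pE s (s1 : `|s| = 1) l (l0 : 0 < l) E : measurable E ->
  (stieltjes (Bnd s1 l0) (@Brc s l) E + mu ltr01 E = stieltjes (Bnd s1 ltr01) (@Brc s 1) E + mu l0 E)%E.
Proof.
move=> mE; have nd2 : {homo (fun x => B s l x + A 1 x) : x y / x <= y}.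
  by move=> x y xy; rewrite lerD// ?And// Bnd.
have rc2 := right_continuousD (@Brc s l) (@Arc 1).
transitivity (stieltjes nd2 rc2 E); first exact/esym/stieltjesD.
by apply: stieltjesD => // x; rewrite /A /B; ring.
Qed.

Let fin (f : R -> R) nd rc E : measurable E -> E `<=` D ->
  exists2 r : R, 0 <= r & @stieltjes f nd rc E = r%:E.
Proof.
move=> mE ED; have fE : @stieltjes f nd rc E \is a fin_num.
  rewrite ge0_fin_numE ?measure_ge0//; apply: le_lt_trans (le_measure _ _ _ ED) _; rewrite ?inE//.
  by rewrite [X in (X < _)%E](stieltjes_itv nd rc (ltW ab)) ltry.
by exists (fine (stieltjes nd rc E)); rewrite ?fineK// fine_ge0// measure_ge0.
Qed.

Let mu_null l (l0 : 0 < l) E r : measurable E -> @lebesgue_measure R E = 0%E -> w E = r%:E ->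
  mu l0 E = (l^-1 * r)%:E.
Proof. by move=> mE E0 wE; rewrite (muE l0 mE) E0 wE mule0 add0e -EFinM. Qed.

(* Letting l tend to infinity, the positive measures with distribution
   functions B s l bound the singular part of W below by itself. *)
Let singular s (s1 : `|s| = 1) E x y : measurable E -> E `<=` D -> @lebesgue_measure R E = 0%E ->
  w E = x%:E -> stieltjes (Bnd s1 ltr01) (@Brc s 1) E = y%:E -> 0 <= x -> x <= y.
Proof.
move=> mE ED E0 wx By x0; apply/ler_addgt0Pl => e e0.
have l0 : 0 < (x + 1) / e by rewrite divr_gt0// ltr_wpDl.
have [z z0 zE] := fin (Bnd s1 l0) (@Brc s ((x + 1) / e)) mE ED.
have := pE s1 l0 mE; rewrite (mu_null l0 mE E0 wx) (mu_null ltr01 mE E0 wx) By zE.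
rewrite -!EFinD => -[]; rewrite invr1 mul1r invfM invrK.
have : (x + 1)^-1 * e * x <= e.
  by rewrite mulrAC -[leRHS]mul1r ler_wpM2r ?(ltW e0)// mulrC ler_pdivrMr ?ltr_wpDl// mul1r; lra.
lra.
Qed.

(** On a null set, [singular] bounds both measures [B] from below by that of W, and by [pmE] they
    add up to twice the latter. Both are equal to it: the measure of 2 k has no singular part. *)
Let kap_null E : measurable E -> E `<=` D -> @lebesgue_measure R E = 0%E ->
  (p ltr01 E - mu ltr01 E = 0)%E.
Proof.
move=> mE ED E0; have [x x0 xE] := fin Wnd Wrc mE ED.
have [y y0 yE] := fin (Bnd n1 ltr01) (@Brc 1 1) mE ED.
have [z z0 zE] := fin (Bnd nN1 ltr01) (@Brc (-1) 1) mE ED.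
have h1 := singular mE ED E0 xE yE x0; have h2 := singular mE ED E0 xE zE x0.
have := pmE ltr01 mE; have := mu_null ltr01 mE E0 xE; rewrite invr1 mul1r => ->.
have -> : p ltr01 E = y%:E by []. have -> : m ltr01 E = z%:E by [].
move=> h; have h3 : y + z = x + x by move: h; rewrite -!EFinD => -[].
by rewrite (_ : y = x) ?subee//; lra.
Qed.

Hypothesis kd : forall y L, a < y < b -> is_derive y 1 k L -> L = 0.

(** By Radon-Nikodym, 2 k is the integral of a density; k has half this density as derivative almost
    everywhere, and [kd] makes it vanish. *)
Lemma ac_constant x : a < x < b -> k x = k a.
Proof.
move=> axb; have ab' := ab.
have pD : (p ltr01 D < +oo)%E by have [r _ rE] := fin (Bnd n1 ltr01) (@Brc 1 1) mD (@subset_refl _ D); rewrite /p rE ltry.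
have uD : (mu ltr01 D < +oo)%E by have [r _ rE] := fin (And ltr01) (@Arc 1) mD (@subset_refl _ D); rewrite /mu rE ltry.
pose q1 := charge_of_finite_measure (mfrestr mD pD).
pose q2 := charge_of_finite_measure (mfrestr mD uD).
pose nu : {charge set (measurableTypeR R) -> \bar R} := cadd q1 (copp q2).
have nuE E : nu E = (p ltr01 (E `&` D) - mu ltr01 (E `&` D))%E by [].
pose leb : {sigma_finite_measure set (measurableTypeR R) -> \bar R} := @lebesgue_measure R.
have nul : nu `<< leb.
  apply/null_content_dominatesP => E mE E0; rewrite nuE; apply: kap_null.
  - exact: measurableI.
  - exact: subIsetr.
  - by apply: (subset_measure0 _ _ (@subIsetl _ E D)) => //; exact: measurableI.
pose f := Radon_Nikodym nu leb.
have ff y : f y \is a fin_num by exact: Radon_Nikodym_fin_num.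
have fi : leb.-integrable setT f by exact: Radon_Nikodym_integrable.
pose g y := fine (f y).
have gE : EFin \o g = f by apply/funext => y /=; rewrite fineK.
have gi E : measurable E -> leb.-integrable E (EFin \o g).
  by move=> mE; rewrite gE; exact: (integrableS measurableT).
pose F y := (\int[leb]_(t in [set` Interval (BRight a) (BRight y)]) g t)%R.
have FE y : a <= y <= b -> F y = 2 * (k y - k a).
  move=> /andP[ay yb]; rewrite /F /Rintegral (_ : \int[leb]_(t in _) _ = nu `]a, y]%classic)%E; last first.
    by rewrite (Radon_Nikodym_integral nul)//; apply: eq_integral => t _; rewrite -/f /g fineK.
  rewrite nuE (_ : `]a, y]%classic `&` D = `]a, y]%classic); last first.
    by apply/setIidl => t; rewrite /D/= !in_itv/= => /andP[-> /le_trans->].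
  rewrite /p /mu !stieltjes_itv//= /A /B; ring.
have lg : locally_integrable [set: R] g.
  split; [|exact: openT|].
    by have /measurable_int := fi; rewrite -gE => /measurable_EFinP.
  move=> K _ cK; have mK : measurable K by exact: compact_measurable.
  by have /integrableP[_] := gi K mK.
have := @FTC1 R g (BRight a) (fun y => gi _ (measurable_itv _)) lg.
move=> /= H.
have ae0 : {ae leb, forall t, (`]a, x]%classic t -> g t = 0)}.
  apply: (negligibleS _ H) => /= t0 nt; move: (t0 : R) nt => {t0} t nt Ht; apply: nt; rewrite /= in_itv/= => /andP[at_ tx].
  have [dF gt] : derivable F t 1 /\ derive1 F t = g t by apply: Ht; rewrite lte_fin.
  have /andP[ax xb] := axb.
  have tb : t < b by exact: le_lt_trans xb.
  have dk : is_derive t 1 (fun y => 2^-1 * F y + k a) (2^-1 * g t).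
    have := is_deriveD (is_deriveZ 2^-1 (DeriveDef dF (erefl _))) (is_derive_cst (k a) t 1).
    by rewrite addr0 -derive1E gt.
  have e0 : 0 < Num.min (t - a) (b - t) by rewrite lt_min !subr_gt0 at_.
  suff /kd : is_derive t 1 k (2^-1 * g t) by rewrite at_ tb => /(_ isT)/eqP; rewrite mulf_eq0 invr_eq0 pnatr_eq0/= => /eqP.
  apply: (is_derive_local dk); exists (Num.min (t - a) (b - t)) => // z.
  rewrite lt_min !ltr_norml => zt; rewrite FE; last by lra.
  by rewrite mulKf ?pnatr_eq0//; ring.
have /andP[ax xb] := axb.
have := FE x (_ : a <= x <= b); rewrite (ltW ax) (ltW xb) => /(_ isT).
rewrite /F /Rintegral (_ : \int[leb]_(t in _) _ = 0)%E /=; last first.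
  rewrite (ae_eq_integral (cst 0%E))//; first exact: integral0.
  - by have /measurable_int := gi _ (measurable_itv (Interval (BRight a) (BRight x))).
  - by apply: (negligibleS _ ae0) => t /= nt h; apply: nt => /h /= ->.
by move=> /esym/eqP; rewrite mulf_eq0 pnatr_eq0/= subr_eq0 => /eqP.
Qed.
End AbsolutelyContinuous.
End Stieltjes.

(** * From quadratic increments to a Stieltjes bound *)

Section Increments.
Context {R : realType}.
Implicit Types (k f : R -> R).

Lemma clamp_mono (c r x y : R) : 0 <= r -> x <= y -> clamp c r x <= clamp c r y.
Proof. by move=> r0 xy; rewrite /clamp; do !case: ifPn; rewrite -?leNgt; lra. Qed.

Lemma clamp_le (c r x y : R) : 0 <= r -> x <= y -> clamp c r y - clamp c r x <= y - x.
Proof. by move=> r0 xy; rewrite /clamp; do !case: ifPn; rewrite -?leNgt; lra. Qed.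

Lemma clamp_continuous (c r : R) : 0 <= r -> continuous (clamp c r).
Proof.
move=> r0 x A /nbhs_ballP[e /= e0 eA]; apply/nbhs_ballP; exists e => //= y.
rewrite -ball_normE /= => xy; apply: eA; rewrite -ball_normE /=.
exact: le_lt_trans (clamp_lip _ _ _ r0) xy.
Qed.

Lemma continuous_translate f (e : R) : continuous f -> continuous (fun y => f (y + e)).
Proof.
move=> cf y; apply: continuous_comp; last exact: cf.
by apply: continuousD; [exact: cvg_id|exact: cst_continuous].
Qed.

Lemma continuous_mulr f g : continuous f -> continuous g -> continuous (fun y => f y * g y).
Proof. by move=> cf cg y; apply: continuousM; [exact: cf|exact: cg]. Qed.

Lemma continuous_addr f g : continuous f -> continuous g -> continuous (fun y => f y + g y).
Proof. by move=> cf cg y; apply: continuousD; [exact: cf|exact: cg]. Qed.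

Lemma continuous_subr f g : continuous f -> continuous g -> continuous (fun y => f y - g y).
Proof. by move=> cf cg y; apply: continuousB; [exact: cf|exact: cg]. Qed.

Lemma continuous_const (c : R) : continuous (fun _ : R => c).
Proof. by move=> y; exact: cst_continuous. Qed.

Lemma continuous_sqr f : continuous f -> continuous (fun y => f y ^+ 2).
Proof. by move=> cf; under eq_fun do rewrite expr2; exact: continuous_mulr. Qed.

Lemma cint_le f g a b : continuous f -> continuous g -> a <= b ->
  (forall t, a <= t <= b -> f t <= g t) -> cint f a b <= cint g a b.
Proof.
move=> cf cg ab fg; have cN := continuous_scale (k := -1) cf.
rewrite -subr_ge0 -[X in _ + X]mulN1r -cintZ// -cintD//.
rewrite -[X in X <= _](mul0r (b - a)); apply: cint_ge => //.
  exact: continuous_addr.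
by move=> t /fg; lra.
Qed.

Lemma cint_cst (c a b : R) : cint (fun=> c) a b = c * (b - a).
Proof.
wlog ab : a b / a <= b.
  move=> H; have [/H//|/ltW/H h] := leP a b; rewrite cintC h; ring.
have dc : forall t : R, a <= t <= b -> is_derive t 1 (fun t => c * t) c.
  move=> t _; apply/is_derive_epsP => e e0; exists 1 => // s _.
  by rewrite (_ : c * s - c * t - c * (s - t) = 0) ?normr0 ?mulr_ge0 ?(ltW e0)//; ring.
rewrite (cint_FTC (@continuous_const c) ab dc); ring.
Qed.

Definition sq_incr k (e y : R) := cint (fun t => (k t - k y) ^+ 2) (y + e / 4) (y + e / 2).

Lemma is_derive_cts f (df : R -> R) : (forall t : R, is_derive t 1 f (df t)) -> continuous f.
Proof. by move=> h t; apply: differentiable_continuous; apply/derivable1_diffP; exact: (@ex_derive _ _ _ _ _ _ _ (h t)). Qed.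

Lemma prim_cts f : continuous f -> continuous (prim f).
Proof. by move=> cf; exact: is_derive_cts (primP cf). Qed.

Lemma sq_incrE k e y : continuous k -> sq_incr k e y =
  (prim (fun t => k t ^+ 2) (y + e / 2) - prim (fun t => k t ^+ 2) (y + e / 4)) +
  ((- (2 * k y)) * (prim k (y + e / 2) - prim k (y + e / 4)) + k y ^+ 2 * (e / 4)).
Proof.
move=> ck; rewrite /sq_incr -!/(cint _ _ _).
have c2 := continuous_sqr ck.
have -> : (fun t => (k t - k y) ^+ 2) = (fun t => k t ^+ 2 + ((- (2 * k y)) * k t + k y ^+ 2)).
  by apply/funext => t; ring.
have c3 : continuous (fun t => - (2 * k y) * k t) by exact: continuous_scale.
have c3' := c3; have c4 : continuous (fun _ : R => k y ^+ 2) by exact: continuous_const.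
rewrite cintD//; last exact: continuous_addr.
by rewrite cintD// cintZ// cint_cst; congr (_ + (_ + _ * _)); lra.
Qed.

Lemma sq_incr_cts k e : continuous k -> continuous (sq_incr k e).
Proof.
move=> ck; have -> : sq_incr k e = fun y => (prim (fun t => k t ^+ 2) (y + e / 2) - prim (fun t => k t ^+ 2) (y + e / 4)) +
  ((- (2 * k y)) * (prim k (y + e / 2) - prim k (y + e / 4)) + k y ^+ 2 * (e / 4)).
  by apply/funext => y; exact: sq_incrE.
have cp := prim_cts ck; have cp2 := prim_cts (continuous_sqr ck).
apply: continuous_addr; first by apply: continuous_subr; exact: continuous_translate.
apply: continuous_addr; apply: continuous_mulr; last exact: continuous_const.
- have -> : (fun y => - (2 * k y)) = (fun y => -2 * k y) by apply/funext => y; ring.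
  exact: continuous_scale.
- by apply: continuous_subr; exact: continuous_translate.
- exact: continuous_sqr.
Qed.

Lemma sq_incr_ge0 k e y : continuous k -> 0 <= e -> 0 <= sq_incr k e y.
Proof.
move=> ck e0; have h : y + e / 4 <= y + e / 2 by lra.
rewrite -(mul0r (y + e / 2 - (y + e / 4))); apply: cint_ge => //.
  by apply: continuous_sqr; apply: continuous_subr => //; exact: continuous_const.
by move=> t _; exact: sqr_ge0.
Qed.

Lemma sq_incrN k e y : sq_incr (fun t => - k t) e y = sq_incr k e y.
Proof. by congr (cint _ _ _); apply/funext => t; rewrite -opprD sqrrN. Qed.

Lemma is_derive_shift f (t s v : R) : is_derive (t + s) 1 f v -> is_derive t 1 (fun u => f (u + s)) v.
Proof.
move=> /is_derive_epsP H; apply/is_derive_epsP => e e0; have [dl dl0 h] := H e e0.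
exists dl => // u ut; have := h (u + s); rewrite (_ : u + s - (t + s) = u - t); last ring.
exact.
Qed.

(** From D^2 >= 2 m e D - (m e)^2, valid for every m, one gets a lower bound linear in k. Integrated
    over [x, y], it involves k only near the two ends, up to the oscillation w; steps at least e/4
    over a range e/4 give 2 m e (e/4)^2 = m e^3 / 8. *)
Lemma sq_incr_lower k m e x y w : continuous k -> 0 < m -> 0 < e -> x <= y ->
  (forall t, 0 <= t <= e -> `|k (x + t) - k x| <= w /\ `|k (y + t) - k y| <= w) ->
  2 * w <= k y - k x ->
  e ^+ 3 * (m * (k y - k x - 2 * w) / 8 - m ^+ 2 * (y - x) / 4) <= cint (sq_incr k e) x y.
Proof.
move=> ck m0 e0 xy hw Dw; pose K := prim k; pose K2 := prim K.
have cK : continuous K by exact: prim_cts.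
have dK (t : R) : is_derive t 1 K (k t) by exact: primP.
have dK2 (t : R) : is_derive t 1 K2 (K t) by exact: primP.
pose psi s := (2 * (m * e)) * ((K (s + e / 2) - K (s + e / 4)) + - (e / 4) * k s) + - ((m * e) ^+ 2 * (e / 4)).
have c1 : continuous (fun s => K (s + e / 2) - K (s + e / 4)) by apply: continuous_subr; exact: continuous_translate.
have c2 : continuous (fun s => - (e / 4) * k s) by exact: continuous_scale.
have c3 : continuous (fun s => (K (s + e / 2) - K (s + e / 4)) + - (e / 4) * k s) by exact: continuous_addr.
have c4 := continuous_scale (k := 2 * (m * e)) c3.
have c5 : continuous (fun _ : R => - ((m * e) ^+ 2 * (e / 4))) by exact: continuous_const.
have cpsi : continuous psi by exact: continuous_addr.
have lower (s : R) : psi s <= sq_incr k e s.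
  have -> : psi s = cint (fun t => (2 * (m * e)) * k t + (- (2 * (m * e) * k s) - (m * e) ^+ 2)) (s + e / 4) (s + e / 2).
    rewrite cintD//; [|exact: continuous_scale|exact: continuous_const].
    by rewrite cintZ// cint_cst /psi /cint -/K; field.
  apply: cint_le; [| |lra|].
  - by apply: continuous_addr; [exact: continuous_scale|exact: continuous_const].
  - by apply: continuous_sqr; apply: continuous_subr => //; exact: continuous_const.
  - move=> t _; have := sqr_ge0 (k t - k s - m * e); rewrite !expr2; lra.
apply: (@le_trans _ _ (cint psi x y)); last by apply: cint_le => //; exact: sq_incr_cts.
have -> : cint psi x y = 2 * (m * e) * ((K2 (y + e / 2) - K2 (x + e / 2)) - (K2 (y + e / 4) - K2 (x + e / 4)) - e / 4 * (K y - K x))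
    - (m * e) ^+ 2 * (e / 4) * (y - x).
  rewrite /psi cintD// cintZ// cintD// cintZ// cint_cst.
  have dd : forall t : R, x <= t <= y -> is_derive t 1 (fun s => K2 (s + e / 2) - K2 (s + e / 4)) (K (t + e / 2) - K (t + e / 4)).
    by move=> t _; apply: is_deriveB; apply: is_derive_shift; exact: dK2.
  by rewrite (cint_FTC c1 xy dd) /cint -/K; field.
pose G (t : R) := (K2 (t + y) - K2 (t + x)) + - (K y - K x) * t.
pose dG (t : R) := (K (t + y) - K (t + x)) - (K y - K x).
have GdG (t : R) : is_derive t 1 G (dG t).
  apply: is_deriveD; first by apply: is_deriveB; exact: is_derive_shift.
  by have := is_deriveZ (- (K y - K x)) (is_derive_id t 1); rewrite /GRing.scale /= mulr1.
have dGlow (t : R) : e / 4 <= t <= e / 2 -> e / 4 * (k y - k x - 2 * w) <= dG t.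
  move=> ht; have t0 : 0 <= t by lra.
  have l1 : (k y - w) * (y + t - y) <= K (y + t) - K y.
    have yt : y <= y + t by lra.
    apply: (derive_mono yt (fun s _ => dK s)) => s hs.
    have [_] := hw (s - y) (ltac:(lra)); rewrite (_ : y + (s - y) = s); last ring.
    by rewrite ler_norml; lra.
  have l2 : (- k x - w) * (x + t - x) <= - K (x + t) - - K x.
    have xt : x <= x + t by lra.
    have dN (s : R) : is_derive s 1 (fun s => - K s) (- k s) by apply: is_deriveN.
    apply: (derive_mono xt (fun s _ => dN s)) => s hs.
    have [+ _] := hw (s - x) (ltac:(lra)); rewrite (_ : x + (s - x) = s); last ring.
    by rewrite ler_norml; lra.
  rewrite (addrC y) addrK in l1; rewrite (addrC x) addrK in l2.
  have : e / 4 * (k y - k x - 2 * w) <= t * (k y - k x - 2 * w) by apply: ler_wpM2r; lra.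
  rewrite /dG; lra.
have := derive_mono (_ : e / 4 <= e / 2) (fun t _ => GdG t) dGlow.
move=> /(_ (ltac:(lra))) h.
have h2 := ler_wpM2l (_ : 0 <= 2 * (m * e)) h; have me : 0 <= 2 * (m * e) by rewrite !mulr_ge0// ltW.
have {}h2 := h2 me; rewrite /G in h2.
rewrite !(addrC _ (e / _)).
apply: le_trans (le_trans _ (lerB h2 (lexx ((m * e) ^+ 2 * (e / 4) * (y - x))))) _.
  by rewrite le_eqVlt; apply/orP; left; apply/eqP; field.
by rewrite le_eqVlt; apply/orP; left; apply/eqP; field.
Qed.

Variables (k : R -> R) (c r M e0 : R).
Hypothesis kc : continuous k.
Hypothesis r0 : 0 < r.
Hypothesis e00 : 0 < e0.
Hypothesis kM : forall e, 0 < e -> e < e0 -> cint (sq_incr k e) (c - r) (c + r) <= M * e ^+ 3.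

(** [sup (ub x)] is the lower limit, as e tends to 0, of e^-3 times the integral of [sq_incr k e]
    over [c - r, x]. Lower limits being superadditive, its increments dominate the lower limits over
    the intermediate intervals. *)
Let ub (x : R) := [set v : R | exists2 e1, 0 < e1 & forall e, 0 < e -> e < e1 ->
   v * e ^+ 3 <= cint (sq_incr k e) (c - r) x].
Let W x := sup (ub (clamp c r x)).

Let mono (e x y : R) : 0 < e -> x <= y -> 0 <= cint (sq_incr k e) x y.
Proof.
move=> e1 xy; rewrite -(mul0r (y - x)); apply: cint_ge => //; first exact: sq_incr_cts.
by move=> t _; apply: sq_incr_ge0 => //; exact: ltW.
Qed.

Let ub_has (x : R) : c - r <= x <= c + r -> has_sup (ub x).
Proof.
move=> /andP[x1 x2]; split.
  by exists 0; exists 1 => // e e1 _; rewrite mul0r; exact: mono.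
exists M => v [e1 e10 h]; pose e := Num.min e0 e1 / 2.
have [f1 f2 f3] : [/\ 0 < e, e < e0 & e < e1].
  have m0 : 0 < Num.min e0 e1 by rewrite lt_min e00.
  have : Num.min e0 e1 <= e0 by rewrite ge_min lexx.
  have : Num.min e0 e1 <= e1 by rewrite ge_min lexx orbT.
  by rewrite /e; move: m0; move: (Num.min e0 e1) => z *; split; lra.
have e3 : 0 < e ^+ 3 by rewrite exprn_gt0.
rewrite -(ler_pM2r e3); apply: le_trans (h e f1 f3) _; apply: le_trans (kM f1 f2).
by rewrite (cint_chasles _ (c - r) x (c + r)) lerDl mono.
Qed.

Let W_step (x y v : R) : c - r <= x -> x <= y -> y <= c + r ->
  (exists2 e1, 0 < e1 & forall e, 0 < e -> e < e1 -> v * e ^+ 3 <= cint (sq_incr k e) x y) ->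
  v <= sup (ub y) - sup (ub x).
Proof.
move=> x1 xy y2 [e1 e10 h].
have hx : c - r <= x <= c + r by rewrite x1 (le_trans xy).
have hy : c - r <= y <= c + r by rewrite y2 (le_trans x1).
have [nx _] := ub_has hx.
rewrite lerBrDr addrC -lerBrDr; apply: ge_sup => // w [e2 e20 hw].
rewrite lerBrDr; apply: ub_le_sup; first by have [] := ub_has hy.
exists (Num.min e1 e2); first by rewrite lt_min e10.
move=> e f0; rewrite lt_min => /andP[f1 f2]; rewrite (cint_chasles _ (c - r) x y) mulrDl.
by rewrite lerD// ?h ?hw.
Qed.

Let cts_bound (x w : R) : 0 < w -> exists2 e1, 0 < e1 & forall t, 0 <= t <= e1 -> `|k (x + t) - k x| <= w.
Proof.
move=> w0; move/cvgrPdist_lt: (kc (x := x)) => /(_ _ w0)/nbhs_ballP[e /= e1 h].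
exists (e / 2); first by rewrite divr_gt0.
move=> t /andP[t1 t2]; have := h (x + t); rewrite /= -ball_normE /= distrC => hh; apply/ltW; rewrite distrC.
by apply: hh; rewrite (_ : x + t - x = t) ?ger0_norm//; [lra|ring].
Qed.

Let W_incr (x y m : R) : 0 < m -> x <= y -> c - r <= x -> y <= c + r ->
  m * `|k y - k x| / 8 - m ^+ 2 * (y - x) / 4 <= sup (ub y) - sup (ub x).
Proof.
move=> m0 xy x1 y2; have Wp : 0 <= sup (ub y) - sup (ub x).
  by apply: W_step => //; exists 1 => // e e1 _; rewrite mul0r mono.
have [->|kxy] := eqVneq (k y) (k x).
  apply: le_trans Wp; rewrite subrr normr0 mulr0 mul0r sub0r oppr_le0 !mulr_ge0// ?exprn_ge0 ?invr_ge0 ?subr_ge0// ltW//.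
have D0 : 0 < `|k y - k x| by rewrite normr_gt0 subr_eq0.
apply/ler_addgt0Pl => d d0; rewrite -lerBlDl.
(* w <= |k y - k x| / 2 meets the hypothesis of [sq_incr_lower], and w <= 4 d / m makes the loss m w
   / 4 at most d. *)
pose w := Num.min (`|k y - k x| / 2) (4 * d / m).
have w0 : 0 < w by rewrite lt_min !divr_gt0// mulr_gt0.
have w1 : 2 * w <= `|k y - k x|.
  by have : w <= `|k y - k x| / 2 by [rewrite ge_min lexx]; lra.
have w2 : m * w / 4 <= d.
  have : w <= 4 * d / m by rewrite ge_min lexx orbT.
  by rewrite ler_pdivlMr//; lra.
have [e1 e10 h1] := cts_bound x w0; have [e2 e20 h2] := cts_bound y w0.
have le1 : m * (`|k y - k x| - 2 * w) / 8 - m ^+ 2 * (y - x) / 4 <= sup (ub y) - sup (ub x).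
  apply: W_step => //; exists (Num.min e1 e2); first by rewrite lt_min e10.
  move=> e f0; rewrite lt_min => /andP[f1 f2]; rewrite mulrC.
  have hw t : 0 <= t <= e -> `|k (x + t) - k x| <= w /\ `|k (y + t) - k y| <= w.
    by move=> ht; split; [apply: h1|apply: h2]; lra.
  have [pos|neg] := lerP 0 (k y - k x).
    by rewrite ger0_norm// in w1 *; exact: sq_incr_lower.
  rewrite ltr0_norm// in w1 *.
  have cN : continuous (fun t => - k t) by have := continuous_scale (k := -1) kc; under eq_fun do rewrite mulN1r.
  have -> : - (k y - k x) = - k y - - k x by ring.
  have -> : cint (sq_incr k e) x y = cint (sq_incr (fun t => - k t) e) x y.
    by congr (cint _ _ _); apply/funext => t; rewrite sq_incrN.
  apply: (@sq_incr_lower (fun t => - k t)) => //; last by lra.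
  by move=> t /hw[g1 g2]; rewrite -!opprD !normrN.
apply: le_trans le1; rewrite -subr_ge0.
rewrite (_ : _ - _ = d - m * w / 4); last by field.
by rewrite subr_ge0.
Qed.

Let W_nd : {homo W : x y / x <= y}.
Proof.
move=> x y xy; rewrite -subr_ge0 /W; have /andP[x1 _] := clamp_in c x (ltW r0); have /andP[_ y2] := clamp_in c y (ltW r0).
have cxy := clamp_mono c (ltW r0) xy.
by apply: W_step => //; exists 1 => // e e1 _; rewrite mul0r; exact: mono.
Qed.

Let kk x := k (clamp c r x).
Let kk_cts : continuous kk.
Proof. by move=> x; apply: continuous_comp; [exact: clamp_continuous (ltW r0) _|exact: kc]. Qed.

(** Right-continuous regularization of W, as required by Stieltjes measures; since k is continuous,
    the increment bound passes to it. *)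
Let Wr x := inf [set W y | y in [set y | x < y]].
Let Wr_has x : has_inf [set W y | y in [set y | x < y]].
Proof.
split; first by exists (W (x + 1)); exists (x + 1) => //=; rewrite ltrDl.
by exists (W x) => _ [y /= xy <-]; apply: W_nd; exact: ltW.
Qed.

Let Wr_le x y : x < y -> Wr x <= W y.
Proof. by move=> xy; apply: ge_inf; [by have [] := Wr_has x|exists y]. Qed.

Let Wr_nd : {homo Wr : x y / x <= y}.
Proof.
move=> x y xy; apply: lb_le_inf; first by have [] := Wr_has y.
by move=> _ [z /= yz <-]; apply: Wr_le; exact: le_lt_trans yz.
Qed.

Let Wr_approx x e : 0 < e -> exists2 y, x < y & forall z, x < z -> z <= y -> W z <= Wr x + e.
Proof.
move=> f0; have [_ [y /= xy <-] h] := inf_adherent f0 (Wr_has x).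
by exists y => // z xz zy; apply: le_trans (ltW h); apply: W_nd.
Qed.

Let Wr_rc : right_continuous Wr.
Proof.
move=> x; apply/cvgrPdist_le => e f0; have [y xy h] := Wr_approx x f0.
near=> z; have xz : x < z by near: z; exact: nbhs_right_gt.
have zy : z < y by near: z; exact: nbhs_right_lt.
have wz : Wr x <= Wr z by apply: Wr_nd; exact: ltW.
rewrite distrC ger0_norm ?subr_ge0// lerBlDl.
pose z2 := (z + y) / 2; have [zz2 z2y] : z < z2 /\ z2 <= y by rewrite /z2; split; lra.
by apply: le_trans (Wr_le zz2) _; apply: h => //; exact: lt_trans zz2.
Unshelve. all: by end_near. Qed.

Lemma increments_constant x :
  (forall y L, c - r < y < c + r -> is_derive y 1 k L -> L = 0) -> c - r < x < c + r -> k x = k (c - r).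
Proof.
move=> kd hx; have r1 := r0.
have cid y : c - r <= y <= c + r -> clamp c r y = y by exact: clamp_id.
have W64nd : {homo (fun x => 64 * Wr x) : x y / x <= y} by move=> y z yz; rewrite ler_wpM2l// Wr_nd.
have W64rc := right_continuousZ (r := 64) Wr_rc.
(* Taking m = l / 4 in [W_incr] and multiplying by 64 / l turns its left side into 2 |dk| - l dx:
   hence the weight 64. *)
have key0 (l y z : R) : 0 < l -> y <= z -> 2 * `|kk z - kk y| <= l * (z - y) + 64 * (W z - W y) / l.
  move=> l0 yz; have /andP[y1 _] := clamp_in c y (ltW r0); have /andP[_ z2] := clamp_in c z (ltW r0).
  have l4 : 0 < l / 4 by rewrite divr_gt0.
  have h1 := W_incr l4 (clamp_mono c (ltW r0) yz) y1 z2; have h2 := clamp_le c (ltW r0) yz.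
  have h3 := ler_wpM2l (ltW l0) h2.
  have l1 : 0 <= 64 / l by rewrite divr_ge0// ltW.
  have := ler_wpM2l l1 h1; rewrite -/(W z) -/(W y) -/(kk z) -/(kk y).
  rewrite (_ : 64 / l * _ = 2 * `|kk z - kk y| - l * (clamp c r z - clamp c r y)); last by field; rewrite gt_eqF.
  rewrite [X in _ <= X -> _]mulrAC; lra.
have key (l y z : R) : 0 < l -> y <= z -> 2 * `|kk z - kk y| <= l * (z - y) + (64 * Wr z - 64 * Wr y) / l.
  (* 68 = 64 + 4: the error d / 68 is spent 64 times on W and 4 times on k. *)
  move=> l0 yz; apply/ler_addgt0Pl => d d0; have d1 : 0 < d / 68 by rewrite divr_gt0.
  move/cvgrPdist_lt: (kk_cts (x := y)) => /(_ _ d1)/nbhs_ballP[e1 /= e10 h1].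
  move/cvgrPdist_lt: (kk_cts (x := z)) => /(_ _ d1)/nbhs_ballP[e2 /= e20 h2].
  have [z' zz' hz'] := Wr_approx z (mulr_gt0 l0 d1).
  pose n := Num.min (Num.min e1 e2) (z' - z).
  have n0 : 0 < n by rewrite !lt_min e10 e20 subr_gt0.
  have n1 : n <= e1 by rewrite !ge_min lexx.
  have n2 : n <= e2 by rewrite !ge_min lexx orbT.
  have n3 : n <= z' - z by rewrite !ge_min lexx orbT.
  move: n n0 n1 n2 n3 => n n0 n1 n2 n3.
  have g1 : `|kk y - kk (y + n / 2)| < d / 68.
    by apply: h1; rewrite /= -ball_normE /= (_ : y - (y + n / 2) = - (n / 2)) ?normrN ?ger0_norm//; [lra|lra|ring].
  have g2 : `|kk z - kk (z + n / 2)| < d / 68.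
    by apply: h2; rewrite /= -ball_normE /= (_ : z - (z + n / 2) = - (n / 2)) ?normrN ?ger0_norm//; [lra|lra|ring].
  have g3 : W (z + n / 2) <= Wr z + l * (d / 68) by apply: hz'; lra.
  have g4 : Wr y <= W (y + n / 2) by apply: Wr_le; lra.
  have yz' : y + n / 2 <= z + n / 2 by lra.
  have := key0 l _ _ l0 yz'; rewrite (_ : z + n / 2 - (y + n / 2) = z - y); last ring.
  have g5 : (W (z + n / 2) - W (y + n / 2)) / l <= (Wr z - Wr y) / l + d / 68.
    by rewrite ler_pdivrMr// mulrDl divfK ?gt_eqF//; lra.
  have := ler_distD (kk (z + n / 2)) (kk z) (kk y); have := ler_distD (kk (y + n / 2)) (kk (z + n / 2)) (kk y).
  rewrite (distrC (kk (y + n / 2)) (kk y)) -mulrA -mulrBr -mulrA; lra.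
have kkd y L : c - r < y < c + r -> is_derive y 1 kk L -> L = 0.
  move=> hy dk; apply: (kd y) => //; apply: (is_derive_local dk).
  exists (Num.min (y - (c - r)) (c + r - y)); first by rewrite lt_min; lra.
  by move=> t; rewrite lt_min !ltr_norml => ht; rewrite /kk cid//; lra.
have ab : c - r < c + r by lra.
have := ac_constant ab kk_cts W64nd W64rc key kkd hx.
by rewrite /kk !cid//; lra.
Qed.
End Increments.

(** * Planar integrals and the Korevaar-Schoen energy *)

Section PlanarIntegrals.
Context {R : realType}.
Local Notation leb := (@lebesgue_measure R).

(* No measurability is required: the integral of a nonnegative function is a
   supremum over the simple functions below it. *)
Lemma le_integral_sub d (T : measurableType d) (mu : {measure set T -> \bar R})
    (D D' : set T) (f g : T -> \bar R) : D `<=` D' ->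
  (forall x, D x -> 0 <= f x)%E -> (forall x, D x -> f x <= g x)%E ->
  (forall x, D' x -> 0 <= g x)%E ->
  (\int[mu]_(x in D) f x <= \int[mu]_(x in D') g x)%E.
Proof.
move=> DD' f0 fg g0; rewrite !ge0_integralE//; apply: le_ereal_sup => _ [h /= hf <-].
exists h => // x; apply: le_trans (hf x) _; rewrite !patchE.
case: ifPn => [/set_mem Dx|_]; first by rewrite ifT ?fg// inE; exact: DD'.
by case: ifPn => // /set_mem; exact: g0.
Qed.

Lemma posp_cts (f : R -> R) : continuous f -> continuous (fun t => Num.max (f t) 0).
Proof.
move=> cf t; have -> : (fun t : R => Num.max (f t) 0) = (fun t : R => 2^-1 * (f t + `|f t|)).
  by apply/funext => s; case: (leP (f s) 0) => h; [rewrite ler0_norm//|rewrite gtr0_norm//]; lra.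
apply: continuous_scale; apply: continuous_addr => // s.
by apply: cvg_norm; exact: cf.
Qed.

Lemma posp_integral (psi : R -> R) a b : continuous psi -> a <= b ->
  ((cint psi a b)%:E <= \int[leb]_(y in `[a, b]%classic) (Num.max (psi y) 0)%:E)%E.
Proof.
move=> cp; rewrite le_eqVlt => /orP[/eqP <-|ab].
  rewrite (_ : cint psi a a = 0) ?integral_ge0//; last by rewrite /cint subrr.
  by move=> y _; rewrite lee_fin le_max lexx orbT.
have cq := posp_cts cp; have dq := primP cq.
rewrite (@continuous_FTC2 R _ (prim (fun t => Num.max (psi t) 0)) a b ab).
- by rewrite -EFinB lee_fin; apply: cint_le => //; [exact: ltW|move=> t _; rewrite le_max lexx].
- by apply: continuous_subspaceT.
- have cP := prim_cts cq; split.
  + by move=> t _; exact: (@ex_derive _ _ _ _ _ _ _ (dq t)).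
  + by apply: cvg_at_right_filter; exact: cP.
  + by apply: cvg_at_left_filter; exact: cP.
- by move=> t _; rewrite derive1E; exact: (@derive_val _ _ _ _ _ _ _ (dq t)).
Qed.

(* [o] exchanges the roles of the two coordinates, so that estimates along
   horizontal and vertical lines are proved once. *)
Definition xo (o : bool) (p : @plane R) : R := if o then p.1 else p.2.
Definition yo (o : bool) (p : @plane R) : R := if o then p.2 else p.1.

Lemma plane_fubini o (f1 f2 : R -> R) : measurable_fun setT f1 -> measurable_fun setT f2 ->
  (forall x, 0 <= f1 x) -> (forall x, 0 <= f2 x) ->
  (\int[plane_measure]_p (f1 (xo o p) * f2 (yo o p))%:E =
   (\int[leb]_x (f1 x)%:E) * \int[leb]_y (f2 y)%:E)%E.
Proof.
move=> m1 m2 p1 p2.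
have mo : measurable_fun setT (xo o) by case: (o); [exact: measurable_fst|exact: measurable_snd].
have mo' : measurable_fun setT (yo o) by case: (o); [exact: measurable_snd|exact: measurable_fst].
have mf : measurable_fun setT (fun p : @plane R => (f1 (xo o p) * f2 (yo o p))%:E).
  by apply/measurable_EFinP; apply: measurable_funM; exact: measurableT_comp.
have f0 p : (0 <= (f1 (xo o p) * f2 (yo o p))%:E)%E by rewrite lee_fin mulr_ge0.
have i2 : (0 <= \int[leb]_y (f2 y)%:E)%E by apply: integral_ge0 => y _; rewrite lee_fin.
have inn x : (\int[leb]_y (f1 x * f2 y)%:E = (f1 x)%:E * \int[leb]_y (f2 y)%:E)%E.
  under eq_integral do rewrite EFinM.
  by rewrite ge0_integralZl//; try (exact/measurable_EFinP); try (by move=> y _; rewrite lee_fin); try by rewrite lee_fin.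
case: o mf f0 {mo mo'} => mf f0.
  rewrite fubini_tonelli1//= /fubini_F /xo /yo /=.
  under eq_integral => x _ do rewrite inn.
  rewrite ge0_integralZr//; [exact/measurable_EFinP|by move=> y _; rewrite lee_fin].
rewrite fubini_tonelli2//= /fubini_G /xo /yo /=.
under eq_integral => x _ do rewrite inn.
rewrite ge0_integralZr//; [exact/measurable_EFinP|by move=> y _; rewrite lee_fin].
Qed.

(** The positive part makes the integrand nonnegative, so that the integral can be compared with
    others through [le_integral_sub]. *)
Lemma strip_integral o (psi : R -> R) (x1 x2 a b : R) : continuous psi -> x1 <= x2 -> a <= b ->
  (((x2 - x1) * cint psi a b)%:E <=
   \int[plane_measure]_(p in [set p | (x1 <= xo o p <= x2)%R /\ (a <= yo o p <= b)%R])
     (Num.max (psi (yo o p)) 0)%:E)%E.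
Proof.
move=> cp x12 ab.
pose f1 := (\1_(`[x1, x2]%classic : set R) : R -> R).
pose f2 y := Num.max (psi y) 0 * (\1_(`[a, b]%classic : set R) y : R).
rewrite integral_mkcond.
have -> : (fun p => (Num.max (psi (yo o p)) 0)%:E) \_ [set p | x1 <= xo o p <= x2 /\ a <= yo o p <= b]
   = (fun p => (f1 (xo o p) * f2 (yo o p))%:E).
  apply/funext => p; rewrite patchE /f1 /f2 !indicE; case: ifPn => [/set_mem[/= h1 h2]|/negP h].
    by rewrite !mem_set//= ?in_itv//= mul1r mulr1.
  congr (_%:E); case: (boolP (xo o p \in _)) => [/set_mem h1|]; last by rewrite mul0r.
  case: (boolP (yo o p \in _)) => [/set_mem h2|]; last by rewrite mulr0 mulr0.
  by exfalso; apply: h; rewrite inE; move: h1 h2; rewrite /= !in_itv.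
have mf1 : measurable_fun setT f1 by exact: measurable_indic (measurable_itv _).
have mf2 : measurable_fun setT f2.
  have q1 : measurable_fun setT (fun y : measurableTypeR R => Num.max (psi y) 0 : R).
    exact: continuous_measurable_fun (posp_cts cp).
  have q2 : measurable_fun setT (\1_(`[a, b]%classic) : measurableTypeR R -> R).
    exact: measurable_indic (measurable_itv _).
  exact: (measurable_funM q1 q2).
have pf1 x : 0 <= f1 x by rewrite /f1 indicE.
have pf2 x : 0 <= f2 x by rewrite /f2 mulr_ge0// ?le_max ?lexx ?orbT// indicE.
rewrite (plane_fubini o mf1 mf2 pf1 pf2).
have -> : (\int[leb]_x (f1 x)%:E = (x2 - x1)%:E)%E.
  rewrite /f1 integral_indic// setIT [LHS](@lebesgue_measure_itv R (Interval (BLeft x1) (BRight x2)))/= lte_fin.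
  by case: ltP => // h; rewrite (le_anti (_ : x2 <= x1 <= x2)) ?subrr ?h.
have -> : (\int[leb]_x (f2 x)%:E = \int[leb]_(y in `[a, b]%classic) (Num.max (psi y) 0)%:E)%E.
  rewrite [RHS]integral_mkcond; apply: eq_integral => y _; rewrite /f2 patchE indicE.
  by case: ifPn => _; rewrite ?mulr1 ?mulr0.
by rewrite EFinM lee_wpmul2l ?lee_fin ?subr_ge0//; exact: posp_integral.
Qed.

Lemma square_compact (z0 : Cplx R) (s : R) : compact (in_square z0 s).
Proof.
have cc : continuous (fun p : R * R => p.1 +i* p.2 : Cplx R).
  move=> p A /cplx_nbhsP[e e0 eA]; have e2 : 0 < e / 2 by rewrite divr_gt0.
  exists (ball p.1 (e / 2), ball p.2 (e / 2)) => /=; first by split; apply/nbhs_ballP; exists (e / 2).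
  move=> p' [/= t1 t2]; apply: eA; apply: le_lt_trans (nc_le_ReIm _) _; rewrite ReB ImB /=.
  by move: t1 t2; rewrite -!ball_normE /= !(distrC (p.1)) !(distrC p.2); lra.
have := continuous_compact (continuous_subspaceT cc) (compact_setX (@segment_compact R (complex.Re z0 - s) (complex.Re z0 + s)) (@segment_compact R (complex.Im z0 - s) (complex.Im z0 + s))).
rewrite (_ : _ @` _ = in_square z0 s)//; apply/seteqP; split => [_ [p [/= h1 h2] <-]|z [h1 h2]].
  by move: h1 h2; rewrite !in_itv /= /in_square /= !ler_norml; split; lra.
exists (complex.Re z, complex.Im z); last by case: (z).
by move: h1 h2; rewrite /= !in_itv /= !ler_norml; split; lra.
Qed.

Variables (T : metricType R) (U : set (Cplx R)) (w : Cplx R -> T) (z0 : Cplx R) (r : R).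
Hypothesis r0 : 0 < r.
Hypothesis Usq : in_square z0 (2 * r) `<=` U.

Lemma cutoff_ex : exists2 phi, cutoff U phi & forall z, in_square z0 r z -> phi z = 1.
Proof.
pose bump (t : R) := Num.max (Num.min 1 (2 - r^-1 * `|t|)) 0.
have cb : continuous bump.
  apply: posp_cts; have -> : (fun t : R => Num.min 1 (2 - r^-1 * `|t|)) = (fun t : R => 1 - Num.max (r^-1 * `|t| - 1) 0).
    apply/funext => t; case: (leP 1 (2 - r^-1 * `|t|)) => h1; case: (leP (r^-1 * `|t| - 1) 0) => h2; lra.
  apply: continuous_subr; first exact: continuous_const.
  apply: posp_cts; apply: continuous_subr; last exact: continuous_const.
  by apply: continuous_scale => t; exact: norm_continuous.
have b01 t : 0 <= bump t <= 1 by rewrite /bump le_max lexx orbT ge_max ge_min lexx ler01.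
have b1 t : `|t| <= r -> bump t = 1.
  move=> tr; rewrite /bump; have : r^-1 * `|t| <= 1 by rewrite mulrC ler_pdivrMr// mul1r.
  by move=> h; rewrite min_l ?max_l//; lra.
have b0 t : 2 * r < `|t| -> bump t = 0.
  move=> tr; rewrite /bump; have : 2 < r^-1 * `|t| by rewrite mulrC ltr_pdivlMr.
  by move=> h; rewrite max_r// ge_min; apply/orP; right; lra.
exists (fun z => bump (complex.Re z - complex.Re z0) * bump (complex.Im z - complex.Im z0)); last first.
  by move=> z [h1 h2]; rewrite !b1// mulr1.
split.
- move=> z; have hb (c : R) : continuous (fun t : R => bump (t - c)) by exact: (@continuous_translate R bump (- c) cb).
  apply: (@continuousM R (Cplx R) (fun z => bump (complex.Re z - complex.Re z0)) (fun z => bump (complex.Im z - complex.Im z0))).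
    exact: (continuous_comp (@continuous_Re R z) (hb (complex.Re z0) _)).
  exact: (continuous_comp (@continuous_Im R z) (hb (complex.Im z0) _)).
- move=> z; have := b01 (complex.Re z - complex.Re z0); have := b01 (complex.Im z - complex.Im z0).
  by move=> /andP[h1 h2] /andP[h3 h4]; rewrite mulr_ge0//= -[X in _ <= X]mulr1 ler_pM.
- exists (in_square z0 (2 * r)); split => //; first exact: square_compact.
  move=> z nz; have [h1|/b0 ->] := leP `|complex.Re z - complex.Re z0| (2 * r); last by rewrite mul0r.
  have [h2|/b0 ->] := leP `|complex.Im z - complex.Im z0| (2 * r); last by rewrite mulr0.
  by exfalso; apply: nz.
Qed.

Hypothesis fin : (ks_energy U w < +oo)%E.

Lemma ks_bounded phi : cutoff U phi -> exists M e0, [/\ 0 <= M, 0 < e0 & forall e, 0 < e -> e < e0 ->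
  (\int[plane_measure]_(y in [set y | U (cplx_of y)]) ((phi (cplx_of y))%:E * ks_density U w e y) <= M%:E)%E].
Proof.
move=> cphi; have : (limf_esup (fun e : R => \int[plane_measure]_(y in [set y | U (cplx_of y)])
    ((phi (cplx_of y))%:E * ks_density U w e y)) 0^'+ < +oo)%E.
  by apply: le_lt_trans fin; apply: ereal_sup_ubound; exists phi.
rewrite limf_esupE; set F := fun e : R => (\int[_]_(_ in _) _)%E.
move=> /ereal_inf_lt[_ [V FV <-]] sV.
have /nbhs_ballP[e0 /= e00 h] := FV.
exists (Num.max (fine (ereal_sup [set F e | e in V])) 0), e0; split => //; first by rewrite le_max lexx orbT.
move=> e e1 e2; have Ve : V e by apply: h => //; rewrite /= -ball_normE /= sub0r normrN gtr0_norm.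
apply: (@le_trans _ _ (ereal_sup [set F e | e in V])); first by apply: ereal_sup_ubound; exists e.
have gen (s : \bar R) : (s < +oo)%E -> (s <= (Num.max (fine s) 0)%:E)%E.
  by case: s => [s _|//|_] /=; rewrite ?leNye// lee_fin le_max lexx.
exact: gen.
Qed.

(** The density is bounded below by restricting the ball to the box [x, x + e/2] x
    [y + e/4, y + e/2], where mdist^2 >= (dk)^2 / 2 - L^2 e^2. The constant L absorbs the Lipschitz
    part by which the increments of k and w differ. *)
Lemma ks_increment o (k : R -> R) (L : R) : continuous k ->
  (forall z z' : Cplx R, in_square z0 (2 * r) z -> in_square z0 (2 * r) z' ->
     `|k (yo o (complex.Re z', complex.Im z')) - k (yo o (complex.Re z, complex.Im z))| <=
       mdist (w z) (w z') + L * nc (z' - z)) -> 0 <= L ->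
  let c := yo o (complex.Re z0, complex.Im z0) in
  exists M e0, 0 < e0 /\ forall e, 0 < e -> e < e0 -> cint (sq_incr k e) (c - r) (c + r) <= M * e ^+ 3.
Proof.
move=> ck kw L0 c; have r1 := r0; have [phi cphi phi1] := cutoff_ex.
have [M [e0 [M0 e00 hM]]] := ks_bounded cphi.
have p0 : 0 < pi :> R by exact: pi_gt0.
exists ((M / (2 * r) + 2 * r * (L ^+ 2 / (2 * pi))) * pi), (Num.min e0 r); split; first by rewrite lt_min e00.
move=> e e1; rewrite lt_min => /andP[e2 e3]; have := hM e e1 e2 => {}hM.
have e4 : 0 < e ^+ 4 by rewrite exprn_gt0.
pose C := 4 / (pi * e ^+ 4); have C0 : 0 <= C by rewrite divr_ge0// mulr_ge0// ltW.
(* The normalization 4 / (pi e^4) times the width e / 2 and the factor 1 / 2 gives 1 / (pi e^3); the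
   error L^2 e^2 over the area e^2 / 8 gives L^2 / (2 pi). *)
pose psi y := 1 / (pi * e ^+ 3) * sq_incr k e y + - (L ^+ 2 / (2 * pi)).
have cS := @sq_incr_cts R k e ck.
pose A : R := 1 / (pi * e ^+ 3).
have cS1 := continuous_scale (k := A) cS.
have cK : continuous (fun _ : R => - (L ^+ 2 / (2 * pi))) by exact: continuous_const.
have cpsi : continuous psi by exact: continuous_addr.
pose xc := xo o (complex.Re z0, complex.Im z0).
have sq_of (p : @plane R) s : `|xo o p - xc| <= s -> `|yo o p - c| <= s -> in_square z0 s (cplx_of p).
  by rewrite /xc /c /in_square /cplx_of; case: (o) => /=.
have inner (p : @plane R) : xc - r <= xo o p <= xc + r -> c - r <= yo o p <= c + r ->
    ((Num.max (psi (yo o p)) 0)%:E <= (phi (cplx_of p))%:E * ks_density U w e p)%E.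
  move=> hx hy; have -> : phi (cplx_of p) = 1 by apply: phi1; apply: sq_of; rewrite ler_norml; lra.
  rewrite mul1e /ks_density -/C.
  set I := (\int[_]_(_ in _) _)%E.
  have I0 : (0 <= I)%E by apply: integral_ge0 => q _; rewrite lee_fin sqr_ge0.
  suff main : ((psi (yo o p))%:E <= C%:E * I)%E.
    by have [_|_] := leP (psi (yo o p)) 0; [exact: mule_ge0|].
  pose kp := k (yo o p).
  pose psi1 t := 2^-1 * (k t - kp) ^+ 2 + - (L ^+ 2 * e ^+ 2).
  have c1 : continuous (fun t => (k t - kp) ^+ 2).
    by apply: continuous_sqr; apply: continuous_subr => //; exact: continuous_const.
  have c2 := continuous_scale (k := 2^-1) c1.
  have c3 : continuous (fun _ : R => - (L ^+ 2 * e ^+ 2)) by exact: continuous_const.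
  have cpsi1 : continuous psi1 by exact: continuous_addr.
  have h1 : xo o p <= xo o p + e / 2 by lra.
  have h2 : yo o p + e / 4 <= yo o p + e / 2 by lra.
  have low := strip_integral o cpsi1 h1 h2.
  have lowI : (((xo o p + e / 2 - xo o p) * cint psi1 (yo o p + e / 4) (yo o p + e / 2))%:E <= I)%E.
    apply: le_trans low _; apply: le_integral_sub.
    - move=> q [/= q1 q2]; split.
        by apply: Usq; apply: sq_of; rewrite ler_norml; clear - hx hy q1 q2 e1 e3; lra.
      have s1 : (xo o q - xo o p) ^+ 2 <= (e / 2) ^+ 2 by rewrite ler_sqr ?nnegrE; clear - q1 q2 e1; lra.
      have s2 : (yo o q - yo o p) ^+ 2 <= (e / 2) ^+ 2 by rewrite ler_sqr ?nnegrE; clear - q1 q2 e1; lra.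
      have s3 : (q.1 - p.1) ^+ 2 + (q.2 - p.2) ^+ 2 = (xo o q - xo o p) ^+ 2 + (yo o q - yo o p) ^+ 2.
        by rewrite /xo /yo; case: (o) => //; rewrite addrC.
      rewrite s3; have : 0 < e ^+ 2 by rewrite exprn_gt0.
      by move: s1 s2; rewrite expr_div_n; lra.
    - by move=> q _; rewrite lee_fin le_max lexx orbT.
    - move=> q [/= q1 q2]; rewrite lee_fin ge_max sqr_ge0 andbT /psi1.
      have sp : in_square z0 (2 * r) (cplx_of p) by apply: sq_of; rewrite ler_norml; clear - hx hy r1; lra.
      have sq : in_square z0 (2 * r) (cplx_of q) by apply: sq_of; rewrite ler_norml; clear - hx hy q1 q2 e1 e3; lra.
      have cE (q' : @plane R) : (complex.Re (cplx_of q'), complex.Im (cplx_of q')) = q' by case: q'.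
      have := kw _ _ sp sq; rewrite !cE -/kp => hk.
      have nce : nc (cplx_of q - cplx_of p) <= e.
        apply: le_trans (nc_le_ReIm _) _; rewrite ReB ImB /cplx_of /=.
        have -> : `|q.1 - p.1| + `|q.2 - p.2| = `|xo o q - xo o p| + `|yo o q - yo o p|.
          by rewrite /xo /yo; case: (o) => //; rewrite addrC.
        by rewrite !ger0_norm; clear - q1 q2 e1; lra.
      have md0 := mdist_ge0 (w (cplx_of p)) (w (cplx_of q)).
      have hL := ler_wpM2l L0 nce.
      have hk2 : `|k (yo o q) - kp| <= mdist (w (cplx_of p)) (w (cplx_of q)) + L * e by clear - hk hL; lra.
      have Le0 : 0 <= L * e by rewrite mulr_ge0 ?(ltW e1).
      rewrite -(real_normK (num_real (k (yo o q) - kp))); move: (mdist _ _) md0 hk2 => m md0 hk2.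
      have : `|k (yo o q) - kp| ^+ 2 <= (m + L * e) ^+ 2 by rewrite ler_sqr ?nnegrE ?addr_ge0.
      have := sqr_ge0 (m - L * e); rewrite !expr2; clear; lra.
    - by move=> q _; rewrite lee_fin sqr_ge0.
  have := lee_wpmul2l (_ : 0 <= C%:E)%E lowI; rewrite lee_fin => /(_ C0); apply: le_trans.
  rewrite -EFinM lee_fin /psi1 cintD// cintZ// cint_cst -/(sq_incr k e (yo o p)) /C /psi.
  rewrite le_eqVlt; apply/orP; left; apply/eqP.
  by move: (pi : R) p0 => P P0; field; rewrite !gt_eqF.
have h1 : xc - r <= xc + r by lra.
have h2 : c - r <= c + r by lra.
have low := strip_integral o cpsi h1 h2.
have : (((xc + r - (xc - r)) * cint psi (c - r) (c + r))%:E <= M%:E)%E.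
  apply: le_trans low (le_trans _ hM); apply: le_integral_sub.
  - move=> p [/= q1 q2]; apply: Usq; apply: sq_of; rewrite ler_norml; clear - q1 q2 r1; lra.
  - by move=> q _; rewrite lee_fin le_max lexx orbT.
  - by move=> q [/= q1 q2]; exact: inner.
  - move=> q _; have [_ ph _] := cphi; have /andP[ph0 _] := ph (cplx_of q).
    apply: mule_ge0; first by rewrite lee_fin.
    apply: mule_ge0; first by rewrite lee_fin.
    by apply: integral_ge0 => q' _; rewrite lee_fin sqr_ge0.
rewrite lee_fin /psi cintD// cintZ// cint_cst => h.
have e30 : 0 < e ^+ 3 by rewrite exprn_gt0.
have r2 : 0 < 2 * r by lra.
have : 1 / (pi * e ^+ 3) * cint (sq_incr k e) (c - r) (c + r) <= M / (2 * r) + 2 * r * (L ^+ 2 / (2 * pi)).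
  rewrite -lerBlDr ler_pdivlMr// mulrC; move: h; rewrite (_ : xc + r - (xc - r) = 2 * r); last ring.
  by rewrite (_ : c + r - (c - r) = 2 * r); [lra|ring].
move=> h'; have pe : 0 < pi * e ^+ 3 :> R by rewrite mulr_gt0.
move: h'; move: (_ / _ + _) (cint _ _ _) => Y X; rewrite -!mulrA; move: (pi * e ^+ 3) pe => P P0.
by rewrite mul1r ler_pdivrMl// mulrC.
Qed.

End PlanarIntegrals.

(** * Functions whose partial derivatives are prescribed up to sign *)

Section PartialDerivatives.
Context {R : realType}.

Lemma cts_sign (f : R -> R) a b : a <= b -> (forall x, a <= x <= b -> {for x, continuous f}) ->
  (forall x, a <= x <= b -> f x != 0) -> 0 < f a -> 0 < f b.
Proof.
move=> ab cf f0 fa; rewrite ltNge; apply/negP => fb.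
have cs : {within `[a, b], continuous f}.
  by apply: continuous_in_subspaceT => x; rewrite inE/= in_itv/= => /cf.
have [|c] := @IVT R f a b 0 ab cs; first by rewrite ge_min le_max fb (ltW fa) orbT.
by rewrite in_itv/= => /f0/eqP.
Qed.

(** [derive1] is 0 where the derivative does not exist, so a nonzero value certifies
    derivability. *)
Lemma derive1_neq0 (f : R -> R) (t : R) : derive1 f t != 0 -> is_derive t 1 f (derive1 f t).
Proof.
move=> f0; have df : derivable f t 1.
  by apply: contrapT => nd; move/eqP: f0; apply; rewrite derive1E; exact: dvgP.
by rewrite derive1E; exact: DeriveDef.
Qed.

Lemma derive1_translate (f : R -> R) (s t : R) : derive1 (fun u => f (u + s)) t = derive1 f (t + s).
Proof.
rewrite /derive1; have -> : (fun h : R => h^-1 *: (f (h + t + s) - f (t + s))) =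
  (fun h : R => h^-1 *: (f (h + (t + s)) - f (t + s))) by apply/funext => h; rewrite addrA.
by [].
Qed.

Lemma derive_mean (f df : R -> R) (a b : R) : a < b -> (forall t : R, a <= t <= b -> is_derive t 1 f (df t)) ->
  exists2 c, a < c < b & f b - f a = df c * (b - a).
Proof.
move=> ab dfE; have [||c] := @MVT R f df a b ab.
- by move=> t; rewrite in_itv/= => t1; apply: dfE; lra.
- apply: continuous_in_subspaceT => t; rewrite inE/= in_itv/= => t1.
  by apply: differentiable_continuous; apply/derivable1_diffP; have [] := dfE t t1.
by rewrite in_itv/= => c1 ->; exists c.
Qed.

Lemma is_derive_ge0 (f : R -> R) (t L e : R) : 0 < e -> is_derive t 1 f L ->
  (forall s, t < s -> s < t + e -> f t <= f s) -> 0 <= L.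
Proof.
move=> e0 /is_derive_epsP H mono; rewrite leNgt; apply/negP => L0.
have L2 : 0 < - L / 2 by lra.
have [dl dl0 h] := H _ L2; pose m := Num.min dl e.
have m0 : 0 < m by rewrite lt_min dl0.
have m1 : m <= dl by rewrite ge_min lexx.
have m2 : m <= e by rewrite ge_min lexx orbT.
move: m m0 m1 m2 => m m0 m1 m2.
have := h (t + m / 2); have := mono (t + m / 2); rewrite (_ : t + m / 2 - t = m / 2); last ring.
rewrite ger0_norm; last lra.
move=> h1 h2; have {}h1 : f t <= f (t + m / 2) by apply: h1; lra.
have {}h2 := h2 (ltac:(lra)); have := ler_norm (f (t + m / 2) - f t - L * (m / 2)).
by have := mulr_gt0 L2 m0; lra.
Qed.

Lemma conv_gt (t lo v u : R) : 0 <= t <= 1 -> lo < v -> lo < u -> lo < v + t * (u - v).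
Proof.
move=> /andP[t0 t1] h1 h2; have t2 : 0 <= 1 - t by lra.
have [uv|vu] := leP v u.
  by have := mulr_ge0 t0 (_ : 0 <= u - v); rewrite subr_ge0 => /(_ uv); lra.
by have := mulr_ge0 t2 (_ : 0 <= v - u); rewrite subr_ge0 => /(_ (ltW vu)); lra.
Qed.

Variables (G V Vx Vy : R -> R -> R) (x0 y0 a b : R).
Hypotheses (a0 : 0 < a) (ab : a < b).
Let box x y := `|x - x0| < b /\ `|y - y0| < b.
Hypothesis Gc : forall x y, box x y -> {for y, continuous (G x)}.
Hypothesis dVx : forall x y, box x y -> is_derive x 1 (V ^~ y) (Vx x y).
Hypothesis dVy : forall x y, box x y -> is_derive y 1 (V x) (Vy x y).
Hypothesis Vx0 : forall x y, box x y -> 0 < Vx x y.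
Hypothesis dG : forall x y, box x y -> exists s : R, [/\ s = 1 \/ s = -1,
  derive1 (G ^~ y) x = s * Vx x y & derive1 (G x) y = s * Vy x y].

Let boxP x y : x0 - b < x < x0 + b -> y0 - b < y < y0 + b -> box x y.
Proof. by rewrite /box !ltr_norml; lra. Qed.

Let Gx x y : box x y -> is_derive x 1 (G ^~ y) (derive1 (G ^~ y) x) /\ derive1 (G ^~ y) x != 0.
Proof.
move=> bx; have [s [sE e1 _]] := dG bx.
have n0 : derive1 (G ^~ y) x != 0.
  rewrite e1; apply: mulf_neq0; last by rewrite gt_eqF ?Vx0.
  by case: sE => ->; rewrite ?oppr_eq0 ?oner_eq0.
by split => //; exact: derive1_neq0.
Qed.

Let Gx_cts x y : box x y -> {for x, continuous (G ^~ y)}.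
Proof. by move=> /Gx[[h _] _]; apply: differentiable_continuous; apply/derivable1_diffP. Qed.

Let incr_neq0 x1 x2 y : x0 - b < x1 -> x1 < x2 -> x2 < x0 + b -> y0 - b < y < y0 + b ->
  G x2 y - G x1 y != 0.
Proof.
move=> h1 h2 h3 hy; have [|c hc ->] := @derive_mean (G ^~ y) (derive1 (G ^~ y)) x1 x2 h2.
  by move=> t ht; have [|//] := @Gx t y; apply: boxP; lra.
apply: mulf_neq0; last by rewrite subr_eq0 gt_eqF.
by have [|//] := @Gx c y; apply: boxP; lra.
Qed.

(* The sign of the increments of G along horizontal segments does not depend on
   the segment: it never vanishes along an affine path between two segments. *)
Let incr_sign p1 p2 q1 q2 y y' : x0 - b < p1 -> p1 < p2 -> p2 < x0 + b ->
  x0 - b < q1 -> q1 < q2 -> q2 < x0 + b -> y0 - b < y < y0 + b -> y0 - b < y' < y0 + b ->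
  0 < G p2 y - G p1 y -> 0 < G q2 y' - G q1 y'.
Proof.
have same z x1 x2 u1 u2 : x0 - b < x1 -> x1 < x2 -> x2 < x0 + b -> x0 - b < u1 -> u1 < u2 -> u2 < x0 + b ->
    y0 - b < z < y0 + b -> 0 < G x2 z - G x1 z -> 0 < G u2 z - G u1 z.
  move=> h1 h2 h3 h4 h5 h6 hz pos.
  pose f (t : R) := G (x2 + t * (u2 - x2)) z - G (x1 + t * (u1 - x1)) z.
  have bd t v u : 0 <= t <= 1 -> x0 - b < v < x0 + b -> x0 - b < u < x0 + b -> x0 - b < v + t * (u - v) < x0 + b.
    move=> ht /andP[v1 v2] /andP[u1' u2']; rewrite (conv_gt ht v1 u1')/=.
    by have := @conv_gt t (- (x0 + b)) (- v) (- u) ht; rewrite !ltrN2 => /(_ v2 u2'); lra.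
  have lc (v u t : R) : {for t, continuous (fun t : R => v + t * (u - v))}.
    by apply: (@cvgD R); [exact: cvg_cst|apply: (@cvgMl R); exact: cvg_id].
  have := @cts_sign f 0 1 ler01; rewrite /f !mul1r !mul0r !addr0 !(addrC x2) !(addrC x1) !subrK; apply => //.
    move=> t ht; apply: (@cvgB R).
      have bx : box (x2 + t * (u2 - x2)) z by apply: boxP => //; apply: bd => //; lra.
      exact: (continuous_comp (lc x2 u2 t) (Gx_cts bx)).
    have bx : box (x1 + t * (u1 - x1)) z by apply: boxP => //; apply: bd => //; lra.
    exact: (continuous_comp (lc x1 u1 t) (Gx_cts bx)).
  move=> t ht; have l1 := bd t x1 u1 ht (ltac:(lra)) (ltac:(lra)); have l2 := bd t x2 u2 ht (ltac:(lra)) (ltac:(lra)).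
  apply: incr_neq0; [lra| |lra|lra].
  have := @conv_gt t 0 (x2 - x1) (u2 - u1) ht; rewrite !subr_gt0 => /(_ h2 h5); lra.
move=> h1 h2 h3 h4 h5 h6 hy hy' pos; apply: (same _ p1 p2) => //.
have [yy|yy] := leP y y'.
  apply: (@cts_sign (fun t => G p2 t - G p1 t) y y') => //.
    by move=> t ht; apply: (@cvgB R); apply: Gc; apply: boxP; lra.
  by move=> t ht; apply: incr_neq0 => //; lra.
have := @cts_sign (fun t => G p2 (- t) - G p1 (- t)) (- y) (- y'); rewrite !opprK; apply => //; first lra.
  have cN (t : R) : {for t, continuous (fun t : R => - t)} by apply: (@cvgN R); exact: cvg_id.
  by move=> t ht; apply: (@cvgB R); [have bx : box p2 (- t) by [apply: boxP; lra]; exact: (continuous_comp (cN t) (Gc bx))|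
    have bx : box p1 (- t) by [apply: boxP; lra]; exact: (continuous_comp (cN t) (Gc bx))].
by move=> t ht; apply: incr_neq0 => //; lra.
Qed.

Let sign_ex : exists s : R, (s = 1 \/ s = -1) /\
  forall x y, box x y -> derive1 (G ^~ y) x = s * Vx x y /\ derive1 (G x) y = s * Vy x y.
Proof.
have a1 := a0; have ab1 := ab.
pose up := 0 < G (x0 + a) y0 - G x0 y0.
have all_up x1 x2 y : x0 - b < x1 -> x1 < x2 -> x2 < x0 + b -> y0 - b < y < y0 + b -> (0 < G x2 y - G x1 y) = up.
  move=> h1 h2 h3 hy; apply/idP/idP; apply: incr_sign; lra.
exists (if up then 1 else -1); split; first by case: (up); [left|right].
move=> x y bx; have [s [sE e1 e2]] := dG bx; have [dg g0] := Gx bx.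
suff -> : (if up then 1 else -1) = s by [].
have [hx hy] := bx; move: hx hy; rewrite !ltr_norml => hx hy.
have e0 : 0 < x0 + b - x by lra.
have V0 := Vx0 bx.
case: ifP => upE.
  have : 0 <= derive1 (G ^~ y) x.
    apply: (is_derive_ge0 e0 dg) => t t1 t2; rewrite -subr_ge0; apply: ltW.
    by rewrite all_up ?upE//; lra.
  by rewrite e1; case: sE => -> //; rewrite mulN1r; lra.
have : 0 <= - derive1 (G ^~ y) x.
  apply: (@is_derive_ge0 (fun t => - G t y) x _ _ e0) => t t1 t2.
  rewrite lerN2 -subr_le0 leNgt all_up ?upE//; lra.
by rewrite e1; case: sE => -> //; rewrite mul1r; lra.
Qed.

(** The sign relating the partial derivatives of G and V may depend on the point. As Vx > 0, the
    derivative of G in x exists and never vanishes, and the constant sign of horizontal increments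
    fixes s. In the other variable Vy may vanish, and [derive1] then does not ensure existence: k is
    only continuous, with derivative 0 wherever it has one. *)
Lemma partial_split : exists s (k : R -> R), [/\ s = 1 \/ s = -1, continuous k,
  forall x y, `|x - x0| <= a -> `|y - y0| <= a -> G x y = s * V x y + k y &
  forall y L, y0 - a < y < y0 + a -> is_derive y 1 k L -> L = 0].
Proof.
have a1 := a0; have ab1 := ab.
have [s [sE sP]] := sign_ex.
pose k0 y := G x0 y - s * V x0 y.
have k0c y : y0 - b < y < y0 + b -> {for y, continuous k0}.
  move=> hy; have bx : box x0 y by apply: boxP => //; lra.
  apply: (@cvgB R); first exact: Gc.
  apply: (@cvgMr R); apply: differentiable_continuous; apply/derivable1_diffP.
  by have [] := dVy bx.
have split x y : `|x - x0| <= a -> `|y - y0| <= a -> G x y = s * V x y + k0 y.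
  rewrite !ler_norml => hx hy.
  pose f t := G t y - s * V t y.
  have df t : x0 - b < t < x0 + b -> is_derive t 1 f 0.
    move=> ht; have bx : box t y by apply: boxP; lra.
    have [dg _] := Gx bx; have [e1 _] := sP _ _ bx.
    have := is_deriveB dg (is_deriveZ s (dVx bx)); rewrite e1 /GRing.scale /= subrr; exact.
  have z t : `|(0 : R)| <= 0 by rewrite normr0.
  have cst p q : x0 - b < p -> p <= q -> q < x0 + b -> f q = f p.
    move=> h1 h2 h3; apply/eqP; rewrite -subr_eq0 -normr_le0.
    have := @derive_bound R f (fun=> 0) p q 0 h2; rewrite mul0r; apply => t ht; [apply: df; lra|by rewrite normr0].
  have : f x = f x0 by have [h|h] := leP x x0; [apply/esym|]; apply: cst; lra.
  by rewrite /f /k0; lra.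
pose k y := k0 (clamp y0 a y).
exists s, k; split => //.
- move=> y; apply: (@continuous_comp _ _ _ (clamp y0 a) k0 y); first exact: clamp_continuous (ltW a0) y.
  by apply: k0c; have := clamp_in y0 y (ltW a0); lra.
- by move=> x y hx hy; rewrite /k clamp_id ?split//; move: hy; rewrite ler_norml; lra.
move=> y L hy dk; have bx : box x0 y by apply: boxP; lra.
have dk0 : is_derive y 1 k0 L.
  apply: (is_derive_local dk); exists (Num.min (y - (y0 - a)) (y0 + a - y)); first by rewrite lt_min; lra.
  by move=> t; rewrite lt_min !ltr_norml => ht; rewrite /k clamp_id//; lra.
have dGy : is_derive y 1 (G x0) (s * Vy x0 y + L).
  have -> : G x0 = (fun y => s * V x0 y + k0 y) by apply/funext => t; rewrite /k0; ring.
  exact: (is_deriveD (is_deriveZ s (dVy bx)) dk0).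
have [_] := sP _ _ bx; rewrite derive1E (@derive_val _ _ _ _ _ _ _ dGy); lra.
Qed.

End PartialDerivatives.

(** * Local form of a map with given Hopf differential *)

Section HopfRegular.
Context {R : realType}.

Lemma cplx_sqr_eq (z w : R[i]) : z ^+ 2 = w ^+ 2 -> exists2 s : R, s = 1 \/ s = -1 & z = s%:C * w.
Proof.
move=> /eqP; rewrite eqf_sqr => /orP[]/eqP ->; [exists 1; [by left|by rewrite rmorph1 mul1r]|exists (-1); [by right|]].
by rewrite rmorphN rmorph1 mulN1r.
Qed.

Lemma ball_convex (z w z0 : Cplx R) r (t : R) : nc (z - z0) < r -> nc (w - z0) < r -> 0 <= t <= 1 ->
  nc (w + t%:C * (z - w) - z0) < r.
Proof.
move=> hz hw /andP[t0 t1]; have -> : w + t%:C * (z - w) - z0 = (1 - t)%:C * (w - z0) + t%:C * (z - z0).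
  by rewrite rmorphB rmorph1; ring.
apply: le_lt_trans (ncD _ _) _; rewrite !ncM !nc_real !ger0_norm ?subr_ge0//.
have t2 : 0 <= 1 - t by lra.
have := conv_gt (_ : 0 <= t <= 1) (_ : - r < - nc (w - z0)) (_ : - r < - nc (z - z0)).
by rewrite !ltrN2 t0 t1 => /(_ isT hw hz); lra.
Qed.

Variables (T : metricType R) (U : set (Cplx R)) (w : Cplx R -> T) (g : Cplx R -> R).
Variables (P h : Cplx R -> Cplx R) (z0 : Cplx R) (rho : R).
Hypothesis rho0 : 0 < rho.
Hypothesis reg : forall z, nc (z - z0) < rho ->
  [/\ U z, {for z, continuous g}, cdiff P z (h z), {for z, continuous h} & h z != 0].
Hypothesis iso : forall z z', nc (z - z0) < rho -> nc (z' - z0) < rho ->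
  mdist (w z) (w z') = `|g z - g z'|.
Hypothesis hopf_eq : forall z, nc (z - z0) < rho -> 4%:R * dz g z ^+ 2 = h z ^+ 2.
Hypothesis fin : (ks_energy U w < +oo)%E.

Definition mk (o : bool) (x y : R) : Cplx R := if o then x +i* y else y +i* x.
Let hx (o : bool) (z : Cplx R) : R := if o then complex.Re (h z) else - complex.Im (h z).
Let hy (o : bool) (z : Cplx R) : R := if o then - complex.Im (h z) else complex.Re (h z).
Let X o (z : Cplx R) := xo o (complex.Re z, complex.Im z).
Let Y o (z : Cplx R) := yo o (complex.Re z, complex.Im z).
Let mkK o z : mk o (X o z) (Y o z) = z. Proof. by case: o; case: z. Qed.
Let mk_nc o x y : nc (mk o x y - z0) <= `|x - X o z0| + `|y - Y o z0|.
Proof.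
apply: le_trans (nc_le_ReIm _) _; rewrite ReB ImB /mk /X /Y /xo /yo.
by case: o => //=; rewrite addrC.
Qed.

Let dmkx o x y : rcdiff (fun t => mk o t y) x (if o then 1 else 'i).
Proof. by case: o; [exact: rcdiff_hseg|exact: rcdiff_vseg]. Qed.
Let dmky o x y : rcdiff (mk o x) y (if o then 'i else 1).
Proof. by case: o; [exact: rcdiff_vseg|exact: rcdiff_hseg]. Qed.

(** As h does not vanish, one of the partial derivatives Re h and -Im h of Re P is nonzero at z0;
    [o] selects the coordinate and [tau] the sign. *)
Let orient : exists o tau, [/\ tau = 1 \/ tau = -1 & 0 < tau * hx o z0].
Proof.
have [_ _ _ _] := @reg z0 (ltac:(by rewrite subrr nc0)).
have sgn (r : R) : r != 0 -> exists tau, [/\ tau = 1 \/ tau = -1 & 0 < tau * r].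
  move=> r0; have [rp|rn] := ltP 0 r; first by exists 1; split; [left|rewrite mul1r].
  by exists (-1); split; [right|rewrite mulN1r oppr_gt0 lt_neqAle r0].
have [re0|/sgn[tau [t1 t2]] _] := eqVneq (complex.Re (h z0)) 0; last by exists true, tau.
have [im0|] := eqVneq (complex.Im (h z0)) 0.
  by move=> /eqP []; apply: complex_eq.
by rewrite -oppr_eq0 => /sgn[tau [t1 t2]] _; exists false, tau.
Qed.

(** Extracting the square root from the equation 4 dz^2 = h^2 leaves a sign depending on the point,
    which is the situation of [partial_split]. *)
Let dz_partial o z : nc (z - z0) < rho -> exists s : R, [/\ s = 1 \/ s = -1,
  derive1 (fun t => g (mk o t (Y o z))) (X o z) = s * hx o z &
  derive1 (fun t => g (mk o (X o z) t)) (Y o z) = s * hy o z].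
Proof.
move=> hz; have e0 := hopf_eq hz; rewrite /dz in e0.
have A : derive1 (fun t : R => g (z + (t +i* 0))) 0 = derive1 (fun t => g (t +i* complex.Im z)) (complex.Re z).
  rewrite -[in RHS](add0r (complex.Re z)) -derive1_translate; congr derive1; apply/funext => t.
  by congr g; case: (z) => u v /=; apply: complex_eq; rewrite ?ReD ?ImD /=; ring.
have B : derive1 (fun t : R => g (z + (0 +i* t))) 0 = derive1 (fun t => g (complex.Re z +i* t)) (complex.Im z).
  rewrite -[in RHS](add0r (complex.Im z)) -derive1_translate; congr derive1; apply/funext => t.
  by congr g; case: (z) => u v /=; apply: complex_eq; rewrite ?ReD ?ImD /=; ring.
rewrite A B in e0; move: e0; set a := derive1 _ _; set b := derive1 _ _ => e0.
have [|s sE] := @cplx_sqr_eq (a +i* - b) (h z).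
  by rewrite -e0 expr_div_n; field.
move=> /eqP; rewrite eq_complex /= => /andP[/eqP ea /eqP eb].
have ea' : a = s * complex.Re (h z) by rewrite ea -Re_realM; case: (h z).
have eb' : b = s * - complex.Im (h z) by rewrite mulrN -Im_realM -[b]opprK eb; case: (h z).
by exists s; split => //; case: o.
Qed.

(** The difference of g and the signed Re P depends on one coordinate only. Its increments are
    bounded by those of w up to the Lipschitz error of P, as [ks_increment] requires, and
    [increments_constant] concludes. *)
Lemma hopf_regular : exists s (c e : R), [/\ s = 1 \/ s = -1, 0 < e &
  forall z, nc (z - z0) < e -> g z = s * complex.Re (P z) + c].
Proof.
case: orient => o [tau [tauE tau0]].
have tau2 : tau * tau = 1 by case: tauE => ->; ring.
have tau1 : `|tau| = 1 by case: tauE => ->; rewrite ?normrN normr1.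
have [_ _ _ hc _] := @reg z0 (ltac:(by rewrite subrr nc0)).
have m0 : 0 < Num.min 1 (tau * hx o z0) by rewrite lt_min ltr01.
have /cvg_cplxP/(_ _ m0)/cplx_nbhsP[r1 r10 near_h] := hc.
pose r2 := Num.min rho r1; have r20 : 0 < r2 by rewrite lt_min rho0.
have r2rho : r2 <= rho by rewrite ge_min lexx.
have r2r1 : r2 <= r1 by rewrite ge_min lexx orbT.
move: r2 r20 r2rho r2r1 => r2 r20 r2rho r2r1.
have inrho z : nc (z - z0) < r2 -> nc (z - z0) < rho by move=> hz; lra.
have hx0 z : nc (z - z0) < r2 -> 0 < tau * hx o z.
  move=> hz; have := near_h z (lt_le_trans hz r2r1); rewrite lt_min => /andP[_].
  have : `|hx o z - hx o z0| <= nc (h z - h z0).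
    rewrite /hx; case: (o); first by rewrite -ReB; exact: Re_le_nc.
    by rewrite -opprD normrN -ImB; exact: Im_le_nc.
  have := ler_norm (tau * (hx o z0 - hx o z)); rewrite normrM tau1 mul1r distrC mulrBr; lra.
have h1 z : nc (z - z0) < r2 -> nc (h z - h z0) <= 1.
  by move=> hz; have := near_h z (lt_le_trans hz r2r1); rewrite lt_min => /andP[/ltW].
(* b keeps the open box in the ball of radius r2, a < b is the range of [partial_split], and 2 r = a
   because [ks_increment] works on a square twice as large. *)
pose b := r2 / 2; pose a := b / 2; pose r := a / 2.
have [a0 ab r0 b0] : [/\ 0 < a, a < b, 0 < r & 0 < b] by rewrite /r /a /b; split; lra.
have ar : 2 * r = a by rewrite /r; field.
have br : 2 * b = r2 by rewrite /b; field.
pose G x y := g (mk o x y); pose V x y := tau * complex.Re (P (mk o x y)).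
pose Vx x y := tau * hx o (mk o x y); pose Vy x y := tau * hy o (mk o x y).
have bx x y : `|x - X o z0| < b /\ `|y - Y o z0| < b -> nc (mk o x y - z0) < r2.
  by move=> [bx1 bx2]; have := mk_nc o x y; lra.
have tmul (F : R -> R) (t L : R) : is_derive t 1 F L -> is_derive t 1 (fun t => tau * F t) (tau * L).
  by move=> dF; have := is_deriveZ tau dF.
have [|||||] := @partial_split R G V Vx Vy (X o z0) (Y o z0) a b a0 ab.
- move=> x y hxy; have [_ cg _ _ _] := reg (inrho _ (bx x y hxy)).
  exact: (@continuous_comp R (Cplx R) R (mk o x) g y (rcdiff_cts (dmky o x y)) cg).
- move=> x y hxy; have [_ _ dP _ _] := reg (inrho _ (bx x y hxy)); apply: tmul.
  have := rcdiff_comp (dmkx o x y) dP; move=> /rcdiffP[+ _]; rewrite /hx.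
  by case: (o) => /=; case: (h _) => u v /=; rewrite ?mulr1 ?mulr0 ?mul0r ?sub0r ?subr0.
- move=> x y hxy; have [_ _ dP _ _] := reg (inrho _ (bx x y hxy)); apply: tmul.
  have := rcdiff_comp (dmky o x y) dP; move=> /rcdiffP[+ _]; rewrite /hy.
  by case: (o) => /=; case: (h _) => u v /=; rewrite ?mulr1 ?mulr0 ?mul0r ?sub0r ?subr0.
- by move=> x y hxy; apply: hx0; exact: bx.
- move=> x y hxy; have [s [sE e1 e2]] := dz_partial o (inrho _ (bx x y hxy)).
  have XE : X o (mk o x y) = x by case: (o).
  have YE : Y o (mk o x y) = y by case: (o).
  exists (s * tau); split.
  + by case: sE tauE => -> [] ->; rewrite ?mulrNN ?mulr1 ?mul1r ?mulrN; [left|right|right|left].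
  + by rewrite /Vx mulrA -(mulrA s) tau2 mulr1 -e1 XE YE.
  + by rewrite /Vy mulrA -(mulrA s) tau2 mulr1 -e2 XE YE.
move=> s [k [sE ck Gk kd]].
have s1 : `|s| = 1 by case: sE => ->; rewrite ?normrN normr1.
have sq z t : in_square z0 t z -> `|X o z - X o z0| <= t /\ `|Y o z - Y o z0| <= t.
  by rewrite /in_square /X /Y; case: (o) => -[].
have sqb z : in_square z0 (2 * r) z -> nc (z - z0) < r2.
  by move=> /sq[q1 q2]; rewrite -(mkK o z); apply: bx; rewrite ar in q1 q2; lra.
have L0 : 0 <= nc (h z0) + 1 by rewrite addr_ge0 ?nc_ge0.
have [||M [e0 [e00 hM]]] := @ks_increment R T U w z0 r r0 _ fin o k (nc (h z0) + 1) ck _ L0.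
- by move=> z /sqb/inrho/reg[].
- move=> z z' hz hz'; have bz := sqb _ hz; have bz' := sqb _ hz'.
  have [q1 q2] := sq _ _ hz; have [q3 q4] := sq _ _ hz'; rewrite ar in q1 q2 q3 q4.
  have := Gk _ _ q1 q2; have := Gk _ _ q3 q4; rewrite /G /V !mkK -/(Y o z) -/(Y o z') => g1 g2.
  rewrite (iso (inrho _ bz) (inrho _ bz')).
  have PL : nc (P z' - P z) <= (nc (h z0) + 1) * nc (z' - z).
    have := @cdiff_MVT R P h (h z0) z' z 1 _ _.
    rewrite mul1r => H; have {}H : nc (P z' - P z - h z0 * (z' - z)) <= nc (z' - z).
      apply: H => t ht; last by apply: h1; exact: ball_convex.
      by have [] := reg (inrho _ (ball_convex bz' bz ht)).
    have -> : P z' - P z = (P z' - P z - h z0 * (z' - z)) + h z0 * (z' - z) by ring.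
    by apply: le_trans (ncD _ _) _; rewrite ncM; lra.
  have -> : k (Y o z') - k (Y o z) = (g z' - g z) - s * tau * complex.Re (P z' - P z).
    by rewrite g1 g2 ReB; ring.
  apply: le_trans (ler_normB _ _) _; rewrite distrC normrM normrM s1 tau1 !mul1r lerD2l.
  exact: le_trans (Re_le_nc _) PL.
have kcst y : Y o z0 - r < y < Y o z0 + r -> k y = k (Y o z0 - r).
  move=> hy'; have hM' : forall e, 0 < e -> e < e0 -> cint (sq_incr k e) (Y o z0 - r) (Y o z0 + r) <= M * e ^+ 3 by exact: hM.
  apply: (increments_constant ck r0 e00 hM') => // y' L hy2; apply: kd; rewrite /r in hy2; lra.
exists (s * tau), (k (Y o z0 - r)), r; split => //.
  by case: sE tauE => -> [] ->; rewrite ?mulrNN ?mulr1 ?mul1r ?mulrN; [left|right|right|left].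
move=> z hz; have [q1 q2] := sq _ _ (ball_in_square (ltW hz)).
have q3 : `|Y o z - Y o z0| < r.
  apply: le_lt_trans hz; rewrite /Y /yo; case: (o) => /=; rewrite -?ReB -?ImB.
    exact: Im_le_nc.
  exact: Re_le_nc.
have := Gk (X o z) (Y o z); rewrite /G /V mkK => -> //; try by rewrite /r in q1 q2; lra.
by rewrite kcst ?mulrA//; move: q3; rewrite ltr_norml; lra.
Qed.
End HopfRegular.

(** * Flat charts of a quadratic differential *)

Section LocalInverse.
Context {R : realType}.
Implicit Types (P h : Cplx R -> Cplx R) (z w W : Cplx R).

Lemma nc_dist_cts (T : topologicalType) (F : T -> Cplx R) (t : T) W : {for t, continuous F} ->
  {for t, continuous (fun s => nc (F s - W) : R)}.
Proof.
move=> cF A /nbhs_ballP[e /= e0 eA]; have /cvg_cplxP/(_ _ e0) := cF.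
apply: filterS => s h; apply: eA; rewrite -ball_normE /=.
have := nc_triangle (F s) (F t) W; have := nc_triangle (F t) (F s) W.
by rewrite (ncB (F t) (F s)) ltr_norml; lra.
Qed.

Definition flat_on P h z0 (r : R) := 0 < r /\
  forall z, nc (z - z0) < r -> [/\ cdiff P z (h z), {for z, continuous h} & h z != 0].

Lemma flat_near P h z0 r k : flat_on P h z0 r -> 0 < k ->
  exists s, [/\ 0 < s, s <= r & forall z z', nc (z - z0) < s -> nc (z' - z0) < s ->
    nc (P z - P z' - h z0 * (z - z')) <= k * nc (z - z')].
Proof.
move=> [r0 hP] k0; have [_ hc _] := hP z0 (ltac:(by rewrite subrr nc0)).
have /cvg_cplxP/(_ _ k0)/cplx_nbhsP[e e0 he] := hc.
exists (Num.min r e); split; rewrite ?lt_min ?r0 ?ge_min ?lexx// => z z'.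
move=> hz hz'; apply: (cdiff_MVT (f' := h)) => t ht.
  have hb := ball_convex hz hz' ht; rewrite lt_min in hb; move/andP: hb => [hb _].
  by have [] := hP _ hb.
have hb := ball_convex hz hz' ht; rewrite lt_min in hb; move/andP: hb => [_ hb].
by apply/ltW/he.
Qed.

(** Injectivity follows from the mean value inequality. For surjectivity, a minimum of |P z - W|
    over a square must be 0, since otherwise a small step along (W - P z) / h z would decrease
    it. *)
Lemma local_inverse P h z0 r : flat_on P h z0 r ->
  exists s K e, [/\ 0 < s <= r, 0 < K, 0 < e,
    (forall z z', nc (z - z0) < s -> nc (z' - z0) < s -> nc (z - z') <= K * nc (P z - P z')) &
    forall W, nc (W - P z0) < e -> exists2 z, nc (z - z0) < s & P z = W].
Proof.
move=> fl; have [r0 hP] := fl; have [_ _ h0] := hP z0 (ltac:(by rewrite subrr nc0)).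
have m0 : 0 < nc (h z0) by rewrite nc_gt0.
have m2 : 0 < nc (h z0) / 2 by rewrite divr_gt0.
have [s [s0 sr hs]] := flat_near fl m2.
have K0 : 0 < 2 / nc (h z0) by rewrite divr_gt0.
have low z z' : nc (z - z0) < s -> nc (z' - z0) < s -> nc (z - z') <= 2 / nc (h z0) * nc (P z - P z').
  move=> hz hz'; have := hs _ _ hz hz'; have := ncD (P z - P z') (- (P z - P z' - h z0 * (z - z'))).
  rewrite ncN [X in nc X <= _](_ : _ = h z0 * (z - z')); last by ring.
  rewrite ncM => g1 g2; rewrite mulrAC ler_pdivlMr//; lra.
move: (2 / nc (h z0)) K0 low => K K0 low.
(* q keeps the square in the ball of radius s; the radius q / (2 K) for W keeps the minimizing point
   away from the boundary of the square. *)
pose q := s / 4; have q0 : 0 < q by rewrite divr_gt0.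
have e0 : 0 < q / (2 * K) by rewrite divr_gt0 ?mulr_gt0.
exists s, K, (q / (2 * K)); split; rewrite ?s0//= => W hW.
have sq z : in_square z0 q z -> nc (z - z0) < s.
  by move=> /square_in_ball; rewrite /q; have s1 := s0; lra.
have cf : {within in_square z0 q, continuous (fun z => nc (P z - W) : R)}.
  apply: continuous_in_subspaceT => z /set_mem/sq hz; apply: nc_dist_cts.
  by have [dPz _ _] := hP z (lt_le_trans hz sr); exact: cdiff_cts dPz.
have sq0 : in_square z0 q z0 by rewrite /in_square !subrr normr0 ltW.
have [z /set_mem zq zmin] := compact_EVT_min (ex_intro _ z0 sq0) (@square_compact R z0 q) cf.
have zmin0 := zmin z0 (mem_set sq0); rewrite (ncB (P z0)) in zmin0.
have zs := sq _ zq; exists z => //.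
have zlt : nc (z - z0) < q.
  have := low z z0 zs (ltac:(by rewrite subrr nc0)); have := nc_triangle (P z) W (P z0) => h1.
  have h2 : nc (P z - P z0) < q / K.
    have -> : q / K = 2 * (q / (2 * K)) by field; rewrite gt_eqF.
    by lra.
  by move: h2; rewrite ltr_pdivlMr// mulrC; lra.
apply/eqP; rewrite -subr_eq0 -nc_eq0; apply/negPn/negP => nz.
have D0 : 0 < nc (P z - W) by rewrite lt_neqAle eq_sym nz nc_ge0.
have [dP _ hz] := hP z (lt_le_trans zs sr).
have hz0 : 0 < nc (h z) by rewrite nc_gt0.
have [dl dl0 hdl] := dP (nc (h z) / 2) (ltac:(by rewrite divr_gt0)).
pose t := Num.min 1 (Num.min dl (q - nc (z - z0)) / 2 * (nc (h z) / nc (P z - W))).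
have n0 : 0 < Num.min dl (q - nc (z - z0)) by rewrite lt_min dl0 subr_gt0.
have t0 : 0 < t by rewrite lt_min ltr01 !mulr_gt0 ?invr_gt0.
have t1 : t <= 1 by rewrite ge_min lexx.
pose v := t%:C * ((W - P z) / h z).
have vE : nc v = t * (nc (P z - W) / nc (h z)).
  by rewrite /v !ncM ncV nc_real gtr0_norm// ncB.
have vn : nc v < Num.min dl (q - nc (z - z0)).
  have : t <= Num.min dl (q - nc (z - z0)) / 2 * (nc (h z) / nc (P z - W)) by rewrite ge_min lexx orbT.
  move=> ht; have pos : 0 < nc (P z - W) / nc (h z) by rewrite divr_gt0.
  have := ler_wpM2r (ltW pos) ht; rewrite vE; set N := Num.min _ _ in n0 *.
  have -> : N / 2 * (nc (h z) / nc (P z - W)) * (nc (P z - W) / nc (h z)) = N / 2.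
    by field; rewrite !gt_eqF.
  lra.
move: vn; rewrite lt_min => /andP[v1 v2].
have inq : in_square z0 q (z + v).
  apply: ball_in_square; have := ncD (z - z0) v; rewrite (_ : z - z0 + v = z + v - z0); [lra|ring].
have := zmin _ (mem_set inq); have := hdl (z + v); rewrite (_ : z + v - z = v); last ring.
move=> /(_ v1) h1.
have hv : h z * v = t%:C * (W - P z) by rewrite /v; field.
have -> : P (z + v) - W = (P (z + v) - P z - h z * v) + (1 - t)%:C * (P z - W).
  by rewrite hv rmorphB rmorph1; ring.
have := ncD (P (z + v) - P z - h z * v) ((1 - t)%:C * (P z - W)).
rewrite ncM nc_real ger0_norm ?subr_ge0// => h2 h3.
have h4 : nc (h z) / 2 * nc v = t / 2 * nc (P z - W) by rewrite vE; field; rewrite gt_eqF.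
have := mulr_gt0 t0 D0; clear - h1 h2 h3 h4; lra.
Qed.

End LocalInverse.

(** * Null sets in the plane *)

Section RationalBoxes.
Context {R : realType}.

Definition rbox (t : rat * rat * rat) : set (@plane R) :=
  [set p | `|p.1 - ratr t.1.1| < ratr t.2 /\ `|p.2 - ratr t.1.2| < ratr t.2].

Lemma rboxP (p : @plane R) (r : R) : 0 < r -> exists2 t, rbox t p &
  forall p' : @plane R, rbox t p' -> `|p'.1 - p.1| < r /\ `|p'.2 - p.2| < r.
Proof.
move=> r0; have r4 : r / 4 < r / 2 by lra.
have [e] := rat_in_itvoo r4; rewrite in_itv/= => he.
have h1 : p.1 - r / 4 < p.1 by lra.
have h2 : p.2 - r / 4 < p.2 by lra.
have [u] := rat_in_itvoo h1; have [v] := rat_in_itvoo h2; rewrite !in_itv/= => hv hu.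
exists (u, v, e); first by rewrite /rbox /= !ltr_norml; split; lra.
by move=> p'; rewrite /rbox /= !ltr_norml => -[g1 g2]; split; lra.
Qed.

(** Boxes with rational data are countably many, and every point has one inside any given
    neighbourhood. *)
Lemma lindelof_null (A : set (@plane R)) :
  (forall p, A p -> exists2 r : R, 0 < r & plane_measure.-negligible
     [set p' | [/\ A p', `|p'.1 - p.1| < r & `|p'.2 - p.2| < r]]) ->
  plane_measure.-negligible A.
Proof.
move=> loc; pose B (n : nat) := [set p : @plane R | exists t, [/\ unpickle n = Some t,
  plane_measure.-negligible (A `&` rbox t) & (A `&` rbox t) p]].
have : plane_measure.-negligible (\bigcup_n B n).
  apply: negligible_bigcup => n; case E : (unpickle n : option (rat * rat * rat)) => [t|]; last first.
    by apply: (negligibleS _ (negligible_set0 _)) => p [t []]; rewrite E.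
  have [nt|nt] := pselect (plane_measure.-negligible (A `&` rbox t)).
    by apply: (negligibleS _ nt) => p [t' []]; rewrite E => -[<-].
  by apply: (negligibleS _ (negligible_set0 _)) => p [t' []]; rewrite E => -[<-].
apply: negligibleS => p Ap; have [r r0 nr] := loc p Ap; have [t tp ht] := rboxP p r0.
exists (pickle t) => //; exists t; split => //; first exact: pickleK.
by apply: (negligibleS _ nr) => p' [Ap' /ht[]].
Qed.

(* A set which is a Lipschitz graph over one coordinate axis is contained in the
   graph of a Lipschitz function defined everywhere (McShane's extension). *)
Lemma lipschitz_graph_null o (A : set (@plane R)) :
  (forall p p', A p -> A p' -> `|xo o p - xo o p'| <= 3 * `|yo o p - yo o p'|) ->
  plane_measure.-negligible A.
Proof.
move=> lip; have [->|/set0P[p0 Ap0]] := eqVneq A set0; first exact: negligible_set0.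
pose S y := [set xo o p + 3 * `|y - yo o p| | p in A].
pose f y := inf (S y).
have lb y : lbound (S y) (xo o p0 - 3 * `|y - yo o p0|).
  move=> _ [p Ap <-]; have := lip _ _ Ap0 Ap; have := ler_norm (xo o p0 - xo o p).
  have := ler_distD y (yo o p0) (yo o p); rewrite (distrC (yo o p0) y); lra.
have hasS y : has_inf (S y) by split; [exists (xo o p0 + 3 * `|y - yo o p0|), p0|exists (xo o p0 - 3 * `|y - yo o p0|)].
have fA p : A p -> f (yo o p) = xo o p.
  move=> Ap; apply/eqP; rewrite eq_le; apply/andP; split.
    by apply: ge_inf; [have [] := hasS (yo o p)|exists p; rewrite // subrr normr0 mulr0 addr0].
  apply: lb_le_inf; first by have [] := hasS (yo o p).
  by move=> _ [p' Ap' <-]; have := lip _ _ Ap Ap'; have := ler_norm (xo o p - xo o p'); lra.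
have flip y y' : f y <= f y' + 3 * `|y - y'|.
  rewrite -lerBlDr; apply: lb_le_inf; first by have [] := hasS y'.
  move=> _ [p Ap <-]; rewrite lerBlDr; apply: (@le_trans _ _ (xo o p + 3 * `|y - yo o p|)).
    by apply: ge_inf; [have [] := hasS y|exists p].
  have := ler_distD y' y (yo o p); lra.
have cf : continuous f.
  move=> y B /nbhs_ballP[e /= e0 eB]; apply/nbhs_ballP; exists (e / 4); first by rewrite /= divr_gt0.
  move=> y'; rewrite -ball_normE /= => hy; apply: eB; rewrite -ball_normE /= ltr_norml.
  by have := flip y y'; have := flip y' y; rewrite (distrC y' y); lra.
pose D := [set p : @plane R | xo o p = f (yo o p)].
have AD : A `<=` D by move=> p Ap; rewrite /D /= fA.
have mf : measurable_fun setT f by exact: continuous_measurable_fun.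
have mo : measurable_fun setT (xo o : @plane R -> R) by case: (o); [exact: measurable_fst|exact: measurable_snd].
have mo' : measurable_fun setT (yo o : @plane R -> R) by case: (o); [exact: measurable_snd|exact: measurable_fst].
have mD : measurable D.
  have mg : measurable_fun setT (fun p : @plane R => xo o p - f (yo o p)).
    by apply: measurable_funB => //; exact: measurableT_comp.
  have := mg measurableT [set 0] (measurable_set1 0); rewrite setTI.
  rewrite (_ : _ @^-1` _ = D)//; apply/seteqP; split => p /=; rewrite /D /=.
    by move/eqP; rewrite subr_eq0 => /eqP.
  by move=> ->; rewrite subrr.
exists D; split => //.
have m1 : measurable_fun setT (fun p : @plane R => (\1_D p : R)%:E).
  by apply/measurable_EFinP; exact: measurable_indic.
have p1 p : (0 <= (\1_D p : R)%:E)%E by rewrite lee_fin indicE.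
have line (u : R) : (\int[@lebesgue_measure R]_x (\1_[set u] x : R)%:E = 0)%E.
  by rewrite integral_indic// setIT; exact: lebesgue_measure_set1.
have : (\int[plane_measure]_p (\1_D p : R)%:E = 0)%E.
  move: m1 p1; rewrite /D; case: (o) => m1 p1.
    rewrite fubini_tonelli2//=; under eq_integral => y _.
      rewrite /fubini_G; under eq_integral => x _.
        rewrite (_ : (\1__ (x, y) : R) = \1_[set f y] x); last first.
          by rewrite !indicE; congr (nat_of_bool _)%:R; apply/idP/idP; rewrite !inE.
        over.
      rewrite line; over.
    exact: integral0.
  rewrite fubini_tonelli1//=; under eq_integral => y _.
    rewrite /fubini_F; under eq_integral => x _.
      rewrite (_ : (\1__ (y, x) : R) = \1_[set f y] x); last first.
        by rewrite !indicE; congr (nat_of_bool _)%:R; apply/idP/idP; rewrite !inE.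
      over.
    rewrite line; over.
  exact: integral0.
by rewrite integral_indic// setIT.
Qed.

(** Near z0, P is close to multiplication by h z0 = u + i v. If |v| <= |u|, the error |u| / 2 gives
    (|u| / 2) |dx| <= (3 |u| / 2) |dy| on a level of Re P: this is the constant 3 of
    [lipschitz_graph_null]. The other case is symmetric. *)
Lemma level_null (P h : Cplx R -> Cplx R) z0 r c : flat_on P h z0 r ->
  exists2 s : R, 0 < s & plane_measure.-negligible
    [set p | nc (cplx_of p - z0) < s /\ complex.Re (P (cplx_of p)) = c].
Proof.
move=> fl; have [r0 hP] := fl; have [_ _ h0] := hP z0 (ltac:(by rewrite subrr nc0)).
pose u := complex.Re (h z0); pose v := complex.Im (h z0).
have key s k (o : bool) : 0 < s -> (forall z z', nc (z - z0) < s -> nc (z' - z0) < s ->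
    nc (P z - P z' - h z0 * (z - z')) <= k * nc (z - z')) ->
    (if o then 2 * k = `|u| /\ `|v| <= `|u| else 2 * k = `|v| /\ `|u| <= `|v|) -> 0 < k ->
    plane_measure.-negligible [set p : @plane R | nc (cplx_of p - z0) < s /\ complex.Re (P (cplx_of p)) = c].
  move=> s0 hs ho k0; apply: (@lipschitz_graph_null o) => p p' [hp cp] [hp' cp'].
  have := hs _ _ hp hp'; have := Re_le_nc (P (cplx_of p) - P (cplx_of p') - h z0 * (cplx_of p - cplx_of p')).
  rewrite !ReB cp cp' subrr sub0r normrN.
  have -> : complex.Re (h z0 * (cplx_of p - cplx_of p')) = u * (p.1 - p'.1) - v * (p.2 - p'.2) :> R.
    by rewrite /u /v; case: (h z0).
  have nn : nc (cplx_of p - cplx_of p') <= `|p.1 - p'.1| + `|p.2 - p'.2|.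
    by apply: le_trans (nc_le_ReIm _) _; rewrite ReB ImB.
  have := ler_wpM2l (ltW k0) nn; rewrite mulrDr => h1 h2 h3.
  have h4 : `|u * (p.1 - p'.1) - v * (p.2 - p'.2)| <= k * `|p.1 - p'.1| + k * `|p.2 - p'.2| by lra.
  move: ho {h1 h2 h3 nn}; rewrite /xo /yo; case: (o) => -[k2 uv]; move: (p.1 - p'.1) (p.2 - p'.2) h4 => x y h4.
    have := ler_normD (u * x - v * y) (v * y); rewrite subrK !normrM -k2 => h5.
    have := ler_wpM2r (normr_ge0 y) uv; rewrite -k2 => h6.
    by rewrite -(ler_pM2l k0); lra.
  have := ler_normB (u * x) (u * x - v * y); rewrite opprB addrC subrK !normrM -k2 => h5.
  have := ler_wpM2r (normr_ge0 x) uv; rewrite -k2 => h6.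
  by rewrite -(ler_pM2l k0); lra.
have [vu|uv] := leP `|v| `|u|.
  have k0 : 0 < `|u| / 2.
    rewrite divr_gt0// normr_gt0; apply: contra h0 => /eqP u0; apply/eqP; apply: complex_eq => //=.
    by apply/eqP; rewrite -normr_le0 -/v (le_trans vu)// u0 normr0.
  have [s [s0 _ hs]] := flat_near fl k0; exists s => //.
  by apply: (key s _ true s0 hs) => //; split => //; field.
have k0 : 0 < `|v| / 2 by rewrite divr_gt0// (le_lt_trans _ uv).
have [s [s0 _ hs]] := flat_near fl k0; exists s => //.
by apply: (key s _ false s0 hs) => //; split; [field|exact: ltW].
Qed.

End RationalBoxes.

(** * Natural coordinates of a quadratic differential *)

Section FlatStructure.
Context {R : realType} (S : riemannSurface R) (q : quad_diff S).
Local Notation ci i := (chart_inv (rs_chart i)).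

Lemma rmapK i (x : S) : rdom i x -> ci i (rmap i x) = x.
Proof. exact: chart_mapK. Qed.

Lemma img_ci (i : rs_idx S) z : (rmap i @` rdom i) z -> rdom i (ci i z) /\ rmap i (ci i z) = z.
Proof. by move=> [x dx <-]; rewrite rmapK. Qed.

Lemma chart_ball i (x : S) : rdom i x -> exists2 r : R, 0 < r &
  forall z, nc (z - rmap i x) < r -> (rmap i @` rdom i) z.
Proof.
move=> dx; have oi := @chart_img_open R S (rs_chart i).
apply/cplx_nbhsP; apply: (open_nbhs_nbhs (conj oi _)); by exists x.
Qed.

Lemma rmap_cts i (x : S) : rdom i x -> {for x, continuous (rmap i)}.
Proof. exact: chart_map_cts. Qed.

Lemma rdom_open i : open (rdom i : set S).
Proof. exact: chart_dom_open. Qed.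

Lemma coef_hol i x : rdom i x -> exists2 r : R, 0 < r & hol_ball (fun z => coef q i (ci i z)) (rmap i x) r.
Proof.
move=> /chart_ball[r r0 hr]; exists r => // w /hr wi.
have [_ hol _] := set_mem (valP q); have := hol i w wi => /derivable_cdiff h.
by eexists; exact: h.
Qed.

Lemma coef_change i j x : rdom i x -> rdom j x -> exists2 D,
  cdiff (transition (rs_chart i) (rs_chart j)) (rmap i x) D & coef q i x = coef q j x * D ^+ 2.
Proof.
move=> dx dy; have [_ _ /(_ i j x dx dy) e] := set_mem (valP q).
exists (derive1 (transition (rs_chart i) (rs_chart j)) (rmap i x)) => //.
by apply: derivable_cdiff; apply: rs_holo; exists x.
Qed.

Lemma coef_neq0 i j x : rdom i x -> rdom j x -> coef q i x != 0 -> coef q j x != 0.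
Proof. by move=> dx dy; have [D _ ->] := coef_change dx dy; apply: contraNneq => ->; rewrite mul0r. Qed.

(** P, read in the chart i, is a natural coordinate of q near x: q = (dP)^2, and vertical curves are
    those along which Re P is constant. *)
Definition flat_at i x P h r := [/\ rdom i x, flat_on P h (rmap i x) r &
  forall z, nc (z - rmap i x) < r -> (rmap i @` rdom i) z /\ h z ^+ 2 = coef q i (ci i z)].

Lemma flat_ex i x : rdom i x -> coef q i x != 0 -> exists P h r, flat_at i x P h r.
Proof.
move=> dx q0; have [r r0 hr] := coef_hol dx; have [r1 r10 hr1] := chart_ball dx.
have [|h [r2 [r20 hh r2r hsq]]] := hol_sqrt r0 hr; first by rewrite rmapK.
have [P [r3 [r30 hP]]] := hol_primitive r20 hh.
have m0 : 0 < Num.min r1 (Num.min r2 r3) by rewrite !lt_min r10 r20.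
exists P, h, (Num.min r1 (Num.min r2 r3)); split => //.
  split => // z; rewrite !lt_min => /andP[z1 /andP[z2 z3]]; split.
  - exact: hP.
  - by have [L /cdiff_cts] := hh z z2.
  - by have [] := hsq z z2.
by move=> z; rewrite !lt_min => /andP[z1 /andP[z2 z3]]; split; [exact: hr1|have [] := hsq z z2].
Qed.

(** A flat box: the natural coordinate maps N onto the disc of radius e about the image of x, with
    holomorphic inverse Y. *)
Record box i (P h : Cplx R -> Cplx R) x (N : set S) (Y : Cplx R -> S) (e r : R) : Prop := Box {
  box_e : 0 < e;
  box_open : open N;
  box_x : N x;
  box_dom : forall y, N y -> [/\ rdom i y, nc (P (rmap i y) - P (rmap i x)) < e & nc (rmap i y - rmap i x) < r];
  box_inv : forall y, N y -> Y (P (rmap i y)) = y;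
  box_cts : forall y, N y -> {for y, continuous (fun y => P (rmap i y))};
  box_h : forall y, N y -> [/\ cdiff P (rmap i y) (h (rmap i y)), h (rmap i y) != 0 & h (rmap i y) ^+ 2 = coef q i y];
  box_Y : forall W, nc (W - P (rmap i x)) < e -> N (Y W) /\ P (rmap i (Y W)) = W;
  box_Ycts : forall W, nc (W - P (rmap i x)) < e -> {for W, continuous Y};
  box_Yd : forall W, nc (W - P (rmap i x)) < e -> cdiff (fun W => rmap i (Y W)) W (h (rmap i (Y W)))^-1
}.

Lemma box_ex i P h x r : flat_at i x P h r -> exists N Y e, box i P h x N Y e r.
Proof.
move=> [dx fl hq]; have [r0 hP] := fl; set z0 := rmap i x in fl hq hP *.
have [s [K [e [/andP[s0 sr] K0 e0 low ex]]]] := local_inverse fl.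
pose N := [set y : S | [/\ rdom i y, nc (rmap i y - z0) < s & nc (P (rmap i y) - P z0) < e]].
pose Yp W := xget z0 [set z | nc (z - z0) < s /\ P z = W].
have YpP W : nc (W - P z0) < e -> nc (Yp W - z0) < s /\ P (Yp W) = W.
  by move=> /ex[z z1 z2]; rewrite /Yp; case: xgetP => [z' _ //|/(_ z)]; case.
have lipY W W' : nc (W - P z0) < e -> nc (W' - P z0) < e -> nc (Yp W - Yp W') <= K * nc (W - W').
  by move=> /YpP[h1 h2] /YpP[h3 h4]; have := low _ _ h1 h3; rewrite h2 h4.
have img W : nc (W - P z0) < e -> rdom i (ci i (Yp W)) /\ rmap i (ci i (Yp W)) = Yp W.
  by move=> /YpP[h1 _]; apply: img_ci; have [] := hq _ (lt_le_trans h1 sr).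
have nearW W : nc (W - P z0) < e -> exists2 d : R, 0 < d & forall W', nc (W' - W) < d -> nc (W' - P z0) < e.
  move=> hW; exists (e - nc (W - P z0)); first by rewrite subr_gt0.
  by move=> W' h1; have := nc_triangle W' W (P z0); lra.
have Zc y : rdom i y -> nc (rmap i y - z0) < s -> {for y, continuous (fun y => P (rmap i y))}.
  move=> dy hy; have [dP _ _] := hP _ (lt_le_trans hy sr).
  exact: (continuous_comp (rmap_cts dy) (cdiff_cts dP)).
have YpY W : nc (W - P z0) < e -> cdiff Yp W (h (Yp W))^-1.
  move=> hW; have [h1 h2] := YpP W hW; have [dP _ hn] := hP _ (lt_le_trans h1 sr).
  move=> eta eta0; have [d1 d10 near1] := nearW W hW.
  have m0 : 0 < nc (h (Yp W)) by rewrite nc_gt0.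
  have k0 : 0 < eta * nc (h (Yp W)) / K by rewrite !divr_gt0 ?mulr_gt0.
  have [dl dl0 hdl] := dP _ k0.
  exists (Num.min d1 (dl / K)); first by rewrite lt_min d10 divr_gt0.
  move=> W'; rewrite lt_min => /andP[/near1 hW' h3].
  have l1 := lipY _ _ hW' hW.
  have h4 : nc (Yp W' - Yp W) < dl by apply: le_lt_trans l1 _; rewrite mulrC -ltr_pdivlMr.
  have := hdl _ h4; rewrite h2 (proj2 (YpP _ hW')) => h5.
  have -> : Yp W' - Yp W - (h (Yp W))^-1 * (W' - W) = - (h (Yp W))^-1 * (W' - W - h (Yp W) * (Yp W' - Yp W)).
    by field.
  rewrite ncM ncN ncV mulrC ler_pdivrMr//; apply: le_trans h5 _.
  have := ler_wpM2l (ltW k0) l1.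
  rewrite [X in _ <= X -> _](_ : _ = eta * nc (W' - W) * nc (h (Yp W))) //; field; by rewrite gt_eqF.
exists N, (fun W => ci i (Yp W)), e; split => //.
- rewrite openE => y [dy h1 h2]; rewrite /interior /=.
  have n1 : \forall y' \near y, rdom i y' by apply: (open_nbhs_nbhs (conj (rdom_open i) dy)).
  have /cvg_cplxP/(_ (s - nc (rmap i y - z0)) (ltac:(by rewrite subr_gt0))) n2 := rmap_cts dy.
  have /cvg_cplxP/(_ (e - nc (P (rmap i y) - P z0)) (ltac:(by rewrite subr_gt0))) n3 := Zc y dy h1.
  apply: filterS3 n1 n2 n3 => y' g1 g2 g3; split => //.
    by have := nc_triangle (rmap i y') (rmap i y) z0; lra.
  by have := nc_triangle (P (rmap i y')) (P (rmap i y)) (P z0); lra.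
- by split => //; rewrite subrr nc0.
- by move=> y [dy h1 h2]; split => //; exact: lt_le_trans sr.
- move=> y [dy h1 h2]; have [g1 g2] := YpP _ h2; have := low _ _ g1 h1.
  rewrite g2 subrr nc0 mulr0 => g3; have /eqP : nc (Yp (P (rmap i y)) - rmap i y) == 0 by rewrite eq_le g3 nc_ge0.
  by move=> /eqP; rewrite nc_eq0 subr_eq0 => /eqP ->; exact: rmapK.
- by move=> y [dy h1 h2]; exact: Zc.
- move=> y [dy h1 h2]; have hs := lt_le_trans h1 sr; have [dP _ hn] := hP _ hs.
  by split => //; have [_ ->] := hq _ hs; rewrite rmapK.
- move=> W hW; have [g1 g2] := YpP _ hW; have [g3 g4] := img _ hW.
  by split; [split; rewrite ?g4 ?g2|rewrite g4 g2].
- move=> W hW; have [g1 g2] := YpP _ hW; have [g3 g4] := img _ hW.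
  have cY : {for W, continuous Yp} := cdiff_cts (YpY W hW).
  apply: (continuous_comp cY); apply: chart_inv_cts; exists (ci i (Yp W)) => //.
- move=> W hW; have [g3 g4] := img _ hW; rewrite g4; apply: (cdiff_local (YpY W hW)).
  have [d d0 hd] := nearW W hW; exists d => // W' /hd/img[] //.
Qed.

Section Vertical.

Lemma rcdiff_local (c d : R -> Cplx R) t v : rcdiff c t v -> (\forall s \near t, d s = c s) -> rcdiff d t v.
Proof.
move=> dc /nbhs_ballP[e1 /= e10 he] e e0; have [dl dl0 h] := dc e e0.
exists (Num.min e1 dl); first by rewrite lt_min e10.
move=> s; rewrite lt_min => /andP[s1 s2]; rewrite !he ?h// -ball_normE /=.
  by rewrite subrr normr0.
by rewrite distrC.
Qed.

(** One chart suffices, because q and the velocity transform by inverse factors: q_i = q_j D^2 and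
    v_j = D v_i. *)
Lemma vertical_crit i (c : R -> S) t v : {for t, continuous c} -> rdom i (c t) ->
  rcdiff (fun s => rmap i (c s)) t v -> coef q i (c t) * v ^+ 2 = -1 -> vertical_at q c t.
Proof.
move=> cc dc dv qv; split => // j dj; have [D dT qD] := coef_change dc dj.
have dj' : rcdiff (fun s => rmap j (c s)) t (D * v).
  apply: (rcdiff_local (rcdiff_comp dv dT)).
  have n1 : \forall s \near t, rdom i (c s).
    by apply: cc; apply: (open_nbhs_nbhs (conj (@rdom_open i) dc)).
  by apply: filterS n1 => s di; rewrite /transition /= -/(rmap i _) rmapK.
exists (complex.Re (D * v)), (complex.Im (D * v)).
have /rcdiffP[h1 h2] := dj'; split => //.
have -> : complex.Re (D * v) +i* complex.Im (D * v) = D * v by case: (D * v).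
by rewrite exprMn mulrA -qD.
Qed.

Lemma vertical_elim i (c : R -> S) t : vertical_at q c t -> rdom i (c t) ->
  exists2 v, rcdiff (fun s => rmap i (c s)) t v & coef q i (c t) * v ^+ 2 = -1.
Proof. by move=> [_ h] /h[a [b [h1 h2 h3]]]; exists (a +i* b) => //; exact/rcdiff_is_derive. Qed.

Lemma vertical_affine (c : R -> S) (s T t : R) : s = 1 \/ s = -1 -> vertical_at q c (s * t + T) ->
  vertical_at q (fun u => c (s * u + T)) t.
Proof.
move=> sE [cc h].
have ca : {for t, continuous (fun u => s * u + T)}.
  by apply: (@cvgD R); [apply: (@cvgMr R); exact: cvg_id|exact: cvg_cst].
have [i di] := rs_cover (c (s * t + T)).
have [v dv qv] := vertical_elim (conj cc h) di.
apply: (@vertical_crit i _ t (s%:C * v)) => //.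
- exact: (continuous_comp ca cc).
- move=> e e0; have [dl dl0 hd] := dv e e0; exists dl => // u ut.
  have e1 : s * u + T - (s * t + T) = s * (u - t) by ring.
  have s1 : `|s| = 1 by case: sE => ->; rewrite ?normrN normr1.
  have := hd (s * u + T); rewrite e1 normrM s1 mul1r rmorphM /= => /(_ ut).
  by rewrite mulrA [v * _]mulrC.
- have s2 : s%:C ^+ 2 = 1 :> R[i] by case: sE => ->; rewrite ?rmorphN rmorph1 ?sqrrN expr1n.
  by rewrite exprMn s2 mul1r.
Qed.

Variables (i : rs_idx S) (P h : Cplx R -> Cplx R) (x : S) (N : set S) (Y : Cplx R -> S) (e r : R).
Hypothesis B : box i P h x N Y e r.
Local Notation Z y := (P (rmap i y)).

(** The velocity of Y along the imaginary direction is i / h up to sign, and q (i / h)^2 = -1 as q =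
    h^2. *)
Lemma line_vertical W (s t0 t : R) : s = 1 \/ s = -1 ->
  nc (W + (s * (t - t0))%:C * 'i - Z x) < e ->
  vertical_at q (fun t => Y (W + (s * (t - t0))%:C * 'i)) t.
Proof.
move=> sE hW; have [NY ZY] := box_Y B hW; have [dY _ _] := box_dom B NY.
have [_ hn hsq] := box_h B NY.
have dl : rcdiff (fun t => W + (s * (t - t0))%:C * 'i) t (s%:C * 'i).
  move=> e1 e10; exists 1 => // u _.
  rewrite (_ : _ - _ - _ = 0) ?nc0 ?mulr_ge0 ?(ltW e10)//.
  by rewrite !rmorphM !rmorphB /=; ring.
apply: (@vertical_crit i _ t _ _ _ (rcdiff_comp dl (box_Yd B hW))) => //.
  exact: (continuous_comp (rcdiff_cts dl) (box_Ycts B hW)).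
have E (H u : R[i]) : H != 0 -> H ^+ 2 * (H^-1 * u) ^+ 2 = u ^+ 2 by move=> H0; field.
rewrite -hsq E// exprMn sqr_i.
by case: sE => ->; rewrite ?rmorphN rmorph1 ?sqrrN expr1n mul1r.
Qed.

Lemma vertical_box (c : R -> S) t : vertical_at q c t -> N (c t) ->
  exists2 s : R, s = 1 \/ s = -1 & rcdiff (fun u => Z (c u)) t (s%:C * 'i).
Proof.
move=> vc Nc; have [dc _ _] := box_dom B Nc; have [dP hn hsq] := box_h B Nc.
have [v dv qv] := vertical_elim vc dc.
have [|s sE hv] := @cplx_sqr_eq R (h (rmap i (c t)) * v) 'i.
  by rewrite exprMn hsq qv sqr_i.
by exists s => //; rewrite -hv; exact: rcdiff_comp dv dP.
Qed.

(** In the natural coordinate the velocity is i or -i at each time. That its sign is constant comes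
    from [partial_split], applied to Im P along c with a dummy second variable. *)
Lemma straight (c : R -> S) (t0 eta : R) : 0 < eta -> (forall t, `|t - t0| < eta -> vertical_at q c t) ->
  N (c t0) -> exists d s : R, [/\ 0 < d, d <= eta, s = 1 \/ s = -1 &
    forall t, `|t - t0| < d -> N (c t) /\ Z (c t) = Z (c t0) + (s * (t - t0))%:C * 'i].
Proof.
move=> eta0 vc Nc; have [cc _] := vc t0 (ltac:(by rewrite subrr normr0)).
have /nbhs_ballP[d1 /= d10 hd1] : \forall t \near t0, N (c t).
  by apply: cc; apply: (open_nbhs_nbhs (conj (box_open B) Nc)).
pose b := Num.min eta d1; have b0 : 0 < b by rewrite lt_min eta0.
have beta : b <= eta by rewrite ge_min lexx.
have bd : b <= d1 by rewrite ge_min lexx orbT.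
move: b b0 beta bd => b b0 beta bd.
have Nb t : `|t - t0| < b -> N (c t).
  by move=> ht; apply: hd1; rewrite -ball_normE /= distrC; exact: lt_le_trans bd.
have dZ t : `|t - t0| < b -> exists2 s : R, s = 1 \/ s = -1 & rcdiff (fun u => Z (c u)) t (s%:C * 'i).
  by move=> ht; apply: vertical_box; [apply: vc; exact: lt_le_trans beta|exact: Nb].
have ReI (s : R) : complex.Re (s%:C * 'i) = 0 by rewrite /= !mulr0 mul0r subrr.
have ImI (s : R) : complex.Im (s%:C * 'i) = s by rewrite /= mulr1 mul0r addr0.
have a0 : 0 < b / 2 by rewrite divr_gt0.
have ab : b / 2 < b by lra.
pose f t : R := complex.Im (Z (c t)).
have df t : `|t - t0| < b -> exists2 s : R, s = 1 \/ s = -1 & is_derive t 1 f s.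
  by move=> /dZ[s sE /rcdiffP[_]]; rewrite ImI; exists s.
have cst (u : R) : (fun=> f u) = cst (f u) by [].
have [|||s [k [sE _ fE _]]] := @partial_split R (fun t _ => f t) (fun t _ => t) (fun _ _ => 1) (fun _ _ => 0) t0 0 (b / 2) b a0 ab.
- by move=> u v _; exact: cst_continuous.
- by [].
- move=> u v [/df[s sE ds] _]; exists s; split => //.
    by rewrite mulr1 derive1E derive_val.
  by rewrite mulr0 derive1E (@derive_val _ _ _ _ _ _ _ (is_derive_cst (f u) v 1)).
have Re0 t : `|t - t0| < b -> complex.Re (Z (c t)) = complex.Re (Z (c t0)).
  move=> ht; pose g t : R := complex.Re (Z (c t)).
  have dg t' : `|t' - t0| < b -> is_derive t' 1 g 0.
    by move=> /dZ[s' _ /rcdiffP[]]; rewrite ReI.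
  have aux p p' : p <= p' -> `|p - t0| < b -> `|p' - t0| < b -> g p' = g p.
    rewrite !ltr_norml => pp h1 h2; apply/eqP; rewrite -subr_eq0 -normr_le0.
    have := @derive_bound R g (fun=> 0) p p' 0 pp; rewrite mul0r; apply => u hu.
      by apply: dg; rewrite ltr_norml; lra.
    by rewrite normr0.
  have tt0 : `|t0 - t0| < b by rewrite subrr normr0.
  by have [h1|/ltW h1] := leP t t0; [apply/esym|]; apply: aux.
exists (b / 2), s; split => //; first by lra.
move=> t ht; have htb : `|t - t0| < b by lra.
split; first exact: Nb.
have n0 : `|(0 : R) - 0| <= b / 2 by rewrite subrr normr0 ltW.
have tt : `|t0 - t0| <= b / 2 by rewrite subrr normr0 ltW.
have := fE t 0 (ltW ht) n0; have := fE t0 0 tt n0; rewrite /f => f1 f2.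
apply: complex_eq; rewrite ?ReD ?ImD ?ReI ?ImI ?addr0 ?Re0//.
by rewrite f1 f2; ring.
Qed.

End Vertical.
End FlatStructure.

(** * Vertical trajectories on a regular level *)

Section Trajectories.
Context {R : realType}.

(** Otherwise the supremum of the s such that E holds on [a, s] could be exceeded. *)
Lemma continuation (E : R -> Prop) a b : a <= b ->
  (exists2 e, 0 < e & forall u, a <= u -> u < a + e -> E u) ->
  (forall s, a < s -> s <= b -> (forall u, a <= u -> u < s -> E u) ->
     exists2 e, 0 < e & forall u, s <= u -> u < s + e -> E u) ->
  forall u, a <= u -> u <= b -> E u.
Proof.
move=> ab [e0 e00 base] step.
pose A := [set s | a <= s <= b /\ forall u, a <= u -> u <= s -> E u].
have Aa : A a by split; [rewrite lexx|move=> u u1 u2; apply: base => //; lra].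
have hA : has_sup A by split; [exists a|exists b => s [/andP[]]].
pose m := sup A; have am : a <= m by apply: ub_le_sup => //; have [] := hA.
have mb : m <= b by apply: ge_sup; [exists a|move=> s [/andP[]]].
have Em u : a <= u -> u < m -> E u.
  move=> au um; have d0 : 0 < m - u by rewrite subr_gt0.
  by have [s [_ hs]] := sup_adherent d0 hA; rewrite subKr => /ltW; exact: hs.
have [e e1 he] : exists2 e, 0 < e & forall u, m <= u -> u < m + e -> E u.
  have [ma|ma] := eqVneq m a; first by exists e0 => // u; rewrite ma; exact: base.
  by apply: step => //; rewrite lt_neqAle eq_sym ma.
have Ee u : a <= u -> u < m + e -> E u.
  by move=> au ue; have [h|h] := ltP u m; [exact: Em|exact: he].
have [bm|bm] := leP b m; first by move=> u au ub; apply: Ee => //; lra.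
pose s := Num.min b (m + e / 2).
have sb : s <= b by rewrite ge_min lexx.
have se : s <= m + e / 2 by rewrite ge_min lexx orbT.
have ms : m < s by rewrite lt_min bm; lra.
have : A s by split; [rewrite sb andbT; lra|move=> u u1 u2; apply: Ee => //; lra].
by move=> As; have := ub_le_sup (proj2 hA) As; rewrite -/m leNgt ms.
Qed.

Lemma hausdorff_agree (T : topologicalType) (c d : R -> T) (s : R) : hausdorff_space T ->
  {for s, continuous c} -> {for s, continuous d} ->
  (forall e, 0 < e -> exists2 u, `|u - s| < e & c u = d u) -> c s = d s.
Proof.
move=> hT cc cd H; apply: hT => A B /cc/nbhs_ballP[e1 /= e10 h1] /cd/nbhs_ballP[e2 /= e20 h2].
have m0 : 0 < Num.min e1 e2 by rewrite lt_min e10.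
have [u] := H _ m0; rewrite lt_min distrC => /andP[u1 u2] cdu.
by exists (c u); split; [apply: (h1 u)|rewrite cdu; apply: (h2 u)]; rewrite -ball_normE.
Qed.

Context (S : riemannSurface R) (q : quad_diff S).

Lemma vertical_shift (c : R -> S) (T t : R) : vertical_at q c (t + T) -> vertical_at q (fun u => c (u + T)) t.
Proof.
have -> : (fun u => c (u + T)) = (fun u => c (1 * u + T)) by apply/funext => u; rewrite mul1r.
by move=> h; apply: vertical_affine; [left|rewrite mul1r].
Qed.

Lemma vertical_opp (c : R -> S) (T t : R) : vertical_at q c (T - t) -> vertical_at q (fun u => c (T - u)) t.
Proof.
have -> : (fun u => c (T - u)) = (fun u => c (-1 * u + T)) by apply/funext => u; rewrite mulN1r addrC.
by move=> h; apply: vertical_affine; [right|rewrite mulN1r addrC].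
Qed.

Lemma vertical_local (c d : R -> S) (s e : R) : vertical_at q c s -> 0 < e ->
  (forall u, `|u - s| < e -> d u = c u) -> vertical_at q d s.
Proof.
move=> vc e0 dc; have ds : d s = c s by apply: dc; rewrite subrr normr0.
have near_s : \forall u \near s, d u = c u.
  by apply/nbhs_ballP; exists e => // u; rewrite -ball_normE /= distrC; exact: dc.
have [i di] := rs_cover (c s); have [v dv qv] := vertical_elim vc di.
apply: (@vertical_crit R S q i d s v); rewrite ?ds//.
  have [cc _] := vc; move=> A nA; rewrite ds in nA; have := cc A nA.
  by apply: filterS2 near_s => u /= ->.
by apply: (rcdiff_local dv); apply: filterS near_s => u ->.
Qed.

Lemma vertical_neq0 (c : R -> S) t i : vertical_at q c t -> rdom i (c t) -> coef q i (c t) != 0.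
Proof.
move=> vc di; have [v _ qv] := vertical_elim vc di; apply/eqP => e; move: qv; rewrite e mul0r.
by move/esym/eqP; rewrite oppr_eq0 oner_eq0.
Qed.

Lemma vertical_flat (c : R -> S) t : vertical_at q c t -> exists i P h N Y e r, box q i P h (c t) N Y e r.
Proof.
move=> vc; have [i di] := rs_cover (c t); have [P [h [r fl]]] := flat_ex di (vertical_neq0 vc di).
by have [N [Y [e B]]] := box_ex fl; exists i, P, h, N, Y, e, r.
Qed.

(** At a time s before which the curves agree, they take the same value by continuity and run in a
    flat box along the same vertical line; the agreement before s forces the same direction. *)
Let unique_fwd (c d : R -> S) (al be t0 e0 : R) : al < t0 ->
  (forall t, al < t < be -> vertical_at q c t /\ vertical_at q d t) -> 0 < e0 ->
  (forall t, `|t - t0| < e0 -> c t = d t) -> forall t, t0 <= t -> t < be -> c t = d t.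
Proof.
move=> al0 vcd e00 near0 t t0t tbe; apply: (@continuation (fun t => c t = d t) t0 t) => //.
  exists e0 => // u u1 u2; apply: near0; rewrite ger0_norm; lra.
move=> s s1 s2 left_s; have hs : al < s < be by lra.
have [vc vd] := vcd s hs.
have cds : c s = d s.
  apply: (hausdorff_agree (@rs_hausdorff R S)); [by have [] := vc|by have [] := vd|].
  move=> e1 e10; pose u := Num.max t0 (s - e1 / 2).
  have u1 : t0 <= u by rewrite le_max lexx.
  have u2 : s - e1 / 2 <= u by rewrite le_max lexx orbT.
  have u3 : u < s by rewrite gt_max s1; lra.
  by exists u; [rewrite ltr_norml; lra|exact: left_s].
have [i [P [h [N [Y [e [r B]]]]]]] := vertical_flat vc.
have eta0 : 0 < Num.min (s - al) (be - s) by rewrite lt_min; lra.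
have vl (w : R) : `|w - s| < Num.min (s - al) (be - s) -> al < w < be.
  by rewrite lt_min !ltr_norml; lra.
have [d1 [s' [d10 _ sE hc]]] := straight B eta0 (fun w hw => proj1 (vcd w (vl w hw))) (box_x B).
have Nd : N (d s) by rewrite -cds; exact: box_x B.
have [d2 [s2' [d20 _ sE2 hd]]] := straight B eta0 (fun w hw => proj2 (vcd w (vl w hw))) Nd.
have m0 : 0 < Num.min d1 d2 by rewrite lt_min d10.
exists (Num.min d1 d2) => // w w1 w2.
have [ws1 ws2] : `|w - s| < d1 /\ `|w - s| < d2.
  by move: w2; rewrite -ltrBlDl lt_min ger0_norm ?subr_ge0// => /andP[].
have [N1 Z1] := hc w ws1; have [N2 Z2] := hd w ws2.
suff ss : s' = s2' by rewrite -(box_inv B N1) -(box_inv B N2) Z1 Z2 cds ss.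
pose u := Num.max t0 (s - Num.min d1 d2 / 2).
have u1 : t0 <= u by rewrite le_max lexx.
have u2 : s - Num.min d1 d2 / 2 <= u by rewrite le_max lexx orbT.
have u3 : u < s by rewrite gt_max s1; lra.
have us : `|u - s| < Num.min d1 d2 by rewrite ltr_norml; lra.
move: us; rewrite lt_min => /andP[us1 us2].
have [_ Zc] := hc u us1; have [_ Zd] := hd u us2.
move: Zc; rewrite (left_s u u1 u3) Zd cds => /addrI/(congr1 (@complex.Im R)).
rewrite /= !mulr1 !mul0r !addr0 => /(mulIf _); rewrite subr_eq0 lt_eqF// => /(_ isT).
by [].
Qed.

Lemma vertical_unique (c d : R -> S) (al be t0 e0 : R) : al < t0 < be ->
  (forall t, al < t < be -> vertical_at q c t /\ vertical_at q d t) -> 0 < e0 ->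
  (forall t, `|t - t0| < e0 -> c t = d t) -> forall t, al < t < be -> c t = d t.
Proof.
move=> /andP[al0 be0] vcd e00 near0 t /andP[alt tbe].
have [tt|tt] := leP t0 t; first exact: (unique_fwd al0 vcd e00 near0).
have b0 : - be < - t0 by rewrite ltrN2.
have := @unique_fwd (fun u => c (0 - u)) (fun u => d (0 - u)) (- be) (- al) (- t0) e0 b0 _ e00 _ (- t).
have -> : 0 - - t = t by rewrite sub0r opprK.
apply; [|by move=> u hu; apply: near0; rewrite (_ : 0 - u - t0 = - (u - - t0)) ?normrN//; ring|by rewrite lerN2 ltW|by rewrite ltrN2].
by move=> u hu; have [|v1 v2] := vcd (0 - u); [lra|split; exact: vertical_opp].
Qed.

Variables (f : S -> R) (a : R).
Hypothesis fc : continuous f.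
Hypothesis f_flat : forall x i, rdom i x -> coef q i x != 0 -> f x <> 0 -> f x <> a ->
  exists P h r, flat_at q i x P h r /\
    forall z, nc (z - rmap i x) < r -> f (chart_inv (rs_chart i) z) = complex.Re (P z).

Lemma f_box (x : S) i : rdom i x -> coef q i x != 0 -> f x <> 0 -> f x <> a ->
  exists P h N Y e r, box q i P h x N Y e r /\ forall y, N y -> f y = complex.Re (P (rmap i y)).
Proof.
move=> dx q0 f0 fa; have [P [h [r [fl fP]]]] := f_flat dx q0 f0 fa.
have [N [Y [e B]]] := box_ex fl; exists P, h, N, Y, e, r; split => // y Ny.
by have [dy _ hy] := box_dom B Ny; rewrite -fP// rmapK.
Qed.

Let loc_const (c : R -> S) (s eta : R) : 0 < eta -> (forall t, `|t - s| < eta -> vertical_at q c t) ->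
  f (c s) <> 0 -> f (c s) <> a -> exists2 d, 0 < d & forall t, `|t - s| < d -> f (c t) = f (c s).
Proof.
move=> eta0 vc f0 fa; have vs := vc s (ltac:(by rewrite subrr normr0)).
have [i di] := rs_cover (c s); have q0 := vertical_neq0 vs di.
have [P [h [N [Y [e [r [B fB]]]]]]] := f_box di q0 f0 fa.
have [d [s' [d0 _ _ hc]]] := straight B eta0 vc (box_x B).
exists d => // t /hc[Nt Zt]; rewrite (fB _ Nt) (fB _ (box_x B)) Zt ReD /= !mulr0 mul0r.
by rewrite subrr addr0.
Qed.

Let f_const_fwd (c : R -> S) (al be t0 : R) : al < t0 -> (forall t, al < t < be -> vertical_at q c t) ->
  f (c t0) <> 0 -> f (c t0) <> a -> forall t, t0 <= t -> t < be -> f (c t) = f (c t0).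
Proof.
move=> al0 vc f0 fa t t0t tbe; apply: (@continuation (fun t => f (c t) = f (c t0)) t0 t) => //.
  have eta0 : 0 < Num.min (t0 - al) (be - t0) by rewrite lt_min; lra.
  have [|d d0 hd] := @loc_const c t0 _ eta0 _ f0 fa.
    by move=> w; rewrite lt_min !ltr_norml => hw; apply: vc; lra.
  by exists d => // u u1 u2; apply: hd; rewrite ger0_norm; lra.
move=> s s1 s2 left_s.
have fs : f (c s) = f (c t0).
  apply: (@hausdorff_agree R (fun t => f (c t)) (fun=> f (c t0)) s (@norm_hausdorff R R)).
  - by have [|cc _] := vc s; [lra|]; apply: (continuous_comp cc); exact: fc.
  - exact: cst_continuous.
  - move=> e1 e10; pose u := Num.max t0 (s - e1 / 2).
    have u1 : t0 <= u by rewrite le_max lexx.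
    have u2 : s - e1 / 2 <= u by rewrite le_max lexx orbT.
    have u3 : u < s by rewrite gt_max s1; lra.
    by exists u; [rewrite ltr_norml; lra|exact: left_s].
have eta0 : 0 < Num.min (s - al) (be - s) by rewrite lt_min; lra.
have [|||d d0 hd] := @loc_const c s _ eta0.
- by move=> w; rewrite lt_min !ltr_norml => hw; apply: vc; lra.
- by rewrite fs.
- by rewrite fs.
by exists d => // u u1 u2; rewrite -fs; apply: hd; rewrite ger0_norm; lra.
Qed.

Lemma f_const (c : R -> S) (al be t0 : R) : al < t0 < be -> (forall t, al < t < be -> vertical_at q c t) ->
  f (c t0) <> 0 -> f (c t0) <> a -> forall t, al < t < be -> f (c t) = f (c t0).
Proof.
move=> /andP[al0 be0] vc f0 fa t /andP[alt tbe].
have [tt|tt] := leP t0 t; first exact: (f_const_fwd al0 vc f0 fa).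
have b0 : - be < - t0 by rewrite ltrN2.
have := @f_const_fwd (fun u => c (0 - u)) (- be) (- al) (- t0) b0.
rewrite !sub0r !opprK => H; have := H _ f0 fa (- t); rewrite sub0r opprK; apply; rewrite ?lerN2 ?ltrN2 ?(ltW tt)//.
by move=> u hu; apply: vertical_opp; apply: vc; lra.
Qed.

Hypothesis compactS : compact [set: S].
Variable v : R.
Hypothesis (v0 : v <> 0) (va : v <> a).
Hypothesis v_neq0 : forall y i, f y = v -> rdom i y -> coef q i y != 0.

Lemma interval_nbhd (I : set R) x y : open I -> is_interval I -> I x -> I y ->
  exists al be, [/\ al < x < be, al < y < be & forall t, al < t < be -> I t].
Proof.
move=> oI iI; wlog xy : x y / x <= y.
  move=> H Ix Iy; have [xy|/ltW yx] := leP x y; first exact: H.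
  by have [al [be [h1 h2 h3]]] := H y x yx Iy Ix; exists al, be.
move=> Ix Iy.
have /nbhs_ballP[e1 /= e10 h1] : nbhs x I by apply: (open_nbhs_nbhs (conj oI Ix)).
have /nbhs_ballP[e2 /= e20 h2] : nbhs y I by apply: (open_nbhs_nbhs (conj oI Iy)).
have I1 : I (x - e1 / 2) by apply: h1; rewrite -ball_normE /= opprB addrC subrK gtr0_norm; lra.
have I2 : I (y + e2 / 2) by apply: h2; rewrite -ball_normE /= opprD addrA subrr sub0r normrN gtr0_norm; lra.
exists (x - e1 / 2), (y + e2 / 2); split; try lra.
by move=> t ht; apply: (iI _ _ I1 I2); lra.
Qed.

Lemma f_const_curve I c t0 t : vertical_curve q I c -> I t0 -> I t -> f (c t0) = v -> f (c t) = v.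
Proof.
move=> [_ oI iI vI] It0 It fv; have [al [be [h1 h2 h3]]] := interval_nbhd oI iI It0 It.
rewrite -fv; apply: (@f_const c al be) => //; rewrite ?fv//.
by move=> u /h3/vI.
Qed.

(** Compactness enters through cluster points: the level v is closed, and by [v_neq0] its points are
    not zeros of q, hence have flat boxes. *)
Lemma cluster_level (F : set_system S) : ProperFilter F -> F [set y | f y = v] ->
  exists i P h x N Y e r, [/\ cluster F x, f x = v, box q i P h x N Y e r & forall y, N y -> f y = complex.Re (P (rmap i y))].
Proof.
move=> FF Fv; have [x [_ clx]] := compactS FF filterT.
have fx : f x = v.
  apply: contrapT => fxv; have := @clx [set y | f y = v] [set y | f y <> v] Fv.
  case; last by move=> y [/= ].
  have d0 : 0 < `|f x - v| by rewrite normr_gt0 subr_eq0; apply/eqP.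
  have /cvgrPdist_lt/(_ _ d0) := fc (x := x); apply: filterS => y /= h e; move: h; rewrite e ltxx.
  by [].
have [i di] := rs_cover x; have q0 := v_neq0 fx di.
have [||P [h [N [Y [e [r [B fB]]]]]]] := f_box di q0; rewrite ?fx//.
by exists i, P, h, x, N, Y, e, r.
Qed.

Lemma box_small i P h x N Y e r d : box q i P h x N Y e r -> 0 < d ->
  nbhs x [set y | N y /\ nc (P (rmap i y) - P (rmap i x)) < d].
Proof.
move=> B d0; have n1 : nbhs x N by apply: (open_nbhs_nbhs (conj (box_open B) (box_x B))).
have /cvg_cplxP/(_ _ d0) n2 := box_cts B (box_x B).
by apply: filterS2 n1 n2.
Qed.

(** If I had a supremum b, the curve would visit, less than e/4 before b, a flat box of radius e
    around a cluster point. The vertical line through that position goes on for a time e/2, beyond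
    b, against maximality. *)
Lemma trajectory_unbounded I c t0 M : trajectory q I c -> I t0 -> f (c t0) = v ->
  ~ (forall t, I t -> t <= M).
Proof.
move=> [vI maxI] It0 ft0 IM; have [I0 oI iI vcI] := vI.
have hI : has_sup I by split => //; exists M.
pose b := sup I.
have notb : ~ I b.
  move=> Ib; have /nbhs_ballP[e1 /= e10 h1] : nbhs b I by apply: (open_nbhs_nbhs (conj oI Ib)).
  have : I (b + e1 / 2) by apply: h1; rewrite -ball_normE /= opprD addrA subrr sub0r normrN gtr0_norm; lra.
  by move=> /(ub_le_sup (proj2 hI)); rewrite -/b; lra.
have Ib t : I t -> t < b.
  move=> It; rewrite lt_neqAle (ub_le_sup (proj2 hI) It) andbT; apply/eqP => tb; apply: notb; by rewrite -tb.
have inI t s : I t -> t <= s -> s < b -> I s.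
  move=> It ts sb; have d0 : 0 < b - s by rewrite subr_gt0.
  have [s' Is'] := sup_adherent d0 hI; rewrite subKr => ss'.
  by apply: (iI _ _ It Is'); rewrite ts ltW.
have t0b := Ib _ It0.
pose F : set_system S := c @ b^'-.
have FF : ProperFilter F by exact: fmap_proper_filter.
have Fset (t : R) (A : set S) : t < b -> (forall s, t < s -> s < b -> A (c s)) -> F A.
  move=> tb h; rewrite /F /fmap /=.
  by apply: filterS2 (nbhs_left_gt tb) (nbhs_left_lt b) => s s1 s2; exact: h.
have [|i [P [h [x [N [Y [e [r [clx fx B fB]]]]]]]]] := @cluster_level F FF.
  apply: (Fset t0 _ t0b) => s s1 s2 /=; apply: (f_const_curve vI It0 _ ft0).
  by apply: (inI t0) => //; exact: ltW.
have e0 := box_e B; have e2 : 0 < e / 2 by lra.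
pose t1 := Num.max t0 (b - e / 4).
have t1b : t1 < b by rewrite gt_max t0b; lra.
have [y [[t [tt1 tb <-]] [Nt Zt]]] : [set c s | s in [set s | t1 < s /\ s < b]] `&`
    [set y | N y /\ nc (P (rmap i y) - P (rmap i x)) < e / 2] !=set0.
  by apply: clx; [apply: (Fset t1 _ t1b) => s s1 s2; exists s|exact: (box_small B e2)].
move: tt1 tb; rewrite -/t1 => tt1 tb.
have [tt0 te] : t0 < t /\ b - e / 4 < t by move: tt1; rewrite gt_max => /andP[].
have It : I t by apply: (inI t0) => //; exact: ltW.
have vt s : t0 < s < b -> vertical_at q c s.
  by move=> /andP[s1 s2]; apply: vcI; apply: (inI t0) => //; exact: ltW.
have eta0 : 0 < Num.min (t - t0) (b - t) by rewrite lt_min !subr_gt0 tt0.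
have [|d [s [d0 dle sE hc]]] := @straight R S q i P h x N Y e r B c t _ eta0 _ Nt.
  by move=> w; rewrite lt_min !ltr_norml => hw; apply: vt; lra.
have s1 : `|s| = 1 by case: sE => ->; rewrite ?normrN normr1.
pose l u := Y (P (rmap i (c t)) + (s * (u - t))%:C * 'i).
have inB u : `|u - t| < e / 2 -> nc (P (rmap i (c t)) + (s * (u - t))%:C * 'i - P (rmap i x)) < e.
  move=> hu; rewrite addrAC; apply: le_lt_trans (ncD _ _) _.
  have -> : nc ((s * (u - t))%:C * 'i) = `|u - t|.
    rewrite ncM nc_real normrM s1 mul1r; have -> : nc ('i : R[i]) = 1 by rewrite /= expr0n expr1n add0r sqrtr1.
    by rewrite mulr1.
  by have Zt' := Zt; rewrite /= in Zt'; lra.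
have vl u : `|u - t| < e / 2 -> vertical_at q l u.
  by move=> hu; apply: (line_vertical B sE); exact: inB.
have cl u : `|u - t| < d -> c u = l u.
  by move=> /hc[Nu Zu]; rewrite /l -Zu (box_inv B Nu).
have dt : d <= t - t0 by apply: le_trans dle _; rewrite ge_min lexx.
have db : d <= b - t by apply: le_trans dle _; rewrite ge_min lexx orbT.
have clb u : t <= u -> u < b -> c u = l u.
  move=> tu ub; apply: (@vertical_unique c l (t - d) b t d _ _ d0 cl); try lra.
  move=> w hw; split; first by apply: vt; lra.
  by apply: vl; rewrite ltr_norml; lra.
(* The extension follows c before t and the vertical line l from t on. *)
pose dd u := if u < t then c u else l u.
pose J := [set u : R | I u \/ (t - d < u /\ u < t + e / 2)].
have ddc u : I u -> dd u = c u.
  by move=> Iu; rewrite /dd; case: ltP => // tu; rewrite clb//; exact: Ib.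
have J_vc : vertical_curve q J dd.
  split.
  - by exists t; left.
  - rewrite openE => u [Iu|[u1 u2]].
      have : nbhs u I by apply: (open_nbhs_nbhs (conj oI Iu)).
      by apply: filterS => w Iw; left.
    apply/nbhs_ballP; exists (Num.min (u - (t - d)) (t + e / 2 - u)); first by rewrite /= lt_min; lra.
    by move=> w; rewrite -ball_normE /= lt_min !ltr_norml => hw; right; lra.
  - move=> u w Ju Jw z /andP[uz zw]; have [Iz|nIz] := pselect (I z); first by left.
    right; case: Ju Jw => [Iu|[u1 u2]] [Iw|[w1 w2]].
    + by exfalso; apply: nIz; apply: (iI _ _ Iu Iw); rewrite uz.
    + have zb : b <= z by rewrite leNgt; apply/negP => zb; apply: nIz; exact: (inI u).
      by lra.
    + exfalso; apply: nIz; have [tz|tz] := leP t z; first by apply: (inI t) => //; apply: le_lt_trans zw _; exact: Ib.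
      by apply: (inI t0) => //; lra.
    + by lra.
  - move=> u Ju; have [ut|tu] := ltP u t.
      have Iu : I u by case: Ju => // -[u1 u2]; apply: (inI t0) => //; lra.
      apply: (@vertical_local c dd u (t - u)); [exact: vcI|by rewrite subr_gt0|].
      by move=> w hw; rewrite /dd ifT//; move: hw; rewrite ltr_norml; lra.
    have ue : u < t + e / 2 by case: Ju => [/Ib ub|[_ //]]; lra.
    apply: (@vertical_local l dd u d); [by apply: vl; rewrite ltr_norml; lra|by []|].
    move=> w hw; rewrite /dd; case: ltP => // wt; apply: cl; move: hw; rewrite !ltr_norml; lra.
have JI : J = I.
  by apply: (maxI _ _ J_vc) => [u Iu|u /ddc //]; left.
by apply: notb; rewrite -JI; right; lra.
Qed.

Lemma trajectory_opp I c : trajectory q I c -> trajectory q [set t | I (0 - t)] (fun t => c (0 - t)).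
Proof.
have key J d : vertical_curve q J d -> vertical_curve q [set t | J (0 - t)] (fun t => d (0 - t)).
  move=> [[u Ju] oJ iJ vJ]; split.
  - by exists (- u); rewrite /= sub0r opprK.
  - have cN : continuous (fun t : R => 0 - t) by move=> t; apply: (@cvgB R); [exact: cvg_cst|exact: cvg_id].
    exact: (open_comp (fun x _ => cN x) oJ).
  - by move=> x y Jx Jy z /andP[xz zy]; apply: (iJ _ _ Jy Jx); lra.
  - by move=> t Jt; apply: vertical_opp; exact: vJ.
have N2 (t : R) : 0 - (0 - t) = t by rewrite !sub0r opprK.
move=> [vI maxI]; split; first exact: key.
move=> J d vJ IJ dc; have := maxI _ _ (key _ _ vJ) _ _ => H.
have {}H : [set t | J (0 - t)] = I.
  apply: H => [t It|t It]; first by apply: IJ; rewrite /= N2.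
  by rewrite dc /= N2.
by apply/seteqP; split => t /=; [move=> Jt; rewrite -H /= N2|rewrite -{1}H /= N2].
Qed.

Lemma trajectory_complete I c t0 : trajectory q I c -> I t0 -> f (c t0) = v -> I = setT.
Proof.
move=> tI It0 ft0; have [[_ _ iI _] _] := tI; apply/seteqP; split => // t _.
have up M : exists2 s, I s & M < s.
  apply: contrapT => H; apply: (trajectory_unbounded (M := M) tI It0 ft0) => s Is.
  by rewrite leNgt; apply/negP => Ms; apply: H; exists s.
have dn M : exists2 s, I s & s < M.
  apply: contrapT => H; have := @trajectory_unbounded _ _ (0 - t0) (- M) (trajectory_opp tI).
  rewrite /= !sub0r opprK => /(_ It0 ft0); apply => s; rewrite sub0r => Is.
  by rewrite leNgt; apply/negP => Ms; apply: H; exists (- s) => //; rewrite ltrNl.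
have [s Is ts] := up t; have [s' Is' s't] := dn t.
by apply: (iI _ _ Is' Is); rewrite !ltW.
Qed.

(** Integer times make two visits to the box at least 1 apart. On the box the level is a single
    vertical line, so shifting the first time n to n' makes the positions at n' and m equal; the
    remaining question is the direction of passage. *)
Lemma trajectory_periodic c : trajectory q setT c -> f (c 0) = v ->
  exists2 T, 0 < T & forall t, c (t + T) = c t.
Proof.
move=> [vI _] f0; have [_ _ _ vc0] := vI; have vc t : vertical_at q c t by exact: vc0.
have fv t : f (c t) = v by exact: (f_const_curve vI I I f0).
pose F : set_system S := (fun n : nat => c n%:R) @ \oo.
have FF : ProperFilter F by exact: fmap_proper_filter.
have [|i [P [h [x [N [Y [e [r [clx fx B fB]]]]]]]]] := @cluster_level F FF.
  by exists 0%N => // n _; exact: fv.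
have e0 := box_e B.
(* d <= e / 8 leaves room in the box to compare the two passages, and d <= 1 / 8 gives |n' - n| <
   1/4, less than m - n. *)
pose d := Num.min (e / 8) (1 / 8); have d0 : 0 < d by rewrite lt_min !divr_gt0.
have de : d <= e / 8 by rewrite ge_min lexx.
have d8 : d <= 1 / 8 by rewrite ge_min lexx orbT.
move: d d0 de d8 => d d0 de d8.
have visit k : exists2 n, (k <= n)%N & N (c n%:R) /\ nc (P (rmap i (c n%:R)) - P (rmap i x)) < d.
  have [y [[n kn <-] hy]] : [set c n%:R | n in [set n | (k <= n)%N]] `&`
      [set y | N y /\ nc (P (rmap i y) - P (rmap i x)) < d] !=set0.
    by apply: clx; [exists k => // n /= kn; exists n|exact: (box_small B d0)].
  by exists n.
have [n _ [Nn Zn]] := visit 0%N; have [m nm [Nm Zm]] := visit n.+1.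
pose al := complex.Im (P (rmap i (c n%:R)) - P (rmap i x)).
pose be := complex.Im (P (rmap i (c m%:R)) - P (rmap i x)).
have ald : `|al| < d by exact: le_lt_trans (Im_le_nc _) Zn.
have bed : `|be| < d by exact: le_lt_trans (Im_le_nc _) Zm.
have ZmE : P (rmap i (c m%:R)) = P (rmap i (c n%:R)) + (be - al)%:C * 'i.
  apply: complex_eq; rewrite ?ReD ?ImD /= ?mulr0 ?mul0r ?mulr1 ?subrr ?addr0.
    by rewrite -!fB// !fv.
  by rewrite /be /al !ImB; ring.
have big : 0 < (m%:R - n%:R : R) - 1 / 2.
  by have : n%:R + 1 <= m%:R :> R by [rewrite natr1 ler_nat]; lra.
have lnorm (s u : R) : s = 1 \/ s = -1 -> nc ((s * u)%:C * 'i) = `|u|.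
  move=> sE; rewrite ncM nc_real normrM; have -> : nc ('i : R[i]) = 1 by rewrite /= expr0n expr1n add0r sqrtr1.
  by case: sE => ->; rewrite ?normrN normr1 mul1r mulr1.
(* Near every time T at which c T lies well inside the box, c runs along the
   vertical line through c T during a time longer than the size of the box. *)
have follow (T : R) : N (c T) -> nc (P (rmap i (c T)) - P (rmap i x)) < e / 2 -> exists2 s : R, s = 1 \/ s = -1 &
    forall t, `|t - T| < e / 2 -> c t = Y (P (rmap i (c T)) + (s * (t - T))%:C * 'i).
  move=> NT ZT; have [dd [s [dd0 _ sE hc]]] := straight B (ltr01) (fun t _ => vc t) NT.
  exists s => // t ht; pose l u := Y (P (rmap i (c T)) + (s * (u - T))%:C * 'i).
  apply: (@vertical_unique c l (T - e / 2) (T + e / 2) T dd) => //; try lra.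
  - move=> u hu; split => //; apply: (line_vertical B sE).
    rewrite addrAC; apply: le_lt_trans (ncD _ _) _; rewrite lnorm//.
    by have : `|u - T| < e / 2 by [rewrite ltr_norml; lra]; lra.
  - by move=> u /hc[Nu Zu]; rewrite /l -Zu (box_inv B Nu).
  - by move: ht; rewrite ltr_norml; lra.
have Zn2 : nc (P (rmap i (c n%:R)) - P (rmap i x)) < e / 2 by lra.
have Zm2 : nc (P (rmap i (c m%:R)) - P (rmap i x)) < e / 2 by lra.
have [s sE hn] := follow _ Nn Zn2; have [s' sE' hm] := follow _ Nm Zm2.
have ss : s * s = 1 by case: sE => ->; ring.
pose n' : R := n%:R + s * (be - al).
have ba : `|be - al| < 2 * d by apply: le_lt_trans (ler_normB _ _) _; lra.
have sba : `|s * (be - al)| = `|be - al| by rewrite normrM; case: sE => ->; rewrite ?normrN normr1 mul1r.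
have n'n : `|n' - n%:R| < 2 * d by rewrite /n' addrC addKr sba.
pose tau := s * s'; have tauE : tau = 1 \/ tau = -1.
  by rewrite /tau; case: sE sE' => -> [] ->; rewrite ?mulrNN ?mulr1 ?mul1r ?mulrN; [left|right|right|left].
have tt : tau * tau = 1 by case: tauE => ->; ring.
have near_eq u : `|u| < e / 2 - 2 * d -> c (tau * u + n') = c (u + m%:R).
  move=> hu; have g1 : `|u + m%:R - m%:R| < e / 2 by rewrite addrK; lra.
  have g2 : `|tau * u + n' - n%:R| < e / 2.
    have -> : tau * u + n' - n%:R = tau * u + (n' - n%:R) by ring.
    apply: le_lt_trans (ler_normD _ _) _; have -> : `|tau * u| = `|u|.
      by rewrite normrM; case: tauE => ->; rewrite ?normrN normr1 mul1r.
    by lra.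
  have re : s * (tau * u + n' - n%:R) = (be - al) + s' * (u + m%:R - m%:R).
    transitivity ((s * s) * (s' * u + (be - al))); first by rewrite /n' /tau; ring.
    by rewrite ss; ring.
  by rewrite (hm _ g1) (hn _ g2) ZmE re rmorphD mulrDl addrA.
have ed0 : 0 < e / 2 - 2 * d by lra.
have glob t : c (tau * t + n') = c (t + m%:R).
  apply: (@vertical_unique (fun u => c (tau * u + n')) (fun u => c (u + m%:R)) (- (`|t| + 1)) (`|t| + 1) 0 _ _ _ ed0).
  - by rewrite oppr_lt0 andbb ltr_wpDl.
  - by move=> u _; split; [exact: vertical_affine|exact: vertical_shift].
  - by move=> u; rewrite subr0; exact: near_eq.
  - by rewrite -ltr_norml ltrDl ltr01.
have T0 : 0 < m%:R - n'.
  by have := ler_norm (n' - n%:R); lra.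
(* Same direction: m - n' is a period. Opposite directions: c would be symmetric about the time p =
   (n' + m) / 2, although it runs straight ahead in a flat box near p. *)
case: tauE => tau1.
  exists (m%:R - n') => // t; have := glob (t - n'); rewrite tau1 mul1r subrK => ->.
  by congr c; ring.
exfalso; pose p := (n' + m%:R) / 2.
have refl u : c (p - u) = c (p + u).
  have := glob ((n' - m%:R) / 2 + u); rewrite tau1 => g.
  by transitivity (c (-1 * ((n' - m%:R) / 2 + u) + n')); [|rewrite g]; congr c; rewrite /p; field.
have [i' [P' [h' [N' [Y' [e' [r' B']]]]]]] := vertical_flat (vc p).
have [dd [s2 [dd0 _ sE2 hc]]] := straight B' (ltr01) (fun t _ => vc t) (box_x B').
have h1 : `|p - dd / 2 - p| < dd by rewrite addrAC subrr sub0r normrN gtr0_norm ?divr_gt0// ltr_pdivrMr// ltr_pMr// ltr1n.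
have h2 : `|p + dd / 2 - p| < dd by rewrite addrAC subrr add0r gtr0_norm ?divr_gt0// ltr_pdivrMr// ltr_pMr// ltr1n.
have [_ Z1] := hc _ h1; have [_ Z2] := hc _ h2.
move: Z1; rewrite refl Z2 => /addrI/(congr1 (@complex.Im R)).
rewrite /= !mulr1 !mul0r !addr0; case: sE2 => ->; lra.
Qed.

End Trajectories.

(** * Null levels, finiteness of zeros and the Jenkins-Strebel property *)

Section JenkinsStrebel.
Context {R : realType}.

Lemma last_zero (g : R -> R) p r : p <= r -> (forall t, p <= t <= r -> {for t, continuous g}) -> g p = 0 ->
  exists al, [/\ p <= al <= r, g al = 0 & forall t, al < t <= r -> g t != 0].
Proof.
move=> pr cg gp; pose A := [set t | p <= t <= r /\ g t = 0].
have hA : has_sup A by split; [exists p; split; rewrite ?lexx|exists r => t [/andP[]]].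
have Ap : A p by split; rewrite ?lexx.
have al1 : p <= sup A by apply: ub_le_sup => //; have [] := hA.
have al2 : sup A <= r by apply: ge_sup; [exists p|move=> t [/andP[]]].
exists (sup A); split; first by rewrite al1.
- apply/eqP/negPn/negP => g0.
  have d0 : 0 < `|g (sup A)| by rewrite normr_gt0.
  have ca : {for sup A, continuous g} by apply: cg; rewrite al1.
  move/cvgrPdist_lt: ca => /(_ _ d0)/nbhs_ballP[e /= e0 he].
  have [t [ht gt] te] := sup_adherent e0 hA.
  have ts : t <= sup A by apply: ub_le_sup; [have [] := hA|].
  have := he t; rewrite -ball_normE /= ger0_norm ?subr_ge0// gt subr0 ltxx => H.
  by have /H : sup A - t < e by lra.
move=> t /andP[t1 t2]; apply/eqP => gt; have : A t by split=> //; lra.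
by move=> /(ub_le_sup (proj2 hA)); rewrite leNgt t1.
Qed.

Lemma unit_slope_gap (s a l v w : R) : s = 1 \/ s = -1 -> 0 < l -> l < a ->
  v = 0 \/ v = a -> w = 0 \/ w = a -> s * l = w - v -> False.
Proof. by move=> [] -> l0 la [] -> [] -> E; move: E l0 la; lra. Qed.

Lemma negligible_seq (T : eqType) (A : T -> set (@plane R)) (s : seq T) :
  (forall w, w \in s -> plane_measure.-negligible (A w)) ->
  plane_measure.-negligible [set p | exists2 w, w \in s & A w p].
Proof.
elim: s => [|w s IH] h.
  by apply: (negligibleS _ (negligible_set0 _)) => p [].
have h1 := h w (mem_head _ _); have h2 : plane_measure.-negligible [set p | exists2 w, w \in s & A w p].
  by apply: IH => w' ws; apply: h; rewrite inE ws orbT.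
apply: (negligibleS _ (negligibleU h1 h2)) => p [w']; rewrite inE => /orP[/eqP -> ?|ws' ?]; [by left|by right; exists w'].
Qed.

Context (S : riemannSurface R) (q : quad_diff S).
Variables (f : S -> R) (a : R).
Hypothesis a0 : 0 < a.
Hypothesis fc : continuous f.
Hypothesis f_flat : forall x i, rdom i x -> coef q i x != 0 -> f x <> 0 -> f x <> a ->
  exists P h r, flat_at q i x P h r /\
    forall z, nc (z - rmap i x) < r -> f (chart_inv (rs_chart i) z) = complex.Re (P z).
Hypothesis f_int : forall O : set S, open O -> O !=set0 -> (forall y, O y -> f y = 0 \/ f y = a) ->
  exists y i, [/\ O y, rdom i y & coef q i y = 0].
Hypothesis compactS : compact [set: S].

Section ExtremalLevel.
Variables (i : rs_idx S) (P h : Cplx R -> Cplx R) (x : S) (N : set S) (Y : Cplx R -> S) (e r : R).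
Hypothesis B : box q i P h x N Y e r.
Let W0 : Cplx R := P (rmap i x).
Let g (W : Cplx R) : R := f (Y W).
Let ext (W : Cplx R) := g W = 0 \/ g W = a.
Let inb (d : R) (W : Cplx R) := `|complex.Re W - complex.Re W0| < d /\ `|complex.Im W - complex.Im W0| < d.
Variable d : R.
Hypothesis (d0 : 0 < d) (de : 2 * d <= e) (da : 2 * d <= a).

Let inb_nc W : inb d W -> nc (W - W0) < e.
Proof. by move=> [h1 h2]; apply: le_lt_trans (nc_le_ReIm _) _; rewrite ReB ImB; have de1 := de; lra. Qed.

Let g_cts W : inb d W -> {for W, continuous g}.
Proof. by move=> /inb_nc/(box_Ycts B) cY; apply: (continuous_comp cY); exact: fc. Qed.

(** A non-extremal value at one point would be the value on the whole vertical segment, by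
    [f_const]. *)
Let vertical_ext u y y' : inb d (u +i* y) -> inb d (u +i* y') -> ext (u +i* y) -> ext (u +i* y').
Proof.
move=> b1 b2 E1; apply: contrapT => nE; pose c t := Y ((u +i* 0) + (1 * (t - 0))%:C * 'i).
have cE t : c t = Y (u +i* t).
  by congr Y; apply: complex_eq; rewrite ?ReD ?ImD /=; ring.
move: b1 b2; rewrite /inb /= !ltr_norml => -[h1 h2] [_ h3].
have bd t : complex.Im W0 - d < t < complex.Im W0 + d -> inb d (u +i* t).
  by move=> ht; rewrite /inb /= !ltr_norml; split; lra.
have vc t : complex.Im W0 - d < t < complex.Im W0 + d -> vertical_at q c t.
  move=> ht; apply: (line_vertical B); first by left.
  have -> : (u +i* 0) + (1 * (t - 0))%:C * 'i = u +i* t :> Cplx R.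
    by apply: complex_eq; rewrite ?ReD ?ImD /=; ring.
  by apply: inb_nc; exact: bd.
have [f0 fa] : f (c y') <> 0 /\ f (c y') <> a by rewrite cE; split => E2; apply: nE; [left|right].
have b1' : complex.Im W0 - d < y' < complex.Im W0 + d by move: h3; lra.
have b2' : complex.Im W0 - d < y < complex.Im W0 + d by move: h2; lra.
have := f_const fc f_flat b1' vc f0 fa b2'; rewrite !cE -/(g _) -/(g _) => H.
by apply: nE; case: E1; rewrite /ext H; [left|right].
Qed.

(** Off the extremal levels f is Re P2 for a second natural coordinate P2, whose derivative with
    respect to the coordinate of the box is 1 or -1. *)
Let dg u y : inb d (u +i* y) -> ~ ext (u +i* y) -> exists2 s : R, s = 1 \/ s = -1 &
  is_derive u 1 (fun u => g (u +i* y)) s.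
Proof.
move=> b1 nE; have hW := inb_nc b1; have [NY ZY] := box_Y B hW; have [dY _ _] := box_dom B NY.
have [_ hn hsq] := box_h B NY.
have q0 : coef q i (Y (u +i* y)) != 0 by rewrite -hsq expf_neq0.
have f0 : f (Y (u +i* y)) <> 0 by move=> E; apply: nE; left.
have fa : f (Y (u +i* y)) <> a by move=> E; apply: nE; right.
have [P2 [h2 [r2 [[_ [r20 fl2] fh2] fP2]]]] := f_flat dY q0 f0 fa.
set x' := Y (u +i* y) in dY hn hsq q0 fl2 fP2 fh2.
have xx : nc (rmap i x' - rmap i x') < r2 by rewrite subrr nc0.
have [dP2 _ _] := fl2 _ xx; have [_ h2sq] := fh2 _ xx; rewrite rmapK// in h2sq.
have dl : rcdiff (hseg y) u 1 := rcdiff_hseg y u.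
have dRY := rcdiff_comp dl (box_Yd B hW).
have dd := rcdiff_comp dRY dP2.
have [|s sE hs] := @cplx_sqr_eq R (h2 (rmap i x') * ((h (rmap i x'))^-1 * 1)) 1.
  by rewrite mulr1 exprMn exprVn hsq h2sq expr1n divff.
rewrite [X in rcdiff _ _ X]hs mulr1 in dd; have /rcdiffP[dR _] := dd.
exists s => //; apply: (@is_derive_local _ _ _ _ _ dR).
have cc : {for u, continuous (fun t => rmap i (Y (hseg y t)))} := rcdiff_cts dRY.
have /cvg_cplxP/(_ _ r20) n1 := cc.
have cY : {for u, continuous (fun t => Y (hseg y t))} := continuous_comp (rcdiff_cts dl) (box_Ycts B hW).
have n2 : \forall t \near u, rdom i (Y (hseg y t)).
  by apply: cY; apply: (open_nbhs_nbhs (conj (@rdom_open R S i) dY)).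
have [e1 /= e10 he] := iffLR (nbhs_ballP (u : R) _) (filterI n1 n2).
exists e1 => // t; rewrite distrC => ht; have [|h1 h3] := he t; first by rewrite -ball_normE.
by rewrite /g -/(hseg y t) -fP2// rmapK.
Qed.

(** Otherwise there is a horizontal interval [r1, r2] with extremal ends; it contains a regular
    point r0, as [f_int] would give a zero of q in the box. Between the extremal points next to r0
    on both sides, the mean value theorem yields a slope 1 or -1 on an interval shorter than a. *)
Lemma extremal_line W : inb d W -> ext W0 -> ext W -> complex.Re W = complex.Re W0.
Proof.
move=> bW E0 E1; apply: contrapT => ne; have d1 := d0.
pose y0 := complex.Im W0; pose G u := g (u +i* y0).
have W0E : complex.Re W0 +i* y0 = W0 by rewrite /y0; case: W0.
have EG0 : ext (complex.Re W0 +i* y0) by rewrite W0E.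
have bW1 : inb d (complex.Re W +i* y0) by have [h1 _] := bW; split; rewrite //= subrr normr0.
have EG1 : ext (complex.Re W +i* y0).
  by apply: (vertical_ext (y := complex.Im W)) => //; rewrite (_ : _ +i* _ = W)//; case: (W).
have [r1 [r2 [r12 b1 b2 E1' E2']]] : exists r1 r2, [/\ r1 < r2, `|r1 - complex.Re W0| < d, `|r2 - complex.Re W0| < d, ext (r1 +i* y0) & ext (r2 +i* y0)].
  have [h1 _] := bW; have [hh|hh] := ltP (complex.Re W0) (complex.Re W).
    by exists (complex.Re W0), (complex.Re W); rewrite subrr normr0.
  by exists (complex.Re W), (complex.Re W0); rewrite subrr normr0 lt_neqAle hh andbT; split => //; apply/eqP.
move: b1 b2; rewrite !ltr_norml => b1 b2.
have bd u t : r1 <= u <= r2 -> `|t - y0| < d -> inb d (u +i* t).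
  by move=> hu ht; split => //=; rewrite ltr_norml; lra.
have yy : `|y0 - y0| < d by rewrite subrr normr0.
have [r0 hr nE] : exists2 r0, r1 < r0 < r2 & ~ ext (r0 +i* y0).
  apply: contrapT => H.
  have allE u t : r1 < u < r2 -> `|t - y0| < d -> ext (u +i* t).
    move=> hu ht; have bu := bd u t (ltac:(lra)) ht; have bu0 := bd u y0 (ltac:(lra)) yy.
    by apply: (vertical_ext bu0 bu); apply: contrapT => nE; apply: H; exists u.
  pose O := [set y : S | N y /\ (r1 < complex.Re (P (rmap i y)) < r2 /\ `|complex.Im (P (rmap i y)) - y0| < d)].
  have [||y Oy|y [j [[Ny _] dy qy]]] := f_int (O := O).
  - rewrite openE => y [Ny [/andP[h1 h2] h3]]; rewrite /interior /=.
    have n1 : nbhs y N by apply: (open_nbhs_nbhs (conj (box_open B) Ny)).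
    have cZ := box_cts B Ny.
    have m0 : 0 < Num.min (complex.Re (P (rmap i y)) - r1) (Num.min (r2 - complex.Re (P (rmap i y))) (d - `|complex.Im (P (rmap i y)) - y0|)).
      by rewrite !lt_min !subr_gt0 h1 h2.
    have /cvg_cplxP/(_ _ m0) n2 := cZ.
    apply: filterS2 n1 n2 => y' Ny'; rewrite !lt_min => /andP[g1 /andP[g2 g3]]; split => //.
    have k1 := le_lt_trans (Re_le_nc _) g1; have k2 := le_lt_trans (Re_le_nc _) g2; have k3 := le_lt_trans (Im_le_nc _) g3.
    rewrite ReB ltr_norml in k1; rewrite ReB ltr_norml in k2; rewrite ImB in k3; split; first by lra.
    by have := ler_distD (complex.Im (P (rmap i y))) (complex.Im (P (rmap i y'))) y0; lra.
  - pose W1 := ((r1 + r2) / 2) +i* y0; have bW2 : inb d W1 by apply: bd => //; lra.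
    have [NW ZW] := box_Y B (inb_nc bW2).
    by exists (Y W1); split => //; rewrite ZW /= subrr normr0; split => //; lra.
  - have [Ny [h1 h2]] := Oy; have := allE _ _ h1 h2; rewrite /ext /g.
    by rewrite (_ : _ +i* _ = P (rmap i y)) ?(box_inv B)//; case: (P _).
  - have [dy' _ _] := box_dom B Ny; have [_ hn hsq] := box_h B Ny.
    have : coef q j y != 0 by apply: (coef_neq0 dy' dy); rewrite -hsq expf_neq0.
    by rewrite qy eqxx.
have Gc u : r1 <= u <= r2 -> {for u, continuous G}.
  move=> hu; apply: (@continuous_comp _ _ _ (hseg y0) g u); first exact: rcdiff_cts (rcdiff_hseg y0 u).
  by apply: g_cts; exact: bd.
pose k u := G u * (G u - a).
have kE u : k u = 0 <-> ext (u +i* y0).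
  rewrite /k /ext; split=> [/eqP|].
    by rewrite /G mulf_eq0 subr_eq0 => /orP[]/eqP ->; [left|right].
  by rewrite /G => -[->|->]; rewrite ?mul0r ?subrr ?mulr0.
have kc u : r1 <= u <= r2 -> {for u, continuous k}.
  by move=> hu; apply: (@cvgM R); [exact: Gc|apply: (@cvgB R); [exact: Gc|exact: cvg_cst]].
have [|u hu||al [hal kal nal]] := @last_zero k r1 r0; [lra|by apply: kc; lra|exact/kE|].
(* By reflection, -be is the first zero of k after r0. *)
have [|u hu||be [hbe kbe nbe]] := @last_zero (fun u => k (- u)) (- r2) (- r0); first by lra.
- have cN : {for u, continuous (fun u : R => - u)} by apply: (@cvgN R); exact: cvg_id.
  by apply: (continuous_comp cN); apply: kc; lra.
- by rewrite opprK; exact/kE.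
have al_r0 : al < r0.
  rewrite lt_neqAle; apply/andP; split; last by lra.
  by apply/eqP => E; apply: nE; apply/kE; rewrite -E.
have be_r0 : r0 < - be.
  rewrite lt_neqAle; apply/andP; split; last by lra.
  by apply/eqP => E; apply: nE; apply/kE; rewrite E.
have nEu u : al < u < - be -> ~ ext (u +i* y0).
  move=> hu /kE k0; have [h1|h1] := leP u r0.
    by have := nal u; rewrite k0 eqxx => H; have : false by apply: H; lra.
  by have := nbe (- u); rewrite opprK k0 eqxx => H; have : false by apply: H; lra.
have dG u : al < u < - be -> exists2 s : R, s = 1 \/ s = -1 & is_derive u 1 G s.
  by move=> hu; apply: dg; [apply: bd => //; lra|exact: nEu].
have albe : al < - be by lra.
have [||c] := @MVT R G (derive1 G) al (- be) albe.
- move=> u; rewrite in_itv/= => /dG[s _ ds]; rewrite derive1E; apply: DeriveDef; last by [].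
  by have [] := ds.
- by apply: continuous_in_subspaceT => u; rewrite inE/= in_itv/= => hu; apply: Gc; lra.
rewrite in_itv/= => /dG[s sE ds]; rewrite derive1E (@derive_val _ _ _ _ _ _ _ ds) => GE.
have /kE e1 := kal; have /kE e2 := kbe; have a1 := a0; have da1 := da.
move: e1 e2 GE; rewrite /ext -/(G _) -/(G _).
have lt_d : - be - al < a by lra.
have al0 : 0 < - be - al by rewrite subr_gt0.
by move=> X1 X2 /esym E; exact: (unit_slope_gap sE al0 lt_d X1 X2 E).
Qed.

End ExtremalLevel.

(** By [lindelof_null] the question is local, and near a point the level lies in a level of Re P for
    a natural coordinate P: by [f_flat] off the extremal values, by [extremal_line] on them. *)
Lemma level_set_null (w : R) i : plane_measure.-negligible
  [set p : @plane R | exists x, [/\ rdom i x, coef q i x != 0, f x = w & rmap i x = cplx_of p]].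
Proof.
apply: lindelof_null => p [x [dx q0 fx xp]].
have fin P h r1 (d : R) : flat_at q i x P h r1 -> 0 < d ->
    (forall x', rdom i x' -> nc (rmap i x' - rmap i x) < d -> f x' = w -> complex.Re (P (rmap i x')) = complex.Re (P (rmap i x))) ->
    exists2 r : R, 0 < r & plane_measure.-negligible [set p' : @plane R | [/\ exists x, [/\ rdom i x, coef q i x != 0, f x = w & rmap i x = cplx_of p'],
      `|p'.1 - p.1| < r & `|p'.2 - p.2| < r]].
  move=> [_ fl _] dd hd; have [s s0 ns] := level_null (complex.Re (P (rmap i x))) fl.
  have m0 : 0 < Num.min s d by rewrite lt_min s0.
  exists (Num.min s d / 2); first by rewrite divr_gt0.
  apply: (negligibleS _ ns) => p' [[x' [dx' _ fx' xp']] h1 h2].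
  have : nc (cplx_of p' - rmap i x) < Num.min s d.
    by rewrite xp; apply: le_lt_trans (nc_le_ReIm _) _; rewrite ReB ImB /=; lra.
  by rewrite lt_min => /andP[g1 g2]; split => //; rewrite -xp'; apply: hd; rewrite ?xp'.
have [w0|w0] := pselect (w = 0 \/ w = a); last first.
  have f0 : f x <> 0 by rewrite fx => E; apply: w0; left.
  have fa : f x <> a by rewrite fx => E; apply: w0; right.
  have [P [h [r1 [fl fP]]]] := f_flat dx q0 f0 fa.
  have [_ [r10 _] _] := fl.
  apply: (fin P h r1 r1 fl r10) => x' dx' hx' fx'.
  by rewrite -fP// -fP ?subrr ?nc0// !rmapK// fx'.
have [P [h [r1 fl]]] := flat_ex dx q0; have [N [Y [e B]]] := box_ex fl.
have e0 := box_e B; pose d := Num.min (e / 2) (a / 2).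
have d0 : 0 < d by rewrite lt_min !divr_gt0.
have de : 2 * d <= e by have : d <= e / 2 by [rewrite ge_min lexx]; lra.
have da : 2 * d <= a by have : d <= a / 2 by [rewrite ge_min lexx orbT]; lra.
have cP : {for rmap i x, continuous P}.
  by have [_ [r10 fl'] _] := fl; have [dP _ _] := fl' (rmap i x) (ltac:(by rewrite subrr nc0)); exact: cdiff_cts dP.
have /cvg_cplxP/(_ _ d0)/cplx_nbhsP[d2 d20 hd2] := cP.
have nN : nbhs x N by apply: (open_nbhs_nbhs (conj (box_open B) (box_x B))).
have ci_cts : {for rmap i x, continuous (chart_inv (rs_chart i))} by apply: chart_inv_cts; exists x.
have : nbhs (rmap i x) [set z | N (chart_inv (rs_chart i) z)] by apply: ci_cts; rewrite rmapK.
move=> /cplx_nbhsP[d3 d30 hd3].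
apply: (fin P h r1 (Num.min d2 d3) fl); first by rewrite lt_min d20.
move=> x' dx'; rewrite lt_min => /andP[/hd2 g2 /hd3 g3] fx'; rewrite /= rmapK// in g3.
apply: (@extremal_line i P h x N Y e r1 B d d0 de da).
- by split; rewrite -?ReB -?ImB; apply: le_lt_trans g2; [exact: Re_le_nc|exact: Im_le_nc].
- by rewrite (box_inv B (box_x B)) fx.
- by rewrite (box_inv B g3) fx'.
Qed.

Let vanish y := forall i, rdom i y -> coef q i y = 0.

Lemma zero_isolated x : (\forall y \near x, vanish y) \/ (\forall y \near x, y <> x -> ~ vanish y).
Proof.
have [i di] := rs_cover x; have [r r0 hr] := coef_hol q di.
have pull (e : R) : 0 < e -> \forall y \near x, rdom i y /\ nc (rmap i y - rmap i x) < e.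
  move=> e0; have n1 : nbhs x (rdom i) by apply: (open_nbhs_nbhs (conj (@rdom_open R S i) di)).
  have /cvg_cplxP/(_ _ e0) n2 := rmap_cts di; by apply: filterS2 n1 n2.
case: (hol_zeros r0 hr) => -[e e0 he]; [left|right]; apply: filterS (pull e e0) => y [dy hy].
  move=> j dj; have qi := he _ hy; rewrite rmapK// in qi.
  by apply/eqP/negPn/negP => qj; have := coef_neq0 dj dy qj; rewrite qi eqxx.
move=> yx vy; apply: (he _ hy); last by rewrite rmapK// vy.
by move=> E; apply: yx; rewrite -(rmapK dy) E rmapK.
Qed.

Lemma flat_JS : JS S q.
Proof.
pose Z0 := [set x : S | \forall y \near x, vanish y].
(* If the zeros of q have an interior point, q = 0 by connectedness; stated as an implication, the
   case includes an empty surface. *)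
have [Z0E|nZ'] := pselect ([set: S] !=set0 -> Z0 !=set0).
  left; have ZT : Z0 = setT.
    have [[x0 Zx0]|n0] := pselect (Z0 !=set0); last first.
      by apply/seteqP; split => // x _; exfalso; apply/n0/Z0E; exists x.
    apply: (@rs_connected R S); first by exists x0.
    - exists Z0; last by rewrite setTI.
      by rewrite openE => x Zx; exact: near_join.
    - exists Z0; last by rewrite setTI.
      rewrite -openC openE => x nZx; rewrite /interior /=.
      case: (zero_isolated x) => // nx; apply: filterS nx => y hy Zy.
      have vy : vanish y by exact: nbhs_singleton Zy.
      by have [yx|yx] := pselect (y = x); [apply: nZx; rewrite -yx|exact: hy yx vy].
  apply: val_inj; apply/funext => i; apply/funext => x /=.
  have [off _ _] := set_mem (valP q).
  have [dx|ndx] := pselect (rdom i x); last exact: off.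
  have : Z0 x by rewrite ZT.
  by move=> /nbhs_singleton/(_ i dx).
have nZ : ~ (Z0 !=set0) by move=> Z0E; apply: nZ'.
pose A x := [set y : S | y <> x -> ~ vanish y].
have nA x : nbhs x (A x) by case: (zero_isolated x) => // h; exfalso; apply: nZ; exists x.
(* If the zeros were infinitely many, the sets containing all but finitely many of them would form a
   proper filter, and a cluster point would be approached by zeros other than itself. *)
have [D zerosD] : exists D : seq S, forall y, vanish y -> y \in D.
  apply: contrapT => nD; pose F : set_system S := [set B | exists D : seq S, forall y, vanish y -> y \notin D -> B y].
  have FF : ProperFilter F.
    split; last split.
    - move=> [D hD]; apply: nD; exists D => y vy; apply/negPn/negP => /(hD _ vy).
      by [].
    - by exists [::].
    - move=> B C [D hD] [E hE]; exists (D ++ E) => y vy; rewrite mem_cat negb_or => /andP[? ?].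
      by split; [exact: hD|exact: hE].
    - by move=> B C BC [D hD]; exists D => y vy yD; exact/BC/hD.
  have [x [_ clx]] := compactS FF filterT.
  have Fx : F [set y | vanish y /\ y <> x] by exists [:: x] => y vy; rewrite inE => /eqP.
  by have [y [[vy yx] Ay]] := clx _ _ Fx (nA x); exact: Ay yx vy.
right; split.
  by move=> q0; apply: nZ' => -[x _]; exists x; apply: nearW => y i _; rewrite q0.
move=> i; pose s := 0 :: a :: [seq f y | y <- D].
apply: (negligibleS _ (@negligible_seq R _ s (fun w _ => level_set_null w i))).
move=> p [x [[I [c [tI nclosed [t It ctx]]]] dx xp]].
have [[_ _ _ vI] _] := tI; have qx : coef q i x != 0 by rewrite -ctx; apply: vertical_neq0; [exact: vI|rewrite ctx].
have [fs|fs] := boolP (f x \in s); first by exists (f x) => //; exists x.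
exfalso; apply: nclosed; move: fs; rewrite !inE !negb_or => /and3P[/eqP v0 /eqP va vD].
have vn y j : f y = f x -> rdom j y -> coef q j y != 0.
  move=> fy dy; apply/eqP => qy; move/negP: vD; apply; apply/mapP; exists y => //.
  by apply: zerosD => k dk; apply/eqP/negPn/negP => qk; have := coef_neq0 dk dy qk; rewrite qy eqxx.
have fct : f (c t) = f x by rewrite ctx.
have IT : I = setT := trajectory_complete fc f_flat compactS v0 va vn tI It fct.
split => //; rewrite IT in tI; apply: (trajectory_periodic fc f_flat compactS v0 va vn tI).
by apply: (f_const_curve fc f_flat v0 va (proj1 tI) (t0 := t)).
Qed.

End JenkinsStrebel.

(** * Coverings *)

Section Gluing.
Context {R : realType}.

Lemma continuous_glue (A T : topologicalType) (f1 f2 : A -> T) (phi : A -> R) (m : R) :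
  continuous f1 -> continuous f2 -> continuous phi -> (forall a, phi a = m -> f1 a = f2 a) ->
  continuous (fun a => if phi a <= m then f1 a else f2 a).
Proof.
move=> c1 c2 cp E a B /=; have [h|h|h] := ltgtP (phi a) m => nB.
- have n : \forall b \near a, phi b < m by apply: (cp a [set t | t < m]); exact: lt_nbhsl.
  by apply: filterS2 n (c1 a B nB) => b hb; rewrite /= ltW.
- have n : \forall b \near a, m < phi b by apply: (cp a [set t | m < t]); exact: lt_nbhsr.
  by apply: filterS2 n (c2 a B nB) => b hb; rewrite /= leNgt hb.
- have nB2 : nbhs (f2 a) B by rewrite -E.
  have n1 : \forall b \near a, B (f1 b) := c1 a B nB.
  have n2 : \forall b \near a, B (f2 b) := c2 a B nB2.
  by apply: filterS2 n1 n2 => b h1 h2 /=; case: ifP.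
Qed.

(** Precomposition with this retraction keeps maps defined on segments and rectangles total and
    continuous, in line with [simply_connected]. *)
Definition clip (a b t : R) : R := clamp ((a + b) / 2) ((b - a) / 2) t.

Lemma clip_in a b t : a <= b -> a <= clip a b t <= b.
Proof. by move=> ab; have := @clamp_in R ((a + b) / 2) ((b - a) / 2) t; rewrite /clip; lra. Qed.

Lemma clip_id a b t : a <= t <= b -> clip a b t = t.
Proof. by move=> h; apply: clamp_id; lra. Qed.

Lemma clip_continuous a b : a <= b -> continuous (clip a b).
Proof.
move=> ab t; apply/cvgrPdist_lt => e e0; apply/nbhs_ballP; exists e => // u tu.
by apply: le_lt_trans tu; apply: clamp_lip; lra.
Qed.

Definition concat (T : Type) (c1 c2 : R -> T) (t : R) : T := if t <= 1 / 2 then c1 (2 * t) else c2 (2 * t - 1).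

Lemma concat_continuous (T : topologicalType) (c1 c2 : R -> T) : continuous c1 -> continuous c2 -> c1 1 = c2 0 ->
  continuous (concat c1 c2).
Proof.
move=> k1 k2 E.
have l1 (t : R) : {for t, continuous (fun t : R => 2 * t)} by apply: (@cvgMr R); exact: cvg_id.
have l2 (t : R) : {for t, continuous (fun t : R => 2 * t - 1)} by apply: (@cvgB R); [exact: l1|exact: cvg_cst].
apply: (@continuous_glue R T (fun t => c1 (2 * t)) (fun t => c2 (2 * t - 1)) id) => t.
- exact: (continuous_comp (l1 t) (k1 _)).
- exact: (continuous_comp (l2 t) (k2 _)).
- exact: cvg_id.
- by move=> /= ->; rewrite (_ : 2 * (1 / 2) = 1) ?subrr//; field.
Qed.

Lemma concat0 (T : Type) (c1 c2 : R -> T) : concat c1 c2 0 = c1 0.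
Proof. by rewrite /concat mulr0 divr_ge0. Qed.

Lemma concat1 (T : Type) (c1 c2 : R -> T) : concat c1 c2 1 = c2 1.
Proof. by rewrite /concat leNgt (_ : 1 / 2 < 1) /=; [congr c2; ring|lra]. Qed.

End Gluing.

(** * Lifting of paths and homotopies, deck transformations *)

Section Lifting.
Context {R : realType} (X Y : topologicalType) (p : X -> Y).
Hypothesis cp : covering p.

Lemma sheet y : exists U : set Y, [/\ open U, U y & forall x, U (p x) -> exists (W : set X) (inv : Y -> X),
  [/\ open W, W x, forall w, W w -> U (p w) /\ inv (p w) = w,
      forall z, U z -> W (inv z) /\ p (inv z) = z & forall z, U z -> {for z, continuous inv}]].
Proof.
have [_ _ /(_ y)[U [V [oU Uy pU _ hV]]]] := cp; exists U; split => // x Ux.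
have [W VW Wx] : (\bigcup_(W in V) W) x by rewrite -pU.
have [oW iW pW opW] := hV W VW.
pose inv z := xget x [set w | W w /\ p w = z].
have invP z : U z -> W (inv z) /\ p (inv z) = z.
  by rewrite -pW => -[w Ww pw]; apply: (@xgetPex _ x [set w | W w /\ p w = z]); exists w.
have WU w : W w -> U (p w) by move=> Ww; rewrite -pW; exists w.
have invK w : W w -> inv (p w) = w.
  by move=> Ww; have [h1 h2] := invP _ (WU _ Ww); apply: iW; rewrite ?inE.
exists W, inv; split => // [w Ww|z Uz B].
  by split; [exact: WU|exact: invK].
rewrite /= nbhsE => -[V' vO OB]; case: vO => oO Oz.
have oP : open (p @` (V' `&` W)) by apply: opW; [exact: openI|move=> ? []].
have [h1 h2] := invP _ Uz.
have Pz : (p @` (V' `&` W)) z by exists (inv z).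
apply: (filterS _ (open_nbhs_nbhs (conj oP Pz))) => _ [w [Ow Ww] <-].
by rewrite /= invK//; exact: OB.
Qed.

Lemma covering_open x N : nbhs x N -> nbhs (p x) (p @` N).
Proof.
move=> nN; have [U [oU Ux /(_ x Ux)[W [inv [oW Wx hW hU ci]]]]] := sheet (p x).
have [_ ix] := hW _ Wx; have nU : nbhs (p x) U by apply: (open_nbhs_nbhs (conj oU Ux)).
have nI : \forall z \near p x, N (inv z) by apply: (ci _ Ux); rewrite ix.
by apply: filterS2 nU nI => z Uz Nz; exists (inv z) => //; have [] := hU _ Uz.
Qed.

(** Near s each of the two paths stays in one sheet; if they meet once there, disjointness makes the
    sheets equal, and p is injective on it. *)
Lemma lift_local (J : R -> Prop) (d d' : R -> X) s : J s -> {for s, continuous d} -> {for s, continuous d'} ->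
  (forall u, J u -> p (d u) = p (d' u)) -> exists2 e : R, 0 < e &
  forall u, J u -> `|u - s| < e -> d u = d' u -> forall u', J u' -> `|u' - s| < e -> d u' = d' u'.
Proof.
move=> Js cd cd' pd; have [_ _ /(_ (p (d s)))[U [V [oU Uy pU disj hV]]]] := cp.
have getW x : p x = p (d s) -> exists2 W, V W & W x.
  by move=> px; have [W VW Wx] : (\bigcup_(W in V) W) x by [rewrite -pU /= px]; exists W.
have [W VW Wd] := getW _ erefl; have [W' VW' Wd'] := getW _ (esym (pd _ Js)).
have [oW iW _ _] := hV W VW; have [oW' _ _ _] := hV W' VW'.
have n1 : \forall u \near s, W (d u) by apply: cd; apply: (open_nbhs_nbhs (conj oW Wd)).
have n2 : \forall u \near s, W' (d' u) by apply: cd'; apply: (open_nbhs_nbhs (conj oW' Wd')).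
have [e /= e0 he] := iffLR (nbhs_ballP (s : R) _) (filterI n1 n2).
have {}he u : `|u - s| < e -> W (d u) /\ W' (d' u) by move=> h; apply: he; rewrite -ball_normE /= distrC.
exists e => // u Ju /he[h1 h2] du u' Ju' /he[h3 h4].
have WW : W = W' by apply: disj => //; exists (d u); split => //; rewrite du.
by apply: iW; rewrite ?inE ?pd// WW.
Qed.

Lemma lift_fwd a b (d d' : R -> X) : a <= b -> continuous d -> continuous d' ->
  (forall t, a <= t <= b -> p (d t) = p (d' t)) -> d a = d' a -> forall t, a <= t <= b -> d t = d' t.
Proof.
move=> ab cd cd' pd da t /andP[ta tb].
have loc s : a <= s <= b -> exists2 e : R, 0 < e & forall u, a <= u <= b -> `|u - s| < e -> d u = d' u ->
    forall u', a <= u' <= b -> `|u' - s| < e -> d u' = d' u'.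
  by move=> hs; apply: (@lift_local (fun u => a <= u <= b)) => //; [exact: cd|exact: cd'].
apply: (@continuation R (fun u => u <= b -> d u = d' u) a b ab _ _ t ta tb tb).
  have aa : a <= a <= b by lra.
  have [e e0 he] := loc a aa; exists e => // u ua ue ub.
  by apply: (he a aa _ da); rewrite ?subrr ?normr0 ?ger0_norm//; lra.
move=> s as_ sb IH; have hs : a <= s <= b by lra.
have [e e0 he] := loc s hs; exists e => // u su ue ub.
pose m := Num.max a (s - e / 2); have ms : m < s by rewrite gt_max; apply/andP; split; lra.
have ma : a <= m by rewrite le_max lexx.
have mse : s - e / 2 <= m by rewrite le_max lexx orbT.
move: m ms ma mse => m ms ma mse.
apply: (he m) => //; first by lra.
- by rewrite ltr_norml; lra.
- by apply: IH; lra.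
- by lra.
- by rewrite ltr_norml; lra.
Qed.

Lemma lift_unique a b (d d' : R -> X) t0 : a <= t0 <= b -> continuous d -> continuous d' ->
  (forall t, a <= t <= b -> p (d t) = p (d' t)) -> d t0 = d' t0 -> forall t, a <= t <= b -> d t = d' t.
Proof.
move=> /andP[at0 t0b] cd cd' pd d0 t /andP[ta tb]; have [h|h] := leP t0 t.
  by apply: (lift_fwd t0b) => // [u hu|]; [apply: pd|]; lra.
have cN (u : R) : {for u, continuous (fun u : R => - u)} by apply: (@cvgN R); exact: cvg_id.
have := @lift_fwd (- t0) (- a) (fun u => d (- u)) (fun u => d' (- u)); rewrite opprK => H.
have := H _ _ _ _ d0 (- t); rewrite opprK; apply; first by lra.
- by move=> u; exact: (continuous_comp (cN u) (cd _)).
- by move=> u; exact: (continuous_comp (cN u) (cd' _)).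
- by move=> u hu; apply: pd; lra.
- by lra.
Qed.

Definition rect (a b c d : R) (z : R * R) := a <= z.1 <= b /\ c <= z.2 <= d.

(** The value is prescribed at an arbitrary point z0 of the rectangle rather than at a corner, which
    makes the property stable under gluing. *)
Definition lifts (H : R * R -> Y) a b c d := forall z0 x0, rect a b c d z0 -> p x0 = H z0 ->
  exists L : R * R -> X, [/\ continuous L, L z0 = x0 & forall z, rect a b c d z -> p (L z) = H z].

Lemma continuous_pairR (T : topologicalType) (f g : T -> R) : continuous f -> continuous g ->
  continuous (fun t => (f t, g t)).
Proof. by move=> cf cg t; exact: (cvg_pair (cf t) (cg t)). Qed.

Lemma continuous_fstR : continuous (fun z : R * R => z.1). Proof. by move=> z; exact: cvg_fst. Qed.
Lemma continuous_sndR : continuous (fun z : R * R => z.2). Proof. by move=> z; exact: cvg_snd. Qed.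

(** Lift the half containing z0, then the other half with the value found at (m, z0.2); uniqueness
    of lifts makes the two agree along the whole common side. *)
Lemma lifts_hsplit H a m b c d : a <= m -> m <= b -> c <= d -> lifts H a m c d -> lifts H m b c d -> lifts H a b c d.
Proof.
move=> am mb cd h1 h2 z0 x0 [hz1 hz2] px.
have [L1 [L2 [[c1 c2] p1 p2 agree val]]] : exists L1 L2 : R * R -> X,
    [/\ continuous L1 /\ continuous L2, forall z, rect a m c d z -> p (L1 z) = H z,
        forall z, rect m b c d z -> p (L2 z) = H z, L1 (m, z0.2) = L2 (m, z0.2) &
        (if z0.1 <= m then L1 z0 else L2 z0) = x0].
  have [hm|hm] := leP z0.1 m.
    have [|L1 [c1 v1 p1]] := h1 z0 x0 _ px; first by split => //; lra.
    have [||L2 [c2 v2 p2]] := h2 (m, z0.2) (L1 (m, z0.2)).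
    - by split => //=; lra.
    - by apply: p1; split => //=; lra.
    by exists L1, L2.
  have [|L2 [c2 v2 p2]] := h2 z0 x0 _ px; first by split => //; lra.
  have [||L1 [c1 v1 p1]] := h1 (m, z0.2) (L2 (m, z0.2)).
  - by split => //=; lra.
  - by apply: p2; split => //=; lra.
  by exists L1, L2.
have cm : continuous (fun t : R => (m, t)) by apply: continuous_pairR => t; [exact: cvg_cst|exact: cvg_id].
have side t : c <= t <= d -> L1 (m, t) = L2 (m, t).
  move=> ht; apply: (@lift_unique c d (fun t => L1 (m, t)) (fun t => L2 (m, t)) z0.2 hz2) => //.
  - by move=> u; exact: (continuous_comp (cm u) (c1 _)).
  - by move=> u; exact: (continuous_comp (cm u) (c2 _)).
  - by move=> u hu; rewrite p1 ?p2//; split => //=; lra.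
pose k (z : R * R) := (z.1, clip c d z.2).
have ck : continuous k.
  apply: continuous_pairR => z; first exact: continuous_fstR.
  exact: (continuous_comp (continuous_sndR (x := z)) (clip_continuous cd (x := _))).
exists (fun z => if z.1 <= m then L1 (k z) else L2 (k z)); split.
- apply: (@continuous_glue R _ _ (fun z => L1 (k z)) (fun z => L2 (k z)) fst) => [z|z|z|z zm].
  + exact: (continuous_comp (ck z) (c1 _)).
  + exact: (continuous_comp (ck z) (c2 _)).
  + exact: continuous_fstR.
  + by rewrite /k zm; apply: side; exact: clip_in.
- by rewrite /k clip_id// -surjective_pairing.
- move=> z [hz hz']; rewrite /k clip_id// -surjective_pairing; case: leP => hm; [apply: p1|apply: p2]; split => //; lra.
Qed.

Lemma continuous_swapR : continuous (fun z : R * R => (z.2, z.1)).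
Proof. by apply: continuous_pairR => z; [exact: continuous_sndR|exact: continuous_fstR]. Qed.

Lemma lifts_swap H a b c d : lifts (fun z => H (z.2, z.1)) c d a b -> lifts H a b c d.
Proof.
move=> h z0 x0 [r1 r2] px; have [||L [cL L0 pL]] := h (z0.2, z0.1) x0.
- by [].
- by rewrite /= -surjective_pairing.
exists (fun z => L (z.2, z.1)); split => //.
  by move=> z; exact: (continuous_comp (continuous_swapR (x := z)) (cL _)).
by move=> z [s1 s2]; rewrite pL//= -surjective_pairing.
Qed.

Lemma lifts_vsplit H a b c m d : c <= m -> m <= d -> a <= b -> lifts H a b c m -> lifts H a b m d -> lifts H a b c d.
Proof.
move=> cm md ab h1 h2; apply: lifts_swap; apply: (lifts_hsplit cm md ab).
  by apply: lifts_swap; move=> z0 x0 hz px; have := h1 z0 x0 hz; rewrite {1}[z0]surjective_pairing => /(_ px)[L [cL L0 pL]];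
    exists L; split => // z hz'; rewrite pL// {1}[z]surjective_pairing.
by apply: lifts_swap; move=> z0 x0 hz px; have := h2 z0 x0 hz; rewrite {1}[z0]surjective_pairing => /(_ px)[L [cL L0 pL]];
  exists L; split => // z hz'; rewrite pL// {1}[z]surjective_pairing.
Qed.

(** [cousin] reduces to rectangles mapped into one evenly covered set, where a local inverse of p
    lifts H. *)
Lemma lift_square H a b c d : continuous H -> a <= b -> c <= d -> lifts H a b c d.
Proof.
move=> cH ab cd; apply: (@cousin R (lifts H)) => // [a' b' c' d' ab' cd' q1 q2 q3 q4|x y hx hy].
  by apply: (@lifts_vsplit H a' b' c' ((c' + d') / 2) d'); [lra|lra|lra|apply: (@lifts_hsplit H a' ((a' + b') / 2) b')|
    apply: (@lifts_hsplit H a' ((a' + b') / 2) b')] => //; lra.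
have [U [oU Uy hU]] := sheet (H (x, y)).
have nU : nbhs (x, y) [set z | U (H z)] by apply: cH; apply: (open_nbhs_nbhs (conj oU Uy)).
have [e /= e0 he] := iffLR (nbhs_ballP ((x, y) : R * R) _) nU.
exists e => // a' b' c' d' h1 h2 h3 h4 h5 h6 h7 h8 z0 x0 hz0 px.
have inU z : rect a' b' c' d' z -> U (H z).
  by move=> [k1 k2]; apply: he; split; rewrite -ball_normE /= ltr_norml; lra.
have Ux0 : U (p x0) by rewrite px; exact: inU.
have [W [inv [oW Wx hW hUi ci]]] := hU _ Ux0.
have ab' : a' <= b' by lra.
have cd' : c' <= d' by lra.
pose k (z : R * R) := (clip a' b' z.1, clip c' d' z.2).
have kin z : rect a' b' c' d' (k z) by split; exact: clip_in.
have kid z : rect a' b' c' d' z -> k z = z by move=> [k1 k2]; rewrite /k !clip_id// -surjective_pairing.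
have ck : continuous k.
  apply: continuous_pairR => z.
    exact: (continuous_comp (continuous_fstR (x := z)) (clip_continuous ab' (x := _))).
  exact: (continuous_comp (continuous_sndR (x := z)) (clip_continuous cd' (x := _))).
exists (fun z => inv (H (k z))); split.
- move=> z; have cHk := continuous_comp (ck z) (cH _).
  exact: (continuous_comp cHk (ci _ (inU _ (kin z)))).
- by rewrite kid// -px; have [_ ->] := hW _ Wx.
- by move=> z hz; rewrite kid//; have [_ ->] := hUi _ (inU _ hz).
Qed.

Lemma lift_path (c : R -> Y) x0 : continuous c -> p x0 = c 0 -> exists d : R -> X,
  [/\ continuous d, d 0 = x0 & forall t, 0 <= t <= 1 -> p (d t) = c t].
Proof.
move=> cc px; have cH : continuous (fun z : R * R => c z.1).
  by move=> z; exact: (continuous_comp (continuous_fstR (x := z)) (cc _)).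
have [||L [cL L0 pL]] := lift_square cH ler01 (lexx (0 : R)) (z0 := (0, 0)) (x0 := x0) => //.
  by split => /=; lra.
have c0 : continuous (fun t : R => (t, 0 : R)) by apply: continuous_pairR => t; [exact: cvg_id|exact: cvg_cst].
exists (fun t => L (t, 0)); split => //.
  by move=> t; exact: (continuous_comp (c0 t) (cL _)).
by move=> t ht; rewrite pL//; split => /=; lra.
Qed.

Lemma lift_constant y (d : R -> X) : continuous d -> (forall t, 0 <= t <= 1 -> p (d t) = y) -> d 1 = d 0.
Proof.
move=> cd pd; apply: (@lift_unique 0 1 d (fun=> d 0) 0) => //; rewrite ?lexx ?ler01//.
  by move=> t; exact: cvg_cst.
by move=> t ht; rewrite !pd//; lra.
Qed.

(** A contraction of c is projected and lifted again from d 0. On the three sides where the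
    contraction is constant the lift is constant as well, so the fourth side, which is d, has equal
    ends. *)
Lemma lift_loop (c d : R -> X) : simply_connected (R := R) X -> continuous c -> c 0 = c 1 -> continuous d ->
  (forall t, 0 <= t <= 1 -> p (d t) = p (c t)) -> d 0 = d 1.
Proof.
move=> [_ _ sc] cc c01 cd pd; have [h [ch h0 h1 hs]] := sc c cc c01; have [cpp _ _] := cp.
have cH : continuous (fun z : R * R => p (h z)) by move=> z; exact: (continuous_comp (ch z) (cpp _)).
have z0 : 0 <= (0 : R) <= 1 by lra.
have z1 : 0 <= (1 : R) <= 1 by lra.
have [||L [cL L0 pL]] := lift_square cH ler01 ler01 (z0 := (0, 0)) (x0 := d 0).
- by split.
- by rewrite pd// h0.
have cv (s : R) : continuous (fun t : R => (s, t)) by apply: continuous_pairR => t; [exact: cvg_cst|exact: cvg_id].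
have cu (t : R) : continuous (fun s : R => (s, t)) by apply: continuous_pairR => s; [exact: cvg_id|exact: cvg_cst].
have cLv s : continuous (fun t => L (s, t)) by move=> t; exact: (continuous_comp (cv s t) (cL _)).
have cLu t : continuous (fun s => L (s, t)) by move=> s; exact: (continuous_comp (cu t s) (cL _)).
have E t : 0 <= t <= 1 -> L (0, t) = d t.
  move=> ht; apply: (@lift_unique 0 1 (fun t => L (0, t)) d 0) => // u hu.
  by rewrite pL ?pd ?h0//; split.
have e1 : L (1, 0) = L (0, 0).
  apply: (@lift_constant (p (c 0)) (fun s => L (s, 0))) => // s hs'.
  by rewrite pL; [have [-> _] := hs s hs'|split].
have e2 : L (1, 1) = L (1, 0).
  apply: (@lift_constant (p (c 0)) (fun t => L (1, t))) => // t ht.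
  by rewrite pL; [rewrite h1|split].
have e3 : L (1, 1) = L (0, 1).
  apply: (@lift_constant (p (c 0)) (fun s => L (s, 1))) => // s hs'.
  by rewrite pL; [have [_ ->] := hs s hs'|split].
by rewrite -(E _ z0) -(E _ z1) -e3 e2 e1.
Qed.

Hypothesis sc : simply_connected (R := R) X.
Hypothesis locally_path_connected : forall (x : X) N, nbhs x N -> exists2 M, nbhs x M &
  forall y, M y -> exists c : R -> X, [/\ continuous c, c 0 = x, c 1 = y & forall t, N (c t)].

Section Transport.
Variables x x' : X.
Hypothesis xx : p x = p x'.

(** z is the end of the lift from x' of the projection of some path from x to y; this will be the
    graph of the deck transformation carrying x to x'. *)
Definition reach y z := exists c d : R -> X, [/\ continuous c /\ continuous d, c 0 = x /\ c 1 = y, d 0 = x' /\ d 1 = z &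
  forall t, 0 <= t <= 1 -> p (d t) = p (c t)].

Lemma reach_ex y : exists z, reach y z.
Proof.
have [_ pc _] := sc; have [c [cc c0 c1]] := pc x y; have [cpp _ _] := cp.
have cpc : continuous (fun t => p (c t)) by move=> t; exact: (continuous_comp (cc t) (cpp _)).
have [|d [cd d0 pd]] := lift_path (x0 := x') cpc; first by rewrite c0.
by exists (d 1), c, d.
Qed.

Lemma reach_ext y z (c d : R -> X) : reach y z -> continuous c -> continuous d -> c 0 = y -> d 0 = z ->
  (forall t, 0 <= t <= 1 -> p (d t) = p (c t)) -> reach (c 1) (d 1).
Proof.
move=> [c1 [d1 [[cc1 cd1] [c10 c11] [d10 d11] pd1]]] cc cd c0 d0 pd.
exists (concat c1 c), (concat d1 d); split.
- by split; apply: concat_continuous; rewrite ?c11 ?d11.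
- by rewrite concat0 concat1.
- by rewrite concat0 concat1.
by move=> t ht; rewrite /concat; case: leP => h; [apply: pd1|apply: pd]; lra.
Qed.

(** Going to y along one path and back along the other is a loop in X; the corresponding lift from
    x' closes up by [lift_loop], and its second half is the reversed lift of the other path. *)
Lemma reach_unique y z z' : reach y z -> reach y z' -> z = z'.
Proof.
move=> r1 [c2 [d2 [[cc2 cd2] [c20 c21] [d20 d21] pd2]]]; have [cpp _ _] := cp.
have cB (t : R) : {for t, continuous (fun t : R => 1 - t)} by apply: (@cvgB R); [exact: cvg_cst|exact: cvg_id].
have cr : continuous (fun t : R => c2 (1 - t)) by move=> t; exact: (continuous_comp (cB t) (cc2 _)).
have cpr : continuous (fun t : R => p (c2 (1 - t))) by move=> t; exact: (continuous_comp (cr t) (cpp (c2 (1 - t)))).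
have pz : p z = p y.
  by have [c [d [_ [_ <-] [_ <-] -> //]]] := r1; lra.
have [|e [ce e0 pe]] := lift_path (x0 := z) cpr; first by rewrite subr0 c21.
have c20' : c2 (1 - 0) = y by rewrite subr0.
have [c [d [[cc cd] [c0 c1] [d0 d1] pd]]] := reach_ext r1 cr ce c20' e0 pe.
have ex : e 1 = x'.
  by rewrite -d1 -d0; symmetry; apply: (lift_loop sc cc _ cd pd); rewrite c0 c1 subrr c20.
have : e (1 - 1) = d2 1.
  apply: (@lift_unique 0 1 (fun t => e (1 - t)) d2 0) => //; rewrite ?lexx ?ler01//.
  - by move=> t; exact: (continuous_comp (cB t) (ce _)).
  - by move=> t ht; rewrite pe ?pd2 ?subKr//; lra.
  - by rewrite subr0 ex d20.
by rewrite subrr e0 d21.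
Qed.

Lemma transport_ex : exists f : X -> X, [/\ continuous f, f x = x' & forall y, p (f y) = p y].
Proof.
pose f y := xget x [set z | reach y z].
have fP y : reach y (f y).
  by have [z rz] := reach_ex y; apply: (@xgetPex _ x [set z | reach y z]); exists z.
have fE y z : reach y z -> f y = z by exact: reach_unique (fP y).
have pf y : p (f y) = p y by have [c [d [_ [_ <-] [_ <-] -> //]]] := fP y; lra.
exists f; split => //.
- move=> y B nB; have [U [oU Uy hU]] := sheet (p y).
  have Uf : U (p (f y)) by rewrite pf.
  have [W [inv [oW Wf hW hUi ci]]] := hU _ Uf; have [_ iy] := hW _ Wf; rewrite pf in iy.
  have [cpp _ _] := cp.
  pose N := [set w : X | U (p w) /\ B (inv (p w))].
  have nN : nbhs y N.
    have n1 : \forall w \near y, U (p w) by apply: (cpp y); apply: (open_nbhs_nbhs (conj oU Uy)).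
    have c2 : {for y, continuous (fun w => inv (p w))} := continuous_comp (cpp y) (ci _ Uy).
    have n2 : \forall w \near y, B (inv (p w)) by apply: c2; rewrite iy.
    exact: filterI n1 n2.
  have [M nM hM] := locally_path_connected nN.
  apply: filterS nM => y1 /hM[c [cc c0 c1 cN]] /=.
  have [_ By1] := cN 1; rewrite c1 in By1.
  suff -> : f y1 = inv (p y1) by [].
  rewrite -c1; apply: fE; apply: (reach_ext (d := fun t => inv (p (c t))) (fP y) cc) => //.
  + move=> t; have cpc := continuous_comp (cc t) (cpp _); have [Ut _] := cN t.
    exact: (continuous_comp cpc (ci _ Ut)).
  + by rewrite c0.
  + by move=> t _; have [Ut _] := cN t; have [_ ->] := hUi _ Ut.
- apply: fE; exists (fun=> x), (fun=> x'); split => //.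
  by split => t; exact: cvg_cst.
Qed.

End Transport.

Lemma lift_map_unique (f : X -> X) x : continuous f -> (forall y, p (f y) = p y) -> f x = x -> forall y, f y = y.
Proof.
move=> cf pf fx y; have [_ pc _] := sc; have [c [cc c0 c1]] := pc x y.
rewrite -c1; apply: (@lift_unique 0 1 (fun t => f (c t)) c 0) => //; rewrite ?lexx ?ler01//.
- by move=> t; exact: (continuous_comp (cc t) (cf _)).
- by rewrite c0.
Qed.

(** The maps attached to (x, x') and (x', x) are inverse to each other, a map over p with a fixed
    point being the identity. *)
Lemma deck_ex x x' : p x = p x' -> exists f f' : X -> X, [/\ continuous f, continuous f', cancel f f' /\ cancel f' f,
  forall y, p (f y) = p y & f x = x'].
Proof.
move=> xx; have [f [cf fx pf]] := transport_ex xx; have [f' [cf' fx' pf']] := transport_ex (esym xx).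
exists f, f'; split => //; split.
- apply: (@lift_map_unique (f' \o f) x) => [y|y|] /=; first exact: (continuous_comp (cf y) (cf' _)).
    by rewrite pf' pf.
  by rewrite fx fx'.
- apply: (@lift_map_unique (f \o f') x') => [y|y|] /=; first exact: (continuous_comp (cf' y) (cf _)).
    by rewrite pf pf'.
  by rewrite fx' fx.
Qed.

End Lifting.

(** * Coordinates and invariant functions on the universal cover *)

Section CoverCoordinates.
Context {R : realType} (S : riemannSurface R) (G : groupType) (X : universal_cover S G).
Local Notation p := (@uc_proj R S G X).

Lemma uc_proj_cts : continuous p.
Proof. by have [] := uc_covering X. Qed.

Lemma rdom_near i x : rdom i (p x) -> \forall y \near x, rdom i (p y).
Proof. by move=> dx; apply: (@uc_proj_cts x); apply: (open_nbhs_nbhs (conj (@rdom_open R S i) dx)). Qed.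

Lemma co_map_cts i x : rdom i (p x) -> {for x, continuous (fun y => rmap i (p y))}.
Proof. by move=> dx; exact: (continuous_comp (@uc_proj_cts x) (rmap_cts dx)). Qed.

Lemma coord_ex x i (N : set X) : rdom i (p x) -> nbhs x N -> exists (k : loc_coord X) (r : R),
  [/\ co_idx k = i, co_dom k x, 0 < r, co_dom k `<=` N &
   (forall z, nc (z - rmap i (p x)) < r -> [/\ co_dom k (co_inv k z), rmap i (p (co_inv k z)) = z & {for z, continuous (co_inv k)}]) /\
   (forall y, co_dom k y -> nc (rmap i (p y) - rmap i (p x)) < r)].
Proof.
move=> dx nN; have [U [oU Ux /(_ x Ux)[W [inv [oW Wx hW hU ci]]]]] := sheet (uc_covering X) (p x).
set z0 := rmap i (p x); pose J z := inv (chart_inv (rs_chart i) z).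
have img0 : (chart_map (rs_chart i) @` chart_dom (rs_chart i)) z0 by exists (p x).
have cc : {for z0, continuous (chart_inv (rs_chart i))} by exact: chart_inv_cts.
have ciz : chart_inv (rs_chart i) z0 = p x by exact: rmapK.
have n1 : \forall z \near z0, U (chart_inv (rs_chart i) z).
  by apply: cc; rewrite ciz; apply: (open_nbhs_nbhs (conj oU Ux)).
have cJ : {for z0, continuous J}.
  by apply: (continuous_comp cc); rewrite ciz; exact: ci.
have Jz : J z0 = x by rewrite /J ciz; have [_] := hW _ Wx.
have n2 : \forall z \near z0, interior N (J z).
  by apply: cJ; rewrite Jz; apply: (open_nbhs_nbhs (conj (open_interior N) nN)).
have [r1 r10 hr1] := chart_ball dx.
have [r2 r20 hr2] := iffLR (cplx_nbhsP z0 _) (filterI n1 n2).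
pose r := Num.min r1 r2; have r0 : 0 < r by rewrite lt_min r10.
have ball_r z : nc (z - z0) < r -> [/\ (rmap i @` rdom i) z, U (chart_inv (rs_chart i) z) & interior N (J z)].
  by rewrite lt_min => /andP[/hr1 h1 /hr2[h2 h3]].
pose D := [set y : X | [/\ interior N y, W y, rdom i (p y) & nc (rmap i (p y) - z0) < r]].
have oD : open D.
  rewrite openE => y [h1 h2 h3 h4]; rewrite /interior /=.
  have m1 : \forall y' \near y, interior N y' by apply: (open_nbhs_nbhs (conj (open_interior N) h1)).
  have m2 : \forall y' \near y, W y' by apply: (open_nbhs_nbhs (conj oW h2)).
  have m3 := rdom_near h3.
  have e0 : 0 < r - nc (rmap i (p y) - z0) by rewrite subr_gt0.
  have /cvg_cplxP/(_ _ e0) m4 := co_map_cts h3.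
  apply: filterS3 (filterI m1 m2) m3 m4 => y' [k1 k2] k3 k4; split => //.
  by have := nc_triangle (rmap i (p y')) (rmap i (p y)) z0; lra.
have Dr y : D y -> rdom i (p y) by case.
have JK y : D y -> J (rmap i (p y)) = y.
  by move=> [_ Wy dy _]; rewrite /J rmapK//; have [_] := hW _ Wy.
exists (Coord oD Dr JK), r; split => //.
- by split => //; rewrite subrr nc0.
- by move=> y [/interior_subset].
split => [z hz|y [_ _ _ hy] //]; have [h1 h2 h3] := ball_r z hz; have [g1 g2] := img_ci h1; have [g3 g4] := hU _ h2.
have pJ : p (J z) = chart_inv (rs_chart i) z by [].
split => /=; rewrite ?pJ//.
  by split; rewrite ?pJ ?g2.
have cz : {for z, continuous (chart_inv (rs_chart i))} by exact: chart_inv_cts.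
exact: (continuous_comp cz (ci _ h2)).
Qed.

Lemma uc_locally_path_connected (x : X) N : nbhs x N -> exists2 M, nbhs x M &
  forall y, M y -> exists c : R -> X, [/\ continuous c, c 0 = x, c 1 = y & forall t, N (c t)].
Proof.
move=> nN; have [i dx] := rs_cover (p x); have [k [r [ik kx r0 kN [hz hy]]]] := coord_ex dx nN.
exists (co_dom k); first by apply: (open_nbhs_nbhs (conj (@co_dom_open _ _ _ _ k) kx)).
subst i => y ky; set z0 := rmap _ _ in hz hy; set z1 := rmap (co_idx k) (p y).
pose l t : Cplx R := z0 + (clip 0 1 t)%:C * (z1 - z0).
have lin t : nc (l t - z0) < r.
  rewrite /l addrC addKr ncM nc_real; have /andP[t0 t1] := @clip_in R 0 1 t ler01.
  by rewrite ger0_norm//; apply: le_lt_trans (hy y ky); rewrite ler_piMl ?nc_ge0.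
exists (fun t => co_inv k (l t)); split.
- move=> t; have [_ _ ck] := hz _ (lin t).
  have cl : {for t, continuous l}.
    have c1 : {for clip 0 1 t, continuous (fun s : R => z0 + s%:C * (z1 - z0))} := rcdiff_cts (rcdiff_line z0 (z1 - z0) _).
    exact: (continuous_comp (clip_continuous ler01 (x := t)) c1).
  exact: (continuous_comp cl ck).
- by rewrite /l clip_id ?lexx ?ler01// mul0r addr0; exact: co_mapK.
- by rewrite /l clip_id ?lexx ?ler01// mul1r addrC subrK; exact: co_mapK.
- by move=> t; have [h _ _] := hz _ (lin t); exact: kN.
Qed.

Lemma deck_transitive (x x' : X) : p x = p x' -> exists g, uc_act g x = x'.
Proof.
move=> xx; have [f [f' [cf cf' [K K'] pf fx]]] := deck_ex (uc_covering X) (uc_simply_connected X) uc_locally_path_connected xx.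
by have [g gE] := uc_deck cf cf' K K' pf; exists g; rewrite -gE.
Qed.

(** The fibres of p are orbits of the deck group, and continuity descends because p is open. *)
Lemma descend (F : X -> R) : continuous F -> (forall g x, F (uc_act g x) = F x) ->
  exists2 f : S -> R, continuous f & forall x, f (p x) = F x.
Proof.
move=> cF Finv; have [_ surj _] := uc_covering X.
have sec s : exists x, p x = s by have : [set: S] s by []; rewrite -surj => -[x _ <-]; exists x.
have [x0 _] := let: And3 _ _ _ := uc_simply_connected X in (let: And3 ne _ _ := uc_simply_connected X in ne).
pose lift s := xget x0 [set x | p x = s].
have liftP s : p (lift s) = s by have [x hx] := sec s; apply: (@xgetPex _ x0 [set x | p x = s]); exists x.
have fE x : F (lift (p x)) = F x.
  by have [g <-] := deck_transitive (esym (liftP (p x))); rewrite Finv.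
exists (fun s => F (lift s)) => // s B nB.
have nF : nbhs (lift s) [set x | B (F x)] by exact: cF.
have := covering_open (uc_covering X) nF; rewrite liftP; apply: filterS => _ [x Bx <-] /=.
by rewrite fE.
Qed.

End CoverCoordinates.

(** * Change of natural coordinate *)

Section ChartChange.
Context {R : realType}.

(** The sign of the derivative may depend on the point a priori; [partial_split] makes it constant.
    Here the partial derivative in y exists and is 0, so the function k of one variable is
    constant. *)
Lemma unit_slope (Phi : Cplx R -> Cplx R) (W0 : Cplx R) (e : R) : 0 < e ->
  (forall W, nc (W - W0) < e -> exists2 s : R, s = 1 \/ s = -1 & cdiff Phi W s%:C) ->
  exists s c d : R, [/\ s = 1 \/ s = -1, 0 < d & forall W, nc (W - W0) < d -> complex.Re (Phi W) = s * complex.Re W + c].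
Proof.
move=> e0 hPhi; pose b := e / 2; have b0 : 0 < b by rewrite divr_gt0.
have be : b + b = e by rewrite /b; lra.
have ab : b / 2 < b by lra.
have a0 : 0 < b / 2 by rewrite divr_gt0.
have bx x y : `|x - complex.Re W0| < b /\ `|y - complex.Im W0| < b -> nc ((x +i* y) - W0) < e.
  by move=> [h1 h2]; apply: le_lt_trans (nc_le_ReIm _) _; rewrite ReB ImB /=; lra.
have dh x y s : cdiff Phi (x +i* y) s%:C -> is_derive x 1 (fun x => complex.Re (Phi (x +i* y)) : R) s.
  move=> dP; have := rcdiff_comp (rcdiff_hseg y x) dP; rewrite mulr1 => /rcdiffP[].
  by [].
have dv x y s : cdiff Phi (x +i* y) s%:C -> is_derive y 1 (fun y => complex.Re (Phi (x +i* y)) : R) 0.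
  move=> dP; have := rcdiff_comp (rcdiff_vseg x y) dP => /rcdiffP[].
  by rewrite Re_realM /= mulr0.
pose Gf x y : R := complex.Re (Phi (x +i* y)).
have [|||s [k [sE kc GE kd]]] := @partial_split R Gf (fun t _ => t) (fun _ _ => 1) (fun _ _ => 0) (complex.Re W0) (complex.Im W0) (b / 2) b a0 ab.
- move=> x y /bx/hPhi[s _ dP]; have [dr _] := dv x y s dP.
  by apply: differentiable_continuous; apply/derivable1_diffP.
- by [].
- move=> x y /bx/hPhi[s sE dP]; exists s; rewrite mulr1 mulr0; split => //; rewrite derive1E.
    by apply: derive_val; exact: dh.
  by rewrite (@derive_val _ _ _ _ _ _ _ (dv x y s dP)).
have k0 y : complex.Im W0 - b / 2 < y < complex.Im W0 + b / 2 -> is_derive y 1 k 0.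
  move=> hy.
  have hb : `|complex.Re W0 - complex.Re W0| < b /\ `|y - complex.Im W0| < b.
    by rewrite subrr normr0 ltr_norml; split => //; lra.
  have [s1 _ dP] := hPhi _ (bx _ _ hb).
  have d1 : is_derive y 1 (fun y => Gf (complex.Re W0) y - s * complex.Re W0) 0.
    have d2 := dv _ _ _ dP.
    have := @is_deriveB _ _ _ _ _ _ _ _ _ d2 (is_derive_cst (s * complex.Re W0) y 1); rewrite subr0; exact.
  pose m := Num.min (y - (complex.Im W0 - b / 2)) (complex.Im W0 + b / 2 - y).
  have m0 : 0 < m by rewrite lt_min !subr_gt0.
  apply: (is_derive_local d1); exists m => // t; rewrite lt_min => /andP[h1 h2].
  by rewrite GE ?subrr ?normr0//; [ring|lra|rewrite ler_norml; move: h1 h2; rewrite !ltr_norml; lra].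
have kconst y : complex.Im W0 - b / 2 < y < complex.Im W0 + b / 2 -> k y = k (complex.Im W0).
  move=> hy; have m0 : complex.Im W0 - b / 2 < complex.Im W0 < complex.Im W0 + b / 2 by lra.
  have H u v : complex.Im W0 - b / 2 < u -> u < v -> v < complex.Im W0 + b / 2 -> k u = k v.
    move=> h1 h2 h3; have [|t _] := @derive_mean R k (fun=> 0) u v h2.
      by move=> t ht; apply: k0; lra.
    by rewrite mul0r => /eqP; rewrite subr_eq0 => /eqP.
  by have [h|h|->//] := ltgtP y (complex.Im W0); [apply: H|symmetry; apply: H]; clear - h hy m0; lra.
exists s, (k (complex.Im W0)), (b / 2); split => // W hW.
have h1 := le_lt_trans (Re_le_nc _) hW; have h2 := le_lt_trans (Im_le_nc _) hW; rewrite ReB in h1; rewrite ImB in h2.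
have := GE (complex.Re W) (complex.Im W) (ltW h1) (ltW h2).
rewrite kconst; last by move: h2; rewrite ltr_norml; lra.
by rewrite /Gf; case: (W).
Qed.

Context (S : riemannSurface R) (q : quad_diff S).

(** P and a natural coordinate P0 in the chart i differ by a map of derivative 1 or -1; the sign and
    the constants are absorbed into a new natural coordinate. *)
Lemma flat_transport i j s P h r (f : S -> R) (s0 c0 : R) : flat_at q j s P h r -> rdom i s ->
  s0 = 1 \/ s0 = -1 ->
  (\forall s' \near s, f s' = s0 * complex.Re (P (rmap j s')) + c0) ->
  exists P' h' r', flat_at q i s P' h' r' /\
    forall z, nc (z - rmap i s) < r' -> f (chart_inv (rs_chart i) z) = complex.Re (P' z).
Proof.
move=> [dj [r0 fl] hq] di s0E nf.
have xx : nc (rmap j s - rmap j s) < r by rewrite subrr nc0.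
have [_ _ hn] := fl _ xx; have [_ hsq] := hq _ xx; rewrite rmapK// in hsq.
have qi : coef q i s != 0 by apply: (coef_neq0 dj di); rewrite -hsq expf_neq0.
have [P0 [h0 [r1 fl0]]] := flat_ex di qi; have [N [Y [e B]]] := box_ex fl0.
pose W0 := P0 (rmap i s); have e0 := box_e B.
have W00 : nc (W0 - W0) < e by rewrite subrr nc0.
have YW0 : Y W0 = s := box_inv B (box_x B).
have n1 : \forall s' \near s, rdom j s' by apply: (open_nbhs_nbhs (conj (@rdom_open R S j) dj)).
have /cvg_cplxP/(_ _ r0) n2 := rmap_cts dj.
have cY : {for W0, continuous Y} := box_Ycts B W00.
have nY : \forall W \near W0, [/\ f (Y W) = s0 * complex.Re (P (rmap j (Y W))) + c0, rdom j (Y W) & nc (rmap j (Y W) - rmap j s) < r].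
  have n3 : \forall s' \near Y W0, [/\ f s' = s0 * complex.Re (P (rmap j s')) + c0, rdom j s' & nc (rmap j s' - rmap j s) < r].
    by rewrite YW0; apply: filterS3 nf n1 n2.
  exact: (cY _ n3).
have [e1 e10 he1] := iffLR (cplx_nbhsP W0 _) nY.
pose e2 := Num.min e e1; have e20 : 0 < e2 by rewrite lt_min e0.
have e2e W : nc (W - W0) < e2 -> nc (W - W0) < e by rewrite lt_min => /andP[].
have e2P W : nc (W - W0) < e2 -> [/\ f (Y W) = s0 * complex.Re (P (rmap j (Y W))) + c0, rdom j (Y W) & nc (rmap j (Y W) - rmap j s) < r].
  by rewrite lt_min => /andP[_ /he1].
have ball_open W : nc (W - W0) < e2 -> exists2 d : R, 0 < d & forall W', nc (W' - W) < d -> nc (W' - W0) < e2.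
  move=> hW; exists (e2 - nc (W - W0)); first by rewrite subr_gt0.
  by move=> W' h1; have := nc_triangle W' W W0; lra.
have [|s1 [c1 [d [s1E d0 PhiE]]]] := @unit_slope (fun W => P (rmap j (Y W))) W0 e2 e20.
  move=> W hW; have [NY ZY] := box_Y B (e2e _ hW); have [_ dY hY] := e2P _ hW.
  have [diY _ _] := box_dom B NY; have [_ h0n h0sq] := box_h B NY.
  have [D dT qT] := coef_change q diY dY.
  have [dP _ _] := fl _ hY; have [_ hsqY] := hq _ hY; rewrite rmapK// in hsqY.
  have TE W' : nc (W' - W0) < e2 -> transition (rs_chart i) (rs_chart j) (rmap i (Y W')) = rmap j (Y W').
    by move=> hW'; have [NY' _] := box_Y B (e2e _ hW'); have [diY' _ _] := box_dom B NY'; rewrite /transition /= rmapK.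
  have dP' : cdiff P (transition (rs_chart i) (rs_chart j) (rmap i (Y W))) (h (rmap j (Y W))) by rewrite TE.
  have dd := cdiff_comp (cdiff_comp (box_Yd B (e2e _ hW)) dT) dP'.
  have [|s2 s2E sv] := @cplx_sqr_eq R (h (rmap j (Y W)) * (D * (h0 (rmap i (Y W)))^-1)) 1.
    rewrite expr1n !exprMn hsqY mulrA -qT exprVn h0sq divff// -h0sq.
    by rewrite expf_neq0.
  exists s2 => //; rewrite sv mulr1 in dd.
  have [d d0 hd] := ball_open W hW; apply: (cdiff_local dd); exists d => // W' /hd hW' /=.
  by rewrite TE.
have [_ [r10 flP0] hq0] := fl0.
have s0s1 : (s0 * s1) ^+ 2 = 1 by rewrite exprMn; case: s0E => ->; case: s1E => ->; rewrite ?sqrrN !expr1n mulr1.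
pose m := Num.min d e2; have m0 : 0 < m by rewrite lt_min d0.
have z00 : nc (rmap i s - rmap i s) < r1 by rewrite subrr nc0.
have [dP0 _ _] := flP0 _ z00; have /cvg_cplxP/(_ _ m0)/cplx_nbhsP[d1 d10 hd1] := cdiff_cts dP0.
have ci_cts : {for rmap i s, continuous (chart_inv (rs_chart i))} by apply: chart_inv_cts; exists s.
have nN : nbhs s N by apply: (open_nbhs_nbhs (conj (box_open B) (box_x B))).
have : nbhs (rmap i s) [set z | N (chart_inv (rs_chart i) z)] by apply: ci_cts; rewrite rmapK.
move=> /cplx_nbhsP[d2 d20 hd2].
exists (fun z => (s0 * s1)%:C * P0 z + (s0 * c1 + c0)%:C), (fun z => (s0 * s1)%:C * h0 z), (Num.min r1 (Num.min d1 d2)).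
split; first split => //.
- split; first by rewrite !lt_min r10 d10.
  move=> z; rewrite !lt_min => /andP[z1 _]; have [dPz ch hz] := flP0 _ z1; split.
  + rewrite -[X in cdiff _ _ X]addr0; apply: cdiffD; last exact: cdiff_cst.
    by have := cdiff_comp dPz (@cdiff_scale R (s0 * s1)%:C (P0 z)).
  + have c2 : {for z, continuous (fun _ : Cplx R => (s0 * s1)%:C : Cplx R)} by exact: cst_continuous.
    exact: (@cvg_cmul R _ (nbhs z) (nbhs_filter z) _ h0 _ _ c2 ch).
  + apply: mulf_neq0 => //; apply/eqP => E; have : ((s0 * s1)%:C ^+ 2 : R[i]) = 1 by rewrite -rmorphXn s0s1.
    by rewrite E expr0n /= => /eqP; rewrite eq_sym oner_eq0.
- move=> z; rewrite !lt_min => /andP[z1 _]; have [h1 h2] := hq0 _ z1; split => //.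
  by rewrite exprMn -rmorphXn s0s1 mul1r.
- move=> z; rewrite !lt_min => /andP[z1 /andP[/hd1 z2 /hd2 z3]]; have [h1 _] := hq0 _ z1.
  have [g1 g2] := img_ci h1; have := box_inv B z3; rewrite g2 => YE.
  move: z2; rewrite /= lt_min => /andP[z4 z5]; have [fE _ _] := e2P _ z5; rewrite YE in fE.
  have := PhiE _ z4; rewrite YE => RE.
  by rewrite fE RE ReD Re_realM /=; ring.
Qed.

End ChartChange.

Lemma flat_JS_cover {R : realType} (S : riemannSurface R) (G : groupType) (X : universal_cover S G) (q : quad_diff S)
  (F : X -> R) (a : R) : compact [set: S] -> 0 < a -> continuous F -> (forall g x, F (uc_act g x) = F x) ->
  (forall x, (forall i, rdom i (uc_proj x) -> coef q i (uc_proj x) != 0) -> F x <> 0 -> F x <> a ->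
    exists j P h r s c, [/\ flat_at q j (uc_proj x) P h r, s = 1 \/ s = -1 &
      \forall x' \near x, F x' = s * complex.Re (P (rmap j (uc_proj x'))) + c]) ->
  (forall O : set X, open O -> O !=set0 -> (forall y, O y -> F y = 0 \/ F y = a) ->
    exists y i, [/\ O y, rdom i (uc_proj y) & coef q i (uc_proj y) = 0]) ->
  JS S q.
Proof.
move=> cS a0 cF Finv Fflat Fint; have [f cf fE] := descend cF Finv; have [cp surj _] := uc_covering X.
have sec s : exists x : X, uc_proj x = s by have : [set: S] s by []; rewrite -surj => -[x _ <-]; exists x.
apply: (flat_JS a0 cf _ _ cS).
- move=> s i di qi f0 fa; have [x xs] := sec s; rewrite -xs fE in f0 fa.
  have qx j : rdom j (uc_proj x) -> coef q j (uc_proj x) != 0 by rewrite xs => dj; exact: (coef_neq0 di dj).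
  have [j [P [h [r [s1 [c [fl sE nF]]]]]]] := Fflat x qx f0 fa; rewrite xs in fl.
  apply: (flat_transport fl di sE (c0 := c)); rewrite -xs.
  have := covering_open (uc_covering X) nF; apply: filterS => _ [x' Fx' <-].
  by rewrite fE.
- move=> O oO [s Os] fO; have [x xs] := sec s.
  have [|||y [i [Oy dy qy]]] := Fint (@uc_proj _ _ _ X @^-1` O).
  + by apply: open_comp => // y _; exact: cp.
  + by exists x; rewrite /= xs.
  + by move=> y Oy; rewrite -fE; exact: fO.
  by exists (uc_proj y), i.
Qed.

(** * Equivariant harmonic maps and Jenkins-Strebel differentials *)

Section DistanceToIntegers.
Context {R : realType}.
Implicit Types (t : R) (m n : int).

Definition zdist t : R := `|t - (Num.floor (t + 1 / 2))%:~R|.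

Lemma zdist_ex t : exists n, zdist t = `|t - n%:~R| /\ - (1 / 2) <= t - n%:~R < 1 / 2.
Proof.
exists (Num.floor (t + 1 / 2)); split => //.
by have := floor_itv (t + 1 / 2); rewrite intrD; lra.
Qed.

Lemma int_dist_ge1 m n : m != n -> 1 <= `|m%:~R - n%:~R| :> R.
Proof. by move=> mn; rewrite -intrB -intr_norm -[1]/(1%:~R) ler_int; lia. Qed.

Lemma zdist_le t m : zdist t <= `|t - m%:~R|.
Proof.
have [n [-> hn]] := zdist_ex t; have [->//|mn] := eqVneq m n.
have g := int_dist_ge1 mn; have := ler_distD t (m%:~R : R) n%:~R; rewrite (distrC m%:~R t).
suff : `|t - n%:~R| <= 1 / 2 by move: g; lra.
by rewrite ler_norml; lra.
Qed.

Lemma zdist_lip t t' : `|zdist t' - zdist t| <= `|t' - t|.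
Proof.
have half u u' : zdist u' - zdist u <= `|u' - u|.
  by have [n [-> _]] := zdist_ex u; have := zdist_le u' n; have := ler_distD u u' (n%:~R); lra.
by have := half t t'; have := half t' t; rewrite (distrC t t') ler_norml; lra.
Qed.

Lemma zdist_continuous : continuous zdist.
Proof.
move=> t; apply/cvgrPdist_lt => e e0; apply/nbhs_ballP; exists e => // t' tt.
exact: le_lt_trans (zdist_lip _ _) tt.
Qed.

Lemma zdist_eq t t' m : t' - t = m%:~R \/ t' + t = m%:~R -> zdist t' = zdist t.
Proof.
have half u u' k : u' - u = k%:~R \/ u' + u = k%:~R -> zdist u' <= zdist u.
  move=> h; have [n [-> _]] := zdist_ex u; case: h => E.
    by apply: le_trans (zdist_le u' (n + k)) _; have -> : u' - (n + k)%:~R = u - n%:~R by rewrite intrD -E; ring.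
  by apply: le_trans (zdist_le u' (k - n)) _; have -> : u' - (k - n)%:~R = - (u - n%:~R) by [rewrite intrB -E; ring]; rewrite normrN.
move=> h; apply/eqP; rewrite eq_le (half _ _ m h); case: h => E.
  by apply: (half _ _ (- m)); left; rewrite mulrNz -E opprB.
by apply: (half _ _ m); right; rewrite addrC.
Qed.

Lemma zdist_int m : zdist m%:~R = 0.
Proof. by apply/eqP; rewrite eq_le normr_ge0 andbT; have := zdist_le m%:~R m; rewrite subrr normr0. Qed.

Lemma zdist_extreme t : zdist t = 0 \/ zdist t = 1 / 2 -> exists m, 2 * t = m%:~R.
Proof.
have [n [-> hn]] := zdist_ex t; case=> E.
  by exists (2 * n); rewrite intrM; move/normr0_eq0: E; lra.
by exists (2 * n - 1); rewrite intrB intrM; move: E hn; case: ger0P; lra.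
Qed.

Lemma zdist_affine t : zdist t <> 0 -> zdist t <> 1 / 2 -> exists s c e : R, [/\ s = 1 \/ s = -1, 0 < e &
  forall t', `|t' - t| < e -> zdist t' = s * t' + c].
Proof.
move=> t0 t1; have [n [tE hn]] := zdist_ex t; rewrite tE in t0 t1.
have tn0 : t - n%:~R <> 0 by move=> E; apply: t0; rewrite E normr0.
have tn1 : t - n%:~R <> - (1 / 2) by move=> E; apply: t1; rewrite E normrN ger0_norm// divr_ge0.
have m0 : 0 < Num.min `|t - n%:~R| (1 / 2 - `|t - n%:~R|).
  rewrite lt_min normr_gt0; apply/andP; split; first exact/eqP.
  by move: t0 t1 tn0 tn1; case: ger0P; lra.
have near_n t' : `|t' - t| < Num.min `|t - n%:~R| (1 / 2 - `|t - n%:~R|) -> zdist t' = `|t' - n%:~R|.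
  rewrite lt_min => /andP[_ h]; rewrite /zdist (@floor_def _ _ n)// intrD.
  by move: h hn; rewrite ltr_norml; case: (ger0P (t - n%:~R)); lra.
have [h|h] := ltP 0 (t - n%:~R).
  exists 1, (- n%:~R), (Num.min `|t - n%:~R| (1 / 2 - `|t - n%:~R|)); split => //; first by left.
  move=> t' ht; rewrite near_n// mul1r; move: ht; rewrite lt_min => /andP[ht _].
  by apply: ger0_norm; move: ht; rewrite ltr_norml (ger0_norm (ltW h)); lra.
exists (-1), n%:~R, (Num.min `|t - n%:~R| (1 / 2 - `|t - n%:~R|)); split => //; first by right.
move=> t' ht; rewrite near_n// mulN1r; move: ht; rewrite lt_min => /andP[ht _].
by rewrite ler0_norm ?opprB 1?addrC//; move: ht; rewrite ltr_norml (ler0_norm h); lra.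
Qed.

Lemma integer_near_constant (A : topologicalType) (f : A -> R) x : {for x, continuous f} ->
  (\forall y \near x, exists m, f y = m%:~R) -> \forall y \near x, f y = f x.
Proof.
move=> cf nZ; have [m fx] := nbhs_singleton nZ.
move/cvgrPdist_lt: cf => /(_ _ ltr01) nf; apply: filterS2 nf nZ => y h [n fy].
apply/eqP/negPn/negP => ne; move: h; rewrite fx fy ltNge int_dist_ge1//.
by apply: contra ne => /eqP E; rewrite fx fy E.
Qed.

End DistanceToIntegers.

(** * The nonabelian case *)

Section NonabelianCase.
Context {R : realType} (S : riemannSurface R) (G : groupType) (X : universal_cover S G).
Context (T : metricType R) (act : G -> T -> T) (u : X -> T) (q : quad_diff S).
Local Notation p := (@uc_proj R S G X).
Local Notation d := (@mdist R T).

Lemma distance_near (x : X) (e : R) : {for x, continuous u} -> 0 < e -> \forall y \near x, d (u x) (u y) < e.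
Proof.
move=> cu e0; have : nbhs (u x) (ball (u x) e) := nbhsx_ballx _ _ e0.
move=> nb; have n : \forall y \near x, ball (u x) e (u y) := cu _ nb.
by apply: filterS n => y; rewrite ballEmdist.
Qed.

Lemma distance_continuous x0 : continuous u -> continuous (fun x => d x0 (u x)).
Proof.
move=> cu x; apply/cvgrPdist_lt => e e0; apply: filterS (distance_near (cu x) e0) => y; apply: le_lt_trans.
have t1 := metric_triangle x0 (u y) (u x); have t2 := metric_triangle x0 (u x) (u y).
by move: t1 t2; rewrite (metric_sym (u y) (u x)) ler_norml; lra.
Qed.

(** A locally constant u factors through the degenerate interval [0, 0], so [hopf] applies with g =
    0. *)
Lemma hopf_constant x : hopf u q -> (\forall y \near x, u y = u x) -> exists2 i, rdom i (p x) & coef q i (p x) = 0.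
Proof.
move=> hu nu; have [i di] := rs_cover (p x); have [k [r [ik kx r0 kN _]]] := coord_ex di nu.
exists i => //; rewrite -ik (hu k `[0, 0] (fun=> u x) (fun=> 0))//.
- rewrite /dz (_ : derive1 _ 0 = 0); last by rewrite derive1_cst.
  by rewrite oppr0 (_ : 0 +i* 0 = 0 :> R[i])// mul0r expr0n /= mulr0.
- move=> s t; rewrite /= !in_itv /= => hs ht.
  by rewrite mdistxx (_ : s = t) ?subrr ?normr0//; lra.
- by move=> y ky; rewrite in_itv /= lexx; split => //; exact: kN.
Qed.

(** Near x, u runs in the geodesic c with parameter g = d(x0, u); isometry of c and [hopf] become
    the hypotheses of [hopf_regular]. *)
Lemma harmonic_flat x0 x (D e : R) (c : R -> T) : Defs.harmonic act u -> hopf u q ->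
  (forall i, rdom i (p x) -> coef q i (p x) != 0) -> 0 < e -> isometric_on `[0, D] c ->
  (forall z, d (u x) z < e -> 0 <= d x0 z <= D /\ z = c (d x0 z)) ->
  exists j P h r s c1, [/\ flat_at q j (p x) P h r, s = 1 \/ s = -1 &
    \forall y \near x, d x0 (u y) = s * complex.Re (P (rmap j (p y))) + c1].
Proof.
move=> [_ cu [_ _ _ W] _] hu hq e0 ic hc; have [k kx kfin] := W x.
have dj := co_sub kx; have [P [h [r fl]]] := flat_ex dj (hq _ dj).
pose N := [set y : X | co_dom k y /\ d (u x) (u y) < e].
have nN : nbhs x N.
  have n1 : nbhs x (co_dom k) by apply: (open_nbhs_nbhs (conj (@co_dom_open _ _ _ _ k) kx)).
  exact: filterI n1 (distance_near (cu x) e0).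
(* The energy is known to be finite on the coordinate k given by [W12loc]; u stays in the segment on
   the smaller k'. *)
have [k' [r' [ik kx' r'0 kN [hz hy]]]] := coord_ex dj nN.
have [_ [r0 flP] hsq] := fl; set z0 := rmap _ _ in hz hy flP hsq.
pose g z := d x0 (u (co_inv k' z)).
have rho0 : 0 < Num.min r r' by rewrite lt_min r0.
have inv z : nc (z - z0) < Num.min r r' -> [/\ nc (z - z0) < r, co_dom k' (co_inv k' z),
    rmap (co_idx k) (p (co_inv k' z)) = z, {for z, continuous (co_inv k')} & co_inv k z = co_inv k' z].
  rewrite lt_min => /andP[z1 /hz[h1 h2 h3]]; split => //.
  by have [h4 _] := kN _ h1; rewrite -{1}h2; exact: co_mapK.
have gk y : co_dom k' y -> g (rmap (co_idx k) (p y)) = d x0 (u y).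
  by move=> ky; have := co_mapK ky; rewrite ik /g => ->.
have gD y : co_dom k' y -> 0 <= d x0 (u y) <= D /\ u y = c (d x0 (u y)).
  by move=> /kN[_ hd]; exact: hc.
have [|||s [c1 [e1 [sE e10 gE]]]] := @hopf_regular R T (co_img k) (u \o co_inv k) g P h z0 _ rho0 _ _ _ kfin.
- move=> z /inv[z1 z2 z3 z4 z5]; have [dP ch hn] := flP _ z1; split => //.
  + by have [h4 _] := kN _ z2; exists (co_inv k' z).
  + exact: (continuous_comp z4 (@distance_continuous x0 cu _)).
- move=> z z' /inv[_ z2 _ _ z5] /inv[_ z2' _ _ z5']; rewrite /= z5 z5'.
  have [h1 h2] := gD _ z2; have [h1' h2'] := gD _ z2'.
  by rewrite h2 h2' ic// /= in_itv.
- move=> z /inv[z1 z2 z3 z4 z5]; have [_ ->] := hsq _ z1.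
  rewrite -{2}z3 rmapK; last by rewrite -ik; exact: co_sub.
  have := hu k' `[0, D] c g ic _ _ z2; rewrite /co_map ik z3 => <- // y ky.
  by rewrite gk// in_itv /=; exact: gD.
exists (co_idx k), P, h, r, s, c1; split => //.
have /cvg_cplxP/(_ _ e10) n1 := co_map_cts dj.
have n2 : nbhs x (co_dom k') by apply: (open_nbhs_nbhs (conj (@co_dom_open _ _ _ _ k') kx')).
by apply: filterS2 n1 n2 => y /gE h1 ky; rewrite -gk.
Qed.

Lemma nonabelian_JS : compact [set: S] -> minimal_gtree act -> Defs.harmonic act u -> hopf u q ->
  ~ abelian_length (length_function act) -> (forall g, exists N : nat, length_function act g = N%:R) -> JS S q.
Proof.
move=> cS minT harm hu nab lN; have [eu cu _ _] := harm.
have [[xp _] _ _] := uc_simply_connected X.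
have [x0 [orb seg stuck]] := integral_tree minT (u xp) lN nab.
have cd := @distance_continuous x0 cu.
have c4 (k t : R) : {for t, continuous (fun t : R => k * t)} by apply: (@cvgMr R); exact: cvg_id.
have cd4 (k : R) : continuous (fun x => k * d x0 (u x)).
  by move=> x; exact: (continuous_comp (@cd x) (c4 k _)).
(* The factors 4 turn the distance to Z/4 into a distance to Z without changing slopes; the maximum
   is 1 / 8. *)
pose F x : R := (1 / 4) * zdist (4 * d x0 (u x)).
have Fq v x : F x = (1 / 4) * v -> zdist (4 * d x0 (u x)) = v by rewrite /F; lra.
have a0 : 0 < 1 / 8 :> R by rewrite divr_gt0.
apply: (@flat_JS_cover R S G X q F (1 / 8) cS a0).
- move=> x; have cz := continuous_comp (@cd4 4 x) (@zdist_continuous R _).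
  exact: (continuous_comp cz (c4 _ _)).
- move=> g x; rewrite /F eu; congr (_ * _); have [m h] := orb g (u x).
  by apply: (@zdist_eq _ _ _ m); case: h => <-; [left|right]; ring.
- move=> x hq F0 Fa; set t := 4 * d x0 (u x).
  have t0 : zdist t <> 0 by move=> E; apply: F0; rewrite /F E mulr0.
  have t1 : zdist t <> 1 / 2 by move=> E; apply: Fa; rewrite /F E; lra.
  have tZ (z : int) : 4 * d x0 (u x) <> z%:~R by move=> E; apply: t0; rewrite /t E zdist_int.
  have [e [D [c [e0 ic hc]]]] := seg _ tZ.
  have [j [P [h [r [s [c1 [fl sE nd]]]]]]] := harmonic_flat harm hu hq e0 ic hc.
  have [s2 [c2 [e2 [s2E e20 zE]]]] := zdist_affine t0 t1.
  exists j, P, h, r, (s2 * s), (s2 * c1 + c2 / 4); split => //.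
    by case: sE => ->; case: s2E => ->; rewrite ?mulrNN !(mulr1, mul1r); [left|right|right|left].
  move/cvgrPdist_lt: (@cd4 4 x) => /(_ _ e20) nt.
  apply: filterS2 nd nt => y dy ty; rewrite /F zE; last by rewrite distrC.
  by rewrite dy; field.
(* Extremal values make 8 d(x0, u) integral, hence locally constant; u then stays on a sphere, is
   locally constant by discreteness, and q vanishes. *)
- move=> O oO [y Oy] FO.
  have nO : nbhs y O by apply: (open_nbhs_nbhs (conj oO Oy)).
  have n8 : \forall y' \near y, exists m : int, 8 * d x0 (u y') = m%:~R.
    apply: filterS nO => y' /FO Fy'; have [m E] := @zdist_extreme R (4 * d x0 (u y')) (ltac:(case: Fy' => Fy'; [left|right]; apply: Fq; rewrite Fy'; lra)).
    by exists m; rewrite -E; ring.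
  have nc8 := integer_near_constant (@cd4 8 y) n8.
  have [e e0 he] := stuck (u y).
  have nu : \forall y' \near y, u y' = u y.
    by apply: filterS2 nc8 (distance_near (cu y) e0) => y' h1 h2; apply: he => //; lra.
  by have [i di qi] := hopf_constant hu nu; exists y, i.
Qed.

End NonabelianCase.

(** * The abelian case *)

Section AbelianCase.
Context {R : realType} (S : riemannSurface R) (G : groupType) (X : universal_cover S G).
Context (w : one_form S).
Local Notation p := (@uc_proj R S G X).

Lemma primitive_cdiff (P : X -> Cplx R) (k : loc_coord X) z : primitive w P -> co_img k z ->
  cdiff (P \o co_inv k) z (coef w (co_idx k) (chart_inv (rs_chart (co_idx k)) z)).
Proof.
move=> pP kz; have [dP eP] := pP k z kz; case: kz eP dP => y ky <-; rewrite /co_map.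
rewrite rmapK; last exact: co_sub.
by rewrite [co_inv k _]co_mapK// => <- /derivable_cdiff.
Qed.

Lemma primitive_coord (P : X -> Cplx R) x i N : primitive w P -> rdom i (p x) -> nbhs x N ->
  exists (k : loc_coord X) (r : R), [/\ 0 < r, nbhs x (co_dom k), co_dom k `<=` N,
    (forall z, nc (z - rmap i (p x)) < r -> [/\ co_dom k (co_inv k z), rmap i (p (co_inv k z)) = z &
       cdiff (P \o co_inv k) z (coef w i (chart_inv (rs_chart i) z))]) &
    (forall y, co_dom k y -> [/\ rdom i (p y), nc (rmap i (p y) - rmap i (p x)) < r & co_inv k (rmap i (p y)) = y])].
Proof.
move=> pP dx nN; have [k [r [ik kx r0 kN [hz hy]]]] := coord_ex dx nN; subst i.
exists k, r; split => //.
- by apply: (open_nbhs_nbhs (conj (@co_dom_open _ _ _ _ k) kx)).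
- move=> z zr; have [h1 h2 h3] := hz z zr; split => //; apply: primitive_cdiff => //.
  by exists (co_inv k z).
- by move=> y ky; split; [exact: co_sub|exact: hy|exact: co_mapK].
Qed.

Lemma primitive_continuous (P : X -> Cplx R) : primitive w P -> continuous P.
Proof.
move=> pP x A nA; have [i di] := rs_cover (p x).
have [k [r [r0 nk _ hz hy]]] := primitive_coord pP di filterT.
have kx := nbhs_singleton nk; have [_ h1 h2] := hy _ kx; have [_ _ dP] := hz _ h1.
have c := continuous_comp (co_map_cts di) (cdiff_cts dP).
have nA' : nbhs x [set y | A ((P \o co_inv k) (rmap i (p y)))] by apply: c; rewrite /= h2.
by apply: filterS2 nA' nk => y Ay /hy[_ _ yE]; rewrite /= -yE.
Qed.

Lemma locally_constant (E : X -> R) : (forall x, \forall y \near x, E y = E x) -> forall x y, E x = E y.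
Proof.
move=> nE x y; have [_ pc _] := uc_simply_connected X; have [c [cc c0 c1]] := pc x y.
rewrite -c0 -c1; apply: (@is_derive_0_is_cst R (fun t => E (c t))) => t.
have n : \forall s \near t, E (c s) = E (c t) by apply: (cc t [set y | E y = E (c t)]); exact: nE.
have [e /= e0 he] := iffLR (nbhs_ballP (t : R) _) n.
apply: (@is_derive_local R (fun=> E (c t)) _ t 0 (is_derive_cst _ _ _)).
by exists e => // s st; apply: he; rewrite -ball_normE /= distrC.
Qed.

(** [re_period] provides its own primitive for each group element; this reduces all periods to those
    of a single P. *)
Lemma primitive_unique (P P' : X -> Cplx R) : primitive w P -> primitive w P' ->
  forall x y, complex.Re (P x - P' x) = complex.Re (P y - P' y).
Proof.
move=> pP pP'; apply: locally_constant => x; have [i di] := rs_cover (p x).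
have [k [r [ik kx r0 _ [hz hy]]]] := coord_ex di (@filterT _ (nbhs x) _); subst i.
have nk : nbhs x (co_dom k) by apply: (open_nbhs_nbhs (conj (@co_dom_open _ _ _ _ k) kx)).
apply: filterS nk => y ky; set z0 := rmap _ _ in hz hy; set z1 := rmap (co_idx k) (p y).
have kI z : nc (z - z0) < r -> co_img k z by move=> /hz[h1 h2 _]; exists (co_inv k z).
have dE z : nc (z - z0) < r -> cdiff (fun z => (P \o co_inv k) z - (P' \o co_inv k) z) z 0.
  move=> /kI kz; rewrite -[0](subrr (coef w (co_idx k) (chart_inv (rs_chart (co_idx k)) z))).
  by apply: cdiffD; [exact: primitive_cdiff|apply: cdiffN; exact: primitive_cdiff].
have hy1 := hy _ ky; have lin (t : R) : 0 <= t <= 1 -> nc (z0 + t%:C * (z1 - z0) - z0) < r.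
  move=> /andP[t0 t1]; rewrite addrC addKr ncM nc_real ger0_norm//.
  by apply: le_lt_trans hy1; rewrite ler_piMl ?nc_ge0.
have := @cdiff_MVT R (fun z => (P \o co_inv k) z - (P' \o co_inv k) z) (fun=> 0) 0 z1 z0 0.
rewrite /= [co_inv k z0]co_mapK// [co_inv k z1]co_mapK// !mul0r => H.
have {}H : nc (P y - P' y - (P x - P' x) - 0) <= 0.
  by apply: H => t ht; [exact: dE (lin t ht)|change (nc (0 - 0 : R[i]) <= 0); rewrite subrr nc0].
have /eqP : nc (P y - P' y - (P x - P' x) - 0) == 0 by rewrite eq_le H nc_ge0.
by move=> /eqP; rewrite nc_eq0 subr0 subr_eq0 => /eqP ->.
Qed.

Lemma abelian_JS (l : G -> R) (q : quad_diff S) : compact [set: S] ->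
  (forall g, exists2 r, re_period X w g r & l g = `|r|) -> (forall g, exists N : nat, l g = N%:R) ->
  square_of w q -> JS S q.
Proof.
move=> cS per lN sq; have [_ [P pP _] _] := per 1%g.
have cP := primitive_continuous pP.
have cRe : continuous (fun x => complex.Re (P x) : R).
  by move=> x; exact: (continuous_comp (@cP x) (@continuous_Re R _)).
have c2 (t : R) : {for t, continuous (fun t : R => 2 * t)} by apply: (@cvgMr R); exact: cvg_id.
have a0 : 0 < 1 / 2 :> R by rewrite divr_gt0.
have [_ hol _] := set_mem (valP w).
have ch i z : (rmap i @` rdom i) z -> {for z, continuous (fun z => coef w i (chart_inv (rs_chart i) z) : Cplx R)}.
  by move=> iz; exact: cdiff_cts (derivable_cdiff (hol i z iz)).
apply: (@flat_JS_cover R S G X q (fun x => zdist (complex.Re (P x))) (1 / 2) cS a0).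
- by move=> x; exact: (continuous_comp (@cRe x) (@zdist_continuous R _)).
- move=> g x; have [r [P' pP' rE] lr] := per g; have [N lNg] := lN g.
  have PE : complex.Re (P (uc_act g x)) - complex.Re (P x) = r.
    by have := primitive_unique pP pP' (uc_act g x) x; rewrite (rE x) !ReB; lra.
  rewrite lNg in lr; have [r0|r0] := leP 0 r.
    by apply: (@zdist_eq _ _ _ (Posz N)); left; rewrite PE -[r]ger0_norm// -lr.
  by apply: (@zdist_eq _ _ _ (- Posz N)); left; have NE : (Posz N)%:~R = N%:R :> R by []; rewrite PE mulrNz NE lr ltr0_norm ?opprK.
- move=> x hq F0 Fa; have [i di] := rs_cover (p x).
  have [k [r [r0 nk _ hz hy]]] := primitive_coord pP di filterT.
  have wx : coef w i (p x) != 0 by have := hq i di; rewrite sq expf_eq0.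
  have img z : nc (z - rmap i (p x)) < r -> (rmap i @` rdom i) z.
    by move=> /hz[h1 h2 _]; have [h3 _ _] := hy _ h1; exists (p (co_inv k z)).
  have hx : nc (rmap i (p x) - rmap i (p x)) < r by rewrite subrr nc0.
  have m0 : 0 < nc (coef w i (p x)) by rewrite nc_gt0.
  have /cvg_cplxP/(_ _ m0)/cplx_nbhsP[r2 r20 hr2] := ch _ _ (img _ hx).
  have [s [c [e [sE e0 zE]]]] := zdist_affine F0 Fa.
  exists i, (P \o co_inv k), (fun z => coef w i (chart_inv (rs_chart i) z)), (Num.min r r2), s, c; split => //.
    split => //.
      split; first by rewrite lt_min r0.
      move=> z; rewrite lt_min => /andP[z1 /hr2 /= z2]; have [_ _ dP] := hz _ z1; split => //.
        by apply: ch; exact: img.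
      apply/eqP => E; move: z2; rewrite E rmapK// sub0r ncN.
      by rewrite ltxx.
    by move=> z; rewrite lt_min => /andP[z1 _]; split; [exact: img|rewrite sq].
  move/cvgrPdist_lt: (@cRe x) => /(_ _ e0) nR.
  apply: filterS2 nR nk => y Ry ky; have [_ _ yE] := hy _ ky.
  by rewrite /= yE zE// distrC.
(* Extremal values make 2 Re P integral, hence locally constant; its two partial derivatives are the
   real part and minus the imaginary part of the coefficient of w, which is therefore 0. *)
- move=> O oO [y Oy] FO.
  have nO : nbhs y O by apply: (open_nbhs_nbhs (conj oO Oy)).
  have c2P := continuous_comp (@cRe y) (c2 _).
  have n2 : \forall y' \near y, exists m : int, 2 * complex.Re (P y') = m%:~R.
    by apply: filterS nO => y' /FO; exact: zdist_extreme.
  have nc2 := integer_near_constant c2P n2.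
  have nR : nbhs y [set y' | complex.Re (P y') = complex.Re (P y)].
    by apply: filterS nc2 => y' /=; lra.
  have [i di] := rs_cover (p y); have [k [r [r0 nk kN hz hy]]] := primitive_coord pP di nR.
  have hx : nc (rmap i (p y) - rmap i (p y)) < r by rewrite subrr nc0.
  have [_ _ dP] := hz _ hx; rewrite rmapK// in dP.
  set z0 := rmap i (p y) in hz hy hx dP.
  have const z : nc (z - z0) < r -> complex.Re (P (co_inv k z)) = complex.Re (P y).
    by move=> /hz[h1 _ _]; exact: kN.
  have zE : z0 = complex.Re z0 +i* complex.Im z0 by case: (z0).
  have dP1 : cdiff (P \o co_inv k) (complex.Re z0 +i* complex.Im z0) (coef w i (p y)) by rewrite -zE.
  have hs : is_derive (complex.Re z0) 1 (fun t : R => complex.Re ((P \o co_inv k) (t +i* complex.Im z0)) : R) (complex.Re (coef w i (p y))).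
    by have := rcdiff_comp (rcdiff_hseg (complex.Im z0) (complex.Re z0)) dP1; rewrite mulr1 => /rcdiffP[].
  have vs : is_derive (complex.Im z0) 1 (fun t : R => complex.Re ((P \o co_inv k) (complex.Re z0 +i* t)) : R) (- complex.Im (coef w i (p y))).
    have := rcdiff_comp (rcdiff_vseg (complex.Re z0) (complex.Im z0)) dP1 => /rcdiffP[d1 _].
    by apply: (is_derive_eq d1); case: (coef w i (p y)) => a b /=; ring.
  have hs0 : is_derive (complex.Re z0) 1 (fun t : R => complex.Re ((P \o co_inv k) (t +i* complex.Im z0)) : R) 0.
    apply: (@is_derive_local R (fun=> complex.Re (P y)) _ _ 0 (is_derive_cst _ _ _)); exists r => // t ht.
    apply: const; apply: le_lt_trans (nc_le_ReIm _) _.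
    by rewrite ReB ImB /= subrr normr0 addr0.
  have vs0 : is_derive (complex.Im z0) 1 (fun t : R => complex.Re ((P \o co_inv k) (complex.Re z0 +i* t)) : R) 0.
    apply: (@is_derive_local R (fun=> complex.Re (P y)) _ _ 0 (is_derive_cst _ _ _)); exists r => // t ht.
    apply: const; apply: le_lt_trans (nc_le_ReIm _) _.
    by rewrite ReB ImB /= subrr normr0 add0r.
  have e1 : complex.Re (coef w i (p y)) = 0.
    by rewrite -(@derive_val _ _ _ _ _ _ _ hs) (@derive_val _ _ _ _ _ _ _ hs0).
  have e2 : - complex.Im (coef w i (p y)) = 0.
    by rewrite -(@derive_val _ _ _ _ _ _ _ vs) (@derive_val _ _ _ _ _ _ _ vs0).
  exists y, i; split => //; rewrite sq (_ : coef w i (p y) = 0) ?expr0n//.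
  by apply: complex_eq; rewrite ?e1//=; lra.
Qed.

End AbelianCase.

Lemma character_proj_surjective {R : realType} (F : fieldType) (v : discrete_valuation F) (c : R)
    (G : groupType) (n : nat) (s : 'I_n -> G) (chi : character_space v c s) :
  exists rho : rep_space v c s, character_proj rho = chi.
Proof.
exists (generic_quotient.repr (generic_quotient.repr chi)).
by rewrite /character_proj /hau_proj /orbit_proj !generic_quotient.reprK.
Qed.

Theorem theorem1p2 (R : realType)
  (F : fieldType) (v : discrete_valuation F) (c : R)
  (F_char0 : [pchar F] =i pred0) (c01 : 0 < c < 1)
  (Sigma : riemannSurface R) (Sigma_compact : compact [set: Sigma])
  (genus : nat) (Sigma_genus : has_genus Sigma genus) (genus_ge2 : (2 <= genus)%N)
  (G : groupType) (X : universal_cover Sigma G)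
  (n : nat) (s : 'I_n -> G) (s_gen : generates s)
  (Phi : character_space v c s -> quad_diff Sigma)
  (Phi_hitchin : is_hitchin_map X Phi) :
  range Phi `<=` JS Sigma.
Proof.
move=> _ [chi _ <-]; have [rho <-] := character_proj_surjective chi.
have [_ <-] := Phi_hitchin; rewrite /hitchin_bar; case: asboolP => _; first by left.
have lN g : exists N : nat, rep_length rho g = N%:R :> R.
  apply: bt_length_natural; have [det1 _] := set_mem (valP rho).
  by rewrite unitmxE (det1 g) unitr1.
(* The default value 0 of [xget], taken when [H_spec] is empty, belongs to [JS]. *)
rewrite /H_map; case: xgetP => [q _ hq|_]; last by left.
case: hq => [[nab [T [act [u [minT lE harm hu]]]]]|[_ [w per sq]]].
  rewrite -lE in nab lN; exact: (nonabelian_JS Sigma_compact minT harm hu nab lN).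
exact: (abelian_JS Sigma_compact per lN sq).
Qed.
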